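(* Let $\Gamma\le \mathrm{PSL}_2(\mathbb R)$ be a geometrically finite Fuchsian group having $\infty$ as cuspidal point, with $\Gamma\neq\Gamma_\infty$, satisfying condition (A): for each relevant isometric sphere of $\Gamma$, its summit is contained in $\partial\mathcal K$ but is not a vertex of $\mathcal K$. Let $Y=\Gamma\backslash\mathbb H$, let $\mathbb A$ be a basal family of precells, $\mathbb S$ a set of choices associated to $\mathbb A$ and $\mathbb T$ a shift map. Let $\mu$ be a measure on the space of geodesics on $Y$. The sets $\widehat{\mathrm{CS}}_{\mathrm{red}}$ and $\widehat{\mathrm{CS}}_{\mathrm{st},\mathrm{red}}$ are cross sections with respect to $\mu$ for the geodesic flow on $Y$ if and only if $\mathrm{NIC}$ is a $\mu$-null set. Moreover, in this case, $\widehat{\mathrm{CS}}_{\mathrm{st},\mathrm{red}}$ is the maximal strong cross section contained in $\widehat{\mathrm{CS}}_{\mathrm{red}}$.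
   Context: **Setting.** $\mathbb H=\{z\in\mathbb C:\operatorname{Im}z>0\}$ is the hyperbolic plane with the Möbius action $g.z$ of $\mathrm{PSL}_2(\mathbb R)$; $\overline{\mathbb H}^g=\{\operatorname{Im}z\ge0\}\cup\{\infty\}$, $\partial_g\mathbb H=\mathbb R\cup\{\infty\}$. For $V\subseteq \mathbb H$, $\partial_gV$ is the intersection of the closure of $V$ in $\overline{\mathbb H}^g$ with $\partial_g\mathbb H$; other closures, boundaries and interiors are taken in $\mathbb H$. Geodesic segments with endpoints in $\partial_g\mathbb H$ are considered as subsets of $\mathbb H$; they are complete if both endpoints are in $\partial_g\mathbb H$. For a Fuchsian group $\Gamma$, a fundamental region is an open $F\subseteq\mathbb H$ whose translates $g.F$ ($g\in\Gamma$) are pairwise disjoint and with $\bigcup_g g.\overline F=\mathbb H$; a closed fundamental region is a closed set whose interior is a fundamental region. $\Gamma$ is geometrically finite if it has a convex fundamental region with finitely many sides. $\infty$ is cuspidal if $\Gamma$ contains a parabolic element fixing $\infty$. $\Gamma_\infty$ is the stabilizer of $\infty$ in $\Gamma$. **Isometric spheres.** For $g=\begin{bmatrix}a&b\\c&d\end{bmatrix}\in\Gamma\setminus\Gamma_\infty$: $I(g)=\{z\in\mathbb H:|cz+d|=1\}$, $\mathrm{ext}\,I(g)=\{|cz+d|>1\}$; the summit of $I(g)$ is its point of maximal imaginary part; $\mathcal K=\bigcap_{g\in\Gamma\setminus\Gamma_\infty}\mathrm{ext}\,I(g)$. An isometric sphere $I$ is relevant if $I\cap\partial\mathcal K$ contains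 a one-dimensional submanifold; then $I\cap\partial\mathcal K$ is its relevant part. A vertex of $\mathcal K$ is an endpoint (in $\overline{\mathbb H}^g$) of a relevant part; it is inner if it lies in $\mathbb H$, otherwise infinite. An infinite vertex is two-sided if it is an endpoint of the relevant parts of two distinct relevant isometric spheres, otherwise one-sided. For a one-sided infinite vertex $v$ there is a unique one-sided infinite vertex $w\ne v$ such that the closed vertical strip of $\mathbb H$ between $v$ and $w$ lies in $\mathcal K$. **Precells.** An inner vertex $v$ is an endpoint of exactly two relevant parts, of spheres with summits $s_1,s_2$; the non-cuspidal precell attached to $v$ is the hyperbolic quadrilateral with vertices $s_1,v,s_2,\infty$ (including its boundary in $\mathbb H$), with vertical sides $[s_i,\infty]$ and non-vertical sides $[s_i,v]$. For an infinite vertex $v$ and each relevant isometric sphere whose relevant part has endpoint $v$, with summit $s$, the hyperbolic triangle with vertices $v,s,\infty$ is a cuspidal precell attached to $v$ (vertical sides $[v,\infty],[s,\infty]$, non-vertical side $[v,s]$). For a one-sided infinite vertex $v$, with $w\ne v$ the unique one-sided infinite vertex such that the closed vertical strip of $\mathbb H$ between $v$ and $w$ lies in $\mathcal K$, this closed vertical strip is a strip precell (attached to $v$ and $w$). A basal family is a set $\mathbb A$ of precells whose union is a closed fundamental region for $\Gamma$. **Cycles and cells.** For $\mathcal A\in\mathbb A$ and a non-vertical side $b$ of $\mathcal A$ there is a unique $g\in\Gamma\setminus\Gamma_\infty$ with $b\subseteq I(g)$ such that $g.b$ is a non-vertical side of some $\mathcal A'\in\mathbb A$; $g$ is called assigned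 to $\mathcal A$. Strip precell $\mathcal A$: $h_{\mathcal A}=\mathrm{id}$, the cycle of $(\mathcal A,\mathrm{id})$ is $((\mathcal A,\mathrm{id}))$, $\mathcal B(\mathcal A)=\mathcal A$, $\mathrm{cyl}(\mathcal A)=2$. Cuspidal $\mathcal A$ with assigned $g$, $\mathcal A'\in\mathbb A$ having non-vertical side $g.b$: the cycle of $(\mathcal A,g)$ is $((\mathcal A,g),(\mathcal A',g^{-1}))$, $\mathcal B(\mathcal A)=\mathcal A\cup g^{-1}.\mathcal A'$, $\mathrm{cyl}(\mathcal A)=3$. Non-cuspidal $\mathcal A$ attached to $v$, with $h_{\mathcal A}$ one of its two assigned elements: let $h_1=h_{\mathcal A}$, $g_1=\mathrm{id}$, $g_{j+1}=h_jg_j$, $\mathcal A_j\in\mathbb A$ the precell attached to $g_j.v$, and for $j\ge2$ let $h_j$ be such that $\{h_j,h_{j-1}^{-1}\}$ is the set of the two elements assigned to $\mathcal A_j$; $k$ is the least index with $g_{k+1}=\mathrm{id}$; the cycle of $(\mathcal A,h_{\mathcal A})$ is $((\mathcal A_j,h_j))_{j=1,\dots,k}$, $\mathcal B(\mathcal A)=\bigcup_{j=1}^kg_j^{-1}.\mathcal A_j$ (independent of the choice of $h_{\mathcal A}$), and $\mathrm{cyl}(\mathcal A)$ is the least $l\in\{1,\dots,k-1\}$ with $\mathcal A_{l+1}=\mathcal A$ if it exists, and $k$ otherwise. The sets $\mathcal B(\mathcal A)$ are the cells; they are convex polyhedra all of whose sides are complete geodesic segments. Two cycles are equivalent if some precell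 occurs in both. A set of choices $\mathbb S$ contains exactly one pair $(\mathcal A,h_{\mathcal A})$ out of each equivalence class of cycles. **Base set.** $\mathrm{BS}\subseteq\mathbb H$ is the union of all $\Gamma$-translates of all sides of all cells, $\mathrm{bd}=\bigcup_{g\in\Gamma}\bigcup_{\mathcal A\in\mathbb A}g.\partial_g\mathcal B(\mathcal A)$. $\pi$ denotes the projections $\mathbb H\to Y$, $S\mathbb H\to SY=\Gamma\backslash S\mathbb H$, $\overline{\mathbb H}^g\to\Gamma\backslash\overline{\mathbb H}^g$. Geodesics (arc length parametrized) on $Y$ are images of geodesics on $\mathbb H$. $\mathrm{NIC}$ is the set of geodesics on $Y$ at least one endpoint of which lies in $\pi(\mathrm{bd})$. **Representatives and reduction.** Let $\mathcal I$ be the finite set of $\alpha=((\mathcal A,h_{\mathcal A}),m)$ with $(\mathcal A,h_{\mathcal A})\in\mathbb S$, $1\le m\le\mathrm{cyl}(\mathcal A)$. To $\alpha$ attach a cell $B_\alpha$ and a vertical side $b_\alpha$ of it: non-cuspidal case: $B_\alpha=\mathcal B(\mathcal A_m)$, $b_\alpha=(h_m^{-1}.\infty,\infty)$; cuspidal case ($\mathcal A$ attached to $v$, cycle $((\mathcal A,g),(\mathcal A',g^{-1}))$): $(B_\alpha,b_\alpha)=(\mathcal B(\mathcal A),(v,\infty))$, $(\mathcal B(\mathcal A'),(g.v,\infty))$, $(\mathcal B(\mathcal A),(g^{-1}.\infty,\infty))$ for $m=1,2,3$; strip case (attached to $v_1<v_2$): $B_\alpha=\mathcal A$, $b_\alpha=(v_m,\infty)$.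 A shift map is any map $\mathbb T\colon\mathcal I\to\Gamma_\infty$. $\mathrm{CS}'_\alpha$ is the set of unit tangent vectors based on $\mathbb T(\alpha).b_\alpha$ that point into the interior of $\mathbb T(\alpha).B_\alpha$. Write $\mathbb T(\alpha).b_\alpha=(x_\alpha,\infty)$ with $x_\alpha\in\mathbb R$; let $I_\alpha=(x_\alpha,\infty)$, $J_\alpha=(-\infty,x_\alpha)$ (intervals in $\mathbb R$) if $\mathbb T(\alpha).B_\alpha\subseteq\{\operatorname{Re}z\ge x_\alpha\}$, and $I_\alpha=(-\infty,x_\alpha)$, $J_\alpha=(x_\alpha,\infty)$ if $\mathbb T(\alpha).B_\alpha\subseteq\{\operatorname{Re}z\le x_\alpha\}$. The intervals $I_\alpha$ of the form $(x,\infty)$ are pairwise distinct and form a chain $I_{\alpha_1}\supsetneq\dots\supsetneq I_{\alpha_{k_1}}$; put $I_{\mathrm{red},\alpha_j}=I_{\alpha_j}\setminus I_{\alpha_{j+1}}$ for $j<k_1$ and $I_{\mathrm{red},\alpha_{k_1}}=I_{\alpha_{k_1}}$; do the same for the chain of intervals $I_\alpha$ of the form $(-\infty,x)$. Let $\gamma_v$ be the geodesic with $\gamma_v'(0)=v$ and $$\mathrm{CS}'_{\mathrm{red},\alpha}=\{v\in\mathrm{CS}'_\alpha:(\gamma_v(\infty),\gamma_v(-\infty))\in I_{\mathrm{red},\alpha}\times J_\alpha\},\qquad \widehat{\mathrm{CS}}_{\mathrm{red}}=\pi\Big(\bigcup_{\alpha\in\mathcal I}\mathrm{CS}'_{\mathrm{red},\alpha}\Big).$$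 $\widehat{\mathrm{CS}}_{\mathrm{st},\mathrm{red}}$ is $\widehat{\mathrm{CS}}_{\mathrm{red}}$ minus all unit tangent vectors to geodesics in $\mathrm{NIC}$. **(Strong) cross section.** $\widehat{C}\subseteq SY$ is a cross section with respect to $\mu$ if (C1) $\mu$-almost every geodesic $\widehat\gamma$ on $Y$ intersects $\widehat C$ infinitely often in the past and in the future (there are $t_n\to\infty$ and $t'_n\to-\infty$ with $\widehat\gamma'(t_n),\widehat\gamma'(t'_n)\in\widehat C$), and (C2) if $\widehat\gamma'(t)\in\widehat C$, then there is $\varepsilon>0$ with $\widehat\gamma'((t-\varepsilon,t+\varepsilon))\cap\widehat C=\{\widehat\gamma'(t)\}$. It is strong if in addition every geodesic intersecting $\widehat C$ at all intersects it infinitely often in the past and in the future. ''Maximal strong cross section contained in $\widehat C$'': a strong cross section contained in $\widehat C$ that contains every strong cross section contained in $\widehat C$. *)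

(* Defs.v *)
From HB Require Import structures.
From mathcomp Require Import all_boot all_order all_algebra.
From mathcomp Require Import complex ring.
From mathcomp Require Import all_classical all_reals all_analysis.

Set Implicit Arguments.
Unset Strict Implicit.
Unset Printing Implicit Defensive.

Import Order.TTheory GRing.Theory Num.Theory.
Import numFieldNormedType.Exports.

Local Open Scope classical_set_scope.
Local Open Scope ring_scope.
Local Open Scope complex_scope.
Local Open Scope quotient_scope.

(* The topology of R[i] given by its absolute value. *)
HB.instance Definition _ (R : realType) := NormedModule.copy R[i] R[i]^o.

Section PSL2.
Variable R : realType.

Definition SL2 := {A : 'M[R]_2 | \det A == 1}.

Definition SL2_one : SL2 := @exist _ _ 1%:M (introT eqP (det1 R 2)).

Fact SL2_mul_subproof (A B : SL2) : \det (val A *m val B) == 1.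
Proof. by rewrite det_mulmx (eqP (valP A)) (eqP (valP B)) mulr1. Qed.
Definition SL2_mul (A B : SL2) : SL2 := @exist _ _ (val A *m val B) (SL2_mul_subproof A B).

Fact SL2_inv_subproof (A : SL2) : \det (invmx (val A)) == 1.
Proof. by rewrite det_inv (eqP (valP A)) invr1. Qed.
Definition SL2_inv (A : SL2) : SL2 := @exist _ _ (invmx (val A)) (SL2_inv_subproof A).

Lemma SL2_unit (A : SL2) : val A \in unitmx.
Proof. by rewrite unitmxE (eqP (valP A)) unitr1. Qed.

Definition psl_rel (A B : SL2) : bool :=
  (val A == val B) || (val A == - val B).

Fact psl_rel_refl : reflexive psl_rel.
Proof. by move=> A; rewrite /psl_rel eqxx. Qed.
Fact psl_rel_sym : symmetric psl_rel.
Proof. by move=> A B; rewrite /psl_rel eq_sym -eqr_oppLR eq_sym [- _ == _]eq_sym. Qed.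
Fact psl_rel_trans : transitive psl_rel.
Proof.
move=> B A C; rewrite /psl_rel.
by case/orP=> /eqP-> /orP[]/eqP->; rewrite ?opprK eqxx ?orbT.
Qed.
Canonical psl_equiv := EquivRel psl_rel psl_rel_refl psl_rel_sym psl_rel_trans.

Definition PSL2 := {eq_quot psl_equiv}.
HB.instance Definition _ := EqQuotient.on PSL2.
HB.instance Definition _ := Choice.on PSL2.

Lemma psl_reprP (A : SL2) :
  val (repr (\pi_PSL2 A)) = val A \/ val (repr (\pi_PSL2 A)) = - val A.
Proof.
have /eqmodP := reprK (\pi_PSL2 A).
by rewrite /= /psl_rel => /orP[]/eqP; [left|right].
Qed.

Lemma psl_piP (A B : SL2) :
  val A = val B \/ val A = - val B -> \pi_PSL2 A = \pi_PSL2 B.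
Proof.
by move=> AB; apply/eqmodP; rewrite /= /psl_rel; case: AB => ->; rewrite eqxx ?orbT.
Qed.

Definition psl_one : PSL2 := \pi_PSL2 SL2_one.
Definition psl_mul (g h : PSL2) : PSL2 := \pi_PSL2 (SL2_mul (repr g) (repr h)).
Definition psl_inv (g : PSL2) : PSL2 := \pi_PSL2 (SL2_inv (repr g)).

Fact psl_mulA : associative psl_mul.
Proof.
move=> f g h; apply: psl_piP => /=.
have := psl_reprP (SL2_mul (repr f) (repr g)).
have := psl_reprP (SL2_mul (repr g) (repr h)).
by rewrite /psl_mul /= => -[]-> []->; rewrite ?mulmxN ?mulNmx mulmxA ?opprK; auto.
Qed.

Fact psl_mul1 : left_id psl_one psl_mul.
Proof.
move=> g; rewrite -[RHS]reprK; apply: psl_piP => /=.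
by have := psl_reprP SL2_one; rewrite /psl_one /= => -[]->; rewrite ?mulNmx mul1mx; auto.
Qed.

Fact psl_mulr1 : right_id psl_one psl_mul.
Proof.
move=> g; rewrite -[RHS]reprK; apply: psl_piP => /=.
by have := psl_reprP SL2_one; rewrite /psl_one /= => -[]->; rewrite ?mulmxN mulmx1; auto.
Qed.

Fact psl_mulV : left_inverse psl_one psl_inv psl_mul.
Proof.
move=> g; apply: psl_piP => /=.
by have := psl_reprP (SL2_inv (repr g)); rewrite /psl_inv /= => -[]->;
  rewrite ?mulNmx mulVmx ?SL2_unit; auto.
Qed.

Fact psl_mulrV : right_inverse psl_one psl_inv psl_mul.
Proof.
move=> g; apply: psl_piP => /=.
by have := psl_reprP (SL2_inv (repr g)); rewrite /psl_inv /= => -[]->;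
  rewrite ?mulmxN mulmxV ?SL2_unit; auto.
Qed.

HB.instance Definition _ :=
  isGroup.Build PSL2 psl_mulA psl_mul1 psl_mulr1 psl_mulV psl_mulrV.

(* Entry of a representative matrix, hence well-defined up to a common sign;
   everything below depends only on the class. *)
Definition coef (i j : 'I_2) (g : PSL2) : R := val (repr g) i j.

(* The topology of PSL2 is the quotient of the subspace topology of SL2. *)
Definition psl_open (U : set PSL2) : Prop :=
  exists2 O : set 'M[R]_2, open O & forall A : SL2, O (val A) <-> U (\pi_PSL2 A).

Definition subgroup (Gam : set PSL2) : Prop :=
  [/\ Gam 1%g, forall g h, Gam g -> Gam h -> Gam (g * h)%g
    & forall g, Gam g -> Gam g^-1%g].

Definition fuchsian (Gam : set PSL2) : Prop :=
  subgroup Gam /\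
  forall g, Gam g -> exists2 U, psl_open U & U `&` Gam = [set g].

Definition parabolic (g : PSL2) : Prop :=
  g <> 1%g /\ `|coef 0 0 g + coef 1 1 g| = 2.

End PSL2.

Section HyperbolicPlane.
Variable R : realType.
Local Notation C := R[i].
Local Notation P1 := (one_point_compactification R[i]).

Definition cabs (z : C) : R := Normc.normc z.

Definition HH : set C := [set z | 0 < complex.Im z].

Definition denom (g : PSL2 R) (z : C) : C := (coef 1 0 g)%:C * z + (coef 1 1 g)%:C.

Definition act (g : PSL2 R) (z : C) : C :=
  ((coef 0 0 g)%:C * z + (coef 0 1 g)%:C) / denom g z.

(* In the Riemann sphere P1, None is the point at infinity; the closure of the
   hyperbolic plane is the subspace {Im z >= 0} + {None}. *)
Definition pinf : P1 := None.
Definition fin (z : C) : P1 := Some z.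

Definition actS (g : PSL2 R) (x : P1) : P1 :=
  match (x : option C) with
  | Some z => if denom g z == 0 then pinf else fin (act g z)
  | None => if coef 1 0 g == 0 then pinf
            else fin (coef 0 0 g / coef 1 0 g)%:C
  end.

Definition bdS : set P1 := [set x | x = pinf \/ exists r : R, x = fin r%:C].

Definition bdg (V : set C) : set P1 := closure (fin @` V) `&` bdS.

Definition clH (V : set C) : set C := closure V `&` HH.
Definition bdH (V : set C) : set C := clH V `\` interior V.

Definition hdist (z w : C) : R :=
  2 * ln ((cabs (z - w) + cabs (z - w^*)) / (2 * Num.sqrt (complex.Im z * complex.Im w))).

(* Arc-length parametrization: isometric embedding of the real line. *)
Definition geodesic (gam : R -> C) : Prop :=
  (forall t, HH (gam t)) /\ forall s t, hdist (gam s) (gam t) = `|s - t|.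

(* Tangent vectors are pairs (base point, vector in R[i]). *)
Definition velocity (c : R -> C) (t : R) : C * C :=
  (c t, (derive1 (@complex.Re R \o c) t) +i* (derive1 (@complex.Im R \o c) t)).

Definition SH : set (C * C) := [set v | HH v.1 /\ cabs v.2 = complex.Im v.1].

Definition actT (g : PSL2 R) (v : C * C) : C * C :=
  (act g v.1, v.2 / denom g v.1 ^+ 2).

(* x is the point of gam at the (possibly infinite) time a *)
Definition reaches (gam : R -> C) (a : \bar R) (x : P1) : Prop :=
  match a with
  | r%:E => x = fin (gam r)
  | +oo%E => fin (gam t) @[t --> +oo] --> x
  | -oo%E => fin (gam t) @[t --> -oo] --> x
  end.

(* The geodesic segment [x, y], as a subset of HH, for x and y in the closure
   of HH in P1. *)
Definition gseg (x y : P1) : set C :=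
  [set z | exists (gam : R -> C) (a b : \bar R) (r : R),
     [/\ geodesic gam, reaches gam a x, reaches gam b y,
         (a <= r%:E <= b)%E & z = gam r]].

Definition hconvex (V : set C) : Prop :=
  forall z w, V z -> V w -> gseg (fin z) (fin w) `<=` V.

(* The (closed) hyperbolic polygon with given vertices in convex position, some
   of which may be ideal. *)
Definition hpolygon (P : set P1) : set C :=
  \bigcap_(V in [set V | [/\ V `<=` HH, hconvex V
                  & forall x y, P x -> P y -> gseg x y `<=` V]]) V.

Definition sides (F : set C) : set (set C) :=
  [set b | [/\ b !=set0, hconvex b, b `<=` bdH F
     & forall b', hconvex b' -> b' `<=` bdH F -> b `<=` b' -> b' = b]].

Definition strip (x y : R) : set C := [set z | HH z /\ x <= complex.Re z <= y].

(* V contains a one-dimensional submanifold, i.e. a regular C^1 arc. *)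
Definition contains_arc (V : set C) : Prop :=
  exists c : R -> C,
    {in `]0, 1[ &, injective c} /\
    forall t, t \in `]0, 1[ ->
      [/\ V (c t), derivable (@complex.Re R \o c) t 1 /\ derivable (@complex.Im R \o c) t 1,
          {for t, continuous (derive1 (@complex.Re R \o c))},
          {for t, continuous (derive1 (@complex.Im R \o c))}
        & (velocity c t).2 <> 0].

(* The geodesic with initial velocity v enters V immediately. *)
Definition points_into (V : set C) (v : C * C) : Prop :=
  exists gam, [/\ geodesic gam, velocity gam 0 = v
    & exists2 e : R, 0 < e & forall t, 0 < t < e -> V (gam t)].

End HyperbolicPlane.

Section FuchsianGroup.
Variables (R : realType) (Gam : set (PSL2 R)).
Local Notation C := R[i].
Local Notation P1 := (one_point_compactification R[i]).

Definition fundamental_region (F : set C) : Prop :=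
  [/\ open F, F `<=` @HH R,
      forall g h, Gam g -> Gam h -> g <> h ->
        (act g @` F) `&` (act h @` F) = set0
    & \bigcup_(g in Gam) (act g @` clH F) = @HH R].

Definition closed_fundamental_region (V : set C) : Prop :=
  [/\ V `<=` @HH R, clH V = V & fundamental_region (interior V)].

Definition geometrically_finite : Prop :=
  exists F, [/\ fundamental_region F, hconvex F & finite_set (sides F)].

Definition stab_inf : set (PSL2 R) :=
  [set g | Gam g /\ actS g (pinf R) = pinf R].

Definition inf_cuspidal : Prop :=
  exists g, [/\ Gam g, parabolic g & actS g (pinf R) = pinf R].

Definition isosphere (g : PSL2 R) : set C := [set z | HH z /\ cabs (denom g z) = 1].
Definition isoext (g : PSL2 R) : set C := [set z | HH z /\ 1 < cabs (denom g z)].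

Definition KK : set C :=
  @HH R `&` \bigcap_(g in Gam `\` stab_inf) isoext g.

Definition is_summit (I : set C) (s : C) : Prop :=
  I s /\ forall z, I z -> complex.Im z <= complex.Im s.

Definition relevant_part (I : set C) : set C := I `&` bdH KK.

Definition relevant (I : set C) : Prop :=
  (exists2 g, (Gam `\` stab_inf) g & I = isosphere g) /\
  contains_arc (relevant_part I).

Definition is_endpoint (S : set C) (x : P1) : Prop :=
  exists2 y, y <> x & S = gseg x y.

Definition vertex (v : P1) : Prop :=
  exists2 I, relevant I & is_endpoint (relevant_part I) v.

Definition inner_vertex (v : P1) : Prop :=
  vertex v /\ exists2 z, HH z & v = fin z.
Definition infinite_vertex (v : P1) : Prop := vertex v /\ ~ inner_vertex v.

Definition two_sided (v : P1) : Prop :=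
  infinite_vertex v /\
  exists I1 I2, [/\ relevant I1, relevant I2, I1 <> I2,
    is_endpoint (relevant_part I1) v & is_endpoint (relevant_part I2) v].
Definition one_sided (v : P1) : Prop := infinite_vertex v /\ ~ two_sided v.

Definition condition_A : Prop :=
  forall I s, relevant I -> is_summit I s -> bdH KK s /\ ~ vertex (fin s).

Definition noncuspidal_precell (v : P1) (s1 s2 : C) (A : set C) : Prop :=
  inner_vertex v /\
  exists I1 I2,
    [/\ relevant I1, relevant I2, I1 <> I2,
        is_endpoint (relevant_part I1) v & is_endpoint (relevant_part I2) v] /\
    [/\ is_summit I1 s1, is_summit I2 s2
      & A = hpolygon [set fin s1; v; fin s2; pinf R]].

Definition cuspidal_precell (v : P1) (s : C) (A : set C) : Prop :=
  infinite_vertex v /\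
  exists I, [/\ relevant I, is_endpoint (relevant_part I) v, is_summit I s
    & A = hpolygon [set v; fin s; pinf R]].

Definition strip_precell (v1 v2 : R) (A : set C) : Prop :=
  [/\ v1 < v2, one_sided (fin v1%:C), one_sided (fin v2%:C),
      strip v1 v2 `<=` KK & A = strip v1 v2].

Definition is_noncuspidal (A : set C) : Prop :=
  exists v s1 s2, noncuspidal_precell v s1 s2 A.
Definition is_cuspidal (A : set C) : Prop := exists v s, cuspidal_precell v s A.
Definition is_strip (A : set C) : Prop := exists v1 v2, strip_precell v1 v2 A.

Definition nonvertical_side (A b : set C) : Prop :=
  (exists v s1 s2, noncuspidal_precell v s1 s2 A /\
     (b = gseg (fin s1) v \/ b = gseg (fin s2) v)) \/
  (exists v s, cuspidal_precell v s A /\ b = gseg (fin s) v).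

Definition basal_family (AA : set (set C)) : Prop :=
  (forall A, AA A -> [\/ is_noncuspidal A, is_cuspidal A | is_strip A]) /\
  closed_fundamental_region (\bigcup_(A in AA) A).

Section BasalFamily.
Variable AA : set (set C).

(* g is the element assigned to the precell A at its non-vertical side b, and
   g maps b to a non-vertical side of A' *)
Definition assigned_at (A b : set C) (g : PSL2 R) (A' : set C) : Prop :=
  [/\ nonvertical_side A b, (Gam `\` stab_inf) g, b `<=` isosphere g,
      AA A' & nonvertical_side A' (act g @` b)].

Definition assigned (A : set C) : set (PSL2 R) :=
  [set g | exists b A', assigned_at A b g A'].

(* A cycle ((A_1, h_1), ..., (A_k, h_k)) is a sequence of pairs; indices are
   shifted by one, so that [cyc_elt c j] is g_(j+1) = h_j ... h_1. *)
Definition precycle : Type := seq (set C * PSL2 R).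
Definition cyc_pair (c : precycle) (j : nat) : set C * PSL2 R :=
  nth (set0, 1%g) c j.
Definition cyc_elt (c : precycle) (j : nat) : PSL2 R :=
  foldl (fun g p => p.2 * g)%g 1%g (take j c).

Definition noncuspidal_cycle (A : set C) (h : PSL2 R) (c : precycle) : Prop :=
  exists v : P1,
  [/\ (0 < size c)%N, cyc_pair c 0 = (A, h), assigned A h,
      forall j, (j < size c)%N -> AA (cyc_pair c j).1 /\
        exists s1 s2, noncuspidal_precell (actS (cyc_elt c j) v) s1 s2 (cyc_pair c j).1
    & forall j, (0 < j < size c)%N ->
        assigned (cyc_pair c j).1
          = [set (cyc_pair c j).2; ((cyc_pair c j.-1).2)^-1%g]] /\
  (cyc_elt c (size c) = 1%g /\ forall j, (0 < j < size c)%N -> cyc_elt c j <> 1%g).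

Inductive is_cycle : set C -> PSL2 R -> precycle -> Prop :=
| StripCycle A : AA A -> is_strip A -> is_cycle A 1%g [:: (A, 1%g)]
| CuspidalCycle A b g A' : AA A -> is_cuspidal A -> assigned_at A b g A' ->
    is_cycle A g [:: (A, g); (A', g^-1%g)]
| NoncuspidalCycle A h c : noncuspidal_cycle A h c -> is_cycle A h c.

(* The union over all admissible h; each of them gives the same set. *)
Definition cell (A : set C) : set C :=
  [set z | exists h c, is_cycle A h c /\
     exists2 j, (j < size c)%N &
       (act (cyc_elt c j)^-1%g @` (cyc_pair c j).1) z].

(* For a non-cuspidal A_1 = A, [index A (A_2, ..., A_k)] is k - 1 if A does not
   occur in this list, and l - 1 if A_(l+1) is its first occurrence. *)
Definition cyl (c : precycle) : nat :=
  let A := (cyc_pair c 0).1 in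
  if `[< is_strip A >] then 2%N
  else if `[< is_cuspidal A >] then 3%N
  else (index A (behead (map fst c))).+1%N.

Definition cycle_equiv (c c' : precycle) : Prop :=
  exists A, (A \in map fst c) /\ (A \in map fst c').

Definition set_of_choices (SS : set (set C * PSL2 R)) : Prop :=
  (forall p, SS p -> exists c, is_cycle p.1 p.2 c) /\
  forall A h c, is_cycle A h c ->
    exists! p, SS p /\ exists2 c', is_cycle p.1 p.2 c' & cycle_equiv c c'.

Definition bd : set P1 :=
  \bigcup_(g in Gam) \bigcup_(A in AA) (actS g @` bdg (cell A)).

Section Representatives.
Variable SS : set (set C * PSL2 R).

Definition label : Type := ((set C * PSL2 R) * nat)%type.

Definition labels : set label :=
  [set al | SS al.1 /\ exists2 c, is_cycle al.1.1 al.1.2 c & (1 <= al.2 <= cyl c)%N].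

(* [rep al B b]: B is the cell and b the vertical side of B attached to al *)
Inductive rep : label -> set C -> set C -> Prop :=
| RepNoncuspidal A h m c : noncuspidal_cycle A h c -> (1 <= m <= cyl c)%N ->
    rep ((A, h), m) (cell (cyc_pair c m.-1).1)
      (gseg (actS ((cyc_pair c m.-1).2)^-1%g (pinf R)) (pinf R))
| RepCuspidal1 A v s g A' : cuspidal_precell v s A ->
    assigned_at A (gseg (fin s) v) g A' ->
    rep ((A, g), 1%N) (cell A) (gseg v (pinf R))
| RepCuspidal2 A v s g A' : cuspidal_precell v s A ->
    assigned_at A (gseg (fin s) v) g A' ->
    rep ((A, g), 2%N) (cell A') (gseg (actS g v) (pinf R))
| RepCuspidal3 A v s g A' : cuspidal_precell v s A ->
    assigned_at A (gseg (fin s) v) g A' ->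
    rep ((A, g), 3%N) (cell A) (gseg (actS g^-1%g (pinf R)) (pinf R))
| RepStrip1 A v1 v2 : strip_precell v1 v2 A ->
    rep ((A, 1%g), 1%N) A (gseg (fin v1%:C) (pinf R))
| RepStrip2 A v1 v2 : strip_precell v1 v2 A ->
    rep ((A, 1%g), 2%N) A (gseg (fin v2%:C) (pinf R)).

(* Only the values on [labels] matter. *)
Definition shift_map (TT : label -> PSL2 R) : Prop :=
  forall al, labels al -> stab_inf (TT al).

Variable TT : label -> PSL2 R.

Definition shifted_rep (al : label) (B b : set C) : Prop :=
  exists B0 b0, [/\ rep al B0 b0, B = act (TT al) @` B0 & b = act (TT al) @` b0].

Definition CS' (al : label) : set (C * C) :=
  [set v | SH v /\ exists B b, [/\ shifted_rep al B b, b v.1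
     & points_into (interior B) v]].

Definition on_right (al : label) (x : R) : Prop :=
  exists B b, [/\ shifted_rep al B b, b = gseg (fin x%:C) (pinf R)
    & B `<=` [set z | x <= complex.Re z]].
Definition on_left (al : label) (x : R) : Prop :=
  exists B b, [/\ shifted_rep al B b, b = gseg (fin x%:C) (pinf R)
    & B `<=` [set z | complex.Re z <= x]].

Definition Iint (al : label) : set R :=
  [set y | (exists2 x, on_right al x & x < y) \/ (exists2 x, on_left al x & y < x)].
Definition Jint (al : label) : set R :=
  [set y | (exists2 x, on_right al x & y < x) \/ (exists2 x, on_left al x & x < y)].

(* [Iint be] comes right after [Iint al] in the chain of its form; intervals of
   the form (x, +oo) and (-oo, x) are never nested. *)
Definition next_label (al be : label) : Prop :=
  [/\ labels al, labels be, Iint be `<` Iint al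
    & ~ exists de, [/\ labels de, Iint be `<` Iint de & Iint de `<` Iint al]].

Definition Ired (al : label) : set R :=
  [set y | Iint al y /\ forall be, next_label al be -> ~ Iint be y].

Definition CS'red (al : label) : set (C * C) :=
  [set v | CS' al v /\ exists gam (y y' : R),
     [/\ geodesic gam, velocity gam 0 = v,
         reaches gam +oo%E (fin y%:C), reaches gam -oo%E (fin y'%:C)
       & Ired al y /\ Jint al y']].

End Representatives.
End BasalFamily.

(* Points of the quotients of HH, SH and the closure of HH by Gam are orbits. *)
Definition piH (z : C) : set C := [set act g z | g in Gam].
Definition piSH (v : C * C) : set (C * C) := [set actT g v | g in Gam].
Definition piS (x : P1) : set P1 := [set actS g x | g in Gam].

Definition SY : set (set (C * C)) := piSH @` @SH R.

(* geodesics on the quotient Y, parametrized by arc length *)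
Definition geodY : Type :=
  {eta : R -> set C | exists2 gam, geodesic gam & eta = piH \o gam}.

HB.instance Definition _ := gen_eqMixin geodY.
HB.instance Definition _ := gen_choiceMixin geodY.

(* Any other lift differs from this one by an element of Gam, when Gam is
   Fuchsian. *)
Definition lift_geod (eta : geodY) : R -> C :=
  proj1_sig (cid2 (proj2_sig eta)).

Definition velocityY (eta : geodY) (t : R) : set (C * C) :=
  piSH (velocity (lift_geod eta) t).

Definition endpointY (eta : geodY) (p : set P1) : Prop :=
  exists x, (reaches (lift_geod eta) +oo%E x \/ reaches (lift_geod eta) -oo%E x)
    /\ p = piS x.

Definition NIC (AA : set (set C)) : set geodY :=
  [set eta | exists2 p, endpointY eta p & (piS @` bd AA) p].

Definition CSred AA SS TT : set (set (C * C)) :=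
  piSH @` \bigcup_(al in labels AA SS) CS'red AA SS TT al.

Definition CSstred AA SS TT : set (set (C * C)) :=
  [set p | CSred AA SS TT p /\
     ~ exists eta t, NIC AA eta /\ velocityY eta t = p].

Definition recurrent_in (CC : set (set (C * C))) (eta : geodY) : Prop :=
  (exists2 t : nat -> R, t n @[n --> \oo] --> +oo & forall n, CC (velocityY eta (t n)))
  /\
  (exists2 t : nat -> R, t n @[n --> \oo] --> -oo & forall n, CC (velocityY eta (t n))).

End FuchsianGroup.

(* Measurable spaces have to be nonempty; a point of the space of geodesics on Y
   is given by the geodesic t |-> i e^t. *)
Section GeodesicSpace.
Variable R : realType.

Definition geod_i (t : R) : R[i] := 0 +i* expR t.

Lemma geod_iP : geodesic geod_i.
Proof.
split=> [t|s t]; first exact: expR_gt0.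
wlog st : s t / t <= s => [hw|].
  case: (leP t s) => [/hw//|/ltW/hw]; rewrite distrC => <-.
  rewrite /hdist /cabs /geod_i /= !subr0 !opprK.
  have -> : (expR s - expR t) ^+ 2 = (expR t - expR s) ^+ 2 by ring.
  by rewrite [expR s + _]addrC [expR s * _]mulrC.
rewrite ger0_norm ?subr_ge0// /hdist /cabs /geod_i /= subr0 expr0n /= !add0r.
rewrite opprK !sqrtr_sqr ger0_norm ?subr_ge0 ?ler_expR// ger0_norm ?addr_ge0 ?expR_ge0//.
have -> : expR s - expR t + (expR s + expR t) = 2 * expR s by ring.
rewrite -expRD.
have -> : expR (s + t) = expR ((s + t) / 2) ^+ 2.
  by rewrite expr2 -expRD; congr expR; field.
rewrite sqrtr_sqr ger0_norm ?expR_ge0// -mulf_div divff ?pnatr_eq0// mul1r.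
by rewrite -expRN -expRD expRK; field.
Qed.

Variable Gam : set (PSL2 R).

Definition geodY_i : geodY Gam := exist _ _ (ex_intro2 _ _ geod_i geod_iP erefl).
HB.instance Definition _ := isPointed.Build (geodY Gam) geodY_i.

(* The sigma-algebra on the space of geodesics on Y is the one generated by an
   arbitrary family G; it is G itself if G is a sigma-algebra. *)
Section CrossSection.
Variables (G : set (set (geodY Gam)))
  (mu : {measure set (g_sigma_algebraType G) -> \bar R}).

Definition cross_section (CC : set (set (R[i] * R[i]))) : Prop :=
  [/\ CC `<=` SY Gam,
      {ae mu, forall eta : geodY Gam, recurrent_in CC eta}
    & forall (eta : geodY Gam) t, CC (velocityY eta t) ->
        exists2 e : R, 0 < e &
          (velocityY eta @` [set` `]t - e, t + e[]) `&` CC = [set velocityY eta t]].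

Definition strong_cross_section (CC : set (set (R[i] * R[i]))) : Prop :=
  cross_section CC /\
  forall eta : geodY Gam, (exists t, CC (velocityY eta t)) -> recurrent_in CC eta.

Definition maximal_strong_cross_section_in (CC D : set (set (R[i] * R[i]))) : Prop :=
  [/\ strong_cross_section D, D `<=` CC
    & forall D', strong_cross_section D' -> D' `<=` CC -> D' `<=` D].

End CrossSection.
End GeodesicSpace.

(* Main.v *)
Require Import Defs.
From HB Require Import structures.
From mathcomp Require Import all_boot all_order all_algebra.
From mathcomp Require Import complex ring lra.
From mathcomp Require Import all_classical all_reals all_analysis.

(* In the coordinates (Re z, |z|^2) hyperbolic lines are straight lines and
   |cz + d|^2 is affine, so the closure of K is given by affine inequalities, and
   a precell is the part of it over an interval whose ends are abscissas of summits
   or ideal vertices; a translate by Gamma of a vertical line over such an end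
   never crosses another one.  There are finitely many such ends modulo Gamma_oo:
   a finite-sided fundamental region is covered by finitely many ideal triangles,
   of finite area, and by half planes, which avoid all translates of the tops of
   the ideal triangles between ends, while these tops have disjoint translates and
   equal area.  The boundary of a cell lies on translates of the vertical lines.

   A geodesic without endpoint in bd has to leave every cell, hence crosses such
   translates; moved to one of the chosen lines, the crossing is a vector of CS',
   and it is followed by a vector of CS'_red on the innermost line, of the same
   direction, that still separates the geodesic from its endpoint.  If for all
   crossings in the far past this happened only after time T, the point at time T
   would, seen from these crossings, stay close to one of finitely many vertical
   lines.  But only finitely many g in Gamma map a point of a given compact set to
   a given line of this kind.  The same finiteness gives (C2) and shows that the
   crossings stop in the direction of an endpoint in bd, since every crossed line
   then meets one fixed compact segment. *)

Set Implicit Arguments.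
Unset Strict Implicit.
Unset Printing Implicit Defensive.

Import Order.TTheory GRing.Theory Num.Theory.
Import numFieldNormedType.Exports.

Local Open Scope classical_set_scope.
Local Open Scope ring_scope.
Local Open Scope complex_scope.
Local Open Scope quotient_scope.

Local Notation Re := complex.Re.
Local Notation Im := complex.Im.

#[local] Hint Extern 0 (Filter _) => exact: nbhs_filter : typeclass_instances.

(** * Elements of PSL2 and their action *)

Section Coefficients.
Variable R : realType.
Implicit Types (g h : PSL2 R).

(** The finite-sided region of the hypothesis is unrelated to [KK Gam], so the finiteness of the
    summits modulo translations has to be extracted from it; this is [finite_axes]. No hyperbolic
    area is formed there. A ball number b at height b/100 has Euclidean size independent of b, so
    the sum of $b^{-2}$ over all balls covering a vertical strip converges, whereas the top between
    two consecutive summits uses up a fixed amount of such a sum. Condition (A) makes the lines over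
    summits rigid: the summit is an inner point of its arc, so the element of the sphere carries
    what lies below one summit to what lies above another. Hence each point of such a line has a
    representative of maximal height on a line of the same kind. Crossings are recorded by two
    relations on times. Existence of crossings needs the exact relation [crs], which depends on the
    direction of the geodesic; isolation of crossings, and their absence near an endpoint in [bd],
    are shown for the coarser [meets]. The latter also gives maximality: a strong cross section
    cannot contain a vector of a geodesic whose crossings stop in one direction. *)

Definition ca g : R := coef 0 0 g.
Definition cb g : R := coef 0 1 g.
Definition cc g : R := coef 1 0 g.
Definition cd g : R := coef 1 1 g.

Lemma ord2P (i : 'I_2) : i = 0 \/ i = 1.
Proof. by case: i => [[|[|m]]] // Hm; [left|right]; exact: val_inj. Qed.

Lemma sum2 (F : 'I_2 -> R) : \sum_i F i = F 0 + F 1.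
Proof.
rewrite !big_ord_recl big_ord0 addr0; congr (_ + F _); exact: val_inj.
Qed.

Lemma det2 (A : 'M[R]_2) : \det A = A 0 0 * A 1 1 - A 0 1 * A 1 0.
Proof.
have e1 : lift (0 : 'I_2) (0 : 'I_1) = 1 by apply: val_inj.
have e0 : lift (1 : 'I_2) (0 : 'I_1) = 0 by apply: val_inj.
rewrite (expand_det_row _ 0) sum2 /cofactor !det_mx11 !mxE /= e1 e0.
by rewrite /= ?addn0 ?add0n expr0 expr1; ring.
Qed.

Lemma mx2P (A B : 'M[R]_2) :
  A 0 0 = B 0 0 -> A 0 1 = B 0 1 -> A 1 0 = B 1 0 -> A 1 1 = B 1 1 -> A = B.
Proof. by move=> *; apply/matrixP=> i j; case: (ord2P i) => ->; case: (ord2P j) => ->. Qed.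

Lemma psl_det g : ca g * cd g - cb g * cc g = 1.
Proof. by rewrite -det2 (eqP (valP (repr g))). Qed.

(* Representatives are only defined up to sign; [e] is that sign. *)
Lemma pslM_coef g h : exists e : R, [/\ e ^+ 2 = 1,
  ca (g * h)%g = e * (ca g * ca h + cb g * cc h),
  cb (g * h)%g = e * (ca g * cb h + cb g * cd h),
  cc (g * h)%g = e * (cc g * ca h + cd g * cc h) &
  cd (g * h)%g = e * (cc g * cb h + cd g * cd h)].
Proof.
have H := psl_reprP (SL2_mul (repr g) (repr h)).
rewrite /ca /cb /cc /cd /coef.
change (repr (g * h)%g) with (repr (\pi_(PSL2 R) (SL2_mul (repr g) (repr h)))).
case: H => ->; [exists 1|exists (-1)]; rewrite ?mxE /= ?mxE !sum2;
  split; rewrite ?mul1r ?mulN1r ?sqrrN ?expr1n //.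
Qed.

Lemma psl1_coef : exists e : R, [/\ e ^+ 2 = 1, ca 1%g = e, cb 1%g = 0, cc 1%g = 0 & cd 1%g = e].
Proof.
have H := psl_reprP (SL2_one R).
rewrite /ca /cb /cc /cd /coef.
change (repr (1 : PSL2 R)%g) with (repr (\pi_(PSL2 R) (SL2_one R))).
by case: H => ->; [exists 1|exists (-1)]; rewrite /SL2_one /= !mxE /= ?oppr0 ?sqrrN expr1n.
Qed.

Lemma psl_ext g h (e : R) : e ^+ 2 = 1 -> ca g = e * ca h -> cb g = e * cb h ->
  cc g = e * cc h -> cd g = e * cd h -> g = h.
Proof.
move=> /eqP; rewrite sqrf_eq1 => he ha hb hc hd.
rewrite -[g]reprK -[h]reprK; apply: psl_piP.
case/orP: he => /eqP e1; [left|right]; apply: mx2P; rewrite ?mxE;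
  move: ha hb hc hd; rewrite /ca /cb /cc /cd /coef e1 ?mul1r ?mulN1r //.
Qed.

Definition mx2 (a b c d : R) : 'M[R]_2 :=
  \matrix_(i < 2, j < 2)
    (if i == 0 then if j == 0 then a else b else if j == 0 then c else d).

(** Source of all explicit isometries. The chosen representative of the class of a matrix is known
    only up to the sign [e]. *)
Lemma mk_ex (a b c d : R) : a * d - b * c = 1 -> exists g (e : R), [/\ e ^+ 2 = 1,
  ca g = e * a, cb g = e * b, cc g = e * c & cd g = e * d].
Proof.
move=> dt.
have D : \det (mx2 a b c d) == 1 by rewrite det2 !mxE /= dt.
have H := psl_reprP (@exist _ _ (mx2 a b c d) D : SL2 R).
exists (\pi_(PSL2 R) (@exist _ _ (mx2 a b c d) D : SL2 R)).
rewrite /ca /cb /cc /cd /coef.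
case: H => -> /=; [exists 1|exists (-1)]; rewrite ?mxE /= ?mxE /=;
  by rewrite ?mul1r ?mulN1r ?sqrrN expr1n.
Qed.

Lemma pslV_coef g : exists e : R, [/\ e ^+ 2 = 1,
  ca g^-1%g = e * cd g, cb g^-1%g = - e * cb g,
  cc g^-1%g = - e * cc g & cd g^-1%g = e * ca g].
Proof.
have [h [e [e1 ha hb hc hd]]] := @mk_ex (cd g) (- cb g) (- cc g) (ca g)
  ltac:(have := psl_det g; lra).
exists e; suff -> : (g^-1)%g = h by rewrite ha hb hc hd !mulrN !mulNr.
apply/(mulIg g)/esym; rewrite mulVg.
have [f [f1 ma mb mc md]] := pslM_coef h g; have [k [k1 ka kb kc kd]] := psl1_coef.
have d := psl_det g.
have fe : (f * e * k) ^+ 2 = 1 by rewrite !exprMn f1 e1 k1 !mul1r.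
have kk : k * k = 1 by rewrite -expr2.
apply: (psl_ext fe); rewrite ?ma ?mb ?mc ?md ?ka ?kb ?kc ?kd ?ha ?hb ?hc ?hd.
- transitivity (f * e * (k * k)); first by rewrite kk mulr1 -[RHS]mulr1 -d; ring.
  by ring.
- by ring.
- by ring.
- transitivity (f * e * (k * k)); first by rewrite kk mulr1 -[RHS]mulr1 -d; ring.
  by ring.
Qed.

End Coefficients.

Section Action.
Variable R : realType.
Implicit Types (g h : PSL2 R) (z w : R[i]).

(** The quantity $|cz+d|^2$, by which [g] divides heights. For $c\ne 0$ the isometric sphere of [g]
    is its level set 1. *)
Definition Nm g z : R := (cc g * Re z + cd g) ^+ 2 + (cc g * Im z) ^+ 2.

Lemma complexP z w : Re z = Re w -> Im z = Im w -> z = w.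
Proof. by case: z => a b; case: w => c d /= -> ->. Qed.

Lemma ReM z w : Re (z * w) = Re z * Re w - Im z * Im w.
Proof. by case: z => a b; case: w. Qed.
Lemma ImM z w : Im (z * w) = Re z * Im w + Im z * Re w.
Proof. by case: z => a b; case: w. Qed.
Lemma ReD z w : Re (z + w) = Re z + Re w.
Proof. by case: z => a b; case: w. Qed.
Lemma ImD z w : Im (z + w) = Im z + Im w.
Proof. by case: z => a b; case: w. Qed.
Lemma ReB z w : Re (z - w) = Re z - Re w.
Proof. by case: z => a b; case: w. Qed.
Lemma ImB z w : Im (z - w) = Im z - Im w.
Proof. by case: z => a b; case: w. Qed.

Lemma Re_denom g z : Re (denom g z) = cc g * Re z + cd g.
Proof. by rewrite /denom /= ReD ReM /= mul0r subr0. Qed.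
Lemma Im_denom g z : Im (denom g z) = cc g * Im z.
Proof. by rewrite /denom /= ImD ImM /= mul0r !addr0. Qed.

Lemma Nm_gt0 g z : HH z -> 0 < Nm g z.
Proof.
rewrite /HH /= => y0; rewrite lt_def addr_ge0 ?sqr_ge0 ?andbT//.
rewrite paddr_eq0 ?sqr_ge0// !sqrf_eq0 mulf_eq0 (gt_eqF y0) orbF.
apply/negP => /andP[/eqP h /eqP c0]; move: h (psl_det g).
by rewrite c0 mul0r add0r => ->; rewrite !mulr0 subr0 => /eqP; rewrite eq_sym oner_eq0.
Qed.

Lemma denom_neq0 g z : HH z -> denom g z != 0.
Proof.
move=> Hz; apply/negP => /eqP d0.
have := Nm_gt0 g Hz; rewrite /Nm -Re_denom -Im_denom d0 /=.
by rewrite expr0n /= addr0 ltxx.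
Qed.

Lemma act_eq g z w : HH z ->
  (ca g)%:C * z + (cb g)%:C = w * denom g z -> act g z = w.
Proof. by move=> Hz e; rewrite /act e mulfK// denom_neq0. Qed.

Lemma actE g z : HH z -> act g z =
  (((ca g * Re z + cb g) * (cc g * Re z + cd g) + ca g * cc g * Im z ^+ 2) / Nm g z)
  +i* (Im z / Nm g z).
Proof.
move=> Hz; have N0 := lt0r_neq0 (Nm_gt0 g Hz); apply: act_eq => //.
have d := psl_det g.
apply: complexP.
- rewrite ReD !ReM Re_denom Im_denom /=.
  rewrite -[_ / _ * (cc g * Im z)]mul1r -d.
  by rewrite /Nm in N0 *; field.
- rewrite ImD !ImM Re_denom Im_denom /=.
  rewrite -[_ / _ * (cc g * Re z + cd g)]mul1r -d.
  by rewrite /Nm in N0 *; field.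
Qed.

Lemma Im_act g z : HH z -> Im (act g z) = Im z / Nm g z.
Proof. by move=> /(actE g) ->. Qed.

Lemma Re_act g z : HH z -> Re (act g z) =
  ((ca g * Re z + cb g) * (cc g * Re z + cd g) + ca g * cc g * Im z ^+ 2) / Nm g z.
Proof. by move=> /(actE g) ->. Qed.

Lemma HH_act g z : HH z -> HH (act g z).
Proof. by move=> Hz; rewrite /HH /= Im_act// divr_gt0// Nm_gt0. Qed.

Lemma moebius_comp_den (F : fieldType) (e c d a' b' c' d' z : F) : c' * z + d' != 0 ->
  e * (c * a' + d * c') * z + e * (c * b' + d * d') =
  e * (c * ((a' * z + b') / (c' * z + d')) + d) * (c' * z + d').
Proof. by move=> h; field. Qed.

Lemma sign_neq0 (F : fieldType) (e : F) : e ^+ 2 = 1 -> e != 0.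
Proof. by move=> e1; rewrite -sqrf_eq0 e1 oner_eq0. Qed.

Lemma denomM g h z : HH z -> exists2 e : R, e ^+ 2 = 1 &
  denom (g * h)%g z = e%:C * denom g (act h z) * denom h z.
Proof.
move=> Hz; have [e [e1 _ _ hc hd]] := pslM_coef g h; exists e => //.
have D := denom_neq0 h Hz.
rewrite {1}/denom -/(cc _) -/(cd _) hc hd !(rmorphM, rmorphD) /=.
exact: moebius_comp_den.
Qed.

Lemma actM g h z : HH z -> act (g * h)%g z = act g (act h z).
Proof.
move=> Hz; have [e [e1 ha hb hc hd]] := pslM_coef g h.
have D := denom_neq0 h Hz; have D2 := denom_neq0 g (HH_act h Hz).
apply: act_eq => //.
rewrite {1}/denom -/(cc _) -/(cd _) ha hb hc hd !(rmorphM, rmorphD) /=.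
rewrite !moebius_comp_den//.
move: D2; rewrite /act -!/(ca _) -!/(cb _); set u := _ / denom h z.
rewrite -[denom g u]/((cc g)%:C * u + (cd g)%:C) => D2.
by field.
Qed.

Lemma act1 z : HH z -> act 1%g z = z.
Proof.
move=> Hz; have [e [e1 ha hb hc hd]] := psl1_coef R.
apply: act_eq => //; rewrite /denom -/(cc _) -/(cd _) ha hb hc hd.
by rewrite addr0 mul0r add0r mulrC.
Qed.

Lemma actK g z : HH z -> act g^-1%g (act g z) = z.
Proof. by move=> Hz; rewrite -actM// mulVg act1. Qed.
Lemma actKV g z : HH z -> act g (act g^-1%g z) = z.
Proof. by move=> Hz; rewrite -actM// mulgV act1. Qed.

Lemma act_inj g z w : HH z -> HH w -> act g z = act g w -> z = w.
Proof. by move=> Hz Hw e; rewrite -(actK g Hz) e actK. Qed.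

Lemma NmM g h z : HH z -> Nm (g * h)%g z = Nm g (act h z) * Nm h z.
Proof.
move=> Hz; have I1 := Im_act (g * h)%g Hz.
have Hh := HH_act h Hz.
move: I1; rewrite actM// Im_act// Im_act// => I1.
have y0 : Im z != 0 by apply: lt0r_neq0.
have n1 := lt0r_neq0 (Nm_gt0 g Hh); have n2 := lt0r_neq0 (Nm_gt0 h Hz).
have n3 := lt0r_neq0 (Nm_gt0 (g * h)%g Hz).
apply: (mulfI y0); apply: (mulIf (invr_neq0 n3)); rewrite -mulrA divff// mulr1.
transitivity (Im z / Nm (g * h)%g z * (Nm g (act h z) * Nm h z)).
  by rewrite -I1; field; rewrite n1.
by rewrite mulrAC.
Qed.

Lemma NmV g z : HH z -> Nm g^-1%g (act g z) = (Nm g z)^-1.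
Proof.
move=> Hz; have n2 := lt0r_neq0 (Nm_gt0 g Hz).
apply: (mulIf n2); rewrite -NmM// mulVg mulVf//.
have [e [e1 ha hb hc hd]] := psl1_coef R.
by rewrite /Nm hc hd !mul0r add0r expr0n addr0.
Qed.

End Action.

Lemma finite_inj (T U : Type) (A : set T) (B : set U) (f : T -> U) :
  finite_set B -> (forall x, A x -> B (f x)) ->
  (forall x y, A x -> A y -> f x = f y -> x = y) -> finite_set A.
Proof.
move=> fB AB inj; have [[a0 Aa0]|nA] := pselect (exists a, A a); last first.
  by rewrite (_ : A = set0)// -subset0 => x Ax; apply: nA; exists x.
(* Only the values on the image of [A] matter; elsewhere [g] takes the default [a0]. *)
pose g b := if pselect (exists a, A a /\ f a = b) is left h then projT1 (cid h) else a0.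
apply: (@sub_finite_set _ _ (g @` B)); last exact: finite_image.
move=> a Aa; exists (f a); first exact: AB.
rewrite /g; case: pselect => [h|[]]; last by exists a.
by case: (cid h) => b /= [Ab fb]; apply: inj.
Qed.

Lemma finite_nat_inj (T : Type) (A : set T) (u : nat -> T) : finite_set A ->
  (forall n, A (u n)) -> exists m n, (m < n)%N /\ u m = u n.
Proof.
move=> fA uA; apply/not_existsP => H.
apply: infinite_nat; apply: (finite_inj fA (f := u)) => // m n _ _ e.
case: (ltngtP m n) => // mn; exfalso.
  by apply: (H m); exists n.
by apply: (H n); exists m.
Qed.

(** * Discreteness and the stabilizer of infinity *)

Section Discrete.
Variables (R : realType) (Gam : set (PSL2 R)).
Hypothesis fuchG : fuchsian Gam.
Implicit Types (g h t : PSL2 R) (z w : R[i]).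

Lemma Gam1 : Gam 1%g. Proof. by case: fuchG => -[]. Qed.
Lemma GamM g h : Gam g -> Gam h -> Gam (g * h)%g.
Proof. by case: fuchG => -[_ H _] _; exact: H. Qed.
Lemma GamV g : Gam g -> Gam g^-1%g.
Proof. by case: fuchG => -[_ _ H] _; exact: H. Qed.

(** Discreteness in terms of entries: the open set isolating 1 comes from an open set of matrices,
    which contains a box around the unit matrix. The sign [e] selects the representative close to
    it. *)
Lemma fuchsian_isolated : exists2 eps : R, 0 < eps & forall g (e : R), Gam g -> e ^+ 2 = 1 ->
  `|e * ca g - 1| < eps -> `|e * cb g| < eps -> `|e * cc g| < eps -> `|e * cd g - 1| < eps ->
  g = 1%g.
Proof.
case: fuchG => _ /(_ _ Gam1) [U [OO oO OU] UG].
have O1 : OO (val (SL2_one R)).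
  apply/OU; have : (U `&` Gam) 1%g by rewrite UG.
  by case.
have /nbhs_ballP[eps /= eps0 bO] : nbhs (val (SL2_one R)) OO by apply: open_nbhs_nbhs.
exists eps => // g e Gg /eqP; rewrite sqrf_eq1 => e1 ha hb hc hd.
suff Ug : U g by have : (U `&` Gam) g by []; rewrite UG.
have [A [valA piA]] : exists A : SL2 R, val A = e *: val (repr g) /\ \pi_(PSL2 R) A = g.
  case/orP: e1 => /eqP ->.
    by exists (repr g); rewrite scale1r reprK.
  have D : \det (- val (repr g)) == 1 by rewrite det2 !mxE mulrNN mulrNN -det2 (valP (repr g)).
  exists (@exist _ _ (- val (repr g)) D); rewrite scaleN1r; split => //.
  by rewrite -[RHS]reprK; apply: psl_piP; right.
rewrite -piA; apply/OU; apply: bO; rewrite valA; split=> // i j.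
rewrite /ball /= distrC !mxE.
by case: (ord2P i) => ->; case: (ord2P j) => -> /=; rewrite ?subr0.
Qed.

Definition bounded_coefs (B : R) : set (PSL2 R) := [set g | Gam g /\
  [/\ `|ca g| <= B, `|cb g| <= B, `|cc g| <= B & `|cd g| <= B]].

(** Pigeonhole: the cube of admissible entries is cut into finitely many small cells, and two
    elements [g], [h] in one cell give $g^{-1}h$ so close to the unit matrix that it is 1. *)
Lemma finite_bounded (B : R) : finite_set (bounded_coefs B).
Proof.
have [eps eps0 H] := fuchsian_isolated.
pose K : R := Num.max B 1; have K1 : 1 <= K by rewrite le_max lexx orbT.
have BK (x : R) : `|x| <= B -> `|x| <= K by move=> /le_trans; apply; rewrite le_max lexx.
(* Cells have side $1/M$. An entry of $g^{-1}h - 1$ is a sum of two products of an entry (at most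
   [K]) and a difference of entries, and each product has to stay below [eps / 2]. *)
pose M : R := 2 * K / eps + 1.
have M0 : 0 < M by rewrite ltr_wpDl// divr_ge0 ?mulr_ge0//; lra.
clearbody K; have ME : M = 2 * K / eps + 1 by []; clearbody M.
have cell (x y : R) : `|x| <= B -> `|y| <= B ->
    Num.truncn ((x + K) * M) = Num.truncn ((y + K) * M) -> `|x - y| * K < eps / 2.
  move=> /BK xB /BK yB e.
  have x0 : 0 <= (x + K) * M by rewrite mulr_ge0 ?(ltW M0)//; move: xB; rewrite ler_norml => /andP[]; lra.
  have y0 : 0 <= (y + K) * M by rewrite mulr_ge0 ?(ltW M0)//; move: yB; rewrite ler_norml => /andP[]; lra.
  have := truncn_itv x0; have := truncn_itv y0; rewrite e.
  move: (Num.truncn _) => n /andP[y1 y2] /andP[x1 x2].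
  have : `|x - y| * M < 1.
    by rewrite -[M]gtr0_norm// -normrM ltr_norml; rewrite -natr1 in x2 y2; apply/andP; split; lra.
  have -> : `|x - y| * M = `|x - y| * K * 2 / eps + `|x - y| by rewrite ME; field; lra.
  move=> h; have {}h : `|x - y| * K * 2 / eps < 1 by have := normr_ge0 (x - y); lra.
  by move: h; rewrite ltr_pdivrMr// mul1r; lra.
pose N := (Num.truncn (2 * K * M)).+1.
have bnd (x : R) : `|x| <= B -> (Num.truncn ((x + K) * M) < N)%N.
  move=> /BK; rewrite ler_norml => /andP[x1 x2]; rewrite ltnS; apply: le_truncn.
  by rewrite ler_pM2r//; lra.
pose f g := ((Num.truncn ((ca g + K) * M), Num.truncn ((cb g + K) * M)),
             (Num.truncn ((cc g + K) * M), Num.truncn ((cd g + K) * M))).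
apply: (finite_inj (B := (`I_N `*` `I_N) `*` (`I_N `*` `I_N)) (f := f)).
- by do !apply: finite_setX; exact: finite_II.
- by move=> g [Gg [a b c d]]; split; split => /=; exact: bnd.
move=> g h [Gg [ag bg cg dg]] [Gh [ah bh ch dh]] [ea eb ec ed].
have {}ea := cell _ _ ag ah ea; have {}eb := cell _ _ bg bh eb.
have {}ec := cell _ _ cg ch ec; have {}ed := cell _ _ dg dh ed.
suff : (g^-1 * h)%g = 1%g by move=> e1; rewrite -[h]mul1g -(mulgV g) -mulgA e1 mulg1.
have [e [e1 va vb vc vd]] := pslV_coef g; have [f' [f1 ma mb mc md]] := pslM_coef g^-1%g h.
have dt := psl_det g.
have pr (x y u : R) : `|x - y| * K < eps / 2 -> `|u| <= B -> `|u * (x - y)| < eps / 2.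
  by move=> h1 /BK h2; rewrite normrM mulrC; apply: le_lt_trans h1; rewrite ler_wpM2l.
have pr2 (x y u x' y' u' s : R) : `|x - y| * K < eps / 2 -> `|u| <= B ->
    `|x' - y'| * K < eps / 2 -> `|u'| <= B ->
    s = u * (x - y) + u' * (x' - y') -> `|s| < eps.
  move=> h1 h2 h3 h4 ->; apply: le_lt_trans (ler_normD _ _) _.
  by have := pr _ _ _ h1 h2; have := pr _ _ _ h3 h4; lra.
have ee : e * e = 1 by rewrite -expr2. have ff : f' * f' = 1 by rewrite -expr2.
have ef : (e * f') ^+ 2 = 1 by rewrite exprMn e1 f1 mul1r.
apply: (H _ (e * f')) => //; first exact: GamM (GamV Gg) Gh.
- apply: (pr2 (ca g) (ca h) (- cd g) (cc g) (cc h) (cb g)); rewrite ?normrN//.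
  rewrite ma va vb -[in LHS]dt.
  transitivity ((e * e) * (f' * f') * (cd g * ca h - cb g * cc h) - (ca g * cd g - cb g * cc g)); first ring.
  by rewrite ee ff; ring.
- apply: (pr2 (cb g) (cb h) (- cd g) (cd g) (cd h) (cb g)); rewrite ?normrN//.
  rewrite mb va vb.
  transitivity ((e * e) * (f' * f') * (cd g * cb h - cb g * cd h)); first ring.
  by rewrite ee ff; ring.
- apply: (pr2 (ca g) (ca h) (cc g) (cc g) (cc h) (- ca g)); rewrite ?normrN//.
  rewrite mc vc vd.
  transitivity ((e * e) * (f' * f') * (- cc g * ca h + ca g * cc h)); first ring.
  by rewrite ee ff; ring.
- apply: (pr2 (cb g) (cb h) (cc g) (cd g) (cd h) (- ca g)); rewrite ?normrN//.
  rewrite md vc vd -[in LHS]dt.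
  transitivity ((e * e) * (f' * f') * (- cc g * cb h + ca g * cd h) - (ca g * cd g - cb g * cc g)); first ring.
  by rewrite ee ff; ring.
Qed.

End Discrete.

Lemma seq_min (R : realDomainType) (s : seq R) (x : R) : x \in s ->
  exists2 m, m \in s & forall y, y \in s -> m <= y.
Proof.
elim: s x => // a s IH x _; case: s IH => [_|b s IH].
  by exists a; rewrite ?inE// => y; rewrite inE => /eqP ->.
have [m ms mm] := IH b (mem_head _ _).
have [am|ma] := leP a m.
  exists a; rewrite ?mem_head// => y; rewrite inE => /orP[/eqP->//|/mm]; exact: le_trans.
exists m; first by rewrite inE ms orbT.
by move=> y; rewrite inE => /orP[/eqP->|/mm//]; exact: ltW.
Qed.

Section Cusp.
Variables (R : realType) (Gam : set (PSL2 R)).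
Hypothesis fuchG : fuchsian Gam.
Hypothesis cuspG : inf_cuspidal Gam.
Implicit Types (g h s t : PSL2 R) (z w : R[i]).

Let GM := GamM fuchG.
Let GV := GamV fuchG.
Let G1 := Gam1 fuchG.

Lemma stab_infE g : stab_inf Gam g <-> Gam g /\ cc g = 0.
Proof.
rewrite /stab_inf /= /cc; case: ifPn => [/eqP->|/eqP c0]; first by split => -[].
by split => -[] //.
Qed.

(** The translation length $b/d$; the product $ab$ equals it when $a = d = \pm 1$, and does not
    change with the sign of the representative. *)
Definition tau t : R := ca t * cb t.

(* [unip t] : [t] is a translation, namely by [tau t]. *)
Definition unip t := [/\ cc t = 0, cd t = ca t & ca t ^+ 2 = 1].

Lemma unip1 : unip 1%g.
Proof. by have [e [e1 ha hb hc hd]] := psl1_coef R; split; rewrite ?hc ?hd ?ha. Qed.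

Lemma tau1 : tau 1%g = 0 :> R.
Proof. by have [e [e1 ha hb hc hd]] := psl1_coef R; rewrite /tau hb mulr0. Qed.

Lemma unipM s t : unip s -> unip t -> unip (s * t)%g /\ tau (s * t)%g = tau s + tau t.
Proof.
move=> [s1 s2 s3] [t1 t2 t3]; have [e [e1 ha hb hc hd]] := pslM_coef s t.
split.
  split; first by rewrite hc s1 t1 !(mulr0, mul0r, addr0).
    by rewrite hd ha s1 t1 s2 t2 !(mulr0, mul0r, addr0, add0r).
  by rewrite ha t1 mulr0 addr0 !exprMn e1 s3 t3 !mulr1.
rewrite /tau ha hb t1 t2 mulr0 addr0.
transitivity (e ^+ 2 * ((ca s ^+ 2) * (ca t * cb t) + (ca t ^+ 2) * (ca s * cb s))); first ring.
by rewrite e1 s3 t3; ring.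
Qed.

Lemma unipV t : unip t -> unip t^-1%g /\ tau t^-1%g = - tau t.
Proof.
move=> [t1 t2 t3]; have [e [e1 ha hb hc hd]] := pslV_coef t.
split; first by split; rewrite ?ha ?hb ?hc ?hd ?t1 ?t2 ?mulr0// exprMn e1 t3 mulr1.
rewrite /tau ha hb t2; transitivity (- (e ^+ 2 * (ca t * cb t))); first ring.
by rewrite e1 mul1r.
Qed.

Lemma unip_act t z : unip t -> HH z -> Re (act t z) = Re z + tau t /\ Im (act t z) = Im z.
Proof.
move=> [t1 t2 t3] Hz.
have N1 : Nm t z = 1 by rewrite /Nm t1 t2 !mul0r add0r expr0n addr0.
rewrite Re_act// Im_act// N1 !divr1 t1 t2; split => //.
transitivity (ca t ^+ 2 * Re z + ca t * cb t); first ring.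
by rewrite t3 mul1r.
Qed.

Lemma conj_unip g t : cc g = 0 -> unip t ->
  unip (g * t * g^-1)%g /\ tau (g * t * g^-1)%g = ca g ^+ 2 * tau t.
Proof.
move=> g0 [t1 t2 t3]; have [e [e1 ha hb hc hd]] := pslM_coef g t.
have [f [f1 va vb vc vd]] := pslV_coef g.
have [k [k1 ma mb mc md]] := pslM_coef (g * t)%g g^-1%g.
have := psl_det g; rewrite g0 mulr0 subr0 => ad.
have e0 : (k * e * f) ^+ 2 = 1 by rewrite !exprMn k1 e1 f1 !mulr1.
have A : ca (g * t * g^-1)%g = k * e * f * ca t.
  by rewrite ma va vc ha g0 t1 -[RHS]mulr1 -ad; ring.
split.
  split.
  - by rewrite mc va vc hc hd g0 t1 !(mulr0, mul0r, addr0, add0r, oppr0).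
  - by rewrite A md vb vd hc hd g0 t1 t2 -[RHS]mulr1 -ad; ring.
  - by rewrite A exprMn e0 t3 mulr1.
rewrite /tau A mb vb vd ha hb t1 t2.
transitivity ((k * e * f) ^+ 2 * (ca g ^+ 2 * (ca t * cb t))); first ring.
by rewrite e0 mul1r.
Qed.

Lemma parab_ex : exists2 T, Gam T & unip T /\ tau T != 0.
Proof.
case: cuspG => T [GT [T1 tr] Tinf].
have [_ c0] : Gam T /\ cc T = 0 by apply/stab_infE.
have ad := psl_det T; rewrite c0 mulr0 subr0 in ad.
have s4 : (ca T + cd T) ^+ 2 = 4.
  by rewrite -[LHS]real_normK ?num_real// /ca /cd tr; ring.
have /eqP : (ca T - cd T) ^+ 2 = 0.
  transitivity ((ca T + cd T) ^+ 2 - 4 * (ca T * cd T)); first ring.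
  by rewrite s4 ad; ring.
rewrite sqrf_eq0 subr_eq0 => /eqP aed.
have a1 : ca T ^+ 2 = 1 by rewrite expr2 -[RHS]ad aed.
exists T => //; split; first by split.
apply/negP => /eqP; rewrite /tau => /eqP; rewrite mulf_eq0 => /orP[] /eqP z0.
  by move/eqP: a1; rewrite z0 expr0n eq_sym oner_eq0.
apply: T1; have [e [e1 ha hb hc hd]] := psl1_coef R.
have ee : (ca T * e) ^+ 2 = 1 by rewrite exprMn a1 e1 mulr1.
have e11 : e * e = 1 by rewrite -expr2.
by apply: (psl_ext ee); rewrite ?ha ?hb ?hc ?hd ?z0 ?c0 ?mulr0// -mulrA e11 mulr1.
Qed.

(** Conjugating a translation repeatedly by such a [g] would give translations of strictly
    decreasing bounded lengths, infinitely many elements with bounded entries. *)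
Lemma no_contraction g : Gam g -> cc g = 0 -> ~ ca g ^+ 2 < 1.
Proof.
move=> Gg c0 a1; have [T GT [uT t0]] := parab_ex.
pose u n := iter n (fun t => g * t * g^-1)%g T.
have uP n : [/\ Gam (u n), unip (u n) & tau (u n) = (ca g ^+ 2) ^+ n * tau T].
  elim: n => [|n [Gn un tn]]; first by rewrite expr0 mul1r.
  have [? tE] := conj_unip c0 un.
  split => //=; first by apply: GM (GM Gg Gn) (GV Gg).
  by rewrite tE tn (exprS (ca g ^+ 2)) mulrA.
have a0 : 0 <= ca g ^+ 2 by exact: sqr_ge0.
have [|m [n [mn e]]] := finite_nat_inj (finite_bounded fuchG (Num.max 1 `|tau T|)) (u := u).
  move=> n; have [Gn [n1 n2 n3] tn] := uP n.
  have aN : `|ca (u n)| = 1.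
    by apply/eqP; rewrite -sqrp_eq1// real_normK ?num_real// n3.
  split => //; rewrite n1 n2 aN normr0 !le_max lexx/= ler01; split => //.
  suff -> : `|cb (u n)| <= `|tau T| by rewrite orbT.
  have -> : `|cb (u n)| = `|tau (u n)| by rewrite /tau normrM aN mul1r.
  rewrite tn normrM (ger0_norm (exprn_ge0 n a0)).
  by apply: ler_piMl => //; apply: exprn_ile1 => //; exact: ltW.
have [_ _ tm] := uP m; have [_ _ tn] := uP n.
have : tau (u m) = tau (u n) by rewrite e.
rewrite tm tn => /(mulIf t0) E.
have A0 : ca g ^+ 2 != 0.
  rewrite sqrf_eq0; apply/negP => /eqP a00; have := psl_det g.
  by rewrite a00 c0 mul0r mulr0 subr0 => /eqP; rewrite eq_sym oner_eq0.
have : (ca g ^+ 2) ^+ n < (ca g ^+ 2) ^+ m.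
  by rewrite ltr_iXn2l// lt_def A0.
by rewrite E ltxx.
Qed.

(** Neither [g] nor its inverse contracts, so the dilation factor of [g] is 1. *)
Lemma stab_unip g : Gam g -> cc g = 0 -> unip g.
Proof.
move=> Gg c0; have ad := psl_det g; rewrite c0 mulr0 subr0 in ad.
have n1 := no_contraction Gg c0.
have [f [f1 va vb vc vd]] := pslV_coef g.
have n2 : ~ ca g^-1%g ^+ 2 < 1.
  by apply: no_contraction (GV Gg) _; rewrite vc c0 mulr0.
rewrite va exprMn f1 mul1r in n2.
have a2 : ca g ^+ 2 * cd g ^+ 2 = 1 by rewrite -exprMn ad expr1n.
have a1 : ca g ^+ 2 = 1 by move/negP: n1; move/negP: n2; rewrite -!leNgt; nra.
split => //; have : ca g * (cd g - ca g) = 0 by rewrite mulrBr ad -expr2 a1 subrr.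
move/eqP; rewrite mulf_eq0 => /orP[/eqP a0|]; last by rewrite subr_eq0 => /eqP.
by move/eqP: a1; rewrite a0 expr0n eq_sym oner_eq0.
Qed.

Lemma transl_pos : exists2 T, Gam T & unip T /\ 0 < tau T.
Proof.
have [T GT [uT t0]] := parab_ex; have [uV tV] := unipV uT.
have [p|n] := ltP 0 (tau T); first by exists T.
exists T^-1%g; first exact: GV.
by rewrite tV oppr_gt0 lt_neqAle t0.
Qed.

Lemma transl_mul T n : Gam T -> unip T -> exists2 t, Gam t & unip t /\ tau t = n%:R * tau T.
Proof.
move=> GT uT; elim: n => [|n [t Gt [ut tt]]].
  by exists 1%g => //; split; [exact: unip1|rewrite tau1 mul0r].
have [u1 t1] := unipM uT ut; exists (T * t)%g; first exact: GM.
by rewrite t1 tt -natr1; split => //; ring.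
Qed.

Lemma shift_ex : exists2 rho : R, 0 < rho & forall x : R, exists2 t, Gam t &
  unip t /\ 0 <= x + tau t <= rho.
Proof.
have [T GT [uT r0]] := transl_pos; exists (tau T) => // x.
have [x0|x0] := leP 0 x.
  have [uV tV] := unipV uT.
  have [t Gt [ut tt]] := transl_mul (Num.truncn (x / tau T)) (GV GT) uV.
  have := @truncn_itv _ (x / tau T) (divr_ge0 x0 (ltW r0)).
  move: (Num.truncn _) tt => n tt; rewrite ler_pdivlMr// ltr_pdivrMr// -natr1 => /andP[a b].
  by exists t => //; split => //; rewrite tt tV; apply/andP; split; lra.
have [t Gt [ut tt]] := transl_mul (Num.truncn (- x / tau T)).+1 GT uT.
have nx0 : 0 <= - x by lra.
have := @truncn_itv _ (- x / tau T) (divr_ge0 nx0 (ltW r0)).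
move: (Num.truncn _) tt => n tt; rewrite ler_pdivlMr// ltr_pdivrMr// -natr1 => /andP[a b].
by exists t => //; split => //; rewrite tt -natr1; apply/andP; split; lra.
Qed.

Lemma finite_transl (B : R) : finite_set [set t | [/\ Gam t, unip t & `|tau t| <= B]].
Proof.
apply: sub_finite_set (finite_bounded fuchG (Num.max 1 B)) => t [Gt [t1 t2 t3] tB].
have aN : `|ca t| = 1 by apply/eqP; rewrite -sqrp_eq1// real_normK ?num_real// t3.
split => //; rewrite t1 t2 aN normr0 !le_max lexx/= ler01; split => //.
by apply/orP; right; rewrite -[`|cb _|]mul1r -{1}aN -normrM.
Qed.

Lemma Nm_unip t z : unip t -> Nm t z = 1.
Proof. by move=> [t1 t2 t3]; rewrite /Nm t1 t2 !mul0r add0r expr0n addr0. Qed.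

Lemma Nm_unipM t g z : HH z -> unip t -> Nm (t * g)%g z = Nm g z.
Proof. by move=> Hz ut; rewrite NmM// Nm_unip// mul1r. Qed.

Lemma unip_cc t g : unip t -> (cc (t * g)%g == 0) = (cc g == 0) /\ (cc (g * t)%g == 0) = (cc g == 0).
Proof.
move=> [t1 t2 t3]; have [e [e1 ha hb hc hd]] := pslM_coef t g.
have [f [f1 ka kb kc kd]] := pslM_coef g t.
have a0 : ca t != 0 by apply: sign_neq0.
rewrite hc kc t1 t2 mul0r add0r mulr0 addr0 !mulf_eq0 (negPf a0) !orbF.
by rewrite (negPf (sign_neq0 e1)) (negPf (sign_neq0 f1)).
Qed.

(** Compact subsets of [HH] that exhaust it, governed by a single number. *)
Definition box (B : R) z := [/\ `|Re z| <= B, B^-1 <= Im z & Im z <= B].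

Lemma box_HH B z : 0 < B -> box B z -> HH z.
Proof. by move=> B0 [_ h _]; apply: lt_le_trans h; rewrite invr_gt0. Qed.

Lemma box_coefs B g z : 1 <= B -> box B z -> box B (act g z) ->
  `|cc g| <= B ^+ 2 /\ `|cd g| <= B + B ^+ 3.
Proof.
move=> B1 bz bw; have B0 : 0 < B by apply: lt_le_trans B1.
have Hz := box_HH B0 bz; case: bz => zr z1 z2; case: bw => wr w1 w2.
have N0 := Nm_gt0 g Hz; move: w1; rewrite Im_act// ler_pdivlMr// mulrC ler_pdivrMr// => w1.
have Nb : Nm g z <= B ^+ 2 by nra.
have h1 : (cc g * Im z) ^+ 2 <= B ^+ 2.
  by apply: le_trans Nb; rewrite /Nm; have := sqr_ge0 (cc g * Re z + cd g); lra.
have h2 : (cc g * Re z + cd g) ^+ 2 <= B ^+ 2.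
  by apply: le_trans Nb; rewrite /Nm; have := sqr_ge0 (cc g * Im z); lra.
have {}h1 : `|cc g * Im z| <= B.
  by rewrite -[B]ger0_norm ?(ltW B0)// -ler_sqr ?nnegrE// !real_normK ?num_real.
have {}h2 : `|cc g * Re z + cd g| <= B.
  by rewrite -[B]ger0_norm ?(ltW B0)// -ler_sqr ?nnegrE// !real_normK ?num_real.
have cB : `|cc g| <= B ^+ 2.
  move: h1; rewrite normrM (gtr0_norm Hz) => h1.
  have : `|cc g| * B^-1 <= B by apply: le_trans h1; rewrite ler_wpM2l.
  by rewrite ler_pdivrMr// expr2.
split => //; have -> : cd g = (cc g * Re z + cd g) - cc g * Re z by ring.
apply: le_trans (ler_normB _ _) _; apply: lerD => //.
by rewrite normrM exprSr ler_pM.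
Qed.

(** Proper discontinuity. The heights of [z] and of its image bound c and d, the same for the
    inverse bounds a, and b is recovered from $az+b = (cz+d)\,gz$; [finite_bounded] then applies. *)
Lemma finite_box B : 1 <= B ->
  finite_set [set g | Gam g /\ exists z, box B z /\ box B (act g z)].
Proof.
move=> B1; pose D := B + B ^+ 3; pose K := B ^+ 2 + D + B * (B ^+ 2 * B + D) + B * (B ^+ 2 * B) + D * B.
apply: sub_finite_set (finite_bounded fuchG K) => g [Gg [z [bz bw]]].
have B0 : 0 < B by apply: lt_le_trans B1.
have Hz := box_HH B0 bz; have Hw := box_HH B0 bw.
have [cB dB] := box_coefs B1 bz bw.
have [_ aB] : `|cc g^-1%g| <= B ^+ 2 /\ `|cd g^-1%g| <= B + B ^+ 3.
  by apply: (box_coefs B1 bw); rewrite actK.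
have [e [e1 va vb vc vd]] := pslV_coef g.
have eN : `|e| = 1 by apply/eqP; rewrite -sqrp_eq1// real_normK ?num_real// e1.
rewrite vd normrM eN mul1r in aB.
have D0 : 0 <= D by rewrite addr_ge0 ?exprn_ge0// ltW.
have p1 : 0 <= B ^+ 2 by exact: sqr_ge0.
have q1 : 0 <= B * (B ^+ 2 * B + D) by rewrite mulr_ge0 ?addr_ge0 ?mulr_ge0// ltW.
have q2 : 0 <= B * (B ^+ 2 * B) by rewrite !mulr_ge0// ltW.
have q3 : 0 <= D * B by rewrite mulr_ge0// ltW.
have bE : cb g = Re (act g z) * (cc g * Re z + cd g) - Im (act g z) * (cc g * Im z) - ca g * Re z.
  have : (ca g)%:C * z + (cb g)%:C = act g z * denom g z by rewrite /act divfK// denom_neq0.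
  move=> /(congr1 (@complex.Re R)); rewrite ReD !ReM Re_denom Im_denom /= => <-; ring.
case: bz => zr z1 z2; case: bw => wr w1 w2.
have zi : `|Im z| <= B by rewrite gtr0_norm.
have wi : `|Im (act g z)| <= B by rewrite gtr0_norm.
have bB : `|cb g| <= B * (B ^+ 2 * B + D) + B * (B ^+ 2 * B) + D * B.
  rewrite bE; apply: le_trans (ler_normB _ _) _; apply: lerD; last first.
    by rewrite normrM ler_pM.
  apply: le_trans (ler_normB _ _) _; apply: lerD.
    rewrite normrM ler_pM//; apply: le_trans (ler_normD _ _) _; apply: lerD => //.
    by rewrite normrM ler_pM.
  by rewrite !normrM ler_pM// ?mulr_ge0// ler_pM.
rewrite -/D in dB aB.
have c1 : B ^+ 2 <= K by rewrite /K; lra.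
have c2 : D <= K by rewrite /K; lra.
have c3 : `|cb g| <= K by rewrite /K; lra.
by split => //; split => //; [apply: le_trans aB c2|apply: le_trans cB c1|apply: le_trans dB c2].
Qed.

(* The closure of [KK Gam]: the points of maximal height in their orbit. *)
Definition clK z : Prop := HH z /\ forall g, Gam g -> 1 <= Nm g z.

Lemma box_ex z : HH z -> forall M, exists2 B, 1 <= B & M <= B /\ box B z.
Proof.
move=> Hz M; exists (1 + `|M| + `|Re z| + Im z + (Im z)^-1).
  have h0 := normr_ge0 M; have h1 := normr_ge0 (Re z).
  have h2 : 0 < (Im z)^-1 by rewrite invr_gt0.
  by have h3 : 0 < Im z by []; lra.
set B := (X in M <= X).
have iz : 0 < (Im z)^-1 by rewrite invr_gt0.
have h0 := normr_ge0 M; have h1 := normr_ge0 (Re z); have h2 := ler_norm M.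
have Hz' : 0 < Im z by [].
have B1 : (Im z)^-1 <= B by rewrite /B; lra.
have B0 : 0 < B by apply: lt_le_trans B1.
split; first by rewrite /B; lra.
split; [by rewrite /B; lra | | by rewrite /B; lra].
by rewrite invf_ple ?posrE.
Qed.

Lemma conj_unip_coef g t : unip t -> exists e : R, [/\ e ^+ 2 = 1,
  e * ca (g * t * g^-1)%g = 1 - ca g * cc g * tau t,
  e * cb (g * t * g^-1)%g = ca g ^+ 2 * tau t,
  e * cc (g * t * g^-1)%g = - (cc g ^+ 2 * tau t) &
  e * cd (g * t * g^-1)%g = 1 + ca g * cc g * tau t].
Proof.
move=> [t1 t2 t3]; have [e [e1 ha hb hc hd]] := pslM_coef g t.
have [f [f1 va vb vc vd]] := pslV_coef g.
have [k [k1 ma mb mc md]] := pslM_coef (g * t)%g g^-1%g.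
have dt := psl_det g.
exists (k * e * f * ca t).
have E : (k * e * f * ca t) ^+ 2 = 1 by rewrite !exprMn k1 e1 f1 t3 !mulr1.
have K : (k * k) * (e * e) * (f * f) = 1 by rewrite -!expr2 k1 e1 f1 !mulr1.
have t4 : ca t * ca t = 1 by rewrite -expr2.
split => //; rewrite ?ma ?mb ?mc ?md ?va ?vb ?vc ?vd ?ha ?hb ?hc ?hd t1 t2 /tau.
- rewrite -[in RHS]dt; transitivity ((k * k) * (e * e) * (f * f) * ((ca t * ca t) * (ca g * cd g - cb g * cc g) - ca g * cc g * (ca t * cb t))); first ring.
  by rewrite K t4; ring.
- transitivity ((k * k) * (e * e) * (f * f) * (ca g ^+ 2 * (ca t * cb t))); first ring.
  by rewrite K mul1r.
- transitivity ((k * k) * (e * e) * (f * f) * (- (cc g ^+ 2 * (ca t * cb t)))); first ring.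
  by rewrite K mul1r.
- rewrite -[in RHS]dt; transitivity ((k * k) * (e * e) * (f * f) * ((ca t * ca t) * (ca g * cd g - cb g * cc g) + ca g * cc g * (ca t * cb t))); first ring.
  by rewrite K t4; ring.
Qed.

Lemma unip_coefM t g : unip t -> exists e : R, [/\ e ^+ 2 = 1,
  ca (t * g)%g = e * (ca g + tau t * cc g), cb (t * g)%g = e * (cb g + tau t * cd g),
  cc (t * g)%g = e * cc g & cd (t * g)%g = e * cd g].
Proof.
move=> [t1 t2 t3]; have [e [e1 ha hb hc hd]] := pslM_coef t g.
have t4 : ca t * ca t = 1 by rewrite -expr2.
exists (e * ca t); split; first by rewrite exprMn e1 t3 mulr1.
- rewrite ha; transitivity (e * (ca t * ca g + (ca t * ca t) * (cb t * cc g))).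
    by rewrite t4 mul1r.
  by rewrite /tau; ring.
- rewrite hb; transitivity (e * (ca t * cb g + (ca t * ca t) * (cb t * cd g))).
    by rewrite t4 mul1r.
  by rewrite /tau; ring.
- by rewrite hc t1 t2; ring.
- by rewrite hd t1 t2; ring.
Qed.

(** A form of Shimizu's lemma. After a translation $|a| \le \rho |c|$, so if c is small the
    conjugate of a translation [T] by [g] is close to the unit matrix, hence trivial, although [T]
    is not. *)
Lemma cc_min : exists2 c0 : R, 0 < c0 & forall g, Gam g -> cc g != 0 -> c0 <= `|cc g|.
Proof.
have [T GT [uT t0]] := transl_pos; have [rho rho0 shift] := shift_ex.
have [eps eps0 iso] := fuchsian_isolated fuchG.
(* [M] dominates the factors [rho], [rho ^+ 2] and 1 of $|c|\,\tau(T)$ in the bounds for the four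
   entries of the conjugate. *)
pose M := 1 + rho + rho ^+ 2; have M0 : 0 < M by rewrite /M; nra.
pose d := Num.min 1 (eps / (M * tau T) / 2).
have d0 : 0 < d by rewrite lt_min ltr01 !divr_gt0// mulr_gt0.
exists d => // g Gg c0; rewrite leNgt; apply/negP => cd'.
have c1 : `|cc g| < 1 by apply: lt_le_trans cd' _; rewrite ge_min lexx.
have c2 : `|cc g| < eps / (M * tau T) / 2 by apply: lt_le_trans cd' _; rewrite ge_min lexx orbT.
have [s Gs [us /andP[x0 x1]]] := shift (ca g / cc g).
have [e [e1 ha hb hc hd]] := unip_coefM g us.
have [f [f1 ka kb kc kd]] := conj_unip_coef (s * g)%g uT.
have Gsg : Gam (s * g)%g := GM Gs Gg.
have cn : 0 < `|cc g| by rewrite normr_gt0.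
have eN : `|e| = 1 by apply/eqP; rewrite -sqrp_eq1// real_normK ?num_real// e1.
have aB : `|ca (s * g)%g| <= rho * `|cc g|.
  have -> : ca (s * g)%g = e * (ca g / cc g + tau s) * cc g by rewrite ha; field.
  by rewrite !normrM eN mul1r ler_wpM2r// ger0_norm.
have cB : `|cc (s * g)%g| = `|cc g| by rewrite hc normrM eN mul1r.
have key : M * `|cc g| * tau T < eps.
  have MT : 0 < M * tau T by rewrite mulr_gt0.
  have : `|cc g| * (M * tau T) <= eps / 2.
    by rewrite -ler_pdivlMr//; apply: ltW; apply: lt_le_trans c2 _; rewrite mulrAC.
  by lra.
have M1 : 1 <= M by rewrite /M; have := sqr_ge0 rho; lra.
have M2 : rho <= M by rewrite /M; have := sqr_ge0 rho; lra.
have M3 : rho ^+ 2 <= M by rewrite /M; lra.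
have bnd (u K : R) : 0 <= K -> K <= M -> `|u| <= K * `|cc g| -> `|u * tau T| < eps.
  move=> K0 KM uK; rewrite normrM (gtr0_norm t0); apply: le_lt_trans key.
  by rewrite ler_pM2r//; apply: le_trans uK _; rewrite ler_pM2r.
have ac : `|ca (s * g)%g * cc (s * g)%g| <= rho * `|cc g|.
  by rewrite normrM cB; apply: le_trans (ler_pM _ _ aB (ltW c1)) _; rewrite ?mulr1.
have P0 : (s * g * T * (s * g)^-1)%g = 1%g.
  apply: (iso _ f) => //; first exact: GM (GM Gsg GT) (GV Gsg).
  - rewrite ka addrAC subrr add0r normrN; exact: (bnd _ rho (ltW rho0)).
  - rewrite kb; apply: (bnd _ (rho ^+ 2)); rewrite ?sqr_ge0//.
    rewrite normrX; apply: le_trans (_ : (rho * `|cc g|) ^+ 2 <= _); first by rewrite ler_sqr ?nnegrE// mulr_ge0// ltW.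
    by rewrite exprMn ler_wpM2l ?sqr_ge0// expr2 ler_piMr// ltW.
  - rewrite kc normrN; apply: (bnd _ 1) => //.
    by rewrite normrX cB mul1r expr2 ler_piMr// ltW.
  - rewrite kd addrAC subrr add0r; exact: (bnd _ rho (ltW rho0)).
have T1 : T = 1%g.
  have P1 : (s * g * T * (s * g)^-1 * (s * g))%g = (s * g)%g by rewrite P0 mul1g.
  rewrite -[X in X = _]mulgA mulVg mulg1 in P1.
  by rewrite -[T]mul1g -(mulVg (s * g)%g) -mulgA P1 mulVg.
by move: t0; rewrite T1 tau1 ltxx.
Qed.

Lemma Nm_lower z : HH z -> exists2 m : R, 0 < m & forall g, Gam g -> m <= Nm g z.
Proof.
move=> Hz; have [c0 c00 cm] := cc_min; have Hz' : 0 < Im z by [].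
exists (Num.min 1 ((c0 * Im z) ^+ 2)); first by rewrite lt_min ltr01 exprn_gt0// mulr_gt0.
move=> g Gg; have [c|c] := eqVneq (cc g) 0.
  by rewrite (Nm_unip _ (stab_unip Gg c)) ge_min lexx.
rewrite ge_min; apply/orP; right; apply: (@le_trans _ _ ((cc g * Im z) ^+ 2)).
  by rewrite !exprMn ler_pM2r ?exprn_gt0// -[_ ^+ 2]real_normK ?num_real// -[leRHS]real_normK ?num_real// ler_sqr ?nnegrE// (gtr0_norm c00) cm.
by rewrite /Nm lerDr sqr_ge0.
Qed.

(** Orbit points that are not too low can be translated into a compact box without changing
    [Nm g z]; the upper bound on their height is [Nm_lower]. This replaces local finiteness of the
    isometric spheres. *)
Lemma finite_Nm z (B : R) : HH z -> finite_set [set Nm g z | g in [set g | Gam g /\ Nm g z <= B]].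
Proof.
move=> Hz; have [rho rho0 shift] := shift_ex; have [m m0 ml] := Nm_lower Hz.
have Hz' : 0 < Im z by [].
have [C C1 [CM bz]] := box_ex Hz (rho + Im z / m + `|B| / Im z).
have C0 : 0 < C by apply: lt_le_trans C1.
have q1 : 0 <= Im z / m by rewrite divr_ge0// ltW.
have q2 : 0 <= `|B| / Im z by rewrite divr_ge0// ltW.
apply: (@sub_finite_set _ _ ([set Nm g z | g in [set g | Gam g /\
   exists w, box C w /\ box C (act g w)]])); last first.
  by apply: finite_image; apply: finite_box.
move=> _ [g [Gg NB] <-]; have [t Gt [ut /andP[x0 x1]]] := shift (Re (act g z)).
have Hg := HH_act g Hz; have [tR tI] := unip_act ut Hg.
exists (t * g)%g; last by rewrite Nm_unipM.
split; first exact: GM.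
exists z; split => //; rewrite actM//; split.
- by rewrite tR ger0_norm//; lra.
- rewrite tI Im_act//; have N0 := Nm_gt0 g Hz.
  have B0 : 0 < B by apply: lt_le_trans NB.
  rewrite invf_ple ?posrE ?divr_gt0// invf_div.
  apply: (@le_trans _ _ (`|B| / Im z)); last lra.
  by rewrite ler_pM2r ?invr_gt0// gtr0_norm.
- rewrite tI Im_act//; apply: (@le_trans _ _ (Im z / m)); last lra.
  by rewrite ler_pM2l// lef_pV2 ?posrE ?ml// Nm_gt0.
Qed.

End Cusp.

(** * Klein coordinates *)

Section Topology.
Variable R : realType.
Implicit Types (z w : R[i]) (U V : set R[i]).

Lemma cabsE z : cabs z = Num.sqrt (Re z ^+ 2 + Im z ^+ 2).
Proof. by case: z. Qed.

Lemma nbhs_boxP z U : nbhs z U <-> exists2 e : R, 0 < e &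
  forall w, `|Re w - Re z| < e -> `|Im w - Im z| < e -> U w.
Proof.
split=> [/nbhs_ballP[eps /= eps0 bU]|[e e0 bU]].
  have [i0 r0] : Im eps = 0 /\ 0 < Re eps by move: eps0; rewrite ltcE /= => /andP[/eqP].
  exists (Re eps / 2) => [|w hr hi]; first by rewrite divr_gt0.
  apply: bU; rewrite /ball /= normc_def ltcE /= i0 eqxx /= ReB ImB.
  rewrite -(ger0_norm (ltW r0)) -sqrtr_sqr ltr_sqrt ?exprn_gt0//.
  have sq (x : R) : `|x| < Re eps / 2 -> x ^+ 2 < (Re eps / 2) ^+ 2.
    by move=> h; rewrite -[x ^+ 2]real_normK ?num_real// ltr_sqr ?nnegrE// divr_ge0// ltW.
  have {}hr := sq _ hr; have {}hi := sq _ hi.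
  have -> : (Re z - Re w) ^+ 2 = (Re w - Re z) ^+ 2 by ring.
  have -> : (Im z - Im w) ^+ 2 = (Im w - Im z) ^+ 2 by ring.
  have := sqr_ge0 (Re eps); move: hr hi; rewrite exprMn => hr hi h; lra.
apply/nbhs_ballP; exists e%:C => /=; first by rewrite ltcE /= eqxx.
move=> w; rewrite /ball /= normc_def ltcE /= eqxx /= ReB ImB => h.
have key (x y : R) : Num.sqrt (x ^+ 2 + y ^+ 2) < e -> `|x| < e.
  move=> h1; apply: le_lt_trans h1; rewrite -sqrtr_sqr ler_wsqrtr//.
  by rewrite lerDl sqr_ge0.
by apply: bU; rewrite distrC; [apply: key h|rewrite addrC in h; apply: key h].
Qed.

Lemma continuous_Re : continuous (@complex.Re R).
Proof.
move=> z; apply/cvgrPdist_lt => e e0; apply/nbhs_boxP; exists e => // w h _.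
by rewrite /= distrC.
Qed.

Lemma continuous_Im : continuous (@complex.Im R).
Proof.
move=> z; apply/cvgrPdist_lt => e e0; apply/nbhs_boxP; exists e => // w _ h.
by rewrite /= distrC.
Qed.

Lemma closure_box V z : closure V z <-> forall e : R, 0 < e ->
  exists2 w, V w & `|Re w - Re z| < e /\ `|Im w - Im z| < e.
Proof.
split=> [cV e e0|H U /nbhs_boxP[e e0 bU]].
  have [|w [Vw [wr wi]]] := cV [set w | `|Re w - Re z| < e /\ `|Im w - Im z| < e].
    by apply/nbhs_boxP; exists e.
  by exists w.
by have [w Vw [wr wi]] := H e e0; exists w; split => //; apply: bU.
Qed.

Lemma interior_box V z : interior V z <-> exists2 e : R, 0 < e &
  forall w, `|Re w - Re z| < e -> `|Im w - Im z| < e -> V w.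
Proof. exact: nbhs_boxP. Qed.

Lemma open_HH : open (@HH R).
Proof.
rewrite openE => z Hz; apply/nbhs_boxP; exists (Im z) => // w _.
by rewrite /HH /= ltr_norml => /andP[]; lra.
Qed.

Lemma continuous_act (g : PSL2 R) z : HH z -> {for z, continuous (act g)}.
Proof.
move=> Hz; rewrite /act; apply: cvgM.
  by apply: cvgD; [apply: cvgM; [exact: cvg_cst|exact: cvg_id]|exact: cvg_cst].
apply: cvgV; first exact: denom_neq0.
by apply: cvgD; [apply: cvgM; [exact: cvg_cst|exact: cvg_id]|exact: cvg_cst].
Qed.

Definition Wk z : R := Re z ^+ 2 + Im z ^+ 2.

Lemma NmE (g : PSL2 R) z : Nm g z = cc g ^+ 2 * Wk z + 2 * cc g * cd g * Re z + cd g ^+ 2.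
Proof. by rewrite /Nm /Wk; ring. Qed.

Lemma continuous_Wk : continuous Wk.
Proof.
move=> z; have R1 := @continuous_Re z; have I1 := @continuous_Im z.
by apply: cvgD; [exact: (cvgM R1 R1)|exact: (cvgM I1 I1)].
Qed.

Lemma continuous_Nm (g : PSL2 R) : continuous (Nm g).
Proof.
move=> z; have R1 := @continuous_Re z; have W1 := @continuous_Wk z.
rewrite (_ : Nm g = fun z => cc g ^+ 2 * Wk z + 2 * cc g * cd g * Re z + cd g ^+ 2); last first.
  by apply/funext => w; rewrite NmE.
apply: cvgD; last exact: cvg_cst.
by apply: cvgD; apply: cvgM => //; exact: cvg_cst.
Qed.

(* Points with real coordinates: the Klein coordinates (Re z, |z|^2) turn geodesics
   into straight lines. *)
Definition pt (X W : R) : R[i] := X +i* Num.sqrt (W - X ^+ 2).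

Lemma ptP (X W : R) : X ^+ 2 < W -> [/\ HH (pt X W), Re (pt X W) = X & Wk (pt X W) = W].
Proof.
move=> h; have h' : 0 < W - X ^+ 2 by lra.
by split => //=; [rewrite /HH /= sqrtr_gt0|rewrite /Wk /= sqr_sqrtr ?ltW//; ring].
Qed.

Lemma HH_Wk z : HH z -> Re z ^+ 2 < Wk z.
Proof. by move=> Hz; rewrite /Wk ltrDl exprn_gt0. Qed.

Lemma pt_eq z w : HH z -> HH w -> Re z = Re w -> Wk z = Wk w -> z = w.
Proof.
move=> Hz Hw r; rewrite /Wk r => /addrI /eqP; rewrite eqrXn2 ?ltW// => /eqP.
exact: complexP.
Qed.

Lemma Im_leWk z w : HH z -> HH w -> Re z = Re w -> (Wk z <= Wk w) = (Im z <= Im w).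
Proof. by move=> Hz Hw r; rewrite /Wk r lerD2l ler_sqr ?nnegrE// ltW. Qed.

Lemma Im_ltWk z w : HH z -> HH w -> Re z = Re w -> (Wk z < Wk w) = (Im z < Im w).
Proof. by move=> Hz Hw r; rewrite /Wk r ltrD2l ltr_sqr ?nnegrE// ltW. Qed.

(* [kseg z w p]: p lies on the geodesic segment from z to w. *)
Definition kseg z w p : Prop := exists s : R, [/\ 0 <= s, s <= 1,
  Re p = (1 - s) * Re z + s * Re w & Wk p = (1 - s) * Wk z + s * Wk w].

Lemma kseg_Nm (g : PSL2 R) z w p (s : R) : Re p = (1 - s) * Re z + s * Re w ->
  Wk p = (1 - s) * Wk z + s * Wk w -> Nm g p = (1 - s) * Nm g z + s * Nm g w.
Proof. by move=> h1 h2; rewrite !NmE h1 h2; ring. Qed.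

Lemma isosphereE (g : PSL2 R) z : isosphere g z <-> HH z /\ Nm g z = 1.
Proof.
rewrite /isosphere /= cabsE Re_denom Im_denom -/(Nm g z).
split => -[Hz h]; split => //; last by rewrite h sqrtr1.
by rewrite -(sqr_sqrtr (ltW (Nm_gt0 g Hz))) h expr1n.
Qed.

Lemma isoextE (g : PSL2 R) z : isoext g z <-> HH z /\ 1 < Nm g z.
Proof.
rewrite /isoext /= cabsE Re_denom Im_denom -/(Nm g z).
have E : HH z -> (1 < Num.sqrt (Nm g z)) = (1 < Nm g z).
  by move=> Hz; rewrite -[in LHS](sqrtr1 R) ltr_sqrt// Nm_gt0.
by split => -[Hz h]; split => //; move: h; rewrite E.
Qed.

End Topology.

(** * The common exterior of the isometric spheres *)

Section Ford.
Variables (R : realType) (Gam : set (PSL2 R)).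
Hypothesis fuchG : fuchsian Gam.
Hypothesis cuspG : inf_cuspidal Gam.
Implicit Types (g h s t : PSL2 R) (z w p : R[i]).

Let GM := GamM fuchG.
Let GV := GamV fuchG.
Let G1 := Gam1 fuchG.
Local Notation clK := (clK Gam).

Lemma hypP g : (Gam `\` stab_inf Gam) g <-> Gam g /\ cc g != 0.
Proof.
split => [[Gg ns]|[Gg c0]]; split => //.
  by apply/eqP => c0; apply: ns; apply/stab_infE.
by move=> /stab_infE[_ /eqP]; rewrite (negPf c0).
Qed.

Lemma clKE z : clK z <-> HH z /\ forall g, Gam g -> cc g != 0 -> 1 <= Nm g z.
Proof.
split=> -[Hz H]; split => // g Gg; first by move=> _; exact: H.
have [/(stab_unip fuchG cuspG Gg) u|c0] := eqVneq (cc g) 0; last exact: H.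
by rewrite Nm_unip.
Qed.

Lemma KKE z : KK Gam z <-> HH z /\ forall g, Gam g -> cc g != 0 -> 1 < Nm g z.
Proof.
split=> -[Hz H]; split => // g.
  by move=> Gg c0; have /isoextE[] : isoext g z by apply: H; apply/hypP.
by move=> /hypP[Gg c0]; apply/isoextE; split => //; apply: H.
Qed.

Lemma KK_clK z : KK Gam z -> clK z.
Proof. by move=> /KKE[Hz H]; apply/clKE; split => // g Gg c0; apply/ltW/H. Qed.

Lemma Nm_up g z w : HH z -> HH w -> Re w = Re z -> Im z < Im w -> cc g != 0 -> Nm g z < Nm g w.
Proof.
move=> Hz Hw r i c0; rewrite !NmE r ltrD2r ltrD2r ltr_pM2l; last first.
  by rewrite exprn_even_gt0.
by rewrite Im_ltWk.
Qed.

Lemma KK_above z w : clK z -> Re w = Re z -> Im z < Im w -> KK Gam w.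
Proof.
move=> /clKE[Hz H] r i; have Hw : HH w by apply: lt_trans i.
apply/KKE; split => // g Gg c0; apply: le_lt_trans (H g Gg c0) _.
exact: Nm_up.
Qed.

Lemma clK_above z w : clK z -> Re w = Re z -> Im z <= Im w -> clK w.
Proof.
move=> Kz r; rewrite le_eqVlt => /orP[/eqP i|i]; last exact/KK_clK/(KK_above Kz).
by rewrite (_ : w = z)//; apply: complexP.
Qed.

(** Both points have the maximal height of one and the same orbit. *)
Lemma Nm_clK g z : Gam g -> clK z -> clK (act g z) -> Nm g z = 1.
Proof.
move=> Gg [Hz H] [Hw H']; have := H' _ (GV Gg); rewrite NmV// => h.
by apply/eqP; rewrite eq_le H// andbT -[Nm g z]invrK invf_le1// invr_gt0 Nm_gt0.
Qed.

Lemma clK_act g z : Gam g -> clK z -> Nm g z = 1 -> clK (act g z).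
Proof.
move=> Gg [Hz H] n1; split; first exact: HH_act.
move=> h Gh; have := H _ (GM Gh Gg); rewrite NmM// n1 mulr1//.
Qed.

Lemma KK_stab g z : Gam g -> KK Gam z -> clK (act g z) -> cc g = 0.
Proof.
move=> Gg /[dup] /KK_clK Kz /KKE[Hz H] Kw; apply/eqP/negPn/negP => c0.
by have := H g Gg c0; rewrite (Nm_clK Gg Kz Kw) ltxx.
Qed.

Lemma KK_stab' g z : Gam g -> clK z -> KK Gam (act g z) -> cc g = 0.
Proof.
move=> Gg Kz Kw; have := KK_stab (GV Gg) Kw; rewrite actK; last by case: Kz.
move=> /(_ Kz) c0; have [f [f1 _ _ vc _]] := pslV_coef g; move: c0; rewrite vc => /eqP.
by rewrite mulf_eq0 oppr_eq0 (negPf (sign_neq0 f1)) => /eqP.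
Qed.

Lemma clK_unip t z : Gam t -> unip t -> HH z -> (clK (act t z) <-> clK z).
Proof.
move=> Gt ut Hz; split=> [Kw|Kz].
  have [uV _] := unipV ut.
  by rewrite -(actK t Hz); apply: clK_act; [exact: GV|exact: Kw|exact: Nm_unip].
by apply: clK_act => //; exact: Nm_unip.
Qed.

Lemma KK_unip t z : Gam t -> unip t -> HH z -> KK Gam z -> KK Gam (act t z).
Proof.
move=> Gt ut Hz /KKE[_ H]; apply/KKE; split; first exact: HH_act.
move=> g Gg c0; have := H _ (GM Gg Gt); rewrite NmM// (Nm_unip z ut) mulr1; apply.
by have [_ ->] := unip_cc g ut.
Qed.

Lemma kseg_clK z w p : clK z -> clK w -> HH p -> kseg z w p -> clK p.
Proof.
move=> [Hz Kz] [Hw Kw] Hp [s [s0 s1 r W]]; split => // g Gg.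
rewrite (kseg_Nm g r W); have := Kz g Gg; have := Kw g Gg => a b.
have : 0 <= s * (Nm g w - 1) by rewrite mulr_ge0//; lra.
have : 0 <= (1 - s) * (Nm g z - 1) by rewrite mulr_ge0//; lra.
by lra.
Qed.

Lemma kseg_KK z w p (s : R) : clK z -> KK Gam w -> HH p -> 0 < s -> s <= 1 ->
  Re p = (1 - s) * Re z + s * Re w -> Wk p = (1 - s) * Wk z + s * Wk w -> KK Gam p.
Proof.
move=> [Hz Kz] /KKE[Hw Kw] Hp s0 s1 r W; apply/KKE; split => // g Gg c0.
rewrite (kseg_Nm g r W); have := Kz g Gg; have := Kw g Gg c0 => a b.
have : 0 < s * (Nm g w - 1) by rewrite mulr_gt0//; lra.
have : 0 <= (1 - s) * (Nm g z - 1) by rewrite mulr_ge0//; lra.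
by lra.
Qed.

(** The relative variation of $|cz+d|^2$ is bounded uniformly in [g], because $|c|\,\mathrm{Im}\,z
    \le |cz+d|$. Uniformity is what an intersection of infinitely many exteriors needs in order to
    be open. *)
Lemma Nm_near z w g : HH z -> `|Re w - Re z| <= Im z / 4 -> `|Im w - Im z| <= Im z / 4 ->
  (1 - 4 * (`|Re w - Re z| + `|Im w - Im z|) / Im z) * Nm g z <= Nm g w.
Proof.
move=> Hz h1 h2; have y0 : 0 < Im z by [].
pose u := cc g * Re z + cd g; pose v := cc g * Im z.
pose a := cc g * (Re w - Re z); pose b := cc g * (Im w - Im z).
have -> : Nm g w = Nm g z + 2 * (u * a + v * b) + (a ^+ 2 + b ^+ 2).
  by rewrite /Nm /u /a /v /b; ring.
have Nz : Nm g z = u ^+ 2 + v ^+ 2 by [].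
have d0 : 0 <= `|Re w - Re z| + `|Im w - Im z| by rewrite addr_ge0.
set d := `|Re w - Re z| + `|Im w - Im z| in d0 *.
have c1 : `|cc g| = `|v| / Im z by rewrite /v normrM (gtr0_norm y0) mulfK// gt_eqF.
have uN : `|u| * `|v| <= Nm g z.
  rewrite Nz -[u ^+ 2]real_normK ?num_real// -[v ^+ 2]real_normK ?num_real//.
  have := sqr_ge0 (`|u| - `|v|); have := sqr_ge0 (`|u| + `|v|); rewrite !expr2; lra.
have vN : `|v| * `|v| <= Nm g z.
  by rewrite Nz -expr2 -[v ^+ 2]real_normK ?num_real// lerDr sqr_ge0.
have k1 : `|u * a| <= Nm g z / Im z * `|Re w - Re z|.
  by rewrite /a !normrM c1 !mulrA ler_wpM2r// ler_wpM2r// invr_ge0 ltW.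
have k2 : `|v * b| <= Nm g z / Im z * `|Im w - Im z|.
  rewrite [`|v * b|]normrM (_ : `|b| = `|v| / Im z * `|Im w - Im z|); last by rewrite /b normrM c1.
  rewrite mulrA mulrA; apply: ler_wpM2r => //; apply: ler_wpM2r => //.
  by rewrite invr_ge0 ltW.
have k3 : `|u * a + v * b| <= Nm g z / Im z * d.
  by apply: le_trans (ler_normD _ _) _; rewrite /d mulrDr; apply: lerD.
have k4 : 0 <= Nm g z / Im z * d.
  by rewrite mulr_ge0// divr_ge0 ?(ltW (Nm_gt0 g Hz))// ltW.
have : - (Nm g z / Im z * d) <= u * a + v * b by move: k3; rewrite ler_norml => /andP[].
have -> : (1 - 4 * d / Im z) * Nm g z = Nm g z - 4 * (Nm g z / Im z * d) by field; rewrite gt_eqF.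
by have := sqr_ge0 a; have := sqr_ge0 b; lra.
Qed.

Lemma KK_open : open (KK Gam).
Proof.
rewrite openE => z /KKE[Hz H]; have y0 : 0 < Im z by [].
(* A gap above 1: only finitely many values of [Nm g z] are at most 2, so the least of those above
   1, or 2 itself, serves for all [g]. *)
have [m m1 mH] : exists2 m : R, 1 < m & forall g, Gam g -> cc g != 0 -> m <= Nm g z.
  have /finite_seqP[s sE] := finite_Nm fuchG cuspG 2 Hz.
  have i2 : 2 \in 2 :: [seq x <- s | 1 < x] by rewrite mem_head.
  have [m ms mm] := seq_min i2; exists m.
    by move: ms; rewrite inE mem_filter => /orP[/eqP->|/andP[]//]; lra.
  move=> g Gg c0; have [N2|N2] := leP (Nm g z) 2; last first.
    by apply: le_trans (mm 2 (mem_head _ _)) (ltW N2).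
  apply: mm; rewrite inE mem_filter H//=; apply/orP; right.
  suff : [set` s] (Nm g z) by [].
  by rewrite -sE; exists g.
pose e := Num.min (Im z / 4) (Im z * (1 - m^-1) / 8).
have mi : 0 < 1 - m^-1 by rewrite subr_gt0 invf_lt1//; lra.
have e0 : 0 < e by rewrite lt_min !divr_gt0// mulr_gt0.
apply/nbhs_boxP; exists e => // w wr wi.
have [a1 b1] : `|Re w - Re z| <= Im z / 4 /\ `|Im w - Im z| <= Im z / 4.
  by split; apply/ltW/(lt_le_trans _ (_ : e <= _)) => //; rewrite ge_min lexx.
have e8 : e <= Im z * (1 - m^-1) / 8 by rewrite ge_min lexx orbT.
apply/KKE; split.
  by move: b1; rewrite /HH /= ler_norml => /andP[]; lra.
move=> g Gg c0; apply: lt_le_trans (Nm_near g Hz a1 b1).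
have dlt : 4 * (`|Re w - Re z| + `|Im w - Im z|) / Im z < 1 - m^-1.
  by rewrite ltr_pdivrMr// mulrC; lra.
have : m^-1 < 1 - 4 * (`|Re w - Re z| + `|Im w - Im z|) / Im z by lra.
move=> k; apply: (@lt_le_trans _ _ ((1 - 4 * (`|Re w - Re z| + `|Im w - Im z|) / Im z) * m)).
  by rewrite -ltr_pdivrMr ?div1r//; lra.
rewrite ler_wpM2l ?mH//; apply/ltW/(lt_trans _ k); rewrite invr_gt0; lra.
Qed.

Lemma clK_closed z : HH z -> closure clK z -> clK z.
Proof.
move=> Hz cz; split => // g Gg; rewrite leNgt; apply/negP => n1.
have [w [[_ /(_ g Gg) Kw] /=]] := cz [set w | Nm g w < 1] (continuous_Nm (lt_nbhsl n1)).
by rewrite ltNge Kw.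
Qed.

Lemma clH_KK : clH (KK Gam) = clK.
Proof.
apply/seteqP; split => z.
  move=> [cz Hz]; apply: clK_closed => //; apply: closure_subset cz => w; exact: KK_clK.
move=> Kz; have [Hz _] := Kz; split => //; apply/closure_box => e e0.
exists (Re z +i* (Im z + e / 2)).
  by apply: (KK_above Kz) => //=; lra.
by rewrite /= subrr normr0 addrAC subrr add0r gtr0_norm; lra.
Qed.

Lemma bdH_KK z : bdH (KK Gam) z <-> clK z /\ exists g, [/\ Gam g, cc g != 0 & Nm g z = 1].
Proof.
rewrite /bdH clH_KK; have -> : (KK Gam)^° = KK Gam by apply/interior_id/KK_open.
split=> [[Kz nK]|[Kz [g [Gg c0 n1]]]]; split => //.
  apply: contrapT => nex; apply: nK; apply/KKE; split; first by case: Kz.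
  move=> g Gg c0; rewrite lt_neqAle; case: Kz => _ -> //; rewrite andbT.
  by apply/eqP => e; apply: nex; exists g.
by move=> /KKE[_ /(_ g Gg c0)]; rewrite n1 ltxx.
Qed.

(** The radii $1/|c|$ of the isometric spheres are bounded by [cc_min]. *)
Lemma high_KK : exists2 H : R, 0 < H & forall z, HH z -> H < Im z -> KK Gam z.
Proof.
have [c0 c00 cm] := cc_min fuchG cuspG; exists c0^-1; first by rewrite invr_gt0.
move=> z Hz h; apply/KKE; split => // g Gg gc; rewrite /Nm.
have : 1 < (cc g * Im z) ^+ 2.
  rewrite -[_ ^+ 2]real_normK ?num_real// exprn_egt1//.
  rewrite normrM (gtr0_norm Hz); have := cm g Gg gc => k.
  have : 1 < c0 * Im z by rewrite mulrC -ltr_pdivrMr// div1r.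
  by move=> /lt_le_trans; apply; rewrite ler_pM2r.
by have := sqr_ge0 (cc g * Re z + cd g); lra.
Qed.

End Ford.

(** * Geodesics and their endpoints *)

Section Geodesics.
Variable R : realType.
Implicit Types (g h k : PSL2 R) (z w p : R[i]) (gam : R -> R[i]).

Lemma Wk_act g z : HH z -> Wk (act g z) =
  (ca g ^+ 2 * Wk z + 2 * ca g * cb g * Re z + cb g ^+ 2) / Nm g z.
Proof.
move=> Hz; have N0 := lt0r_neq0 (Nm_gt0 g Hz).
rewrite /Wk Re_act// Im_act// !expr_div_n -mulrDl.
apply: (mulIf (expf_neq0 2 N0)); rewrite divfK ?expf_neq0//.
rewrite -[RHS]mulrA [_^-1 * _](_ : _ = Nm g z); last by rewrite expr2 mulKf.
transitivity (((ca g * Re z + cb g) * (cc g * Re z + cd g) + ca g * cc g * Im z ^+ 2) ^+ 2 +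
  (ca g * cd g - cb g * cc g) ^+ 2 * Im z ^+ 2); first by rewrite psl_det expr1n mul1r.
by rewrite /Nm; ring.
Qed.

Lemma Re_actW g z : HH z -> Re (act g z) =
  (ca g * cc g * Wk z + (ca g * cd g + cb g * cc g) * Re z + cb g * cd g) / Nm g z.
Proof. by move=> Hz; rewrite Re_act//; congr (_ / _); rewrite /Wk; ring. Qed.

(** In the Klein coordinates [g] is a projective map with denominator [Nm g], which is affine;
    segments go to segments, with the weight rescaled by [Nm g w / Nm g p]. *)
Lemma kseg_act g z w p : HH z -> HH w -> HH p -> kseg z w p ->
  kseg (act g z) (act g w) (act g p).
Proof.
move=> Hz Hw Hp [s [s0 s1 r W]].
have Nz := Nm_gt0 g Hz; have Nw := Nm_gt0 g Hw; have Np := Nm_gt0 g Hp.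
have NE := kseg_Nm g r W.
have Nz0 := lt0r_neq0 Nz; have Nw0 := lt0r_neq0 Nw; have Np0 := lt0r_neq0 Np.
exists (s * Nm g w / Nm g p); split.
- by rewrite divr_ge0 ?mulr_ge0// ltW.
- rewrite ler_pdivrMr// mul1r NE lerDr; apply: mulr_ge0; [by rewrite subr_ge0|exact: ltW].
- rewrite !Re_actW// r W.
  apply: (mulIf Np0); rewrite divfK// [RHS]mulrDl.
  transitivity ((1 - s) * (ca g * cc g * Wk z + (ca g * cd g + cb g * cc g) * Re z + cb g * cd g) +
     s * (ca g * cc g * Wk w + (ca g * cd g + cb g * cc g) * Re w + cb g * cd g)); first ring.
  congr (_ + _).
    have -> : 1 - s * Nm g w / Nm g p = (1 - s) * Nm g z / Nm g p by rewrite NE in Np0 *; field.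
    by field; rewrite ?Np0 ?Nz0 ?Nw0.
  by field; rewrite ?Np0 ?Nz0 ?Nw0.
- rewrite !Wk_act// r W.
  apply: (mulIf Np0); rewrite divfK// [RHS]mulrDl.
  transitivity ((1 - s) * (ca g ^+ 2 * Wk z + 2 * ca g * cb g * Re z + cb g ^+ 2) +
     s * (ca g ^+ 2 * Wk w + 2 * ca g * cb g * Re w + cb g ^+ 2)); first ring.
  congr (_ + _).
    have -> : 1 - s * Nm g w / Nm g p = (1 - s) * Nm g z / Nm g p by rewrite NE in Np0 *; field.
    by field; rewrite ?Np0 ?Nz0 ?Nw0.
  by field; rewrite ?Np0 ?Nz0 ?Nw0.
Qed.

(* [2 * Im z * Im w] times the hyperbolic cosine of the distance. *)
Definition Qf z w : R := Wk z + Wk w - 2 * Re z * Re w.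

Lemma Qf_act g z w : HH z -> HH w -> Qf (act g z) (act g w) = Qf z w / (Nm g z * Nm g w).
Proof.
move=> Hz Hw; rewrite /Qf !Wk_act// !Re_actW//.
have Nz := lt0r_neq0 (Nm_gt0 g Hz); have Nw := lt0r_neq0 (Nm_gt0 g Hw).
apply: (mulIf (mulf_neq0 Nz Nw)); rewrite divfK ?mulf_neq0//.
transitivity ((ca g * cd g - cb g * cc g) ^+ 2 * (Wk z + Wk w - 2 * Re z * Re w)); last first.
  by rewrite psl_det expr1n mul1r.
transitivity ((ca g ^+ 2 * Wk z + 2 * ca g * cb g * Re z + cb g ^+ 2) * Nm g w +
  (ca g ^+ 2 * Wk w + 2 * ca g * cb g * Re w + cb g ^+ 2) * Nm g z -
  2 * (ca g * cc g * Wk z + (ca g * cd g + cb g * cc g) * Re z + cb g * cd g) *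
  (ca g * cc g * Wk w + (ca g * cd g + cb g * cc g) * Re w + cb g * cd g)).
  by field; rewrite Nz Nw.
by rewrite !NmE; ring.
Qed.

Lemma hdistE z w : HH z -> HH w ->
  Qf z w = Im z * Im w * (expR (hdist z w) + expR (- hdist z w)).
Proof.
move=> Hz Hw; have z0 : 0 < Im z by []. have w0 : 0 < Im w by [].
rewrite /hdist !cabsE !ReB !ImB.
have -> : Re w^* = Re w by case: w {Hw w0}.
have -> : Im w^* = - Im w by case: w {Hw w0}.
rewrite opprK.
set A2 := _ ^+ 2 + (Im z - Im w) ^+ 2; set B2 := _ ^+ 2 + _ ^+ 2.
have A20 : 0 <= A2 by rewrite addr_ge0 ?sqr_ge0.
have zw0 : 0 < Im z * Im w by rewrite mulr_gt0.
have BA : B2 = A2 + 4 * (Im z * Im w) by rewrite /A2 /B2; ring.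
set P := 2 * Num.sqrt _; have P0 : 0 < P by rewrite mulr_gt0 ?sqrtr_gt0.
have P2 : P ^+ 2 = 4 * (Im z * Im w) by rewrite exprMn sqr_sqrtr ?ltW//; ring.
set A := Num.sqrt A2; set B := Num.sqrt B2.
have AA : A ^+ 2 = A2 by rewrite sqr_sqrtr.
have BB : B ^+ 2 = B2 by rewrite sqr_sqrtr// BA; nra.
have A0 : 0 <= A by exact: sqrtr_ge0.
have B0 : 0 < B by rewrite sqrtr_gt0 BA; nra.
have AB : (A + B) * (B - A) = P ^+ 2 by rewrite P2 -[RHS](addKr A2) -BA -AA -BB; ring.
set q := (A + B) / P; have q0 : 0 < q by rewrite divr_gt0// ltr_wpDl.
have -> : 2 * ln q = ln (q ^+ 2) by rewrite lnXn// mulr_natl.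
rewrite expRN lnK ?posrE ?exprn_gt0//.
have qi : q^-1 = (B - A) / P.
  apply: (mulfI (lt0r_neq0 q0)); rewrite divff ?lt0r_neq0// /q.
  by rewrite mulrACA AB expr2 -invfM divff// mulf_neq0 ?lt0r_neq0.
rewrite -exprVn qi /q !expr_div_n -mulrDl P2.
have -> : (A + B) ^+ 2 + (B - A) ^+ 2 = 2 * (A2 + B2) by rewrite -AA -BB; ring.
rewrite BA /Qf /Wk; have := lt0r_neq0 z0; have := lt0r_neq0 w0 => w1 z1.
by rewrite /A2; field; rewrite z1 w1.
Qed.

(** The standard form of a geodesic, the image of the imaginary axis. Its endpoints are $k.\infty =
    a/c$ in the future and $k.0 = b/d$ in the past. *)
Definition geo k (t : R) : R[i] := act k (geod_i t).

Lemma HH_i (t : R) : HH (geod_i t). Proof. by rewrite /HH /= expR_gt0. Qed.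
Hint Resolve HH_i : core.

Lemma HH_geo k (t : R) : HH (geo k t). Proof. exact: HH_act. Qed.
Hint Resolve HH_geo : core.

Lemma geoM g k (t : R) : geo (g * k)%g t = act g (geo k t).
Proof. by rewrite /geo actM. Qed.

Lemma hdist_act g z w : HH z -> HH w -> hdist (act g z) (act g w) = hdist z w.
Proof.
(* Invariance is clear only for $e^d + e^{-d}$, which determines d among nonnegative numbers. *)
have ge0 (x y : R[i]) : HH x -> HH y -> 0 <= hdist x y.
  move=> Hx Hy; have x0 : 0 < Im x by []. have y0 : 0 < Im y by [].
  rewrite /hdist mulr_ge0// ln_ge0// ler_pdivlMr ?mulr_gt0 ?sqrtr_gt0 ?mulr_gt0// mul1r.
  apply: (@le_trans _ _ (cabs (x - y^*))); last first.
    by rewrite lerDr cabsE sqrtr_ge0.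
  rewrite cabsE ReB ImB.
  have -> : Re y^* = Re y by case: y {Hy y0}.
  have -> : Im y^* = - Im y by case: y {Hy y0}.
  rewrite opprK -[2 * _]ger0_norm ?mulr_ge0 ?sqrtr_ge0// -sqrtr_sqr ler_wsqrtr//.
  rewrite exprMn sqr_sqrtr ?(ltW (mulr_gt0 x0 y0))//.
  have := sqr_ge0 (Re x - Re y); have := sqr_ge0 (Im x - Im y); rewrite !expr2; lra.
move=> Hz Hw; have := hdistE (HH_act g Hz) (HH_act g Hw); rewrite Qf_act// hdistE//.
have Nz := Nm_gt0 g Hz; have Nw := Nm_gt0 g Hw.
have z0 : 0 < Im z by []. have w0 : 0 < Im w by [].
rewrite !Im_act// => e.
have {e} : expR (hdist z w) + expR (- hdist z w) =
  expR (hdist (act g z) (act g w)) + expR (- hdist (act g z) (act g w)).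
  have c0 : Im z * Im w / (Nm g z * Nm g w) != 0.
    by rewrite mulf_neq0 ?mulf_neq0 ?invr_neq0 ?mulf_neq0 ?lt0r_neq0.
  apply: (mulfI c0); rewrite -mulrAC e.
  by field; rewrite !lt0r_neq0.
have : 0 <= hdist z w by exact: ge0.
have : 0 <= hdist (act g z) (act g w) by apply: ge0; exact: HH_act.
move: (hdist z w) (hdist _ _) => a b b0 a0.
rewrite !expRN; have := expR_ge1Dx a; have := expR_ge1Dx b => hb ha.
have Ea : 1 <= expR a by lra. have Eb : 1 <= expR b by lra.
move=> e; apply: expR_inj; have := @expR_gt0 _ a; have := @expR_gt0 _ b => pb pa.
have : (expR a - expR b) * (expR a * expR b - 1) = 0.
  transitivity ((expR a + (expR a)^-1 - (expR b + (expR b)^-1)) * (expR a * expR b)).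
    by field; rewrite !lt0r_neq0.
  by rewrite e subrr mul0r.
move/eqP; rewrite mulf_eq0 => /orP[|]; first by rewrite subr_eq0 => /eqP.
move/eqP => e2; have : expR a * expR b = 1 by lra.
nra.
Qed.

Lemma geodesic_geo k : geodesic (geo k).
Proof.
have [_ iso] := geod_iP R; split => [t|s t]; first exact: HH_geo.
by rewrite hdist_act.
Qed.

(* The isometry z |-> -1/z reverses the geodesic from 0 to infinity. *)
Lemma flip_ex : exists f : PSL2 R, [/\ ca f = 0, cd f = 0, cb f = - cc f & cc f ^+ 2 = 1].
Proof.
have [|f [e [e1 a b c d]]] := @mk_ex R 0 (-1) 1 0; first by rewrite mul0r mulN1r opprK add0r.
by exists f; rewrite a b c d !mulr0 mulrN mulr1.
Qed.

Definition flip : PSL2 R := projT1 (cid flip_ex).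
Lemma flipP : [/\ ca flip = 0, cd flip = 0, cb flip = - cc flip & cc flip ^+ 2 = 1].
Proof. exact: (projT2 (cid flip_ex)). Qed.

Lemma geo_flip k (t : R) : geo (k * flip)%g t = geo k (- t).
Proof.
rewrite /geo actM//; congr act.
have [a d b c2] := flipP; have Et := @expR_gt0 _ t.
have N : Nm flip (geod_i t) = expR t ^+ 2 by rewrite /Nm d /= mulr0 addr0 expr0n /= add0r exprMn c2 mul1r.
apply: complexP; rewrite ?Re_act ?Im_act// N /=.
  by rewrite a d !mul0r mulr0 !(add0r, addr0) mulr0 mul0r.
by rewrite expRN expr2 invfM mulrA divff ?mul1r// lt0r_neq0.
Qed.

Lemma flip_coef k : exists2 e : R, e ^+ 2 = 1 &
  [/\ ca (k * flip)%g = e * cb k, cb (k * flip)%g = - e * ca k,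
      cc (k * flip)%g = e * cd k & cd (k * flip)%g = - e * cc k].
Proof.
have [a d b c2] := flipP; have [e [e1 ha hb hc hd]] := pslM_coef k flip.
exists (e * cc flip); first by rewrite exprMn e1 c2 mulr1.
by split; rewrite ?ha ?hb ?hc ?hd ?a ?b ?d; ring.
Qed.

(** A time shift is right multiplication by the diagonal matrix with entries $e^{s/2}$ and
    $e^{-s/2}$, which fixes 0 and infinity. *)
Lemma geo_shift k (s : R) : exists k', [/\ forall t, geo k' t = geo k (t + s),
  (cc k' == 0) = (cc k == 0), (cd k' == 0) = (cd k == 0), ca k' / cc k' = ca k / cc k &
  cb k' / cd k' = cb k / cd k].
Proof.
have E2 := @expR_gt0 _ (s / 2).
have [|f [e [e1 a b c d]]] := @mk_ex R (expR (s / 2)) 0 0 (expR (s / 2))^-1.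
  by rewrite mulfV ?lt0r_neq0// mulr0 subr0.
have [x [x1 ha hb hc hd]] := pslM_coef k f.
have fa : ca f != 0 by rewrite a mulf_neq0 ?(sign_neq0 e1) ?lt0r_neq0.
have fd : cd f != 0 by rewrite d mulf_neq0 ?(sign_neq0 e1)// invr_neq0 ?lt0r_neq0.
have x0 := sign_neq0 x1.
have b0 : cb f = 0 by rewrite b mulr0. have c0 : cc f = 0 by rewrite c mulr0.
exists (k * f)%g; split.
- move=> t; rewrite /geo actM//; congr act.
  have N : Nm f (geod_i t) = (expR (s / 2))^-1 ^+ 2.
    by rewrite /Nm c0 d /= !mul0r add0r expr0n addr0 exprMn e1 mul1r.
  apply: complexP; rewrite ?Re_act ?Im_act// N /= ?b0 ?c0 ?mulr0 ?mul0r ?addr0 ?mul0r//.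
  rewrite exprVn invrK expRD; congr (_ * _).
  by rewrite expr2 -expRD; congr expR; field.
- by rewrite hc c0 mulr0 addr0 !mulf_eq0 (negPf x0) (negPf fa) orbF.
- by rewrite hd b0 mulr0 add0r !mulf_eq0 (negPf x0) (negPf fd) orbF.
- rewrite ha hc c0 !mulr0 !addr0 !invfM mulrACA divff// mul1r mulrACA divff// mulr1.
  by [].
- rewrite hb hd b0 !mulr0 !add0r !invfM mulrACA divff// mul1r mulrACA divff// mulr1.
  by [].
Qed.

Lemma geo_Re k (t : R) : Re (geo k t) =
  (ca k * cc k * expR t ^+ 2 + cb k * cd k) / (cc k ^+ 2 * expR t ^+ 2 + cd k ^+ 2).
Proof. by rewrite Re_act// /Nm /= !mulr0 !add0r; congr (_ / _); ring. Qed.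

Lemma geo_Im k (t : R) : Im (geo k t) = expR t / (cc k ^+ 2 * expR t ^+ 2 + cd k ^+ 2).
Proof. by rewrite Im_act// /Nm /= !mulr0 !add0r; congr (_ / _); ring. Qed.

Lemma geo_Wk k (t : R) : Wk (geo k t) =
  (ca k ^+ 2 * expR t ^+ 2 + cb k ^+ 2) / (cc k ^+ 2 * expR t ^+ 2 + cd k ^+ 2).
Proof. by rewrite Wk_act// NmE /Wk /= !mulr0; congr (_ / _); ring. Qed.

(* The geodesic with (real) endpoints al (future) and be (past). *)
Lemma geo_ends (al be : R) : al != be -> exists k, [/\ cc k != 0, cd k != 0,
  ca k / cc k = al & cb k / cd k = be].
Proof.
wlog ab : al be / be < al => [hw n|_].
  have [/hw/(_ n)//|ab] := ltP be al.
  have {}ab : al < be by rewrite lt_neqAle n.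
  have [|k [c0 d0 ha hb]] := hw _ _ ab; first by rewrite eq_sym.
  have [e e1 [fa fb fc fd]] := flip_coef k; have e0 := sign_neq0 e1.
  exists (k * flip)%g; rewrite fa fb fc fd.
  split; rewrite ?mulf_neq0 ?oppr_eq0// -?ha -?hb; field; rewrite ?oppr_eq0 ?e0 ?c0 ?d0//.
pose q := Num.sqrt (al - be); have q0 : 0 < q by rewrite sqrtr_gt0 subr_gt0.
have qq : q * q = al - be by rewrite -expr2 sqr_sqrtr// subr_ge0 ltW.
have qn := lt0r_neq0 q0.
have [|k [e [e1 a b c d]]] := @mk_ex R (al / q) (be / q) q^-1 q^-1.
  transitivity ((al - be) / (q * q)); first by field; rewrite qn.
  by rewrite -qq divff ?mulf_neq0.
have e0 := sign_neq0 e1.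
by exists k; split; rewrite ?a ?b ?c ?d ?mulf_neq0 ?invr_neq0//; field; rewrite ?e0 ?qn.
Qed.

Lemma geo_hit (al be : R) k p : cc k != 0 -> cd k != 0 -> ca k / cc k = al -> cb k / cd k = be ->
  HH p -> Wk p = (al + be) * Re p - al * be -> exists t, p = geo k t.
Proof.
move=> c0 d0 ea eb Hp W.
have ha : ca k = al * cc k by rewrite -ea divfK.
have hb : cb k = be * cd k by rewrite -eb divfK.
have y0 : 0 < Im p by [].
have key : (Re p - be) * (al - Re p) = Im p ^+ 2.
  by transitivity ((al + be) * Re p - al * be - Re p ^+ 2); [ring|rewrite -W /Wk; ring].
have key0 : 0 < (Re p - be) * (al - Re p) by rewrite key exprn_gt0.
have al0 : al - Re p != 0 by apply: contraTneq key0 => ->; rewrite mulr0 ltxx.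
(* The value of $e^{2t}$ obtained by solving [geo_Re] for the abscissa of [p]. *)
pose E := (Re p - be) / (al - Re p) * (cd k / cc k) ^+ 2.
have E0 : 0 < E.
  have -> : E = (Re p - be) * (al - Re p) * (cd k / cc k / (al - Re p)) ^+ 2.
    by rewrite /E; field; rewrite ?c0 ?al0.
  by rewrite mulr_gt0// exprn_even_gt0//= !mulf_neq0 ?invr_eq0.
exists (ln (Num.sqrt E)).
have s0 : 0 < Num.sqrt E by rewrite sqrtr_gt0.
have dt : (al - be) * (cc k * cd k) = 1.
  by rewrite -[RHS](psl_det k) ha hb; ring.
have D0 : Re p - be + (al - Re p) != 0.
  have -> : Re p - be + (al - Re p) = al - be by ring.
  by apply: contraTneq (oner_neq0 R) => e; rewrite -dt e mul0r eqxx.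
have ab0 : al - be != 0.
  by apply: contraTneq (oner_neq0 R) => e; rewrite -dt e mul0r eqxx.
have DE : cc k ^+ 2 * E + cd k ^+ 2 = cd k ^+ 2 * (al - be) / (al - Re p).
  by rewrite /E; field; rewrite ?al0 ?c0.
apply: pt_eq => //.
- rewrite geo_Re lnK ?posrE// sqr_sqrtr ?ltW// DE /E ha hb.
  by field; rewrite ?al0 ?ab0 ?c0 ?d0.
- rewrite geo_Wk lnK ?posrE// sqr_sqrtr ?ltW// DE /E ha hb W.
  by field; rewrite ?al0 ?ab0 ?c0 ?d0.
Qed.

Lemma line_ex0 z w : HH z -> HH w -> z <> w -> exists k t0 t1, geo k t0 = z /\ geo k t1 = w.
Proof.
move=> Hz Hw zw; have z0 : 0 < Im z by []. have w0 : 0 < Im w by [].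
have [r|r] := eqVneq (Re z) (Re w).
  have [|k [e [e1 a b c d]]] := @mk_ex R 1 (Re z) 0 1; first by rewrite mulr0 subr0 mulr1.
  exists k, (ln (Im z)), (ln (Im w)); rewrite mulr0 in c; rewrite mulr1 in a d.
  have ee : e * e = 1 by rewrite -expr2.
  split; apply: complexP; rewrite ?geo_Re ?geo_Im c d expr0n/= !mul0r add0r e1 divr1 ?lnK ?posrE//.
    by rewrite mulr0 mul0r add0r b mulrAC ee mul1r.
  by rewrite mulr0 mul0r add0r b mulrAC ee mul1r.
have r0 : Re z - Re w != 0 by rewrite subr_eq0.
(* The chord through both points in Klein coordinates is $W = SX - P$; the endpoints of the geodesic
   are the roots of $X^2 - SX + P$. *)
pose S := (Wk z - Wk w) / (Re z - Re w); pose P := S * Re z - Wk z.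
have Pw : P = S * Re w - Wk w by rewrite /P /S; field.
have dp : 0 < S ^+ 2 - 4 * P.
  have -> : S ^+ 2 - 4 * P = (S - 2 * Re z) ^+ 2 + 4 * Im z ^+ 2 by rewrite /P /Wk; ring.
  by apply: ltr_wpDl; [exact: sqr_ge0|rewrite mulr_gt0// exprn_gt0].
pose q := Num.sqrt (S ^+ 2 - 4 * P); have q0 : 0 < q by rewrite sqrtr_gt0.
have qq : q ^+ 2 = S ^+ 2 - 4 * P by rewrite sqr_sqrtr// ltW.
have sm : (S + q) / 2 + (S - q) / 2 = S by field.
have pm : (S + q) / 2 * ((S - q) / 2) = P.
  transitivity ((S ^+ 2 - q ^+ 2) / 4); first by field.
  by rewrite qq; field.
have [|k [c0 d0 ea eb]] := @geo_ends ((S + q) / 2) ((S - q) / 2).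
  by rewrite -subr_eq0 (_ : _ - _ = q) ?lt0r_neq0//; field.
have [|t0 E0] := geo_hit c0 d0 ea eb Hz; first by rewrite sm pm /P; ring.
have [|t1 E1] := geo_hit c0 d0 ea eb Hw; first by rewrite sm pm Pw; ring.
by exists k, t0, t1.
Qed.

Lemma line_ex z w : HH z -> HH w -> z <> w ->
  exists k t0 t1, [/\ t0 < t1, geo k t0 = z & geo k t1 = w].
Proof.
move=> Hz Hw zw; have [k [t0 [t1 [E0 E1]]]] := line_ex0 Hz Hw zw.
case: (ltgtP t0 t1) => t01; first by exists k, t0, t1.
  exists (k * flip)%g, (- t0), (- t1); rewrite !geo_flip !opprK; split => //.
  by rewrite ltrN2.
by case: zw; rewrite -E0 -E1 t01.
Qed.

(** A point is determined by its distances $|t|$ and $|1-t|$ from two points at distance 1. After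
    normalizing these to the points i and ei of the imaginary axis, the two distance equations give
    $ie^t$. *)
Lemma geodesicE gam : geodesic gam -> exists k, gam = geo k.
Proof.
move=> [Hg iso].
have d01 : hdist (gam 0) (gam 1) = 1 by rewrite iso sub0r normrN normr1.
have zw : gam 0 <> gam 1.
  move=> e; move: d01; rewrite -e iso subrr normr0 => /eqP.
  by rewrite eq_sym oner_eq0.
have [k [t0 [t1 [t01 E0 E1]]]] := line_ex (Hg 0) (Hg 1) zw.
have [_ isok] := geodesic_geo k.
have t1E : t1 = 1 + t0.
  by move: (isok t1 t0); rewrite gtr0_norm ?subr_gt0// E0 E1 iso subr0 normr1; lra.
have [k' [kE _ _ _ _]] := geo_shift k t0; exists k'; apply/funext => t.
have z0E : geo k' 0 = gam 0 by rewrite kE add0r.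
have z1E : geo k' 1 = gam 1 by rewrite kE -t1E.
pose w := act k'^-1%g (gam t); have Hw : HH w by exact: HH_act.
have gw : act k' w = gam t by rewrite actKV.
have e0 : hdist (geod_i 0) w = `|t|.
  by rewrite -(hdist_act k')// -/(geo k' 0) z0E gw iso sub0r normrN.
have e1 : hdist (geod_i 1) w = `|1 - t|.
  by rewrite -(hdist_act k')// -/(geo k' 1) z1E gw iso.
have ch (x : R) : expR `|x| + expR (- `|x|) = expR x + expR (- x).
  by have [x0|x0] := leP 0 x; [rewrite ger0_norm|rewrite ltr0_norm// opprK addrC].
have := hdistE (HH_i 0) Hw; have := hdistE (HH_i 1) Hw; rewrite e0 e1 (ch t) (ch (1 - t)).
rewrite /Qf /Wk /= !mulr0 !mul0r !subr0 expR0 expr1n expr0n/= !add0r !mul1r.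
rewrite opprB !expRD !expRN => h1 h0.
have Et := @expR_gt0 _ t; have E1p : 1 < expR 1 :> R by rewrite expR_gt1.
have E10 := lt_trans ltr01 E1p.
have Iw : Im w = expR t.
  have : Im w * (expR 1 * (expR 1 * (expR t)^-1 + expR t * (expR 1)^-1) - (expR t + (expR t)^-1)) =
      expR 1 ^+ 2 - 1.
    transitivity (expR 1 * Im w * (expR 1 / expR t + expR t / expR 1) - Im w * (expR t + (expR t)^-1)); first ring.
    by rewrite -h1 -h0; ring.
  have -> : expR 1 * (expR 1 * (expR t)^-1 + expR t * (expR 1)^-1) - (expR t + (expR t)^-1) =
      (expR 1 ^+ 2 - 1) / expR t by field; rewrite !lt0r_neq0.
  have p0 : expR 1 ^+ 2 - 1 != 0 :> R.
    by rewrite lt0r_neq0// subr_gt0 exprn_egt1.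
  move=> h2; apply: (mulIf p0); apply: (mulIf (invr_neq0 (lt0r_neq0 Et))).
  by rewrite -mulrA h2 [expR t * _]mulrC mulfK// lt0r_neq0.
have Rw : Re w = 0.
  move: h0; rewrite Iw mulrDr divff ?lt0r_neq0// -expr2 => h0.
  by apply/eqP; rewrite -sqrf_eq0; apply/eqP; lra.
by rewrite -gw /geo; congr act; apply: complexP.
Qed.

Lemma velocity_geo k t : velocity (geo k) t = (geo k t, (0 +i* expR t) / denom k (geod_i t) ^+ 2).
Proof.
rewrite /velocity; congr (_, _).
have Et := @expR_gt0 _ t.
have D0 : cc k ^+ 2 * (expR t * expR t) + cd k ^+ 2 != 0.
  rewrite lt0r_neq0// (_ : _ + _ = Nm k (geod_i t)) ?Nm_gt0//.
  by rewrite /Nm /=; ring.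
have h0 : is_derive t 1 (@expR R) (expR t) by exact: is_derive_expR.
have h1 : is_derive t 1 (fun x : R => expR x * expR x) (2 * (expR t * expR t)).
  by apply: is_derive_eq; rewrite /GRing.scale /=; ring.
have hD : is_derive t 1 (fun x : R => cc k ^+ 2 * (expR x * expR x) + cd k ^+ 2)
    (cc k ^+ 2 * (2 * (expR t * expR t))).
  by apply: is_derive_eq; rewrite /GRing.scale /=; ring.
pose D x := cc k ^+ 2 * (expR x * expR x) + cd k ^+ 2.
have hV : is_derive t 1 (fun x : R => (D x)^-1) (- (D t) ^- 2 *: (cc k ^+ 2 * (2 * (expR t * expR t)))).
  exact: (@is_deriveV R D t _ 1 D0 hD).
have hR : is_derive t 1 (fun x : R => (ca k * cc k * (expR x * expR x) + cb k * cd k) * (D x)^-1)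
    ((2 * (cc k * cd k) * (expR t * expR t)) / D t ^+ 2).
  apply: is_derive_eq; rewrite /GRing.scale /=.
  rewrite -[in RHS](mulr1 (2 * _)) -(psl_det k); rewrite -/(D t) in D0; rewrite /D in D0 *.
  by field.
have hI : is_derive t 1 (fun x : R => expR x * (D x)^-1)
    (expR t * (cd k ^+ 2 - cc k ^+ 2 * (expR t * expR t)) / D t ^+ 2).
  apply: is_derive_eq; rewrite /GRing.scale /=; rewrite -/(D t) in D0; rewrite /D in D0 *.
  by field.
have DE x : cc k ^+ 2 * expR x ^+ 2 + cd k ^+ 2 = D x by rewrite /D expr2.
have -> : @complex.Re R \o geo k = fun x : R => (ca k * cc k * (expR x * expR x) + cb k * cd k) * (D x)^-1.
  by apply/funext => x; rewrite /comp geo_Re DE expr2.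
have -> : @complex.Im R \o geo k = fun x : R => expR x * (D x)^-1.
  by apply/funext => x; rewrite /comp geo_Im DE.
rewrite !derive1E (@derive_val _ _ _ _ _ _ _ hR) (@derive_val _ _ _ _ _ _ _ hI).
have dn := denom_neq0 k (HH_i t).
apply: (mulIf (expf_neq0 2 dn)); rewrite divfK ?expf_neq0//.
rewrite -/(D t) in D0.
rewrite (expr2 (denom _ _)); rewrite /D in D0 *.
by apply: complexP; rewrite !(ReM, ImM) Re_denom Im_denom /=; field; exact: D0.
Qed.

Lemma velocity_act g k t : velocity (geo (g * k)%g) t = actT g (velocity (geo k) t).
Proof.
rewrite !velocity_geo geoM /actT /=; congr (_, _).
have [e e1 ->] := denomM g k (HH_i t).
by rewrite !exprMn -rmorphXn /= e1 mul1r invfM mulrA mulrAC.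
Qed.

(** The quotient [m] of [k] and [k'] maps a point of the imaginary axis to another one and keeps the
    upward direction; this forces [m] to be diagonal, that is, a time shift. *)
Lemma velocity_inj k k' t t' : velocity (geo k) t = velocity (geo k') t' ->
  forall s, geo k (t + s) = geo k' (t' + s).
Proof.
have [m kE] : exists m : PSL2 R, k = (k' * m)%g by exists (k'^-1 * k)%g; rewrite mulgA mulgV mul1g.
rewrite kE => vE; have p1 : geo (k' * m)%g t = geo k' t' := congr1 fst vE.
have v1 : (actT k' (velocity (geo m) t)).2 = (velocity (geo k') t').2 by rewrite -velocity_act vE.
rewrite /actT !velocity_geo in v1; cbn [fst snd] in v1.
have mz : act m (geod_i t) = geod_i t'.
  exact: (act_inj (HH_act m (HH_i t)) (HH_i t') (etrans (esym (actM k' m (HH_i t))) p1)).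
have Et := @expR_gt0 _ t; have Et' := @expR_gt0 _ t'.
have v2 : 0 +i* expR t = (0 +i* expR t') * denom m (geod_i t) ^+ 2.
  have d1 := denom_neq0 m (HH_i t); have d2 := denom_neq0 k' (HH_i t').
  move: v1; rewrite {1}/geo mz => v1.
  apply: (mulIf (invr_neq0 (expf_neq0 2 d1))); apply: (mulIf (invr_neq0 (expf_neq0 2 d2))).
  by rewrite v1 mulfK ?expf_neq0.
clear vE p1 v1 kE.
have [cd0 dd] : cc m * cd m = 0 /\ expR t' * (cd m ^+ 2 - cc m ^+ 2 * expR t ^+ 2) = expR t.
  rewrite expr2 in v2.
  have := congr1 (@complex.Re R) v2; have := congr1 (@complex.Im R) v2.
  rewrite !(ReM, ImM) Re_denom Im_denom => h2 h1; simpl in h1, h2; split.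
    have : expR t' * expR t * (cc m * cd m) = 0 by lra.
    by move/eqP; rewrite mulf_eq0 mulf_eq0 (gt_eqF Et) (gt_eqF Et') /= => /eqP.
  by rewrite [RHS]h2; ring.
have c0 : cc m = 0.
  move/eqP: cd0; rewrite mulf_eq0 => /orP[/eqP//|/eqP d0].
  move: dd; rewrite d0 expr0n /= sub0r => dd.
  have := mulr_ge0 (ltW Et') (mulr_ge0 (sqr_ge0 (cc m)) (sqr_ge0 (expR t))).
  rewrite mulrN in dd.
  lra.
have ad : ca m * cd m = 1 by have := psl_det m; rewrite c0 mulr0 subr0.
have dd' : expR t' * cd m ^+ 2 = expR t by rewrite -[RHS]dd c0; ring.
have d0 : cd m != 0 by apply: contraTneq (oner_neq0 R) => e; rewrite -ad e mulr0 eqxx.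
have b0 : cb m = 0.
  have H := congr1 (@complex.Re R) mz; rewrite (Re_act m (HH_i t)) c0 in H; simpl in H.
  have {H} : cb m * cd m / Nm m (geod_i t) = 0 by rewrite -[RHS]H; congr (_ / _); ring.
  move/eqP; rewrite mulf_eq0 invr_eq0 (gt_eqF (Nm_gt0 m (HH_i t))) orbF mulf_eq0 (negPf d0) orbF.
  by move/eqP.
move=> s; rewrite geoM /geo; congr act; clear mz v2.
have N : Nm m (geod_i (t + s)) = cd m ^+ 2 by rewrite /Nm c0 /= !mul0r expr0n /= addr0 add0r.
apply: complexP; rewrite ?Re_act ?Im_act// N /= ?b0 ?c0 ?mulr0 ?mul0r ?addr0 ?mul0r//.
by rewrite !expRD -dd' mulrAC mulfK// expf_neq0.
Qed.

End Geodesics.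

Arguments geo : simpl never.
Arguments act : simpl never.

Section Endpoints.
Variable R : realType.
Local Notation P1 := (one_point_compactification R[i]).
Implicit Types (g h k j : PSL2 R) (z w p : R[i]) (gam : R -> R[i]) (x y : P1).
#[local] Hint Resolve HH_i HH_geo : core.

Definition cbox (B : R) : set R[i] := [set w | `|Re w| <= B /\ `|Im w| <= B].

Lemma cbox_compact B : compact (cbox B) /\ closed (cbox B).
Proof.
have cl : closed (cbox B).
  move=> z /closure_box H; split.
    rewrite leNgt; apply/negP; rewrite -subr_gt0 => /H[w [w1 _] [w2 _]].
    have := ler_normB (Re w) (Re w - Re z); rewrite (_ : Re w - (Re w - Re z) = Re z); [lra|ring].
  rewrite leNgt; apply/negP; rewrite -subr_gt0 => /H[w [_ w1] [_ w2]].
  have := ler_normB (Im w) (Im w - Im z); rewrite (_ : Im w - (Im w - Im z) = Im z); [lra|ring].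
split => //.
have -> : cbox B = (fun u : R * R => u.1 +i* u.2) @` (`[- B, B] `*` `[- B, B]).
  apply/seteqP; split => [w [w1 w2]|_ [[u v] /= [u1 u2] <-]].
    exists (Re w, Im w); last by case: w {w1 w2}.
    by split; rewrite /= in_itv /= -ler_norml.
  by split => /=; rewrite ler_norml; [move: u1|move: u2]; rewrite in_itv.
apply: continuous_compact; last by apply: compact_setX; exact: segment_compact.
apply: continuous_subspaceT => -[u v] U /nbhs_boxP[e e0 bU].
exists (ball u e, ball v e) => /=; first by split; apply: nbhsx_ballx.
by move=> [u' v'] [/= h1 h2]; apply: bU => /=; rewrite distrC.
Qed.

Lemma pinftyP (P : set R) : (\forall t \near +oo, P t) <-> exists T : R, forall t, T < t -> P t.
Proof.
split=> [[M [_ MP]]|[T TP]]; first by exists M.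
by exists T; split; rewrite ?num_real.
Qed.

Lemma reaches_fin gam z : reaches gam +oo%E (fin z) <-> forall e : R, 0 < e ->
  exists T : R, forall t, T < t -> `|Re (gam t) - Re z| < e /\ `|Im (gam t) - Im z| < e.
Proof.
split=> [H e e0|H U].
  have /pinftyP[T TP] : \forall t \near +oo, (Some @` [set w | `|Re w - Re z| < e /\ `|Im w - Im z| < e]) (fin (gam t)).
    have H' : forall U, nbhs (fin z : P1) U -> \forall t \near +oo, U (fin (gam t)) := H.
    apply: H'; apply: one_point_compactification_some_nbhs; apply/nbhs_boxP.
    by exists e.
  by exists T => t /TP[w h [<-]].
move=> /nbhs_boxP[e e0 bU]; apply/pinftyP; have [T TP] := H e e0.
by exists T => t /TP[h1 h2]; apply: bU.
Qed.

Lemma reaches_inf gam : reaches gam +oo%E (pinf R) <-> forall B : R,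
  exists T : R, forall t, T < t -> ~ cbox B (gam t).
Proof.
split=> [H B|H U].
  have /pinftyP[T TP] : \forall t \near +oo, ((Some @` (~` cbox B)) `|` [set None]) (fin (gam t) : P1).
    have H' : forall U, nbhs (pinf R : P1) U -> \forall t \near +oo, U (fin (gam t)) := H.
    by apply: H'; exists (cbox B) => //; exact: cbox_compact.
  by exists T => t /TP[[w h [<-]]|].
move=> [K [cK clK] KU].
have bd (f : R[i] -> R) : continuous f -> exists M : R, forall w, K w -> `|f w| <= M.
  move=> cf; have /compact_bounded : compact (f @` K).
    by apply: continuous_compact => //; exact: continuous_subspaceT.
  move=> [M [Mr MP]]; exists (M + 1) => w Kw; apply: (MP (M + 1)); first by rewrite ltrDl.
  by exists w.
have [M1 h1] := bd _ (@continuous_Re R); have [M2 h2] := bd _ (@continuous_Im R).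
have [T TP] := H (Num.max M1 M2); apply/pinftyP; exists T => t /TP nK.
apply: KU; left; exists (gam t) => // Kt; apply: nK.
by split; rewrite le_max ?h1// h2 ?orbT.
Qed.

Lemma reaches_uniq (gam : R -> R[i]) (x y : P1) : reaches gam +oo%E x -> reaches gam +oo%E y -> x = y.
Proof.
have fi z : reaches gam +oo%E (fin z) -> reaches gam +oo%E (pinf R) -> False.
  move=> /reaches_fin /(_ 1 ltr01) [T TP] /reaches_inf /(_ (`|Re z| + `|Im z| + 1)) [T' TP'].
  have /andP[m1 m2] : (T < Num.max T T' + 1) && (T' < Num.max T T' + 1).
    by rewrite !ltrD2r || (rewrite -![_ < _ + 1]ltrBlDr !lt_max; apply/andP; split; apply/orP; [left|right]; lra).
  have [a b] := TP _ m1; apply: (TP' _ m2); move: (gam _) a b => w a b.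
  have := normr_ge0 (Re z); have := normr_ge0 (Im z) => n1 n2; split.
    by have := ler_normD (Re w - Re z) (Re z); rewrite subrK; lra.
  by have := ler_normD (Im w - Im z) (Im z); rewrite subrK; lra.
case: x => [z|]; case: y => [w|] //; last 2 first.
- by move=> h1 h2; case: (fi z h1 h2).
- by move=> h1 h2; case: (fi w h2 h1).
move=> /reaches_fin hz /reaches_fin hw; congr Some.
have key (e : R) : 0 < e -> `|Re z - Re w| < 2 * e /\ `|Im z - Im w| < 2 * e.
  move=> e0; have [T TP] := hz e e0; have [T' TP'] := hw e e0.
  have m1 : T < Num.max T T' + 1 by rewrite ltr_pwDr// le_max lexx.
  have m2 : T' < Num.max T T' + 1 by rewrite ltr_pwDr// le_max lexx orbT.
  have [a b] := TP _ m1; have [a' b'] := TP' _ m2; move: (gam _) a b a' b' => v.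
  rewrite distrC => a; rewrite distrC => b a' b'; split.
    by have := ler_normD (Re z - Re v) (Re v - Re w); rewrite addrA subrK; lra.
  by have := ler_normD (Im z - Im v) (Im v - Im w); rewrite addrA subrK; lra.
apply: complexP; apply/eqP; rewrite -subr_eq0 -normr_eq0; apply/eqP/le_anti; rewrite normr_ge0 andbT.
  by apply/ler_addgt0Pl => e e0; rewrite addr0; have [] := key (e / 2) ltac:(by rewrite divr_gt0) => h _; lra.
by apply/ler_addgt0Pl => e e0; rewrite addr0; have [] := key (e / 2) ltac:(by rewrite divr_gt0) => _ h; lra.
Qed.

Lemma reaches_geo_pinf k : reaches (geo k) +oo%E (actS k (pinf R)).
Proof.
rewrite /actS /= -/(cc k) -/(ca k); case: ifPn => c0.
  apply/reaches_inf => B.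
  have d0 : cd k != 0.
    have := psl_det k; rewrite (eqP c0) mulr0 subr0 => h.
    by apply: contraTneq (oner_neq0 R) => e; rewrite -h e mulr0 eqxx.
  have d2 : 0 < cd k ^+ 2 by rewrite exprn_even_gt0.
  exists (`|B| * cd k ^+ 2) => t tT [_]; apply/negP; rewrite -ltNge.
  apply: le_lt_trans (ler_norm B) _; rewrite geo_Im (eqP c0) expr0n /= mul0r add0r.
  rewrite (gtr0_norm (divr_gt0 (expR_gt0 t) d2)) ltr_pdivlMr//.
  by apply: lt_le_trans tT _; apply: le_trans (expR_ge1Dx t); lra.
apply/reaches_fin => e e0.
have c2 : 0 < cc k ^+ 2 by rewrite exprn_even_gt0.
(* Once $e^t > 1$, the real part and the height both differ from those of the limit by at most
   $(1+|d/c|)/(c^2e^t)$. *)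
pose M : R := (1 + `|cd k / cc k|) / (e * cc k ^+ 2) + 1.
have n0 : 0 <= (1 + `|cd k / cc k|) / (e * cc k ^+ 2).
  by rewrite divr_ge0 ?addr_ge0// mulr_ge0 ?(ltW e0) ?(ltW c2).
exists M => t tM.
have EM : M < expR t by apply: lt_le_trans tM _; apply: le_trans (expR_ge1Dx t); lra.
have E1 : 1 < expR t by rewrite /M in EM; lra.
have E0 : 0 < expR t := lt_trans ltr01 E1.
pose D := cc k ^+ 2 * expR t ^+ 2 + cd k ^+ 2.
have DE : cc k ^+ 2 * expR t <= D.
  apply: (@le_trans _ _ (cc k ^+ 2 * expR t ^+ 2)); last by rewrite lerDl sqr_ge0.
  by rewrite ler_pM2l// expr2 ler_peMl// ltW.
have D0 : 0 < D by apply: lt_le_trans DE; rewrite mulr_gt0.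
have key (u : R) : 0 <= u -> u <= 1 + `|cd k / cc k| -> u / (cc k ^+ 2 * expR t) < e.
  move=> u0 uM; rewrite (ltr_pdivrMr _ _ (mulr_gt0 c2 E0)); apply: (le_lt_trans uM).
  by rewrite mulrA -(ltr_pdivrMl _ _ (mulr_gt0 e0 c2)) mulrC; rewrite /M in EM; lra.
have nn := normr_ge0 (cd k / cc k).
split.
  have -> : Re (geo k t) - Re (ca k / cc k)%:C = - (cd k / cc k) / D.
    rewrite geo_Re -/D /=; apply: (mulIf (lt0r_neq0 D0)); rewrite mulrBl !divfK ?lt0r_neq0//.
    have dt := psl_det k; rewrite -[RHS]mulr1 -dt /D; field; exact: c0.
  rewrite normrM normfV (gtr0_norm D0) normrN; apply: le_lt_trans (key `|cd k / cc k| _ _); [|by []|lra].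
  by rewrite ler_wpM2l// lef_pV2 ?posrE// mulr_gt0.
have -> : Im (ca k / cc k)%:C = 0 by [].
rewrite subr0 geo_Im -/D gtr0_norm ?divr_gt0//.
apply: le_lt_trans (key 1 _ _); [|by []|lra].
rewrite (ler_pdivrMr _ _ D0) mulrAC mul1r (ler_pdivlMr _ _ (mulr_gt0 c2 E0)) mulrC.
by rewrite /D -mulrA -expr2 lerDl sqr_ge0.
Qed.

Lemma reaches_neg gam x : reaches gam -oo%E x <-> reaches (fun t => gam (- t)) +oo%E x.
Proof. by rewrite /reaches /=; exact: cvgNy_compNP. Qed.

Lemma geo_flip_fun k : (fun t => geo k (- t)) = geo (k * flip R)%g.
Proof. by apply/funext => t; rewrite geo_flip. Qed.

Lemma actS_flip k : actS (k * flip R)%g (pinf R) = actS k (fin 0).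
Proof.
have [e e1 [ha hb hc hd]] := flip_coef k; have e0 := sign_neq0 e1.
rewrite /actS /fin /= -/(cc _) -/(ca _) hc ha mulf_eq0 (negPf e0) /=.
have -> : denom k 0 = (cd k)%:C by rewrite /denom mulr0 add0r.
have -> : ((cd k)%:C == 0) = (cd k == 0) by rewrite eq_complex /= eqxx andbT.
case: ifPn => // d0; congr Some; rewrite /act mulr0 add0r /denom mulr0 add0r -/(cb k) -/(cd k).
rewrite -fmorph_div; congr (_%:C); field; rewrite ?e0 ?d0//.
Qed.

Lemma reaches_geo_p k x : reaches (geo k) +oo%E x <-> x = actS k (pinf R).
Proof.
split=> [h|->]; last exact: reaches_geo_pinf.
apply: (reaches_uniq h); exact: reaches_geo_pinf.
Qed.

Lemma reaches_geo_m k x : reaches (geo k) -oo%E x <-> x = actS k (fin 0).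
Proof. by rewrite reaches_neg geo_flip_fun reaches_geo_p actS_flip. Qed.

Lemma actS_pinf k : actS k (pinf R) = if cc k == 0 then pinf R else fin (ca k / cc k)%:C.
Proof. by []. Qed.

Lemma actS_0 k : actS k (fin 0) = if cd k == 0 then pinf R else fin (cb k / cd k)%:C.
Proof.
rewrite /actS /fin /= .
have -> : denom k 0 = (cd k)%:C by rewrite /denom mulr0 add0r.
have -> : ((cd k)%:C == 0) = (cd k == 0) by rewrite eq_complex /= eqxx andbT.
case: ifPn => // d0; congr Some; rewrite /act mulr0 add0r /denom mulr0 add0r -/(cb k) -/(cd k).
by rewrite -fmorph_div.
Qed.

Lemma reaches_rev gam a x : reaches gam a x -> reaches (fun t => gam (- t)) (- a)%E x.
Proof.
have e : (fun t => gam (- - t)) = gam by apply/funext => t; rewrite opprK.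
case: a => [a /=||]; first by rewrite opprK.
  by rewrite -{1}e => /(reaches_neg (fun t => gam (- t))).
by move=> /reaches_neg.
Qed.

Lemma gseg_sym x y p : gseg x y p -> gseg y x p.
Proof.
move=> [gam [a [b [r [Gg ra rb /andP[ar rb'] ->]]]]].
have [k kE] := geodesicE Gg.
exists (fun t => gam (- t)), (- b)%E, (- a)%E, (- r); split.
- by rewrite kE geo_flip_fun; exact: geodesic_geo.
- exact: reaches_rev.
- exact: reaches_rev.
- by rewrite EFinN !leeN2 ar rb'.
- by rewrite opprK.
Qed.

Lemma vert_ex (X : R) : exists k, [/\ cc k = 0, cd k != 0, cb k / cd k = X &
  forall t, geo k t = X +i* expR t].
Proof.
have [|k [e [e1 a b c d]]] := @mk_ex R 1 X 0 1; first by rewrite mulr0 subr0 mulr1.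
have e0 := sign_neq0 e1; rewrite mulr1 in a d; rewrite mulr0 in c.
have ee : e * e = 1 by rewrite -expr2.
exists k; split; rewrite ?d//; first by rewrite b; field.
move=> t; apply: complexP; rewrite ?geo_Re ?geo_Im c d ?b expr0n /= !mul0r add0r e1 divr1//.
by rewrite mulr0 mul0r add0r mulrAC ee mul1r.
Qed.

Lemma geod_ex z : HH z -> exists k t, geo k t = z.
Proof.
move=> Hz; have [k [_ _ _ kE]] := vert_ex (Re z); exists k, (ln (Im z)).
by rewrite kE lnK ?posrE//; case: z {Hz kE}.
Qed.

Lemma reaches_HH k a z : HH z -> reaches (geo k) a (fin z) -> exists2 t : R, a = t%:E & z = geo k t.
Proof.
have nr (X : R) : ~ HH X%:C by rewrite /HH /= ltxx.
move=> Hz; case: a => [t [->]||]; first by exists t.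
  move=> /reaches_geo_p; rewrite actS_pinf; case: ifP => // _ [zE].
  by case: (nr (ca k / cc k)); rewrite -zE.
move=> /reaches_geo_m; rewrite actS_0; case: ifP => // _ [zE].
by case: (nr (cb k / cd k)); rewrite -zE.
Qed.

Lemma kseg_i (a b r : R) : a <= r -> r <= b -> kseg (geod_i a) (geod_i b) (geod_i r).
Proof.
move=> ar rb; have mono (u v : R) : u <= v -> expR u ^+ 2 <= expR v ^+ 2.
  by move=> uv; rewrite ler_sqr ?nnegrE ?expR_ge0// ler_expR.
have h1 := mono _ _ ar; have h2 := mono _ _ rb.
rewrite /kseg /Wk /= expr0n /= !add0r.
have [ab|ab] := eqVneq (expR b ^+ 2) (expR a ^+ 2).
  by exists 0; split; rewrite ?mulr0 ?addr0// mul0r addr0 subr0 mul1r; lra.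
have d0 : 0 < expR b ^+ 2 - expR a ^+ 2.
  by rewrite lt_def subr_eq0 ab/= subr_ge0; apply: le_trans h2.
exists ((expR r ^+ 2 - expR a ^+ 2) / (expR b ^+ 2 - expR a ^+ 2)); split.
- by rewrite divr_ge0 ?subr_ge0//; apply: le_trans h2.
- by rewrite ler_pdivrMr// mul1r lerB.
- by rewrite !mulr0 addr0.
- by field; rewrite gt_eqF.
Qed.

Lemma gseg_HH z w p : HH z -> HH w -> (gseg (fin z) (fin w) p <-> HH p /\ kseg z w p).
Proof.
move=> Hz Hw; split.
  move=> [gam [a [b [r [Gg ra rb ab ->]]]]]; have [k kE] := geodesicE Gg; subst gam.
  have [a' aE zE] := reaches_HH Hz ra; have [b' bE wE] := reaches_HH Hw rb.
  move: ab; rewrite aE bE !lee_fin => /andP[h1 h2]; split => //.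
  by rewrite zE wE; apply: kseg_act => //; exact: kseg_i.
move=> [Hp kp]; have [zw|zw] := pselect (z = w).
  have -> : p = z.
    move: kp; rewrite -zw => -[s [s0 s1 r W]]; apply: pt_eq => //; rewrite ?r ?W; ring.
  have [k [t kt]] := geod_ex Hz; exists (geo k), t%:E, t%:E, t.
  by rewrite -zw /= kt lexx; split => //; exact: geodesic_geo.
have [k [t0 [t1 [t01 E0 E1]]]] := line_ex Hz Hw zw.
have := kseg_act k^-1%g Hz Hw Hp kp; rewrite -E0 -E1 /geo !actK//.
set q := act _ p; have Hq : HH q by exact: HH_act.
have e01 : expR t0 ^+ 2 <= expR t1 ^+ 2.
  by rewrite ler_sqr ?nnegrE ?expR_ge0// ler_expR ltW.
move=> [s [s0 s1]]; rewrite /Wk /= !mulr0 addr0 => r; rewrite r expr0n /= !add0r => W.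
have y0 : 0 < Im q by [].
have lo : expR t0 <= Im q.
  rewrite -ler_sqr ?nnegrE ?expR_ge0 ?(ltW y0)// W;
  have : 0 <= s * (expR t1 ^+ 2 - expR t0 ^+ 2) by rewrite mulr_ge0 ?subr_ge0.
  by clear -s0; lra.
have hi : Im q <= expR t1.
  rewrite -ler_sqr ?nnegrE ?expR_ge0 ?(ltW y0)// W.
  have : 0 <= (1 - s) * (expR t1 ^+ 2 - expR t0 ^+ 2) by rewrite mulr_ge0 ?subr_ge0.
  by clear -s0; lra.
exists (geo k), t0%:E, t1%:E, (ln (Im q)); split.
- exact: geodesic_geo.
- by [].
- by [].
- by rewrite !lee_fin -[t0 <= _]ler_expR -[_ <= t1]ler_expR (lnK (y0 : Im q \in Num.pos)) lo hi.
- rewrite /geo (_ : geod_i _ = q) ?actKV//.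
  by apply: complexP; rewrite //= lnK ?posrE.
Qed.

Lemma gseg_pinf z p : HH z -> (gseg (fin z) (pinf R) p <-> [/\ HH p, Re p = Re z & Im z <= Im p]).
Proof.
move=> Hz; split.
  move=> [gam [a [b [r [Gg ra rb ab ->]]]]]; have [k kE] := geodesicE Gg; subst gam.
  have [a' aE zE] := reaches_HH Hz ra.
  case: b rb ab => [b //||/[swap]]; last by rewrite andbC aE leeNy_eq.
  move=> /reaches_geo_p; rewrite actS_pinf; case: ifP => // /eqP c0 _.
  rewrite aE lee_fin leey andbT => ar; split => //.
    rewrite zE !geo_Re c0 expr0n /= !mul0r mulr0 !mul0r; ring.
  have d0 : cd k != 0.
    have := psl_det k; rewrite c0 mulr0 subr0 => h.
    by apply: contraTneq (oner_neq0 R) => e; rewrite -h e mulr0 eqxx.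
  rewrite zE !geo_Im c0 expr0n /= !mul0r !add0r ler_pM2r ?ler_expR//.
  by rewrite invr_gt0 exprn_even_gt0.
move=> [Hp r i]; have [k [c0 d0 _ kE]] := vert_ex (Re z).
exists (geo k), (ln (Im z))%:E, +oo%E, (ln (Im p)); split.
- exact: geodesic_geo.
- by rewrite /= kE lnK ?posrE//; case: z {Hz r i kE}.
- by apply/reaches_geo_p; rewrite actS_pinf c0 eqxx.
- by rewrite leey andbT lee_fin ler_ln ?posrE.
- by rewrite kE lnK ?posrE// -r; case: p {Hp r i}.
Qed.

Lemma gseg_line (X : R) p : gseg (fin X%:C) (pinf R) p <-> HH p /\ Re p = X.
Proof.
split.
  move=> [gam [a [b [r [Gg ra rb ab ->]]]]]; have [k kE] := geodesicE Gg; subst gam.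
  have Hr := HH_geo k r.
  case: a ra ab => [a|_|ra ab].
  - move=> e; have {}e : X%:C = geo k a by apply: Some_inj.
    by have := HH_geo k a; rewrite -e /HH /= ltxx.
  - by rewrite leye_eq.
  split => //; case: b rb ab => [b //||_]; last by rewrite andbC leeNy_eq.
  move=> /reaches_geo_p; rewrite actS_pinf; case: ifP => // /eqP c0 _ _.
  move: ra => /reaches_geo_m; rewrite actS_0; case: ifP => // d0 [->].
  by rewrite geo_Re c0 expr0n /= !mul0r mulr0 mul0r; field; rewrite d0.
move=> [Hp r]; have [k [c0 d0 e kE]] := vert_ex X.
exists (geo k), -oo%E, +oo%E, (ln (Im p)); split.
- exact: geodesic_geo.
- by apply/reaches_geo_m; rewrite actS_0 (negPf d0) e.
- by apply/reaches_geo_p; rewrite actS_pinf c0 eqxx.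
- by rewrite leey leNye.
- by rewrite kE lnK ?posrE// -r; case: p {Hp r}.
Qed.

(** The barycentric weight of the future endpoint at [geo k t] on the Klein chord between the two
    endpoints. *)
Definition wt k (t : R) : R := cc k ^+ 2 * expR t ^+ 2 / (cc k ^+ 2 * expR t ^+ 2 + cd k ^+ 2).

Lemma wt_mono k : cc k != 0 -> cd k != 0 ->
  (forall t, 0 < wt k t < 1) /\ (forall s t, (wt k s <= wt k t) = (s <= t)).
Proof.
move=> c0 d0; have c2 : 0 < cc k ^+ 2 by rewrite exprn_even_gt0.
have d2 : 0 < cd k ^+ 2 by rewrite exprn_even_gt0.
have A0 t : 0 < cc k ^+ 2 * expR t ^+ 2 by rewrite mulr_gt0// exprn_gt0// expR_gt0.
have D0 t : 0 < cc k ^+ 2 * expR t ^+ 2 + cd k ^+ 2 by rewrite addr_gt0.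
split=> [t|s t].
  by rewrite /wt divr_gt0//= ltr_pdivrMr// mul1r ltrDl.
rewrite /wt (ler_pdivrMr _ _ (D0 s)) [leRHS]mulrAC (ler_pdivlMr _ _ (D0 t)) !mulrDr.
rewrite [X in X + _ <= _]mulrC lerD2l (ler_pM2r d2) (ler_pM2l c2).
by rewrite ler_sqr ?nnegrE ?expR_ge0// ler_expR.
Qed.

Lemma geo_wt k (t : R) : cc k != 0 -> cd k != 0 ->
  Re (geo k t) = cb k / cd k + wt k t * (ca k / cc k - cb k / cd k) /\
  Wk (geo k t) = (ca k / cc k + cb k / cd k) * Re (geo k t) - ca k / cc k * (cb k / cd k).
Proof.
move=> c0 d0; have E0 := expR_gt0 t.
have D0 : cc k ^+ 2 * expR t ^+ 2 + cd k ^+ 2 != 0.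
  apply: lt0r_neq0; apply: addr_gt0; last by rewrite exprn_even_gt0.
  by apply: mulr_gt0; [rewrite exprn_even_gt0|exact: exprn_gt0].
rewrite geo_Wk geo_Re /wt; split; field; rewrite c0 d0 exprMn D0 //.
Qed.

Lemma reach_line k a z : cc k != 0 -> cd k != 0 -> reaches (geo k) a (fin z) ->
  [/\ 0 <= Im z, Wk z = (ca k / cc k + cb k / cd k) * Re z - ca k / cc k * (cb k / cd k) &
  cb k / cd k < ca k / cc k -> forall r : R,
   ((a <= r%:E)%E -> Re z <= Re (geo k r)) /\ ((r%:E <= a)%E -> Re (geo k r) <= Re z)].
Proof.
move=> c0 d0; have [wb wm] := wt_mono c0 d0.
case: a => [t [->]|/reaches_geo_p|/reaches_geo_m].
- split; [exact: ltW (HH_geo k t)|by case: (geo_wt t c0 d0)|].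
  move=> ba r; rewrite !lee_fin.
  have [-> _] := geo_wt t c0 d0; have [-> _] := geo_wt r c0 d0.
  by rewrite !lerD2l !ler_pM2r ?subr_gt0// !wm.
- rewrite actS_pinf (negPf c0) => -[->]; split; [by []|by rewrite /Wk /=; ring|].
  move=> ba r; split=> [|_]; first by rewrite leye_eq.
  have [-> _] := geo_wt r c0 d0; have /andP[w0 w1] := wb r.
  have -> : Re (ca k / cc k)%:C = ca k / cc k by [].
  have : 0 <= (1 - wt k r) * (ca k / cc k - cb k / cd k) by rewrite mulr_ge0 ?subr_ge0// ltW.
  by clear; lra.
- rewrite actS_0 (negPf d0) => -[->]; split; [by []|by rewrite /Wk /=; ring|].
  move=> ba r; split=> [_|]; last by rewrite leeNy_eq.
  have [-> _] := geo_wt r c0 d0; have /andP[w0 w1] := wb r.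
  by rewrite lerDl mulr_ge0 ?subr_ge0// ltW.
Qed.

Lemma reach_vert k : cc k = 0 \/ cd k = 0 -> exists X : R, forall a z,
  reaches (geo k) a (fin z) -> Re z = X.
Proof.
have D := psl_det k; case=> [c0|d0].
  have d0 : cd k != 0.
    by apply: contraTneq (oner_neq0 R) => e; rewrite -D c0 e !mulr0 subr0 eqxx.
  exists (cb k / cd k) => a z; case: a => [t [->]|/reaches_geo_p|/reaches_geo_m].
  - by rewrite geo_Re c0 expr0n /= !mul0r mulr0 mul0r; field; rewrite d0.
  - by rewrite actS_pinf c0 eqxx.
  - by rewrite actS_0 (negPf d0) => -[->].
have c0 : cc k != 0.
  by apply: contraTneq (oner_neq0 R) => e; rewrite -D d0 e !mulr0 subr0 eqxx.
exists (ca k / cc k) => a z; case: a => [t [->]|/reaches_geo_p|/reaches_geo_m].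
- rewrite geo_Re d0 expr0n /= mulr0 !addr0; field.
  by rewrite c0 /= gt_eqF// expR_gt0.
- by rewrite actS_pinf (negPf c0) => -[->].
- by rewrite actS_0 d0 eqxx.
Qed.

Lemma line2 (S P S' P' x y : R) : S * x - P = S' * x - P' -> S * y - P = S' * y - P' -> x != y ->
  S = S' /\ P = P'.
Proof.
move=> h1 h2 xy; have n : x - y != 0 by rewrite subr_eq0.
have e : (S - S') * (x - y) = 0 by rewrite -[RHS](subrr (S' * x - P')) -{1}h1; lra.
have SS : S = S' by apply/eqP; rewrite -subr_eq0; move/eqP: e; rewrite mulf_eq0 (negPf n) orbF.
by split => //; move: h1; rewrite SS; lra.
Qed.

Lemma circ_hit (al be : R) k z : be < al -> cc k != 0 -> cd k != 0 -> ca k / cc k = al ->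
  cb k / cd k = be -> 0 <= Im z -> Wk z = (al + be) * Re z - al * be ->
  exists2 a, reaches (geo k) a (fin z) & forall r : R,
    (Re z <= Re (geo k r) -> (a <= r%:E)%E) /\ (Re (geo k r) <= Re z -> (r%:E <= a)%E).
Proof.
move=> ba c0 d0 E1 E2; have [wb wm] := wt_mono c0 d0; have bd : 0 < al - be by rewrite subr_gt0.
rewrite le_eqVlt => /orP[/eqP z0|z0] W; last first.
  have [t ->] := geo_hit c0 d0 E1 E2 z0 W; exists t%:E => // r.
  have [-> _] := geo_wt t c0 d0; have [-> _] := geo_wt r c0 d0.
  by rewrite E1 E2 !lee_fin !lerD2l !ler_pM2r// !wm.
have W0 : (Re z - al) * (Re z - be) = 0.
  by move: W; rewrite /Wk -z0 expr0n /= addr0 => W; rewrite -[RHS](subrr (Re z ^+ 2)) {2}W; ring.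
move/eqP: W0; rewrite mulf_eq0 !subr_eq0 => /orP[]/eqP ze.
  exists +oo%E; first by apply/reaches_geo_p; rewrite actS_pinf (negPf c0) E1; congr Some; apply: complexP.
  move=> r; rewrite leey; split=> //; rewrite ze; have [-> _] := geo_wt r c0 d0; rewrite E1 E2.
  have /andP[w0 w1] := wb r => h; exfalso.
  have : 0 < (1 - wt k r) * (al - be) by rewrite mulr_gt0// subr_gt0.
  by clear -h; lra.
exists -oo%E; first by apply/reaches_geo_m; rewrite actS_0 (negPf d0) E2; congr Some; apply: complexP.
move=> r; rewrite leNye; split=> //; rewrite ze; have [-> _] := geo_wt r c0 d0; rewrite E1 E2.
have /andP[w0 w1] := wb r => h; exfalso.
have : 0 < wt k r * (al - be) by rewrite mulr_gt0.
by clear -h; lra.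
Qed.

Lemma circ_roots (S P : R) z w : Re z < Re w ->
  Wk z = S * Re z - P -> Wk w = S * Re w - P -> exists al be : R,
  [/\ be < al, S = al + be & P = al * be].
Proof.
move=> zw W1 W2; pose d := S ^+ 2 - 4 * P.
have n1 : (2 * Re z - S) ^+ 2 <= d.
  by have := sqr_ge0 (Im z); move: W1; rewrite /d /Wk; lra.
have n2 : (2 * Re w - S) ^+ 2 <= d.
  by have := sqr_ge0 (Im w); move: W2; rewrite /d /Wk; lra.
have d0 : 0 < d.
  rewrite lt_neqAle (le_trans (sqr_ge0 _) n1) andbT; apply/negP => /eqP dd.
  have e1 : 2 * Re z - S = 0 by apply/eqP; rewrite -sqrf_eq0 eq_le dd n1 -dd sqr_ge0.
  have e2 : 2 * Re w - S = 0 by apply/eqP; rewrite -sqrf_eq0 eq_le dd n2 -dd sqr_ge0.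
  by lra.
have s0 : 0 < Num.sqrt d by rewrite sqrtr_gt0.
have s2 : Num.sqrt d ^+ 2 = d by rewrite sqr_sqrtr// ltW.
exists ((S + Num.sqrt d) / 2), ((S - Num.sqrt d) / 2); split; [lra|lra|].
by rewrite (_ : _ * _ = (S ^+ 2 - Num.sqrt d ^+ 2) / 4); [rewrite s2 /d; field|field].
Qed.

Lemma gseg_circ (S P : R) z w p : 0 <= Im z -> 0 <= Im w -> Re z < Re w ->
  Wk z = S * Re z - P -> Wk w = S * Re w - P ->
  gseg (fin z) (fin w) p <-> [/\ HH p, Wk p = S * Re p - P & Re z <= Re p <= Re w].
Proof.
move=> z0 w0 zw W1 W2; have [al [be [ba SE PE]]] := circ_roots zw W1 W2.
split; last first.
  move=> [Hp Wp /andP[zp pw]]; rewrite {S}SE {P}PE in W1 W2 Wp.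
  have [k [c0 d0 E1 E2]] : exists k, [/\ cc k != 0, cd k != 0, ca k / cc k = al & cb k / cd k = be].
    by apply: geo_ends; rewrite gt_eqF.
  have [t pt] := geo_hit c0 d0 E1 E2 Hp Wp.
  have [a ra am] := circ_hit ba c0 d0 E1 E2 z0 W1.
  have [b rb bm] := circ_hit ba c0 d0 E1 E2 w0 W2.
  exists (geo k), a, b, t; split => //; first exact: geodesic_geo.
  by rewrite (proj1 (am t)) -?pt// (proj2 (bm t)) -?pt.
move=> [gam [a [b [r [Gg ra rb /andP[ar rb'] ->]]]]]; have [k kE] := geodesicE Gg; subst gam.
have Hr := HH_geo k r.
have [v|/not_orP[/eqP c0 /eqP d0]] := pselect (cc k = 0 \/ cd k = 0).
  have [X vX] := reach_vert v; move: (vX _ _ ra) (vX _ _ rb) zw => -> ->; by rewrite ltxx.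
have [_ L1 m1] := reach_line c0 d0 ra; have [_ L2 m2] := reach_line c0 d0 rb.
move: (L1) (L2); rewrite W1 W2 => e1 e2.
have [sE pE] := line2 e1 e2 (negbT (lt_eqF zw)).
have [_ ->] := geo_wt r c0 d0; rewrite -sE -pE; split => //.
have [ba'|ba'] := ltP (cb k / cd k) (ca k / cc k).
  by rewrite (proj1 (m1 ba' r) ar) (proj2 (m2 ba' r) rb').
(* If [geo k] ran from right to left, its reversal would run from left to right and pass [w] no
   later than [z], against [Re z < Re w]. *)
exfalso; have [f f1 [fa fb fc fd]] := flip_coef k; have f0 := sign_neq0 f1.
have c0' : cc (k * flip R)%g != 0 by rewrite fc mulf_neq0.
have d0' : cd (k * flip R)%g != 0 by rewrite fd mulf_neq0 ?oppr_eq0.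
have E1 : ca (k * flip R)%g / cc (k * flip R)%g = cb k / cd k.
  by rewrite fa fc; field; rewrite f0 d0.
have E2 : cb (k * flip R)%g / cd (k * flip R)%g = ca k / cc k.
  by rewrite fb fd; field; rewrite f0 c0.
have ba2 : ca k / cc k < cb k / cd k.
  rewrite lt_def ba' andbT; apply/negP => /eqP e; have D := psl_det k.
  suff : ca k * cd k - cb k * cc k = 0 by rewrite D => /eqP; rewrite oner_eq0.
  have -> : ca k = ca k / cc k * cc k by rewrite divfK.
  by rewrite -e; field.
have ra' : reaches (geo (k * flip R)%g) (- a)%E (fin z).
  by rewrite -geo_flip_fun; exact: reaches_rev.
have rb2 : reaches (geo (k * flip R)%g) (- b)%E (fin w).
  by rewrite -geo_flip_fun; exact: reaches_rev.
have [_ _ m1'] := reach_line c0' d0' ra'; have [_ _ m2'] := reach_line c0' d0' rb2.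
rewrite E1 E2 in m1' m2'.
have h1 : (- b <= (- r)%:E)%E by rewrite EFinN leeN2.
have h2 : ((- r)%:E <= - a)%E by rewrite EFinN leeN2.
have := proj1 (m2' ba2 (- r)) h1; have := proj2 (m1' ba2 (- r)) h2.
by move=> i1 i2; have := le_lt_trans (le_trans i2 i1) zw; rewrite ltxx.
Qed.

(** A nondegenerate segment contains two points with different abscissas; they determine its
    geodesic, which is therefore the given semicircle, and the endpoints lie on the closure of the
    latter. *)
Lemma gseg_arc (S P : R) (A : set R[i]) x y : A !=set0 -> (forall p, A p -> HH p /\ Wk p = S * Re p - P) ->
  A = gseg x y -> y <> x -> exists z w, [/\ x = fin z, y = fin w & Re z != Re w] /\
  [/\ 0 <= Im z, 0 <= Im w, Wk z = S * Re z - P & Wk w = S * Re w - P].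
Proof.
move=> [p0 Ap0] AW AE yx; move: (Ap0); rewrite AE.
move=> [gam [a [b [r [Gg ra rb /andP[ar rb'] _]]]]]; have [k kE] := geodesicE Gg; subst gam.
have ab : (a < b)%E.
  rewrite lt_neqAle (le_trans ar rb') andbT; apply/negP => /eqP abE; apply: yx.
  move: ra rb; rewrite abE; case: (b) => [t|/reaches_geo_p-> /reaches_geo_p|/reaches_geo_m-> /reaches_geo_m] //=.
  by move=> -> ->.
have [r1 [r2 [r12 h1 h2]]] : exists r1 r2 : R, [/\ r1 < r2, (a <= r1%:E <= b)%E & (a <= r2%:E <= b)%E].
  have [rb2|rb2] := eqVneq r%:E b; last first.
    have lt : (r%:E < b)%E by rewrite lt_neqAle rb2.
    have {lt} : exists2 r2 : R, r < r2 & (r2%:E <= b)%E.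
      case: (b) lt => [t||]; [|by exists (r + 1); rewrite ?leey ?ltrDl|by []].
      by rewrite lte_fin => rt; exists t.
    move=> [r2 rr2 r2b]; exists r, r2; rewrite ar rb' r2b rr2; split => //.
    by rewrite andbT; apply: le_trans ar _; rewrite lee_fin ltW.
  have lt : (a < r%:E)%E by rewrite rb2.
  have {lt} : exists2 r2 : R, r2 < r & (a <= r2%:E)%E.
    case: (a) lt => [t||]; [|by []|by exists (r - 1); rewrite ?leNye ?ltrBlDr ?ltrDl].
    by rewrite lte_fin => rt; exists t.
  move=> [r2 rr2 r2b]; exists r2, r; rewrite ar rb' r2b rr2; split => //=.
  by apply: le_trans rb'; rewrite lee_fin ltW.
have [H1 W1] : HH (geo k r1) /\ Wk (geo k r1) = S * Re (geo k r1) - P.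
  by apply: AW; rewrite AE; exists (geo k), a, b, r1.
have [H2 W2] : HH (geo k r2) /\ Wk (geo k r2) = S * Re (geo k r2) - P.
  by apply: AW; rewrite AE; exists (geo k), a, b, r2.
have inj (s t : R) : geo k s = geo k t -> s = t.
  move=> e; apply/eqP; rewrite -subr_eq0 -normr_eq0; case: (Gg) => _ /(_ s t) <-; rewrite e.
  by case: (Gg) => _ ->; rewrite subrr normr0.
have nr : Re (geo k r1) != Re (geo k r2).
  apply/eqP => e; have : r1 = r2 by apply: inj; apply: pt_eq => //; rewrite W1 W2 e.
  by move=> e2; move: r12; rewrite e2 ltxx.
have [v|/not_orP[/eqP c0 /eqP d0]] := pselect (cc k = 0 \/ cd k = 0).
  have [X vX] := reach_vert v.
  by move: nr; rewrite (vX r1%:E _ erefl) (vX r2%:E _ erefl) eqxx.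
have [_ L1] := geo_wt r1 c0 d0; have [_ L2] := geo_wt r2 c0 d0.
move: (L1) (L2); rewrite W1 W2 => e1 e2; have [sE pE] := line2 e1 e2 nr.
have fn c x' : reaches (geo k) c x' -> exists z, x' = fin z.
  case: c => [t ->||]; first by exists (geo k t).
    by move=> /reaches_geo_p ->; rewrite actS_pinf (negPf c0); eexists.
  by move=> /reaches_geo_m ->; rewrite actS_0 (negPf d0); eexists.
have [z zE] := fn _ _ ra; have [w wE] := fn _ _ rb; exists z, w.
rewrite zE in ra; rewrite wE in rb.
have [z0 L3 _] := reach_line c0 d0 ra; have [w0 L4 _] := reach_line c0 d0 rb.
split; split => //; rewrite ?sE ?pE//.
apply/eqP => re; apply: yx; rewrite zE wE; congr Some; apply: complexP => //.
have e : Wk w = Wk z by rewrite L3 L4 re.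
apply/eqP; rewrite -(@eqrXn2 _ 2)//; apply/eqP.
by move: e; rewrite /Wk re => /addrI.
Qed.

End Endpoints.

(** * Isometric spheres and precells *)

Section Spheres.
Variables (R : realType) (Gam : set (PSL2 R)).
Hypothesis fuchG : fuchsian Gam.
Hypothesis cuspG : inf_cuspidal Gam.
Local Notation P1 := (one_point_compactification R[i]).
Local Notation clK := (clK Gam).
Implicit Types (g h k : PSL2 R) (z w p q : R[i]) (X Y e d u s : R) (A I : set R[i]) (x v : P1).

Definition ctr g : R := - cd g / cc g.
(** The isometric sphere as a line in the Klein coordinates, $|z|^2$ as an affine function of the
    real part. The boundary of [KK Gam] becomes an upper envelope of such lines. *)
Definition hg g X : R := 2 * ctr g * X - ctr g ^+ 2 + (cc g ^+ 2)^-1.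
Definition summit g : R[i] := ctr g +i* `|cc g|^-1.
(* The point of the isometric sphere of [g] over [X] is on the boundary of KK. *)
Definition onK g X := [/\ Gam g, cc g != 0 & exists z, [/\ clK z, Re z = X & Nm g z = 1]].
(** [X] is an ideal boundary point of the region: no isometric sphere covers any point of the line
    over it. *)
Definition ivert X := forall z, HH z -> Re z = X -> clK z.
(* The summit of the sphere of [g] lies over [e], in the interior of an arc of the
   boundary of [KK Gam]. *)
Definition axisS g e := [/\ Gam g, cc g != 0, ctr g = e &
  exists2 s, 0 < s & forall X, `|X - e| <= s -> onK g X].
Definition sg s := s = 1 \/ s = -1.

Lemma NmC g z : cc g != 0 -> Nm g z = cc g ^+ 2 * (Wk z - hg g (Re z)) + 1.
Proof. by move=> c0; rewrite NmE /hg /ctr; field. Qed.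

Lemma cc2_gt0 g : cc g != 0 -> 0 < cc g ^+ 2.
Proof. by move=> c0; rewrite exprn_even_gt0. Qed.

Lemma Nm_eq1 g z : cc g != 0 -> (Nm g z = 1 <-> Wk z = hg g (Re z)).
Proof.
move=> c0; rewrite NmC//; split=> [/eqP|->]; last by rewrite subrr mulr0 add0r.
by rewrite -subr_eq0 addrK mulf_eq0 sqrf_eq0 (negPf c0) /= subr_eq0 => /eqP.
Qed.

Lemma Nm_ge1 g z : cc g != 0 -> (1 <= Nm g z) = (hg g (Re z) <= Wk z).
Proof. by move=> c0; rewrite NmC// lerDr pmulr_rge0 ?subr_ge0// cc2_gt0. Qed.

Lemma Nm_gt1 g z : cc g != 0 -> (1 < Nm g z) = (hg g (Re z) < Wk z).
Proof. by move=> c0; rewrite NmC// ltrDr pmulr_rgt0 ?subr_gt0// cc2_gt0. Qed.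

Lemma hgE g X : hg g X = X ^+ 2 + ((cc g ^+ 2)^-1 - (X - ctr g) ^+ 2).
Proof. by rewrite /hg; ring. Qed.

Lemma onK_pt g X : onK g X -> [/\ X ^+ 2 < hg g X, clK (pt X (hg g X)) & Nm g (pt X (hg g X)) = 1].
Proof.
move=> [Gg c0 [z [Kz <- /Nm_eq1-/(_ c0) W]]]; have [Hz _] := Kz.
have h := HH_Wk Hz; rewrite W in h; have [Hp r1 w1] := ptP h.
rewrite (_ : pt _ _ = z); first by split=> //; apply/Nm_eq1.
by apply: pt_eq => //; rewrite w1.
Qed.

Lemma onK_le g h X : onK g X -> Gam h -> cc h != 0 -> hg h X <= hg g X.
Proof.
move=> [Gg c0 [z [Kz <- /Nm_eq1-/(_ c0) W]]] Gh h0.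
by rewrite -W -Nm_ge1//; case: Kz => _ /(_ _ Gh).
Qed.

Lemma onK_Gam g X : onK g X -> Gam g /\ cc g != 0. Proof. by case. Qed.

Lemma onK_hg g h X : onK g X -> onK h X -> hg g X = hg h X.
Proof.
move=> gX hX; apply/eqP; rewrite eq_le.
by rewrite (onK_le hX) ?(onK_le gX)//; [case: hX|case: hX|case: gX|case: gX].
Qed.

Lemma onK_clK g X z : onK g X -> HH z -> Re z = X -> (clK z <-> hg g X <= Wk z).
Proof.
move=> gX Hz zX; have [Gg c0] := onK_Gam gX; split=> [[_ /(_ _ Gg)]|h].
  by rewrite Nm_ge1// zX.
have [l K1 _] := onK_pt gX; have [H1 r1 w1] := ptP l.
by apply: (clK_above fuchG cuspG K1); rewrite ?zX ?r1// -Im_leWk ?w1// ?zX.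
Qed.

Lemma onK_KK g X z : onK g X -> HH z -> Re z = X -> (KK Gam z <-> hg g X < Wk z).
Proof.
move=> gX Hz zX; have [Gg c0] := onK_Gam gX; split=> [/KKE[_ /(_ _ Gg c0)]|h].
  by rewrite Nm_gt1// zX.
have [l K1 _] := onK_pt gX; have [H1 r1 w1] := ptP l.
by apply: (KK_above fuchG cuspG K1); rewrite ?zX ?r1// -Im_ltWk ?w1// ?zX.
Qed.

Lemma onK_ivert g X : onK g X -> ivert X -> False.
Proof.
move=> gX iX; have [l K1 _] := onK_pt gX.
have l2 : X ^+ 2 < (X ^+ 2 + hg g X) / 2 by lra.
have [H2 r2 w2] := ptP l2.
by have /(onK_clK gX H2 r2) := iX _ H2 r2; rewrite w2; lra.
Qed.

Lemma ivert_KK X z : ivert X -> HH z -> Re z = X -> KK Gam z.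
Proof.
move=> iX Hz zX; have Hw : HH (X +i* (Im z / 2)) by rewrite /HH /= divr_gt0.
apply: (KK_above fuchG cuspG (iX _ Hw erefl)) => //=.
by rewrite ltr_pdivrMr// mulr_natr mulr2n ltrDl.
Qed.

Lemma ctr_eq g h : ctr g = ctr h -> (exists X, hg g X = hg h X) -> cc g ^+ 2 = cc h ^+ 2.
Proof. by move=> cE [X]; rewrite /hg cE => /addrI/invr_inj. Qed.

Lemma onK2_ctr g h X Y : onK g X -> onK h X -> onK g Y -> onK h Y -> X != Y ->
  ctr g = ctr h /\ cc g ^+ 2 = cc h ^+ 2.
Proof.
move=> gX hX gY hY XY; have e1 := onK_hg gX hX; have e2 := onK_hg gY hY.
have cE : ctr g = ctr h.
  have : (ctr g - ctr h) * (X - Y) = 0 by move: e1 e2; rewrite /hg; lra.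
  by move/eqP; rewrite mulf_eq0 !subr_eq0 (negPf XY) orbF => /eqP.
by split=> //; apply: ctr_eq => //; exists X.
Qed.

(** At an inner point of an edge of an upper envelope of lines there is only one supporting line. *)
Lemma onK_int g h X s : 0 < s -> onK g (X - s) -> onK g X -> onK g (X + s) -> onK h X ->
  ctr g = ctr h /\ cc g ^+ 2 = cc h ^+ 2.
Proof.
move=> s0 g1 gX g2 hX; have [Gh h0] := onK_Gam hX.
have l1 := onK_le g1 Gh h0; have l2 := onK_le g2 Gh h0; have e := onK_hg gX hX.
have cE : ctr g = ctr h.
  have e1 : 0 <= s * (ctr h - ctr g) by move: l1 e; rewrite /hg; lra.
  have e2 : 0 <= s * (ctr g - ctr h) by move: l2 e; rewrite /hg; lra.
  by apply/eqP; rewrite eq_le; move: e1 e2; rewrite !(pmulr_rge0 _ s0) !subr_ge0 => -> ->.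
by split=> //; apply: ctr_eq => //; exists X.
Qed.

Lemma axisS_uniq g e h : axisS g e -> onK h e -> ctr h = e.
Proof.
move=> [_ _ <- [s s0 gs]] he.
have [|||<-//] := @onK_int g h (ctr g) s s0 _ _ _ he; apply: gs.
- by rewrite addrAC subrr add0r normrN gtr0_norm.
- by rewrite subrr normr0 ltW.
- by rewrite addrAC subrr add0r gtr0_norm.
Qed.

Lemma isosphere_eq g h : cc g != 0 -> cc h != 0 -> ctr g = ctr h -> cc g ^+ 2 = cc h ^+ 2 ->
  isosphere g = isosphere h.
Proof.
move=> g0 h0 e1 e2; apply/seteqP; split=> z /isosphereE[Hz /Nm_eq1 W]; apply/isosphereE; split=> //.
  by apply/Nm_eq1 => //; rewrite W// /hg e1 e2.
by apply/Nm_eq1 => //; rewrite W// /hg e1 e2.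
Qed.

Lemma summitP g : cc g != 0 -> [/\ HH (summit g), Re (summit g) = ctr g, Nm g (summit g) = 1 &
  Wk (summit g) = hg g (ctr g)].
Proof.
move=> c0; have W : Wk (summit g) = hg g (ctr g).
  by rewrite /Wk /hg /= exprVn real_normK ?num_real//; ring.
split=> //; first by rewrite /HH /= invr_gt0 normr_gt0.
by apply/Nm_eq1.
Qed.

Lemma is_summitE g z : cc g != 0 -> is_summit (isosphere g) z -> z = summit g.
Proof.
move=> c0 [/isosphereE[Hs N1] mx]; have [H1 r1 n1 w1] := summitP c0.
have i1 : Im (summit g) <= Im z by apply: mx; apply/isosphereE.
move/(Nm_eq1 _ c0): N1; rewrite hgE /Wk => /addrI e.
have i2 : Im z ^+ 2 <= Im (summit g) ^+ 2.
  by rewrite /= exprVn real_normK ?num_real// e lerBlDr lerDl sqr_ge0.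
have ie : Im z = Im (summit g).
  by apply/eqP; rewrite eq_le i1 andbT -ler_sqr ?nnegrE ?(ltW Hs) ?(ltW H1).
apply: complexP => //; rewrite r1; apply/eqP; rewrite -subr_eq0 -sqrf_eq0; apply/eqP.
by move: e; rewrite ie /= exprVn real_normK ?num_real//; lra.
Qed.

Hypothesis condA : condition_A Gam.

Lemma relpartE g z : Gam g -> cc g != 0 ->
  (relevant_part Gam (isosphere g) z <-> clK z /\ Nm g z = 1).
Proof.
move=> Gg c0; split=> [[/isosphereE[Hz n] /(bdH_KK fuchG cuspG)[K _]]|[K n]] //.
split; first by apply/isosphereE; split=> //; case: K.
by apply/(bdH_KK fuchG cuspG); split=> //; exists g.
Qed.

Lemma quad_gt0 (c r x y X : R) : x < X -> X < y -> 0 <= r - (x - c) ^+ 2 -> 0 <= r - (y - c) ^+ 2 ->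
  0 < r - (X - c) ^+ 2.
Proof.
move=> xX Xy h1 h2; have xy : 0 < y - x by lra.
rewrite -(pmulr_rgt0 _ xy).
have -> : (y - x) * (r - (X - c) ^+ 2) = (y - X) * (r - (x - c) ^+ 2) + (X - x) * (r - (y - c) ^+ 2)
  + (X - x) * (y - X) * (y - x) by ring.
have a1 : 0 <= (y - X) * (r - (x - c) ^+ 2) by rewrite mulr_ge0//; lra.
have a2 : 0 <= (X - x) * (r - (y - c) ^+ 2) by rewrite mulr_ge0//; lra.
have a3 : 0 < (X - x) * (y - X) * (y - x) by rewrite !mulr_gt0//; lra.
lra.
Qed.

(** Here condition (A) is used: the summit lies on the relevant part and is none of its endpoints,
    so the arc extends to both sides of the summit. The sign [s] points from the endpoint to the
    summit. *)
Lemma rel_arc I x : relevant Gam I -> is_endpoint (relevant_part Gam I) x ->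
  exists g z s, [/\ Gam g, cc g != 0, I = isosphere g & x = fin z] /\
  [/\ sg s, 0 < s * (ctr g - Re z), 0 <= Im z & Wk z = hg g (Re z)] /\
  [/\ axisS g (ctr g), forall X, 0 < s * (X - Re z) -> s * (X - ctr g) <= 0 -> onK g X &
    HH z -> clK z].
Proof.
move=> rI ex; have [[g /hypP[Gg c0] IE] [c [_ cP]]] := rI.
have [y yx yE] := ex; have rP z := @relpartE g z Gg c0; rewrite -IE in rP.
have ne : relevant_part Gam I !=set0.
  by exists (c (1/2)); have [|//] := cP (1/2); rewrite in_itv /=; apply/andP; split; lra.
have hgS (X : R) : hg g X = 2 * ctr g * X - (ctr g ^+ 2 - (cc g ^+ 2)^-1) by rewrite /hg; ring.
have [|z [w [[xE yE' nzw] [z0 w0 zW wW]]]] := gseg_arc (S := 2 * ctr g) (P := ctr g ^+ 2 - (cc g ^+ 2)^-1) ne _ yE yx.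
  by move=> p /rP[[Hp _] /(Nm_eq1 _ c0) ->]; rewrite hgS.
have [S1 S2 S3 S4] := summitP c0.
have sI : is_summit I (summit g).
  rewrite IE; split; first exact/isosphereE.
  move=> p /isosphereE[Hp /(Nm_eq1 _ c0)]; rewrite hgE /Wk => /addrI e.
  rewrite -ler_sqr ?nnegrE ?(ltW Hp) ?(ltW S1)// e /= exprVn real_normK ?num_real//.
  by rewrite lerBlDr lerDl sqr_ge0.
have [sb nv] := condA rI sI.
have srp : relevant_part Gam I (summit g) by split => //; case: sI.
have zW' : 0 <= (cc g ^+ 2)^-1 - (Re z - ctr g) ^+ 2.
  by move: zW; rewrite -hgS hgE /Wk => /addrI <-; exact: sqr_ge0.
have wW' : 0 <= (cc g ^+ 2)^-1 - (Re w - ctr g) ^+ 2.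
  by move: wW; rewrite -hgS hgE /Wk => /addrI <-; exact: sqr_ge0.
have sn q x' : x' = fin q -> is_endpoint (relevant_part Gam I) x' -> 0 <= Im q -> Wk q = hg g (Re q) -> Re q != ctr g.
  move=> xq ep q0 qW; apply/eqP => qe; apply: nv; exists I => //; rewrite (_ : fin (summit g) = x')// xq; congr Some.
  apply: complexP => //; apply/eqP; rewrite -(@eqrXn2 _ 2) ?(ltW S1)//; apply/eqP.
  by move: qW; rewrite qe -S4 /Wk S2 qe => /addrI ->.
have zn := sn z x xE ex z0 ltac:(by rewrite zW hgS).
have ey : is_endpoint (relevant_part Gam I) y.
  exists x; first by move/esym.
  by rewrite yE; apply/seteqP; split=> q; exact: gseg_sym.
have wn := sn w y yE' ey w0 ltac:(by rewrite wW hgS).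
have mem (a b : R[i]) : 0 <= Im a -> 0 <= Im b -> Re a < Re b -> Wk a = hg g (Re a) -> Wk b = hg g (Re b) ->
    0 <= (cc g ^+ 2)^-1 - (Re a - ctr g) ^+ 2 -> 0 <= (cc g ^+ 2)^-1 - (Re b - ctr g) ^+ 2 ->
    (forall p, relevant_part Gam I p <-> gseg (fin a) (fin b) p) ->
    [/\ forall X, Re a < X -> X < Re b -> onK g X, Re a <= ctr g <= Re b,
      HH a -> clK a & HH b -> clK b].
  move=> a0 b0 ab aW bW qa qb mE.
  have gc p := @gseg_circ R (2 * ctr g) (ctr g ^+ 2 - (cc g ^+ 2)^-1) a b p a0 b0 ab.
  rewrite -!hgS in gc; have {}gc p := gc p aW bW.
  split.
  - move=> X aX Xb; split=> //; have l : X ^+ 2 < hg g X.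
      by rewrite hgE ltrDl; apply: quad_gt0 aX Xb _ _.
    have [Hp r1 w1] := ptP l; exists (pt X (hg g X)).
    have [K N] : clK (pt X (hg g X)) /\ Nm g (pt X (hg g X)) = 1; last by [].
      by apply/rP/mE/gc; rewrite -hgS w1 r1 !ltW.
  - by have /mE/gc[_ _] := srp; rewrite S2.
  - by move=> Ha; have [] : clK a /\ Nm g a = 1 by apply/rP/mE/gc; rewrite -hgS lexx ltW.
  - by move=> Ha; have [] : clK b /\ Nm g b = 1 by apply/rP/mE/gc; rewrite -hgS lexx ltW.
have mE1 p : relevant_part Gam I p <-> gseg (fin z) (fin w) p by rewrite yE xE yE'.
have mE2 p : relevant_part Gam I p <-> gseg (fin w) (fin z) p.
  by rewrite yE xE yE'; split; exact: gseg_sym.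
rewrite -hgS in zW; rewrite -hgS in wW.
have ax (a b : R) : a < ctr g -> ctr g < b -> (forall X, a < X -> X < b -> onK g X) -> axisS g (ctr g).
  move=> ac cb ab; split=> //; exists (Num.min (ctr g - a) (b - ctr g) / 2).
    by rewrite divr_gt0// lt_min !subr_gt0 ac.
  move=> X; rewrite ler_norml; set m := Num.min _ _ => /andP[x1 x2].
  have m0 : 0 < m by rewrite lt_min !subr_gt0 ac.
  have m1 : m <= ctr g - a by rewrite ge_min lexx.
  have m2 : m <= b - ctr g by rewrite ge_min lexx orbT.
  by apply: ab; lra.
move: nzw; rewrite neq_lt => /orP[zw|wz].
  have [ar /andP[c1 c2] Hz _] := mem z w z0 w0 zw zW wW zW' wW' mE1.
  have c1' : Re z < ctr g by rewrite lt_neqAle zn.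
  have c2' : ctr g < Re w by rewrite lt_neqAle eq_sym wn.
  exists g, z, 1; split=> //; split; first by split=> //; [left|lra].
  by split=> //; [exact: ax c1' c2' ar|move=> X h1 h2; apply: ar; lra].
have [ar /andP[c1 c2] _ Hz] := mem w z w0 z0 wz wW zW wW' zW' mE2.
have c1' : Re w < ctr g by rewrite lt_neqAle wn.
have c2' : ctr g < Re z by rewrite lt_neqAle eq_sym zn.
exists g, z, (-1); split=> //; split; first by split=> //; [right|lra].
by split=> //; [exact: ax c1' c2' ar|move=> X h1 h2; apply: ar; lra].
Qed.

Definition tset e s d : set R[i] := [set z | clK z /\ 0 <= s * (Re z - e) <= d].

(* Precells over the interval from [e] to [e + s * d], where the sign [s] allows to
   start from either end: non-cuspidal with vertex [p] over [e + s * u], cuspidal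
   with summit over [e], strip. *)
Definition nct A e s d u g h p := [/\ sg s, 0 < u, u < d & A = tset e s d] /\
  [/\ axisS g e, axisS h (e + s * d), forall X, 0 <= s * (X - e) <= u -> onK g X &
      forall X, u <= s * (X - e) <= d -> onK h X] /\
  [/\ clK p, Re p = e + s * u, Nm g p = 1 & Nm h p = 1].

Definition cut A e s d g := [/\ sg s, 0 < d & A = tset e s d] /\
  [/\ axisS g e, ivert (e + s * d), d = `|cc g|^-1 & forall X, 0 <= s * (X - e) < d -> onK g X].

Definition stt A e s d := [/\ sg s, 0 < d & A = tset e s d] /\
  [/\ forall X, 0 <= s * (X - e) <= d -> ivert X,
      exists e' d' g, cut (tset e' s d') e' s d' g /\ e' + s * d' = e &
      exists e' d' g, cut (tset e' (- s) d') e' (- s) d' g /\ e' - s * d' = e + s * d].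

Lemma sg2 s : sg s -> s * s = 1. Proof. by case=> ->; rewrite ?mulrNN mulr1. Qed.

Lemma sgN s : sg s -> sg (- s). Proof. by case=> ->; [right|left; rewrite opprK]. Qed.

Lemma tset_sym e s d : sg s -> tset e s d = tset (e + s * d) (- s) d.
Proof.
by case=> ->; apply/seteqP; split=> z [K /andP[h1 h2]]; split=> //; apply/andP; split; lra.
Qed.

Lemma sg_end e s d : sg s -> e + s * d + - s * d = e.
Proof. by move=> _; ring. Qed.

Lemma nct_sym A e s d u g h p : nct A e s d u g h p -> nct A (e + s * d) (- s) d (d - u) h g p.
Proof.
move=> [[S u0 ud AE] [[ag ah gX hX] [K r n1 n2]]]; split; last split.
- by split; [exact: sgN|lra|lra|rewrite AE; exact: tset_sym].
- split=> //; first by rewrite sg_end.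
    by move=> X /andP[h1 h2]; apply: hX; case: S h1 h2 => ->; lra.
  by move=> X /andP[h1 h2]; apply: gX; case: S h1 h2 => ->; lra.
- by split=> //; rewrite r; ring.
Qed.

Lemma stt_sym A e s d : stt A e s d -> stt A (e + s * d) (- s) d.
Proof.
move=> [[S d0 AE] [iv c1 c2]]; split.
  by split; [exact: sgN|by []|rewrite AE; exact: tset_sym].
split.
- by move=> X /andP[h1 h2]; apply: iv; case: S h1 h2 => ->; lra.
- by move: c2 => [e' [d' [g [c ee]]]]; exists e', d', g; rewrite mulNr.
- by move: c1 => [e' [d' [g [c ee]]]]; exists e', d', g; rewrite opprK mulNr opprK sg_end.
Qed.

Lemma gseg_ideal x : x = pinf R \/ (exists X, x = fin X%:C) -> gseg x x = set0.
Proof.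
move=> H; apply/seteqP; split=> // p [gam [a [b [r [Gg ra rb /andP[ab1 ab2] _]]]]].
have [k kE] := geodesicE Gg; subst gam.
have nr (t : R) : x <> fin (geo k t).
  case: H => [->|[X ->]] //; have := HH_geo k t; move: (geo k t) => w Hw e.
  have {}e : X%:C = w by apply: Some_inj.
  by move: Hw; rewrite -e /HH /= ltxx.
case: a ra ab1 => [t /nr []|_|/reaches_geo_m xa _]; first by rewrite leye_eq.
case: b rb ab2 => [t /nr []|/reaches_geo_p xb _|_]; last by rewrite leeNy_eq.
move: xa xb; rewrite actS_0 actS_pinf; have D := psl_det k.
have [d0|d0] := eqVneq (cd k) 0; have [c0|c0] := eqVneq (cc k) 0 => -> //.
  by move: D; rewrite d0 c0 !mulr0 subrr => /esym/eqP; rewrite oner_eq0.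
move=> e; have {}e : (cb k / cd k)%:C = (ca k / cc k)%:C by apply: Some_inj.
have {}e : cb k / cd k = ca k / cc k by move: (congr1 (@complex.Re R) e).
suff : ca k * cd k - cb k * cc k = 0 by rewrite D => /eqP; rewrite oner_eq0.
have -> : ca k = ca k / cc k * cc k by rewrite divfK.
by rewrite -e; field.
Qed.

Lemma tset_convex e s d : hconvex (tset e s d).
Proof.
move=> z w [Kz /andP[z1 z2]] [Kw /andP[w1 w2]] p.
have [Hz _] := Kz; have [Hw _] := Kw.
move=> /(gseg_HH p Hz Hw)[Hp kp]; split; first exact: kseg_clK kp.
move: kp => [l [l0 l1 -> _]].
have -> : s * ((1 - l) * Re z + l * Re w - e) = (1 - l) * (s * (Re z - e)) + l * (s * (Re w - e)) by ring.
apply/andP; split; first by rewrite addr_ge0// mulr_ge0// subr_ge0.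
have -> : d = (1 - l) * d + l * d by ring.
by apply: lerD; rewrite ler_wpM2l// subr_ge0.
Qed.

Lemma gseg_summit_pinf g p : cc g != 0 -> gseg (fin (summit g)) (pinf R) p <->
  [/\ HH p, Re p = ctr g & hg g (ctr g) <= Wk p].
Proof.
move=> c0; have [H1 r1 n1 w1] := summitP c0.
split=> [/(gseg_pinf p H1)[Hp r i]|[Hp r i]].
  by split; rewrite ?r// -w1 Im_leWk// r.
by apply/gseg_pinf => //; split; rewrite ?r// -Im_leWk ?w1// r.
Qed.

(** Two high points over the ends span a segment passing above [p], and the vertical segment from
    [q] up to it contains [p]. *)
Lemma polyP (V : set R[i]) z1 z2 : V `<=` @HH R -> hconvex V -> (exists M, forall p, HH p -> Re p = Re z1 -> M <= Wk p -> V p) ->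
  (exists M, forall p, HH p -> Re p = Re z2 -> M <= Wk p -> V p) ->
  forall q p, V q -> HH p -> Re p = Re q -> Wk q <= Wk p ->
  (exists2 l : R, 0 <= l <= 1 & Re p = (1 - l) * Re z1 + l * Re z2) -> V p.
Proof.
move=> VH Vc [M1 h1] [M2 h2] q p Vq Hp rp wp [l /andP[l0 l1] pl].
pose M := Num.max (Num.max M1 M2) (Num.max (Wk p) (Num.max (Re z1 ^+ 2) (Re z2 ^+ 2))) + 1.
have [m1 m2 m3 [m4 m5]] : [/\ M1 <= M, M2 <= M, Wk p < M & Re z1 ^+ 2 < M /\ Re z2 ^+ 2 < M].
  rewrite /M; set m := Num.max _ _; have mm (x : R) : x <= m -> x <= m + 1 by lra.
  have mn (x : R) : x <= m -> x < m + 1 by lra.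
  by split; [apply: mm|apply: mm|apply: mn|split; apply: mn]; rewrite !le_max lexx ?orbT.
have [P1 r1 w1] := ptP m4; have [P2 r2 w2] := ptP m5.
have V1 : V (pt (Re z1) M) by apply: h1; rewrite ?w1.
have V2 : V (pt (Re z2) M) by apply: h2; rewrite ?w2.
have mp : Re p ^+ 2 < M by apply: lt_trans m3; exact: HH_Wk.
have [P3 r3 w3] := ptP mp.
have V3 : V (pt (Re p) M).
  apply: (Vc _ _ V1 V2); apply/gseg_HH => //; split=> //; exists l; split=> //; rewrite ?r3 ?r1 ?r2//.
  by rewrite w1 w2 w3; ring.
have Hq := VH _ Vq.
apply: (Vc _ _ Vq V3); apply/gseg_HH => //; split=> //.
have d0 : 0 < M - Wk q by lra.
exists ((Wk p - Wk q) / (M - Wk q)); split.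
- by rewrite divr_ge0 ?(ltW d0)// subr_ge0.
- by rewrite ler_pdivrMr// mul1r; lra.
- by rewrite r3 rp; ring.
- by rewrite w3; field; rewrite gt_eqF.
Qed.

Lemma sg_conv s e d X : sg s -> 0 < d -> 0 <= s * (X - e) <= d ->
  exists2 l : R, 0 <= l <= 1 & X = (1 - l) * e + l * (e + s * d).
Proof.
move=> S d0 /andP[h1 h2]; exists (s * (X - e) / d).
  by rewrite divr_ge0 ?(ltW d0)// ler_pdivrMr// mul1r.
have -> : (1 - s * (X - e) / d) * e + s * (X - e) / d * (e + s * d) = e + s * s * (X - e).
  by field; rewrite gt_eqF.
by rewrite sg2// mul1r addrC subrK.
Qed.

(** Links the definition of a precell as a convex hull to the description by inequalities: the part
    of [clK] over the interval is convex, and conversely each of its points lies above one of the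
    two non-vertical sides. *)
Lemma nct_poly A e s d u g h p : nct A e s d u g h p ->
  A = hpolygon [set fin (summit g); fin p; fin (summit h); pinf R].
Proof.
move=> N; have [[S u0 ud AE] [[ag ah gX hX] [Kp rp n1 n2]]] := N.
have [Gg g0 cg _] := ag; have [Gh h0 ch _] := ah; have [Hp _] := Kp.
have [S1 S2 S3 S4] := summitP g0; have [T1 T2 T3 T4] := summitP h0.
have d0 : 0 < d by lra.
have tg q : HH q -> Re q = e -> hg g (Re q) <= Wk q -> tset e s d q.
  move=> Hq rq wq; split; last by rewrite rq subrr mulr0 lexx ltW.
  by apply/(onK_clK (gX (Re q) _) Hq) => //; rewrite rq subrr mulr0 lexx ltW.
have th q : HH q -> Re q = e + s * d -> hg h (Re q) <= Wk q -> tset e s d q.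
  move=> Hq rq wq; have E : s * (Re q - e) = d by rewrite rq addrC addKr mulrA sg2// mul1r.
  split; last by rewrite E lexx ltW.
  by apply/(onK_clK (hX (Re q) _) Hq) => //; rewrite E lexx ltW.
have Ep : s * (Re p - e) = u by rewrite rp addrC addKr mulrA sg2// mul1r.
have tp : tset e s d p by split=> //; rewrite Ep !ltW.
have sgt : tset e s d (summit g) by apply: tg; rewrite ?S2 ?S4.
have sht : tset e s d (summit h) by apply: th; rewrite ?T2 ?T4.
have up q q' : tset e s d q -> HH q -> gseg (fin q) (pinf R) q' -> tset e s d q'.
  move=> [Kq h1] Hq /(gseg_pinf q' Hq)[Hq' r i]; split; last by rewrite r.
  exact: (clK_above fuchG cuspG Kq).
rewrite AE; apply/seteqP; split=> [z [Kz zs]|z].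
  have [Hz _] := Kz.
  move=> V [VH Vc Vs]; have := @polyP V (summit g) (summit h) VH Vc _ _ _ z.
  have Vg : V (summit g).
    by apply: (Vs (fin (summit g)) (fin (summit g))); rewrite /=; [by do 3 left|by do 3 left|];
      apply/gseg_HH => //; split=> //; exists 0; split; rewrite ?lexx ?ler01//; ring.
  have Vp : V p.
    by apply: (Vs (fin p) (fin p)); rewrite /=; [by left; left; right|by left; left; right|];
      apply/gseg_HH => //; split=> //; exists 0; split; rewrite ?lexx ?ler01//; ring.
  have Vh : V (summit h).
    by apply: (Vs (fin (summit h)) (fin (summit h))); rewrite /=; [by left; right|by left; right|];
      apply/gseg_HH => //; split=> //; exists 0; split; rewrite ?lexx ?ler01//; ring.
  move=> H; have {}H := H (ex_intro _ (hg g e) _) (ex_intro _ (hg h (e + s * d)) _).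
  have [zu|uz] := leP (s * (Re z - e)) u.
    have zi : 0 <= s * (Re z - e) <= u by move/andP: zs => [-> _].
    have gz := gX _ zi; have [l K1 N1] := onK_pt gz; have [Hq rq wq] := ptP l.
    apply: (H _ _ (pt (Re z) (hg g (Re z)))) => //; rewrite ?rq ?wq//.
    - by move=> q Hq' rq' wq'; apply: (Vs (fin (summit g)) (pinf R)); [by do 3 left|by right|];
        apply/gseg_summit_pinf => //; split; rewrite // ?rq' ?S2// cg.
    - by move=> q Hq' rq' wq'; apply: (Vs (fin (summit h)) (pinf R)); [by left; right|by right|];
        apply/gseg_summit_pinf => //; split; rewrite // ?rq' ?T2// ch.
    - apply: (Vc _ _ Vg Vp); apply/gseg_HH => //; split=> //.
      exists (s * (Re z - e) / u); have un : u != 0 by rewrite gt_eqF.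
      have [i1 i2] := andP zi.
      split; [by rewrite divr_ge0// ltW|by rewrite ler_pdivrMr// mul1r| |].
        have -> : (1 - s * (Re z - e) / u) * Re (summit g) + s * (Re z - e) / u * Re p = e + s * s * (Re z - e).
          by rewrite rp S2 cg; field.
        by rewrite rq sg2// mul1r addrC subrK.
      have -> : Wk p = hg g (Re p) by apply/Nm_eq1.
      rewrite wq S4 rp cg.
      have E : Re z = e + s * s * (Re z - e) by rewrite sg2// mul1r addrC subrK.
      by rewrite [in LHS]E /hg; move: (cc g ^+ 2)^-1 => r; field.
    - by apply/(onK_clK gz).
    - by rewrite S2 T2 cg ch; apply: sg_conv.
  have zi : u <= s * (Re z - e) <= d by move/andP: zs => [_ ->]; rewrite ltW.
  have gz := hX _ zi; have [l K1 N1] := onK_pt gz; have [Hq rq wq] := ptP l.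
  apply: (H _ _ (pt (Re z) (hg h (Re z)))) => //; rewrite ?rq ?wq//.
  - by move=> q Hq' rq' wq'; apply: (Vs (fin (summit g)) (pinf R)); [by do 3 left|by right|];
      apply/gseg_summit_pinf => //; split; rewrite // ?rq' ?S2// cg.
  - by move=> q Hq' rq' wq'; apply: (Vs (fin (summit h)) (pinf R)); [by left; right|by right|];
      apply/gseg_summit_pinf => //; split; rewrite // ?rq' ?T2// ch.
  - apply: (Vc _ _ Vp Vh); apply/gseg_HH => //; split=> //.
    exists ((s * (Re z - e) - u) / (d - u)); have un : d - u != 0 by rewrite gt_eqF// subr_gt0.
    have [i1 i2] := andP zi; have du : 0 < d - u by lra.
    have E : Re z = e + s * s * (Re z - e) by rewrite sg2// mul1r addrC subrK.
    split; [by rewrite divr_ge0 ?(ltW du)// subr_ge0|by rewrite ler_pdivrMr// mul1r lerB| |].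
      by rewrite rq rp T2 ch {1}E; field.
    have -> : Wk p = hg h (Re p) by apply/Nm_eq1.
    by rewrite wq T4 rp ch [in LHS]E /hg; move: (cc h ^+ 2)^-1 => r; field.
  - by apply/(onK_clK gz).
  - by rewrite S2 T2 cg ch; apply: sg_conv.
apply; split; [by move=> w [[]]|exact: tset_convex|].
have I1 q q' : tset e s d q -> tset e s d q' -> gseg (fin q) (fin q') `<=` tset e s d by exact: tset_convex.
have I2 q : tset e s d q -> gseg (fin q) (pinf R) `<=` tset e s d.
  by move=> tq q' h1; apply: up h1 => //; case: tq => -[].
have I3 q : tset e s d q -> gseg (pinf R) (fin q) `<=` tset e s d.
  by move=> tq q' /gseg_sym h1; apply: up h1 => //; case: tq => -[].
have I4 : gseg (pinf R) (pinf R) `<=` tset e s d by rewrite gseg_ideal; [|left].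
by move=> x y [[[->|->]|->]|->] [[[->|->]|->]|->]; auto.
Qed.

Lemma cut_poly A e s d g : cut A e s d g ->
  A = hpolygon [set fin (e + s * d)%:C; fin (summit g); pinf R].
Proof.
move=> [[S d0 AE] [ag iv dE gX]]; have [Gg g0 cg _] := ag.
have [S1 S2 S3 S4] := summitP g0; set v := e + s * d.
have Ev : s * (v - e) = d by rewrite /v addrC addKr mulrA sg2// mul1r.
have sgt : tset e s d (summit g).
  split; last by rewrite S2 cg subrr mulr0 lexx ltW.
  by apply/(onK_clK (gX e _) S1); rewrite ?S2// ?S4 ?cg// subrr mulr0 lexx d0.
(* Since [d] is the radius, the sphere reaches the real axis at [v]. *)
have hv : hg g v = v ^+ 2.
  have E2 : (v - e) ^+ 2 = d ^+ 2 by rewrite -Ev exprMn (expr2 s) sg2// mul1r.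
  by rewrite hgE cg E2 dE exprVn real_normK ?num_real// subrr addr0.
have ev : e != v.
  by apply/eqP => ee; move: Ev d0; rewrite -ee subrr mulr0 => <-; rewrite ltxx.
have arc z : 0 <= s * (Re z - e) < d -> HH z -> Wk z = hg g (Re z) -> gseg (fin (summit g)) (fin v%:C) z.
  move=> /andP[z1 z2] Hz wz; have hS X : hg g X = 2 * e * X - (e ^+ 2 - (cc g ^+ 2)^-1) by rewrite /hg cg; ring.
  have W1 : Wk (summit g) = 2 * e * Re (summit g) - (e ^+ 2 - (cc g ^+ 2)^-1) by rewrite S4 hS S2 cg.
  have W2 : Wk v%:C = 2 * e * Re v%:C - (e ^+ 2 - (cc g ^+ 2)^-1) by rewrite -hS /= hv /Wk /= expr0n addr0.
  move: ev; rewrite neq_lt => /orP[lt|lt].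
    apply/(gseg_circ (S := 2 * e) (P := e ^+ 2 - (cc g ^+ 2)^-1)) => //; rewrite ?(ltW S1)//; first by rewrite S2 cg.
    split; rewrite ?wz ?hS// S2 cg /=; case: S Ev z1 z2 => -> Ev z1 z2; apply/andP; split; lra.
  apply: gseg_sym; apply/(gseg_circ (S := 2 * e) (P := e ^+ 2 - (cc g ^+ 2)^-1)) => //; rewrite ?(ltW S1)//; first by rewrite S2 cg.
  split; rewrite ?wz ?hS// S2 cg /=; case: S Ev z1 z2 => -> Ev z1 z2; apply/andP; split; lra.
have arc' z : gseg (fin (summit g)) (fin v%:C) z -> tset e s d z.
  have hS X : hg g X = 2 * e * X - (e ^+ 2 - (cc g ^+ 2)^-1) by rewrite /hg cg; ring.
  have W1 : Wk (summit g) = 2 * e * Re (summit g) - (e ^+ 2 - (cc g ^+ 2)^-1) by rewrite S4 hS S2 cg.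
  have W2 : Wk v%:C = 2 * e * Re v%:C - (e ^+ 2 - (cc g ^+ 2)^-1) by rewrite -hS /= hv /Wk /= expr0n addr0.
  have fin_ : HH z -> Wk z = hg g (Re z) -> 0 <= s * (Re z - e) <= d -> tset e s d z.
    move=> Hz wz /andP[i1 i2]; split; last by rewrite i1.
    have lt : s * (Re z - e) < d.
      rewrite lt_neqAle i2 andbT; apply/eqP => E.
      have rz : Re z = v.
        by apply/eqP; rewrite -subr_eq0; case: S E Ev => ->; lra.
      by have := HH_Wk Hz; rewrite wz rz hv ltxx.
    by apply/(onK_clK (gX (Re z) _) Hz); rewrite ?i1 ?lt// wz.
  move: ev; rewrite neq_lt => /orP[lt|lt].
    move=> /(gseg_circ (S := 2 * e) (P := e ^+ 2 - (cc g ^+ 2)^-1)) [//||||//|Hz]; rewrite ?(ltW S1)//; first by rewrite S2 cg.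
    by rewrite -hS S2 cg /= => wz /andP[i1 i2]; apply: fin_ => //; case: S Ev => -> Ev; apply/andP; split; lra.
  move=> /gseg_sym /(gseg_circ (S := 2 * e) (P := e ^+ 2 - (cc g ^+ 2)^-1)) [//||||//|Hz]; rewrite ?(ltW S1)//; first by rewrite S2 cg.
  by rewrite -hS S2 cg /= => wz /andP[i1 i2]; apply: fin_ => //; case: S Ev => -> Ev; apply/andP; split; lra.
have vt z : HH z -> Re z = v -> tset e s d z.
  by move=> Hz rz; split; [exact: iv|rewrite rz Ev lexx ltW].
rewrite AE; apply/seteqP; split=> [z [Kz zs]|z].
  have [Hz _] := Kz.
  move=> V [VH Vc Vs]; have [/andP[z1 z2]] := (zs, tt).
  have VV q : HH q -> Re q = v -> V q.
    move=> Hq rq; apply: (Vs (fin v%:C) (pinf R)); [by left; left|by right|].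
    by apply/gseg_line.
  move: z2; rewrite le_eqVlt => /orP[/eqP E|z2] _.
    by apply: VV => //; apply/eqP; rewrite -subr_eq0; case: S E Ev => ->; lra.
  have zi : 0 <= s * (Re z - e) < d by rewrite z1.
  have gz := gX _ zi; have [l K1 N1] := onK_pt gz; have [Hq rq wq] := ptP l.
  apply: (@polyP V (summit g) v%:C VH Vc _ _ (pt (Re z) (hg g (Re z)))) => //; rewrite ?rq ?wq//.
  - exists (hg g e) => q Hq' rq' wq'; apply: (Vs (fin (summit g)) (pinf R)); [by left; right|by right|].
    by apply/gseg_summit_pinf => //; split; rewrite // ?rq' ?S2// cg.
  - by exists 0 => q Hq' rq' _; apply: VV.
  - apply: (Vs (fin (summit g)) (fin v%:C)); [by left; right|by left; left|].
    by apply: arc => //; rewrite rq.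
  - by apply/(onK_clK gz).
  - by rewrite S2 cg /=; apply: sg_conv.
apply; split; [by move=> w [[]]|exact: tset_convex|].
have H1 : gseg (fin (summit g)) (fin (summit g)) `<=` tset e s d by apply: tset_convex.
have H2 : gseg (fin (summit g)) (pinf R) `<=` tset e s d.
  move=> q /(gseg_summit_pinf q g0)[Hq rq wq]; split; last by rewrite rq cg subrr mulr0 lexx ltW.
  apply/(onK_clK (gX e _) Hq); rewrite ?rq// ?subrr ?mulr0 ?lexx ?d0//; by rewrite -cg.
have H3 : gseg (fin v%:C) (pinf R) `<=` tset e s d by move=> q /gseg_line[]; exact: vt.
have H4 : gseg (fin v%:C) (fin v%:C) `<=` tset e s d by rewrite gseg_ideal//; right; exists v.
have H5 : gseg (pinf R) (pinf R) `<=` tset e s d by rewrite gseg_ideal; [|left].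
move=> x y [[->|->]|->] [[->|->]|->] q h;
  [exact: H4 h|exact: arc' (gseg_sym h)|exact: H3 h|exact: arc' h|exact: H1 h|exact: H2 h
  |exact: H3 (gseg_sym h)|exact: H2 (gseg_sym h)|exact: H5 h].
Qed.

Lemma nc_data v (s1 s2 : R[i]) A : noncuspidal_precell Gam v s1 s2 A -> exists e s d u g h p,
  [/\ nct A e s d u g h p, v = fin p, s1 = summit g & s2 = summit h].
Proof.
move=> [[_ [z0 Hz vz]] [I1 [I2 [[r1 r2 I12 e1 e2] [m1 m2 AE]]]]].
have [g [z [s [[Gg g0 IE1 xz] [[S sp _ zW] [ag gX Kz]]]]]] := rel_arc r1 e1.
have [h [w [t [[Gh h0 IE2 xw] [[T tp _ wW] [ah hX Kw]]]]]] := rel_arc r2 e2.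
have zz : z = z0 by apply: Some_inj; rewrite -[LHS]xz -[RHS]vz.
have ww : w = z0 by apply: Some_inj; rewrite -[LHS]xw -[RHS]vz.
subst z w; have K := Kz Hz; have rg := is_summitE g0; rewrite -IE1 in rg.
have rh := is_summitE h0; rewrite -IE2 in rh.
(* Two arcs that leave the vertex to the same side would share two abscissas on the envelope, and
   the spheres would coincide. *)
have ts : t = - s.
  have [//|st] : t = - s \/ t = s by case: S => ->; case: T => ->; rewrite ?opprK; auto.
  case: I12; rewrite IE1 IE2; subst t.
  pose a := Num.min (s * (ctr g - Re z0)) (s * (ctr h - Re z0)).
  have a0 : 0 < a by rewrite lt_min sp tp.
  have a1 : a <= s * (ctr g - Re z0) by rewrite ge_min lexx.
  have a2 : a <= s * (ctr h - Re z0) by rewrite ge_min lexx orbT.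
  have E (b : R) : s * (Re z0 + s * b - Re z0) = b by rewrite addrC addKr mulrA sg2// mul1r.
  have F (c b : R) : s * (Re z0 + s * b - c) = b - s * (c - Re z0).
    by rewrite -[in RHS](E b); ring.
  have [] := @onK2_ctr g h (Re z0 + s * a) (Re z0 + s * (a / 2)).
  - by apply: gX; rewrite ?E ?F; lra.
  - by apply: hX; rewrite ?E ?F; lra.
  - by apply: gX; rewrite ?E ?F; lra.
  - by apply: hX; rewrite ?E ?F; lra.
  - by apply/eqP => ee; have := E a; rewrite ee E; lra.
  exact: isosphere_eq.
subst t; pose u := s * (ctr g - Re z0); pose u' := - s * (ctr h - Re z0).
exists (ctr g), (- s), (u + u'), u, g, h, z0.
have nu : 0 < u by []. have nu' : 0 < u' by [].
have N1 : Nm g z0 = 1 by apply/Nm_eq1.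
have N2 : Nm h z0 = 1 by apply/Nm_eq1.
have gz0 : onK g (Re z0) by split=> //; exists z0.
have hz0 : onK h (Re z0) by split=> //; exists z0.
have ce : ctr g + - s * (u + u') = ctr h.
  rewrite /u /u' (_ : _ + _ = ctr g - (s * s) * (ctr g - ctr h)); last ring.
  by rewrite sg2//; ring.
have N : nct A (ctr g) (- s) (u + u') u g h z0; last first.
  by split=> //; [exact: rg|exact: rh].
suff [P1 [P2 P3]] : [/\ sg (- s), 0 < u & u < u + u'] /\
  [/\ axisS g (ctr g), axisS h (ctr g + - s * (u + u')), forall X, 0 <= - s * (X - ctr g) <= u -> onK g X &
      forall X, u <= - s * (X - ctr g) <= u + u' -> onK h X] /\
  [/\ clK z0, Re z0 = ctr g + - s * u, Nm g z0 = 1 & Nm h z0 = 1].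
  case: P1 => p1 p2 p3.
  have N' : nct (tset (ctr g) (- s) (u + u')) (ctr g) (- s) (u + u') u g h z0 by [].
  suff -> : A = tset (ctr g) (- s) (u + u') by [].
  by rewrite AE vz (rg _ m1) (rh _ m2) -(nct_poly N').
split; first by split; [exact: sgN|by []|lra].
split; last first.
  split=> //; rewrite /u (_ : _ + _ = ctr g - (s * s) * (ctr g - Re z0)); last ring.
  by rewrite sg2//; ring.
split=> //; first by rewrite ce.
- move=> X /andP[x1 x2]; have [->//|Xz] := eqVneq X (Re z0).
  apply: gX; last by lra.
  have : s * (X - Re z0) != 0 by rewrite mulf_neq0 ?subr_eq0//; case: S => ->; rewrite ?oppr_eq0 oner_eq0.
  by move=> nz; rewrite lt_neqAle eq_sym nz /=; rewrite /u in x2; lra.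
- move=> X /andP[x1 x2]; have [->//|Xz] := eqVneq X (Re z0).
  apply: hX; last first.
    have -> : - s * (X - ctr h) = - s * (X - ctr g) - (u + u') by rewrite /u /u'; ring.
    by rewrite subr_le0.
  have : s * (X - Re z0) != 0 by rewrite mulf_neq0 ?subr_eq0//; case: S => ->; rewrite ?oppr_eq0 oner_eq0.
  by move=> nz; rewrite mulNr oppr_gt0 lt_neqAle nz /=; rewrite /u in x1; lra.
Qed.

(** The arc descends to the real axis at [x], so a point over [x] is a limit of points of the same
    height that lie above the arc. *)
Lemma limit_ivert g (x : R) s e : sg s -> 0 < e -> (forall X, 0 < s * (X - x) < e -> onK g X) -> hg g x = x ^+ 2 -> ivert x.
Proof.
move=> S e0 gX hx z Hz rz; apply: clK_closed => //; apply/closure_box => r r0.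
have y0 : 0 < Im z ^+ 2 by rewrite exprn_gt0.
have [m m0 mP] : exists2 m, 0 < m & forall t, 0 < t -> t < m -> hg g (x + s * t) < (x + s * t) ^+ 2 + Im z ^+ 2.
  pose B := `|2 * ctr g - 2 * x| + 1; have B0 : 0 < B by rewrite ltr_wpDl.
  exists (Im z ^+ 2 / B); first by rewrite divr_gt0.
  move=> t t0; rewrite ltr_pdivlMr// => tB.
  have -> : hg g (x + s * t) = x ^+ 2 + 2 * ctr g * (s * t) by rewrite -hx /hg; ring.
  have : (2 * ctr g - 2 * x) * (s * t) <= t * B.
    apply: le_trans (ler_norm _) _; rewrite normrM mulrC (_ : `|s * t| = t); last first.
      by rewrite normrM (gtr0_norm t0); case: S => ->; rewrite ?normrN normr1 mul1r.
    by rewrite ler_pM2l// /B lerDl.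
  by have := sqr_ge0 (s * t); lra.
pose t := Num.min (Num.min m e) r / 2.
have tp : 0 < Num.min (Num.min m e) r by rewrite !lt_min m0 e0 r0.
have [t1 t2 t3] : [/\ t < m, t < e & t < r].
  by split; rewrite /t ltr_pdivrMr//; [have : Num.min (Num.min m e) r <= m by rewrite !ge_min lexx|
   have : Num.min (Num.min m e) r <= e by rewrite !ge_min lexx orbT|
   have : Num.min (Num.min m e) r <= r by rewrite ge_min lexx orbT]; lra.
have t0 : 0 < t by rewrite /t divr_gt0.
have Hw : HH ((x + s * t) +i* Im z) by exact: Hz.
have E : s * (x + s * t - x) = t by rewrite addrC addKr mulrA sg2// mul1r.
exists ((x + s * t) +i* Im z).
  apply/(onK_clK (gX (x + s * t) _) Hw) => //; first by rewrite E t0.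
  by rewrite /Wk /= ltW// mP.
rewrite /= rz subrr normr0 r0 addrC addKr normrM (gtr0_norm t0); split=> //.
by case: S => ->; rewrite ?normrN normr1 mul1r.
Qed.

Lemma rel_cut I (x : R) : relevant Gam I -> is_endpoint (relevant_part Gam I) (fin x%:C) ->
  exists e s d g, [/\ cut (tset e s d) e s d g, I = isosphere g & e + s * d = x].
Proof.
move=> rI ei; have [g [z [s [[Gg g0 IE xz] [[S sp z0 zW] [ag gX Kz]]]]]] := rel_arc rI ei.
have ze : x%:C = z by apply: Some_inj.
have iz : Im z = 0 by rewrite -ze.
have rz : Re z = x by rewrite -ze.
set d := s * (ctr g - Re z) in sp.
have re : ctr g + - s * d = Re z.
  rewrite /d (_ : _ + _ = ctr g - (s * s) * (ctr g - Re z)); last ring.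
  by rewrite sg2//; ring.
have hz : hg g (Re z) = Re z ^+ 2 by rewrite -zW /Wk iz expr0n addr0.
have dE : d = `|cc g|^-1.
  apply/eqP; rewrite -(@eqrXn2 _ 2) ?(ltW sp)// ?invr_ge0//; apply/eqP.
  rewrite exprVn real_normK ?num_real//; move: hz; rewrite hgE => /eqP.
  rewrite -subr_eq0 addrC addKr subr_eq0 => /eqP ->.
  by rewrite /d -[RHS]mul1r -(sg2 S); ring.
exists (ctr g), (- s), d, g; split=> //; last by rewrite re.
split; first by split=> //; exact: sgN.
split=> //; last first.
  move=> X /andP[x1 x2]; apply: gX; last by lra.
  by rewrite /d in x2; lra.
rewrite re; apply: (@limit_ivert g _ s d S sp _ hz) => X /andP[x1 x2].
by apply: gX => //; rewrite /d in x2; lra.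
Qed.

Lemma endpoint_real I x : relevant Gam I -> is_endpoint (relevant_part Gam I) x ->
  ~ (exists2 z, HH z & x = fin z) -> exists r : R, x = fin r%:C.
Proof.
move=> rI ei nz; have [g [z [s [[Gg g0 IE xz] [[S sp z0 zW] _]]]]] := rel_arc rI ei.
exists (Re z); rewrite xz; congr Some; apply: complexP => //=.
apply/eqP; rewrite eq_le z0 andbT leNgt; apply/negP => Hz; apply: nz; by exists z.
Qed.

Lemma cu_data v (s0 : R[i]) A : cuspidal_precell Gam v s0 A -> exists e s d g,
  [/\ cut A e s d g, v = fin (e + s * d)%:C & s0 = summit g].
Proof.
move=> [[vv niv] [I [rI ei si AE]]].
have [|x vx] := endpoint_real rI ei; first by move=> h; apply: niv.
rewrite vx in ei; have [e [s [d [g [C IE xE]]]]] := rel_cut rI ei.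
have [_ [[_ g0 _ _] _ _ _]] := C.
have sE : s0 = summit g by apply: is_summitE => //; rewrite -IE.
exists e, s, d, g; rewrite xE; split=> //.
by rewrite AE sE vx -xE -(cut_poly C).
Qed.

Lemma st_data (v1 v2 : R) A : strip_precell Gam v1 v2 A -> stt A v1 1 (v2 - v1).
Proof.
move=> [v12 o1 o2 sK AE].
have iv X : v1 <= X <= v2 -> ivert X.
  by move=> h z Hz rz; apply: (KK_clK fuchG cuspG); apply: sK; split; rewrite ?rz.
have side (v : R) : one_sided Gam (fin v%:C) -> exists e s d g, cut (tset e s d) e s d g /\ e + s * d = v.
  move=> [[[I rI eI] niv] _]; have [e [s [d [g [C _ xE]]]]] := rel_cut rI eI.
  by exists e, s, d, g.
have nK g X : v1 <= X <= v2 -> onK g X -> False by move=> /iv h /onK_ivert; apply.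
split.
  split; [by left|by rewrite subr_gt0|rewrite AE; apply/seteqP; split=> z].
    move=> [Hz /andP[z1 z2]]; split; last by apply/andP; split; lra.
    by apply: (KK_clK fuchG cuspG); apply: sK; split=> //; apply/andP.
  by move=> [[Hz _] /andP[z1 z2]]; split=> //; apply/andP; split; lra.
split=> [X /andP[x1 x2]||].
- by apply: iv; apply/andP; split; lra.
- have [e [s [d [g [C ve]]]]] := side v1 o1; exists e, d, g.
  have [[[sE|sE] d0 _] [_ _ _ gX]] := C; first by rewrite -sE.
  (* With the opposite sign the arc ending at [v1] would run below the strip, over which there is no
     boundary point of [KK Gam]. *)
  exfalso; pose m := Num.min d (v2 - v1).
  have [m0 m1 m2] : [/\ 0 < m, m <= d & m <= v2 - v1].
    by rewrite lt_min d0 subr_gt0 v12 !ge_min !lexx orbT.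
  apply: (nK g (v1 + m / 2)); first by apply/andP; split; lra.
  by apply: gX; rewrite -ve sE; apply/andP; split; lra.
- have [e [s [d [g [C ve]]]]] := side v2 o2; exists e, d, g.
  have [[[sE|sE] d0 _] [_ _ _ gX]] := C; last by rewrite -sE; split=> //; rewrite -ve sE; ring.
  exfalso; pose m := Num.min d (v2 - v1).
  have [m0 m1 m2] : [/\ 0 < m, m <= d & m <= v2 - v1].
    by rewrite lt_min d0 subr_gt0 v12 !ge_min !lexx orbT.
  apply: (nK g (v2 - m / 2)); first by apply/andP; split; lra.
  by apply: gX; rewrite -ve sE; apply/andP; split; lra.
Qed.

End Spheres.

(** * Vertical lines *)

Section Tiles.
Variables (R : realType) (Gam : set (PSL2 R)).
Hypothesis fuchG : fuchsian Gam.
Hypothesis cuspG : inf_cuspidal Gam.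
Local Notation clK := (clK Gam).
Local Notation onK := (onK Gam).
Local Notation axisS := (axisS Gam).
Local Notation ivert := (ivert Gam).
Local Notation tset := (tset Gam).
Local Notation cut := (cut Gam).
Local Notation nct := (nct Gam).
Local Notation stt := (stt Gam).
Let GM := GamM fuchG.
Let GV := GamV fuchG.
Let G1 := Gam1 fuchG.
Implicit Types (g h k t : PSL2 R) (z w p q : R[i]) (X Y e d u s x y : R) (A I : set R[i]).

(** The point $g.\infty$, which is the centre of the isometric sphere of the inverse. *)
Definition pol g : R := ca g / cc g.

Lemma NmC2 g z : cc g != 0 -> Nm g z = cc g ^+ 2 * ((Re z - ctr g) ^+ 2 + Im z ^+ 2).
Proof. by move=> c0; rewrite /Nm /ctr; field. Qed.

Lemma Re_actC g z : cc g != 0 -> HH z -> Re (act g z) = pol g - (Re z - ctr g) / Nm g z.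
Proof.
move=> c0 Hz; have n0 := lt0r_neq0 (Nm_gt0 g Hz); rewrite Re_act//; apply: (mulIf n0).
rewrite mulrBl !divfK// /pol /ctr /Nm.
have D := psl_det g; have -> : Re z - - cd g / cc g = (ca g * cd g - cb g * cc g) * (Re z + cd g / cc g).
  by rewrite D; field.
by field.
Qed.

Lemma ccV g : (cc g^-1%g == 0) = (cc g == 0) /\ cc g^-1%g ^+ 2 = cc g ^+ 2.
Proof.
have [e [e1 _ _ -> _]] := pslV_coef g; have e0 := sign_neq0 e1.
by rewrite mulf_eq0 oppr_eq0 (negPf e0) exprMn sqrrN e1 mul1r.
Qed.

Lemma ctrV g : ctr g^-1%g = pol g /\ pol g^-1%g = ctr g.
Proof.
have [e [e1 a _ c d]] := pslV_coef g; have e0 := sign_neq0 e1.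
rewrite /ctr /pol a c d; have [->|c0] := eqVneq (cc g) 0.
  by rewrite !mulr0 invr0 !mulr0.
by split; field; rewrite c0 e0.
Qed.

Lemma unipMl t g : unip t -> [/\ ctr (t * g)%g = ctr g, cc g != 0 -> pol (t * g)%g = pol g + tau t &
  cc (t * g)%g ^+ 2 = cc g ^+ 2].
Proof.
move=> ut; have [e [e1 a _ c d]] := unip_coefM g ut; have e0 := sign_neq0 e1.
rewrite /ctr /pol a c d exprMn e1 mul1r; split=> // [|c0]; last by field; rewrite c0 e0.
have [->|c0] := eqVneq (cc g) 0; first by rewrite !mulr0 invr0 !mulr0.
by field; rewrite c0 e0.
Qed.

Lemma unipMr t g : unip t -> [/\ cc g != 0 -> ctr (g * t^-1)%g = ctr g + tau t, pol (g * t^-1)%g = pol g &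
  cc (g * t^-1)%g ^+ 2 = cc g ^+ 2].
Proof.
move=> ut; have [a b c] := unipMl g^-1%g ut.
have E : (g * t^-1)%g = (t * g^-1)^-1%g by rewrite invgF.
rewrite E (ctrV _).1 (ctrV _).2 (ccV _).2; split; last by rewrite c (ccV _).2.
  by move=> c0; rewrite b ?(ccV _).1// (ctrV _).2.
by rewrite a (ctrV _).1.
Qed.

Lemma cc_neq0 g h : cc g ^+ 2 = cc h ^+ 2 -> (cc g != 0) = (cc h != 0).
Proof. by move=> e; rewrite -[cc g == 0]sqrf_eq0 e sqrf_eq0. Qed.

(** On its isometric sphere [g] preserves heights and reflects abscissas about the centre, and it
    keeps maximal height within the orbit. *)
Lemma onK_flip g X : onK g X -> onK g^-1%g (pol g - (X - ctr g)).
Proof.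
move=> [Gg c0 [z [Kz zX N1]]]; have [Hz _] := Kz; split; [exact: GV|by rewrite (ccV _).1|].
exists (act g z); split; [exact: clK_act| |by rewrite NmV// N1 invr1].
by rewrite Re_actC// N1 divr1 zX.
Qed.

Lemma axisS_flip g e : axisS g e -> axisS g^-1%g (pol g).
Proof.
move=> [Gg c0 ce [s s0 gX]]; split; [exact: GV|by rewrite (ccV _).1|by rewrite (ctrV _).1|].
exists s => // X Xs; have := onK_flip (gX (e - (X - pol g)) _); rewrite addrAC subrr add0r normrN => /(_ Xs).
by rewrite ce (_ : _ - _ = X)//; ring.
Qed.

Lemma onK_tl t g X : Gam t -> unip t -> onK g X -> onK (t * g)%g X.
Proof.
move=> Gt ut [Gg c0 [z [Kz zX N1]]]; have [a b c] := unipMl g ut; have [Hz _] := Kz.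
split; [exact: GM|by rewrite (cc_neq0 c)|exists z; split=> //].
by rewrite Nm_unipM.
Qed.

Lemma Nm_tr t g z : unip t -> HH z -> Nm (g * t^-1)%g (act t z) = Nm g z.
Proof.
move=> ut Hz; have H2 := HH_act t Hz.
by rewrite NmM// actK// [Nm t^-1%g _]Nm_unip ?mulr1//; case: (unipV ut).
Qed.

Lemma onK_tr t g X : Gam t -> unip t -> onK g X -> onK (g * t^-1)%g (X + tau t).
Proof.
move=> Gt ut [Gg c0 [z [Kz zX N1]]]; have [a b c] := unipMr g ut; have [Hz _] := Kz.
split; [by apply: GM => //; exact: GV|by rewrite (cc_neq0 c)|].
have [r i] := unip_act ut Hz.
by exists (act t z); split; [apply/(clK_unip fuchG)|rewrite r zX|rewrite Nm_tr].
Qed.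

Lemma axisS_tr t g e : Gam t -> unip t -> axisS g e -> axisS (g * t^-1)%g (e + tau t).
Proof.
move=> Gt ut [Gg c0 ce [s s0 gX]]; have [a b c] := unipMr g ut.
split; [by apply: GM => //; exact: GV|by rewrite (cc_neq0 c)|by rewrite a// ce|].
exists s => // X Xs; rewrite -[X](subrK (tau t)); apply: onK_tr => //; apply: gX.
by rewrite -addrA -opprD [tau t + e]addrC.
Qed.

Lemma axisS_tl t g e : Gam t -> unip t -> axisS g e -> axisS (t * g)%g e.
Proof.
move=> Gt ut [Gg c0 ce [s s0 gX]]; have [a b c] := unipMl g ut.
split; [exact: GM|by rewrite (cc_neq0 c)|by rewrite a// ce|].
by exists s => // X Xs; apply: onK_tl => //; exact: gX.
Qed.

Lemma ivert_tr t e : Gam t -> unip t -> ivert e -> ivert (e + tau t).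
Proof.
move=> Gt ut iv z Hz rz; have [u' tu'] := unipV ut; have [r i] := unip_act u' Hz.
apply/(clK_unip fuchG (GV Gt) u' Hz); apply: iv; first exact: HH_act.
by rewrite r rz tu' addrK.
Qed.

Lemma tset_tr t e s d : Gam t -> unip t -> tset (e + tau t) s d = act t @` tset e s d.
Proof.
move=> Gt ut; have [u' tu'] := unipV ut; apply/seteqP; split=> z.
  move=> [Kz zs]; have [Hz _] := Kz; exists (act t^-1%g z); last by rewrite actKV.
  have [r i] := unip_act u' Hz; split; first by apply/(clK_unip fuchG (GV Gt) u' Hz).
  by rewrite r tu' -addrA [- tau t - e]addrC -opprD.
move=> [w [Kw ws] <-]; have [Hw _] := Kw; have [r i] := unip_act ut Hw.
split; first by apply/(clK_unip fuchG Gt ut Hw).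
by rewrite r opprD addrACA subrr addr0.
Qed.

Lemma cut_tr t e s d g : Gam t -> unip t -> cut (tset e s d) e s d g ->
  cut (tset (e + tau t) s d) (e + tau t) s d (g * t^-1)%g.
Proof.
move=> Gt ut [[S d0 _] [ag iv dE gX]]; have [_ _ c] := unipMr g ut.
split=> //; split; first exact: axisS_tr.
- by rewrite addrAC; exact: ivert_tr.
- by rewrite dE; congr (_^-1); apply/eqP; rewrite -(@eqrXn2 _ 2)// !real_normK ?num_real// c.
- move=> X /andP[x1 x2]; rewrite -[X](subrK (tau t)); apply: onK_tr => //; apply: gX.
  by rewrite -addrA -opprD [tau t + e]addrC x1.
Qed.

(* The vertical lines over these points contain the vertical sides of precells. *)
Definition End e := (exists g, axisS g e) \/
  exists e' s d g, cut (tset e' s d) e' s d g /\ e' + s * d = e.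

Lemma End_tr t e : Gam t -> unip t -> End e -> End (e + tau t).
Proof.
move=> Gt ut [[g ag]|[e' [s [d [g [c <-]]]]]]; first by left; exists (g * t^-1)%g; exact: axisS_tr.
by right; exists (e' + tau t), s, d, (g * t^-1)%g; split; [exact: cut_tr|ring].
Qed.

Lemma End_tr' t e : Gam t -> unip t -> End (e + tau t) -> End e.
Proof.
move=> Gt ut; have [u' tu'] := unipV ut; move=> /(End_tr (GV Gt) u').
by rewrite tu' addrK.
Qed.

(** Wider than [End]: it admits the line over any ideal boundary point of [KK Gam]. The argument of
    [noncross] works for these as well, and endpoints in [bd] lead to them. *)
Definition Lin e := (exists g, axisS g e) \/ ivert e.

Lemma End_case e : End e -> Lin e.
Proof. by case=> [|[e' [s [d [g [[_ [_ iv _ _]] <-]]]]]]; [left|right]. Qed.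

Definition lmap k x y := forall w, HH w -> (Re w = x <-> Re (act k w) = y).

Lemma lmapM k l x y (v : R) : lmap k x y -> lmap l y v -> lmap (l * k)%g x v.
Proof. by move=> h1 h2 w Hw; rewrite h1// actM//; apply: h2; exact: HH_act. Qed.

Lemma lmapV k x y : lmap k x y -> lmap k^-1%g y x.
Proof. by move=> h w Hw; rewrite h ?actKV//; exact: HH_act. Qed.

Lemma lmap1 x : lmap 1%g x x. Proof. by move=> w Hw; rewrite act1. Qed.

Lemma lmap_unip t x : unip t -> lmap t x (x + tau t).
Proof. by move=> ut w Hw; have [-> _] := unip_act ut Hw; split=> [->//|/addIr]. Qed.

Lemma lmap_ctr g : cc g != 0 -> lmap g (ctr g) (pol g).
Proof.
move=> c0 w Hw; rewrite Re_actC//; split=> [->|]; first by rewrite subrr mul0r subr0.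
move=> /eqP; rewrite -subr_eq0 addrC addKr oppr_eq0 mulf_eq0 invr_eq0.
by rewrite (gt_eqF (Nm_gt0 g Hw)) orbF subr_eq0 => /eqP.
Qed.

Lemma lmapP k x y : cc k != 0 -> lmap k x y -> ctr k = x /\ pol k = y.
Proof.
move=> c0 l; pose w1 := x +i* 1 : R[i]; pose w2 := x +i* 2 : R[i].
have H1 : HH w1 by exact: ltr01.
have H2 : HH w2 by rewrite /HH /= ltr0n.
have /(l _ H1) : Re w1 = x by []. have /(l _ H2) : Re w2 = x by [].
rewrite !Re_actC// => e2 e1; suff cx : ctr k = x.
  by split=> //; move: e1; rewrite cx /= subrr mul0r subr0.
apply/eqP; rewrite -subr_eq0 -oppr_eq0 opprB; apply/negP => /negP n0.
have : (x - ctr k) / Nm k w1 = (x - ctr k) / Nm k w2 by move: e1 e2 => /=; lra.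
move=> /(mulfI n0)/invr_inj; rewrite !NmC2//= => /(mulfI _); rewrite sqrf_eq0 => /(_ c0)/addrI.
by rewrite expr1n; lra.
Qed.

(** On a line over a summit the points above it lie in [clK]; those below are carried by the element
    of the sphere to points above the summit of the inverse. Two elements therefore suffice for the
    whole line. *)
Lemma clK_lin e : Lin e -> exists K : seq (PSL2 R * R),
  (forall u : PSL2 R * R, u \in K -> [/\ Gam u.1, Lin u.2, End e -> End u.2 & lmap u.1 e u.2]) /\
  forall z, HH z -> Re z = e -> exists2 u, u \in K & clK (act u.1 z).
Proof.
case=> [[g ag]|iv]; last first.
  exists [:: (1%g, e)]; split=> [u|z Hz ze].
    by rewrite inE => /eqP->; split=> //; [right|exact: lmap1].
  by exists (1%g, e); rewrite ?inE//= act1//; exact: iv.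
have [Gg c0 ce [s s0 gX]] := ag; have oe : onK g e by apply: gX; rewrite subrr normr0 ltW.
have ax := axisS_flip ag; have [_ c0' _ [s' s0' gX']] := ax.
exists [:: (1%g, e); (g, pol g)]; split=> [u|z Hz ze].
  rewrite !inE => /orP[]/eqP->; first by split=> //; [left; exists g|exact: lmap1].
  split=> //=; [by left; exists g^-1%g|by move=> _; left; exists g^-1%g|].
  by rewrite -ce; exact: lmap_ctr.
have [Kz|nK] := pselect (clK z); first by exists (1%g, e); rewrite ?inE ?eqxx//= act1.
exists (g, pol g); rewrite ?inE ?eqxx ?orbT//=.
have n1 : Nm g z < 1.
  by rewrite ltNge; apply/negP => n; apply: nK; apply/(onK_clK fuchG cuspG oe) => //; rewrite -ze -Nm_ge1.
have Hg := HH_act g Hz.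
have rg : Re (act g z) = pol g by apply/(lmap_ctr c0 Hz); rewrite ce.
apply/(onK_clK fuchG cuspG (gX' (pol g) _) Hg rg); first by rewrite subrr normr0 ltW.
rewrite -rg -Nm_ge1// NmV// invf_ge1 ?Nm_gt0//; exact: ltW.
Qed.

Lemma clK_end e z : Lin e -> HH z -> Re z = e ->
  exists k x, [/\ Gam k, Lin x, End e -> End x, lmap k e x & clK (act k z)].
Proof.
move=> Le Hz ze; have [K [KP Kz]] := clK_lin Le; have [u uK cu] := Kz z Hz ze.
by have [G L E l] := KP u uK; exists u.1, u.2.
Qed.

(** Unless [k] is a translation, [z] lies on its isometric sphere. Over a summit this forces the
    sphere to be centred at [x], and [k] maps the line over its centre to a vertical line; over an
    ideal point it is impossible. *)
Lemma end_lmap k x y z : Lin x -> Gam k -> clK z -> Re z = x -> clK (act k z) ->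
  Re (act k z) = y -> lmap k x y.
Proof.
move=> Ex Gk Kz zx Kkz kzy; have [Hz _] := Kz.
have [c0|c0] := eqVneq (cc k) 0.
  have uk := stab_unip fuchG cuspG Gk c0; have [r _] := unip_act uk Hz.
  by rewrite -kzy r zx; exact: lmap_unip.
have N1 := Nm_clK fuchG Gk Kz Kkz.
have ok : onK k x by split=> //; exists z.
have cx : ctr k = x.
  by case: Ex => [[g ag]|iv]; [exact: (axisS_uniq ag ok)|case: (onK_ivert fuchG cuspG ok iv)].
rewrite -kzy -cx (_ : Re (act k z) = pol k); first exact: lmap_ctr.
by apply/(lmap_ctr c0) => //; rewrite cx.
Qed.

(* A point of a line and its image on another line can be moved to the closure of
   [KK Gam], where elements of Gamma preserve the height. *)
Lemma noncross e e' k z : Lin e -> Lin e' -> Gam k -> HH z -> Re z = e' -> Re (act k z) = e ->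
  lmap k e' e.
Proof.
move=> Ee Ee' Gk Hz ze kze; have Hk := HH_act k Hz.
have [k1 [x1 [G_1 E1 _ l1 K1]]] := clK_end Ee' Hz ze.
have [k2 [x2 [G_2 E2 _ l2 K2]]] := clK_end Ee Hk kze.
have H1 := HH_act k1 Hz.
have l : lmap (k2 * k * k1^-1)%g x1 x2.
  apply: (@end_lmap _ _ _ (act k1 z)) => //; first by apply: GM; [exact: GM|exact: GV].
  - by apply/l1.
  - by rewrite actM// actK// actM.
  - by rewrite actM// actK// actM//; apply/l2.
have := lmapM (lmapM l1 l) (lmapV l2).
by rewrite mulgVK mulKg.
Qed.

(** A quantitative form of [noncross]. On the line over [e'], the equation [Re (act k z) = e] means
    [Nm k z = Q]; if the inequality failed, this would have a solution [z] in [HH], a genuine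
    crossing. *)
Lemma noncross_le e e' k : End e -> End e' -> Gam k -> cc k != 0 ->
  0 < (pol k - e) * (e' - ctr k) -> 1 <= cc k ^+ 2 * ((pol k - e) * (e' - ctr k)).
Proof.
move=> Ee Ee' Gk c0 P0; rewrite leNgt; apply/negP => P1.
have ye : pol k - e != 0 by apply: contraTneq P0 => ->; rewrite mul0r ltxx.
have c2 := cc2_gt0 c0; set dl := e' - ctr k in P0 P1; set yy := pol k - e in P0 P1 ye.
pose Q := dl / yy; have Q0 : 0 < Q.
  have -> : Q = yy * dl / yy ^+ 2 by rewrite /Q; field.
  by rewrite divr_gt0// exprn_even_gt0.
have QE : Q - cc k ^+ 2 * dl ^+ 2 = Q * (1 - cc k ^+ 2 * (yy * dl)) by rewrite /Q; field.
have Y2 : 0 < (Q - cc k ^+ 2 * dl ^+ 2) / cc k ^+ 2 by rewrite divr_gt0// QE mulr_gt0// subr_gt0.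
pose z := e' +i* Num.sqrt ((Q - cc k ^+ 2 * dl ^+ 2) / cc k ^+ 2) : R[i].
have Hz : HH z by rewrite /HH /= sqrtr_gt0.
have NQ : Nm k z = Q by rewrite NmC2//= sqr_sqrtr ?(ltW Y2)// -/dl; field.
have kz : Re (act k z) = e.
  rewrite Re_actC// NQ /= -/dl /Q (_ : _ / _ = yy); first by rewrite /yy; ring.
  by field; rewrite ye /=; apply: contraTneq P0 => ->; rewrite mulr0 ltxx.
have [cE _] := lmapP c0 (noncross (End_case Ee) (End_case Ee') Gk Hz erefl kz).
by move: P0; rewrite /dl cE subrr mulr0 ltxx.
Qed.

(** The arithmetic of [zone_disj], in coordinates centred at [pol k] and [ctr k], where [k] becomes
    $w \mapsto -1/(c_2 w)$. Ends a < 0 < b satisfy $YY' \le -ab$ by non-crossing. If both intervals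
    reach across 0, the widths give $-ab \le \frac49 YY'$. If neither does, the inner ends give $1
    \le -c_2ab \le -c_2xx' < 1$. The mixed cases combine both arguments through $xY' = -x'Y$. *)
Lemma zone_alg0 (c2 a1 a2 b1 b2 x x' Y Y' : R) : 0 < c2 -> 0 < Y -> 0 < Y' ->
  a1 < x -> x < a2 -> b1 < x' -> x' < b2 -> 3 * (a2 - a1) <= 2 * Y -> 3 * (b2 - b1) <= 2 * Y' ->
  x * (c2 * (x' ^+ 2 + Y' ^+ 2)) = - x' -> Y * (c2 * (x' ^+ 2 + Y' ^+ 2)) = Y' ->
  (forall a b, (a = a1 \/ a = a2) -> (b = b1 \/ b = b2) -> a * b < 0 -> 1 <= - (c2 * (a * b))) ->
  0 <= x' -> False.
Proof.
move=> c0 Y0 Y0' xa1 xa2 xb1 xb2 wa wb E1 E2 NC x0'.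
have F1 : x * Y' = - x' * Y by rewrite -E1 -{1}E2; ring.
have x0 : x <= 0 by rewrite -(pmulr_lle0 _ Y0') mulrC mulrC F1 mulNr oppr_le0 mulr_ge0// ltW.
have F2 : c2 * (Y * Y') <= 1.
  rewrite -(ler_pM2r Y0') mul1r -[leRHS]E2 (_ : c2 * (Y * Y') * Y' = Y * (c2 * Y' ^+ 2)); last ring.
  by rewrite ler_pM2l// ler_pM2l// lerDr sqr_ge0.
have NC' a b : (a = a1 \/ a = a2) -> (b = b1 \/ b = b2) -> a < 0 -> 0 < b -> Y * Y' <= - a * b.
  move=> ha hb a0 b0; have /(NC _ _ ha hb) h : a * b < 0 by rewrite nmulr_rlt0.
  by rewrite -(ler_pM2l c0); apply: le_trans F2 _; rewrite mulNr mulrN.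
have a10 : a1 < 0 by lra. have b20 : 0 < b2 by lra.
have [a20|a20] := ltP a2 0.
  have [b10|b10] := ltP 0 b1.
    have h := NC' a2 b1 (or_intror erefl) (or_introl erefl) a20 b10.
    have h1 : - a2 * b1 <= - x * x' by apply: ler_pM; lra.
    have h3 : - a2 * b1 * c2 >= 1.
      by have := NC a2 b1 (or_intror erefl) (or_introl erefl); rewrite nmulr_rlt0// => /(_ b10); lra.
    have h4 : c2 * (- x * x') < 1.
      have n0 : 0 < c2 * (x' ^+ 2 + Y' ^+ 2).
        by rewrite mulr_gt0// ltr_wpDl ?sqr_ge0// exprn_gt0.
      rewrite -(ltr_pM2r n0) mul1r (_ : c2 * (- x * x') * (c2 * (x' ^+ 2 + Y' ^+ 2)) = - (x * (c2 * (x' ^+ 2 + Y' ^+ 2))) * x' * c2); last ring.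
      rewrite E1 opprK (_ : x' * x' * c2 = c2 * x' ^+ 2); last ring.
      by rewrite ltr_pM2l// ltrDl exprn_gt0.
    have h5 : c2 * (- a2 * b1) <= c2 * (- x * x') by rewrite ler_pM2l.
    lra.
  have h := NC' a2 b2 (or_intror erefl) (or_intror erefl) a20 b20.
  have h1 : - a2 * b2 <= - x * b2 by rewrite ler_pM2r; lra.
  have h2 : Y * Y' ^+ 2 <= Y * (x' * b2).
    apply: (@le_trans _ _ (- x * b2 * Y')); first by rewrite expr2 mulrA ler_pM2r//; lra.
    by rewrite (_ : - x * b2 * Y' = - (x * Y') * b2); [rewrite F1; lra|ring].
  rewrite ler_pM2l// in h2.
  have h3 : x' * b2 <= (2 / 3 * Y') * (2 / 3 * Y') by apply: ler_pM; lra.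
  by have : 0 < Y' ^+ 2; [rewrite exprn_gt0|lra].
have [b10|b10] := ltP 0 b1.
  have h := NC' a1 b1 (or_introl erefl) (or_introl erefl) a10 b10.
  have h1 : - a1 * b1 <= - a1 * x' by rewrite ler_pM2l; lra.
  have h2 : Y' * Y ^+ 2 <= Y' * (- a1 * - x).
    apply: (@le_trans _ _ (- a1 * x' * Y)).
      by rewrite (_ : Y' * Y ^+ 2 = Y * Y' * Y); [rewrite ler_pM2r//; lra|ring].
    by rewrite (_ : - a1 * x' * Y = a1 * (- x' * Y)); [rewrite -F1; lra|ring].
  rewrite ler_pM2l// in h2.
  have h3 : - a1 * - x <= (2 / 3 * Y) * (2 / 3 * Y) by apply: ler_pM; lra.
  by have : 0 < Y ^+ 2; [rewrite exprn_gt0|lra].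
have h := NC' a1 b2 (or_introl erefl) (or_intror erefl) a10 b20.
have h3 : - a1 * b2 <= (2 / 3 * Y) * (2 / 3 * Y') by apply: ler_pM; lra.
by have : 0 < Y * Y'; [rewrite mulr_gt0|lra].
Qed.

Lemma zone_alg (c2 a1 a2 b1 b2 x x' Y Y' : R) : 0 < c2 -> 0 < Y -> 0 < Y' ->
  a1 < x -> x < a2 -> b1 < x' -> x' < b2 -> 3 * (a2 - a1) <= 2 * Y -> 3 * (b2 - b1) <= 2 * Y' ->
  x * (c2 * (x' ^+ 2 + Y' ^+ 2)) = - x' -> Y * (c2 * (x' ^+ 2 + Y' ^+ 2)) = Y' ->
  (forall a b, (a = a1 \/ a = a2) -> (b = b1 \/ b = b2) -> a * b < 0 -> 1 <= - (c2 * (a * b))) ->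
  False.
Proof.
move=> c0 Y0 Y0' xa1 xa2 xb1 xb2 wa wb E1 E2 NC.
have [x0|x0] := leP 0 x'; first exact: (@zone_alg0 c2 a1 a2 b1 b2 x x' Y Y').
apply: (@zone_alg0 c2 (- a2) (- a1) (- b2) (- b1) (- x) (- x') Y Y') => //; rewrite ?ltrN2//.
- by lra.
- by lra.
- by rewrite sqrrN mulNr E1.
- by rewrite sqrrN.
- move=> a b ha hb ab; rewrite -[a * b]mulrNN; apply: NC; last by rewrite mulrNN.
    by case: ha => ->; rewrite opprK; auto.
  by case: hb => ->; rewrite opprK; auto.
- by rewrite oppr_ge0 ltW.
Qed.

(* The translates of these tops of ideal triangles do not overlap. *)
Definition zone e1 e2 z := [/\ HH z, e1 < Re z, Re z < e2 & 3 * (e2 - e1) <= 2 * Im z].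

Lemma zone_disj e1 e2 e1' e2' k z : End e1 -> End e2 -> End e1' -> End e2' -> Gam k ->
  zone e1' e2' z -> zone e1 e2 (act k z) -> cc k = 0.
Proof.
move=> E1 E2 E1' E2' Gk [Hz z1 z2 z3] [Hk k1 k2 k3]; apply/eqP/negPn/negP => c0.
have n0 := Nm_gt0 k Hz; have NE := NmC2 z c0.
apply: (@zone_alg (cc k ^+ 2) (e1 - pol k) (e2 - pol k) (e1' - ctr k) (e2' - ctr k)
  (Re (act k z) - pol k) (Re z - ctr k) (Im (act k z)) (Im z)) => //; try by lra.
- exact: cc2_gt0.
- by rewrite -NE Re_actC// addrAC subrr add0r mulNr divfK ?gt_eqF.
- by rewrite -NE Im_act// divfK ?gt_eqF.
- move=> a b ha hb ab.
  have [e Ee aE] : exists2 e, End e & a = e - pol k by case: ha => ->; [exists e1|exists e2].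
  have [e' Ee' bE] : exists2 e, End e & b = e - ctr k by case: hb => ->; [exists e1'|exists e2'].
  have E : - (a * b) = (pol k - e) * (e' - ctr k) by rewrite aE bE; ring.
  by rewrite -mulrN E; apply: noncross_le => //; rewrite -E oppr_gt0.
Qed.

(** The common form of the three kinds of precells: [e] is either of the two ends and [s] points
    from it into the interval. *)
Definition tile A e s d := [\/ exists u g h p, nct A e s d u g h p, exists g, cut A e s d g,
  exists g, cut A (e + s * d) (- s) d g | stt A e s d].

Lemma tile_set A e s d : tile A e s d -> [/\ sg s, 0 < d & A = tset e s d].
Proof.
move=> [[u [g [h [p [[S u0 ud ->] _]]]]]|[g [[]]]|[g [[S d0 ->] _]]|[[]]] //.
  by split=> //; exact: lt_trans ud.
have S' : sg s by rewrite -[s]opprK; exact: sgN.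
by split=> //; rewrite -tset_sym.
Qed.

Lemma tile_sym A e s d : tile A e s d -> tile A (e + s * d) (- s) d.
Proof.
move=> [[u [g [h [p n]]]]|[g c]|[g c]|c].
- by constructor 1; exists (d - u), h, g, p; exact: nct_sym.
- by constructor 3; exists g; rewrite opprK mulNr addrK.
- by constructor 2; exists g.
- by constructor 4; exact: stt_sym.
Qed.

Lemma tile_end A e s d : tile A e s d -> End e.
Proof.
move=> [[u [g [h [p [_ [[ag _ _ _] _]]]]]]|[g [_ [ag _ _ _]]]|[g c]|[_ [_ [e' [d' [g c]]] _]]].
- by left; exists g.
- by left; exists g.
- right; exists (e + s * d), (- s), d, g; split; last by ring.
  by have [[_ _ <-] _] := c.
- by right; exists e', s, d', g.
Qed.

Lemma tile_end2 A e s d : tile A e s d -> End (e + s * d).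
Proof. by move=> /tile_sym/tile_end. Qed.

Lemma cut_near e s d g m : cut (tset e s d) e s d g -> 0 < m ->
  exists X, onK g X /\ 0 < s * (e + s * d - X) < m.
Proof.
move=> [[S d0 _] [_ _ _ gX]] m0; pose a := Num.min (m / 2) d.
have [a0 a1 a2] : [/\ 0 < a, a < m & a <= d].
  have h1 : a <= m / 2 by rewrite ge_min lexx.
  by split; [rewrite lt_min d0 divr_gt0|lra|rewrite ge_min lexx orbT].
exists (e + s * (d - a)); split.
  by apply: gX; rewrite addrC addKr mulrA sg2// mul1r; apply/andP; split; lra.
have -> : s * (e + s * d - (e + s * (d - a))) = s * s * a by ring.
by rewrite sg2// mul1r a0.
Qed.

Lemma End_onK e m : End e -> 0 < m -> exists g X, onK g X /\ `|X - e| < m.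
Proof.
move=> [[g [_ _ _ [s s0 gX]]]|[e' [s [d [g [c <-]]]]]] m0.
  by exists g, e; rewrite subrr normr0; split=> //; apply: gX; rewrite subrr normr0 ltW.
have [X [gX /andP[x1 x2]]] := cut_near c m0; exists g, X; split=> //.
have [[S _ _] _] := c; rewrite ltr_norml.
by case: S x1 x2 => -> x1 x2; apply/andP; split; lra.
Qed.

Lemma End_arc_not g X s : 0 < s -> onK g (X - s) -> onK g X -> onK g (X + s) -> End X -> ctr g = X.
Proof.
move=> s0 g1 gX g2 /End_case[[h ah]|iv]; first exact: (axisS_uniq ah gX).
by case: (onK_ivert fuchG cuspG gX iv).
Qed.

(** Arcs exist arbitrarily close to every end, which excludes the inside of a strip. Otherwise, an
    inner point of an arc could only be an end if the arc had its summit there, but the arcs over a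
    tile have their summits over its ends; and at a vertex the supporting line is not unique. *)
Lemma tile_open A e s d X : tile A e s d -> 0 < s * (X - e) < d -> ~ End X.
Proof.
have cutn e' s' d' g Y : cut A e' s' d' g -> 0 < s' * (Y - e') < d' -> ~ End Y.
  move=> [[S d0 _] [ag iv _ gX]] /andP[x1 x2] EY.
  pose m := Num.min (s' * (Y - e')) (d' - s' * (Y - e')) / 2.
  have m0 : 0 < Num.min (s' * (Y - e')) (d' - s' * (Y - e')) by rewrite lt_min x1 subr_gt0.
  have m1 : Num.min (s' * (Y - e')) (d' - s' * (Y - e')) <= s' * (Y - e') by rewrite ge_min lexx.
  have m2 : Num.min (s' * (Y - e')) (d' - s' * (Y - e')) <= d' - s' * (Y - e') by rewrite ge_min lexx orbT.
  have mp : 0 < m by rewrite divr_gt0.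
  have mE : Num.min (s' * (Y - e')) (d' - s' * (Y - e')) = 2 * m by rewrite /m; field.
  rewrite mE in m1 m2.
  have cY : ctr g = Y.
    by apply: (End_arc_not mp) => //; apply: gX; case: S x1 x2 m1 m2 => -> x1 x2 m1 m2; apply/andP; split; lra.
  by have [_ _ ce _] := ag; move: x1; rewrite -cY ce subrr mulr0 ltxx.
move=> [[u [g [h [p n]]]]|[g c]|[g c]|[[S d0 _] [iv _ _]]] Xi; last 3 first.
- exact: cutn c Xi.
- have [[S' _ _] _] := c; apply: (cutn _ _ _ _ _ c).
  by move: Xi S' => /andP[x1 x2]; rewrite /sg => -[/eqP|/eqP]; rewrite ?eqr_oppLR ?opprK => /eqP sE;
    rewrite sE in x1 x2 *; apply/andP; split; lra.
- move=> EX; pose m := Num.min (s * (X - e)) (d - s * (X - e)).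
  have /andP[x1 x2] := Xi; have m0 : 0 < m by rewrite lt_min x1 subr_gt0.
  have m1 : m <= s * (X - e) by rewrite ge_min lexx.
  have m2 : m <= d - s * (X - e) by rewrite ge_min lexx orbT.
  have [g [Y [gY]]] := End_onK EX m0; rewrite ltr_norml => /andP[y1 y2].
  apply: (onK_ivert fuchG cuspG gY); apply: iv.
  by case: S x1 x2 m1 m2 => -> x1 x2 m1 m2; apply/andP; split; lra.
have [[S u0 ud _] [[ag ah gX hX] _]] := n; have /andP[x1 x2] := Xi => EX.
have [_ _ cg _] := ag; have [_ _ ch _] := ah.
have nb (a b c : R) k : a < s * (X - e) -> s * (X - e) < b -> (forall Y, a <= s * (Y - e) <= b -> onK k Y) -> ctr k = X.
  move=> aX Xb kY; pose m := Num.min (s * (X - e) - a) (b - s * (X - e)).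
  have m0 : 0 < m by rewrite lt_min !subr_gt0 aX.
  have m1 : m <= s * (X - e) - a by rewrite ge_min lexx.
  have m2 : m <= b - s * (X - e) by rewrite ge_min lexx orbT.
  by apply: (End_arc_not m0) => //; apply: kY; case: S aX Xb m1 m2 => -> aX Xb m1 m2; apply/andP; split; lra.
have [xu|xu|xu] := ltgtP (s * (X - e)) u.
- have cX := nb 0 u 0 g x1 xu gX; move: x1; rewrite -cX cg subrr mulr0 ltxx //.
- have cX := nb u d 0 h xu x2 hX; move: x2; rewrite -cX ch (_ : s * _ = s * s * d); last ring.
  by rewrite sg2// mul1r ltxx.
have oX : onK g X by apply: gX; rewrite ltW//= xu.
have oX' : onK h X by apply: hX; rewrite xu lexx ltW.
case: (End_case EX) => [[k ak]|iv]; last exact: (onK_ivert fuchG cuspG oX iv).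
have := axisS_uniq ak oX; rewrite cg => eX.
by move: x1; rewrite eX subrr mulr0 ltxx.
Qed.

Lemma tile_overlap A A' e d e' d' X : tile A e 1 d -> tile A' e' 1 d' ->
  e < X < e + d -> e' < X < e' + d' -> e = e' /\ d = d'.
Proof.
move=> T T' /andP[x1 x2] /andP[y1 y2].
have n1 Y : e < Y -> Y < e + d -> ~ End Y.
  by move=> h1 h2; apply: (tile_open T); apply/andP; split; lra.
have n2 Y : e' < Y -> Y < e' + d' -> ~ End Y.
  by move=> h1 h2; apply: (tile_open T'); apply/andP; split; lra.
have E1 := tile_end T; have E2 := tile_end2 T; rewrite mul1r in E2.
have E1' := tile_end T'; have E2' := tile_end2 T'; rewrite mul1r in E2'.
have ee : e = e'.
  apply/eqP; rewrite eq_le !leNgt; apply/andP; split; apply/negP => h.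
    by apply: (n2 e) => //; lra.
  by apply: (n1 e') => //; lra.
split=> //; apply/eqP; rewrite eq_le !leNgt; apply/andP; split; apply/negP => h.
  by apply: (n1 (e' + d')) => //; lra.
by apply: (n2 (e + d)) => //; lra.
Qed.

Lemma tile_int A e s d z : tile A e s d -> KK Gam z -> 0 < s * (Re z - e) < d -> interior A z.
Proof.
move=> /tile_set[S d0 ->] Kz /andP[z1 z2].
have /interior_box[r r0 rK] : interior (KK Gam) z.
  by have := KK_open fuchG cuspG; rewrite openE => h; exact: (h z Kz).
apply/interior_box; pose m := Num.min r (Num.min (s * (Re z - e)) (d - s * (Re z - e))).
have m0 : 0 < m by rewrite !lt_min r0 z1 subr_gt0.
have m1 : m <= r by rewrite ge_min lexx.
have m2 : m <= s * (Re z - e) by rewrite !ge_min lexx orbT.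
have m3 : m <= d - s * (Re z - e) by rewrite !ge_min lexx !orbT.
exists m => // w w1 w2; split.
  by apply: (KK_clK fuchG cuspG); apply: rK; [exact: lt_le_trans m1|exact: lt_le_trans m1].
by move: w1; rewrite ltr_norml; case: S z1 z2 m2 m3 => -> z1 z2 m2 m3 /andP[w1 w3]; apply/andP; split; lra.
Qed.

Lemma tile_clK A e s d : tile A e s d -> A `<=` clK.
Proof. by move=> /tile_set[_ _ ->] z []. Qed.

Lemma tile_tr t A e s d : Gam t -> unip t -> tile A e s d -> tile (act t @` A) (e + tau t) s d.
Proof.
move=> Gt ut T; have [S d0 AE] := tile_set T.
have E : act t @` A = tset (e + tau t) s d by rewrite AE tset_tr.
rewrite E; case: T => [[u [g [h [p [[_ u0' ud' _] [[ag ah gX hX] [Kp rp n1 n2]]]]]]]|[g [c1 c2]]|[g [c1 c2]]|[_ [iv c1 c2]]].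
- constructor 1; exists u, (g * t^-1)%g, (h * t^-1)%g, (act t p).
  have [Hp _] := Kp; have [r i] := unip_act ut Hp.
  have sh X : s * (X - (e + tau t)) = s * (X - tau t - e) by ring.
  split; [by []|split].
    split; [exact: axisS_tr|by rewrite addrAC; exact: axisS_tr| |].
      by move=> X; rewrite sh => h1; rewrite -[X](subrK (tau t)); apply: onK_tr => //; exact: gX.
    by move=> X; rewrite sh => h1; rewrite -[X](subrK (tau t)); apply: onK_tr => //; exact: hX.
  by split; rewrite ?Nm_tr// ?r ?rp; [apply/(clK_unip fuchG)|ring].
- constructor 2; exists (g * t^-1)%g; apply: cut_tr => //; by case: c1 => _ _ <-.
- constructor 3; exists (g * t^-1)%g.
  have E2 : tset (e + tau t) s d = tset (e + s * d + tau t) (- s) d by rewrite tset_sym// addrAC.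
  have E3 : e + tau t + s * d = e + s * d + tau t by ring.
  have [_ _ AE'] := c1; rewrite E2 E3; apply: cut_tr => //.
  by rewrite -AE'; exact: (conj c1 c2).
- constructor 4; split=> //; split.
  + move=> X h1; rewrite -[X](subrK (tau t)); apply: ivert_tr => //; apply: iv.
    by move: h1; rewrite (_ : s * (X - (e + tau t)) = s * (X - tau t - e)); last ring.
  + move: c1 => [e' [d' [g [c ee]]]]; exists (e' + tau t), d', (g * t^-1)%g; split; first exact: cut_tr.
    by rewrite -ee; ring.
  + move: c2 => [e' [d' [g [c ee]]]]; exists (e' + tau t), d', (g * t^-1)%g; split; first exact: cut_tr.
    by rewrite addrAC ee; ring.
Qed.

End Tiles.

(** * The basal family as a partition of a horocycle *)

Section BasalTiles.
Variables (R : realType) (Gam : set (PSL2 R)).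
Hypothesis fuchG : fuchsian Gam.
Hypothesis cuspG : inf_cuspidal Gam.
Hypothesis condA : condition_A Gam.
Variables (AA : set (set R[i])).
Hypothesis basal : basal_family Gam AA.
Implicit Types (g h k t : PSL2 R) (z w p q : R[i]) (X Y e d u s x y : R) (A : set R[i]).

Lemma AA_tile A : AA A -> exists e d, tile Gam A e 1 d.
Proof.
have norm e s d : tile Gam A e s d -> exists e d, tile Gam A e 1 d.
  move=> T; have [[sE|sE] d0 _] := tile_set T; subst s; first by exists e, d.
  by exists (e + -1 * d), d; have := tile_sym T; rewrite opprK.
case: basal => + _ => /[apply] -[[v [s1 [s2 /(nc_data fuchG cuspG condA)]]]|[v [s /(cu_data fuchG cuspG condA)]]|[v1 [v2 /(st_data fuchG cuspG condA)]]].
- move=> [e [s [d [u [g [h [p [n _ _ _]]]]]]]]; apply: (norm e s d).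
  by constructor 1; exists u, g, h, p.
- by move=> [e [s' [d [g [c _ _]]]]]; apply: (norm e s' d); constructor 2; exists g.
- by move=> st; exists v1, (v2 - v1); constructor 4.
Qed.

Lemma AA_cover z : HH z -> exists k A w, [/\ Gam k, AA A, A w & act k w = z].
Proof.
move=> Hz; case: basal => _ [VH cV [_ _ _]].
move=> /seteqP[_ /(_ z Hz)] [k Gk [w [cw Hw] <-]].
have : clH (\bigcup_(A in AA) A) w by split=> //; apply: closureS cw; exact: interior_subset.
by rewrite cV => -[A AAA Aw]; exists k, A, w.
Qed.

Lemma AA_uniq1 A A' k z : AA A -> AA A' -> Gam k -> interior A z -> interior A' (act k z) -> k = 1%g.
Proof.
move=> AAA AAA' Gk iz ikz; case: basal => _ [VH _ [_ FH dF _]].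
have sub B : AA B -> interior B `<=` interior (\bigcup_(A in AA) A).
  by move=> h; apply: interiorS; exact: bigcup_sup.
have Hz : HH z by apply: FH; exact: sub iz.
apply: contrapT => k1.
have : ((act 1%g @` interior (\bigcup_(A in AA) A)) `&` (act k^-1%g @` interior (\bigcup_(A in AA) A))) z.
  split; first by exists z; rewrite ?act1//; exact: sub iz.
  by exists (act k z); [exact: sub ikz|rewrite actK].
rewrite dF//; [exact: (Gam1 fuchG)|exact: (GamV fuchG)|].
by move=> e; apply: k1; rewrite -[k]invgK -e invg1.
Qed.

(** Above all isometric spheres, equivalence under Gamma to a point of [clK] is equivalence by a
    translation. Hence the intervals of the precells, translated, cover the real line. *)
Lemma AA_cover_high : exists2 H, 0 < H & forall z, H < Im z -> KK Gam z /\
  exists t A e d, [/\ Gam t, unip t, AA A, tile Gam A e 1 d & e <= Re (act t z) <= e + d].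
Proof.
have [H H0 HK] := high_KK fuchG cuspG; exists H => // z Hz.
have hz : HH z by exact: lt_trans Hz.
have Kz := HK _ hz Hz; split=> //.
have [k [A [w [Gk AAA Aw kw]]]] := AA_cover hz.
have [e [d T]] := AA_tile AAA; have Kw := tile_clK T Aw; have [Hw _] := Kw.
have c0 : cc k = 0 by apply: (KK_stab' fuchG cuspG Gk Kw); rewrite kw.
have uk := stab_unip fuchG cuspG Gk c0; have [uk' _] := unipV uk.
exists k^-1%g, A, e, d; split=> //; first exact: (GamV fuchG).
rewrite -kw actK//; have [_ _ AE] := tile_set T; move: Aw; rewrite AE => -[_ /andP[h1 h2]].
by apply/andP; split; lra.
Qed.

(** Test point: a point over [X] above all isometric spheres, which is interior to one precell and
    whose translate is interior to the other. *)
Lemma AA_uniq A A' e d e' d' t X : AA A -> AA A' -> tile Gam A e 1 d -> tile Gam A' e' 1 d' ->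
  Gam t -> unip t -> e < X < e + d -> e' < X + tau t < e' + d' -> t = 1%g /\ A = A'.
Proof.
move=> AAA AAA' T T' Gt ut x1 x2; have [H H0 HK] := AA_cover_high.
pose z := X +i* (H + 1) : R[i].
have [Kz _] := HK z ltac:(by rewrite /= ltrDl).
have Hz : HH z by case: Kz.
have [r i] := unip_act ut Hz.
have t1 : t = 1%g.
  apply: (AA_uniq1 AAA AAA' Gt (z := z)).
    by apply: (tile_int fuchG cuspG T Kz); move/andP: x1 => [a b]; apply/andP; split => /=; lra.
  apply: (tile_int fuchG cuspG T'); first exact: (KK_unip fuchG).
  by rewrite r /=; move/andP: x2 => [a b]; apply/andP; split => /=; lra.
split=> //; move: x2; rewrite t1 tau1 addr0 => x2.
have [ee dd] := tile_overlap fuchG cuspG T T' x1 x2.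
by have [_ _ ->] := tile_set T; have [_ _ ->] := tile_set T'; rewrite ee dd.
Qed.

End BasalTiles.

(** * Finiteness of the precells modulo translations *)

Section Connect.
Variable R : realType.
Implicit Types (z w p q : R[i]) (s : R) (F : set R[i]).

Lemma continuous_reim (u v : R -> R) : continuous u -> continuous v ->
  continuous (fun s => u s +i* v s : R[i]).
Proof.
move=> cu cv s U /nbhs_boxP[e e0 bU].
have h1 : \forall t \near s, `|u t - u s| < e.
  by have /cvgr_distC_lt := cu s; apply.
have h2 : \forall t \near s, `|v t - v s| < e.
  by have /cvgr_distC_lt := cv s; apply.
by near=> t; apply: bU => /=; near: t.
Unshelve. all: by end_near. Qed.

(** Connectedness of [0, 1], transported along the segment. *)
Lemma conn_kseg F z w : HH z -> HH w -> open F -> F z ->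
  (forall p, HH p -> kseg z w p -> closure F p -> F p) -> F w.
Proof.
move=> Hz Hw oF Fz H.
pose c s : R[i] := pt ((1 - s) * Re z + s * Re w) ((1 - s) * Wk z + s * Wk w).
have cc : continuous c.
  have lin (a b : R) : continuous (fun s : R => (1 - s) * a + s * b).
    move=> s; apply: cvgD; apply: cvgM; [apply: cvgB|..]; by [exact: cvg_cst|exact: cvg_id].
  apply: continuous_reim; first exact: lin.
  move=> s; apply: (@continuous_comp _ _ _ (fun s => (1 - s) * Wk z + s * Wk w - ((1 - s) * Re z + s * Re w) ^+ 2) Num.sqrt); last exact: sqrt_continuous.
  by apply: cvgB; [exact: lin|rewrite expr2; apply: cvgM; exact: lin].
have W s : 0 <= s <= 1 -> ((1 - s) * Re z + s * Re w) ^+ 2 < (1 - s) * Wk z + s * Wk w.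
  move=> /andP[s0 s1]; have hz := HH_Wk Hz; have hw := HH_Wk Hw.
  have e : (1 - s) * Re z ^+ 2 + s * Re w ^+ 2 - ((1 - s) * Re z + s * Re w) ^+ 2 = s * (1 - s) * (Re z - Re w) ^+ 2 by ring.
  have n : 0 <= s * (1 - s) * (Re z - Re w) ^+ 2 by apply: mulr_ge0; [apply: mulr_ge0; [|rewrite subr_ge0]|exact: sqr_ge0].
  have [s2|s2] := ltP s 1.
    have a1 : (1 - s) * Re z ^+ 2 < (1 - s) * Wk z by rewrite ltr_pM2l// subr_gt0.
    have a2 : s * Re w ^+ 2 <= s * Wk w by rewrite ler_wpM2l// ltW.
    lra.
  have -> : s = 1 by apply/eqP; rewrite eq_le s1.
  by rewrite subrr !mul0r !mul1r !add0r.
have cP s : 0 <= s <= 1 -> HH (c s) /\ kseg z w (c s).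
  move=> s01; have [h1 h2 h3] := ptP (W s s01); split=> //.
  by move/andP: s01 => [? ?]; exists s; split.
have c0 : c 0 = z.
  have [h1 h2 h3] := ptP (W 0 ltac:(by rewrite lexx ler01)).
  by apply: pt_eq => //; rewrite ?h2 ?h3; ring.
have c1 : c 1 = w.
  have [h1 h2 h3] := ptP (W 1 ltac:(by rewrite lexx ler01)).
  by apply: pt_eq => //; rewrite ?h2 ?h3; ring.
have E : `[0, 1]%classic `&` (c @^-1` F) = `[0, 1]%classic :> set R.
  apply: (@segment_connected R 0 1).
  - by exists 0; split; [rewrite /= in_itv /= lexx ler01|rewrite /= c0].
  - exists (c @^-1` F) => //; exact: open_comp.
  - exists (c @^-1` closure F); first by apply: closed_comp => //; exact: closed_closure.
    apply/seteqP; split=> s [s01 h]; split=> //; first exact: subset_closure.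
    by move: s01; rewrite /= in_itv /= => s01; have [h1 h2] := cP s s01; exact: H.
have : (`[0, 1]%classic `&` (c @^-1` F)) 1 by rewrite E /= in_itv /= lexx ler01.
by move=> [_]; rewrite /= c1.
Qed.

(** Affine functions of the Klein coordinates. Every hyperbolic half plane is the positivity set of
    one of them. *)
Definition lf (a b c : R) z : R := a + b * Re z + c * Wk z.

Lemma lf_cont a b c : continuous (lf a b c).
Proof.
move=> z; apply: cvgD; [apply: cvgD; [exact: cvg_cst|]|]; apply: cvgM; try exact: cvg_cst.
  exact: continuous_Re.
exact: continuous_Wk.
Qed.

Lemma lf_conv a b c z w p s : Re p = (1 - s) * Re z + s * Re w ->
  Wk p = (1 - s) * Wk z + s * Wk w -> lf a b c p = (1 - s) * lf a b c z + s * lf a b c w.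
Proof. by rewrite /lf => -> ->; ring. Qed.

(* barycentric coordinates in the projective model *)
Lemma convex_triangle (b : set R[i]) z1 z2 z3 w : hconvex b -> b `<=` @HH R -> b z1 -> b z2 -> b z3 -> HH w ->
  forall l1 l2 l3, 0 < l1 -> 0 < l2 -> 0 < l3 -> l1 + l2 + l3 = 1 ->
  Re w = l1 * Re z1 + l2 * Re z2 + l3 * Re z3 -> Wk w = l1 * Wk z1 + l2 * Wk z2 + l3 * Wk z3 -> b w.
Proof.
move=> cb bH b1 b2 b3 Hw l1 l2 l3 p1 p2 p3 ls rw ww.
have H1 := bH _ b1; have H2 := bH _ b2; have H3 := bH _ b3.
pose s := l3 / (l2 + l3); have p23 : 0 < l2 + l3 by rewrite addr_gt0.
have s0 : 0 < s by rewrite divr_gt0.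
have s1 : s < 1 by rewrite ltr_pdivrMr// mul1r ltrDr.
pose X := (1 - s) * Re z2 + s * Re z3; pose W := (1 - s) * Wk z2 + s * Wk z3.
have XW : X ^+ 2 < W.
  have h2 := HH_Wk H2; have h3 := HH_Wk H3.
  have a1 : (1 - s) * Re z2 ^+ 2 < (1 - s) * Wk z2 by rewrite ltr_pM2l// subr_gt0.
  have a2 : s * Re z3 ^+ 2 < s * Wk z3 by rewrite ltr_pM2l.
  have e : (1 - s) * Re z2 ^+ 2 + s * Re z3 ^+ 2 - X ^+ 2 = s * (1 - s) * (Re z2 - Re z3) ^+ 2 by rewrite /X; ring.
  have n : 0 <= s * (1 - s) * (Re z2 - Re z3) ^+ 2 by apply: mulr_ge0; [apply: mulr_ge0; [exact: ltW|rewrite subr_ge0 ltW]|exact: sqr_ge0].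
  rewrite /W; lra.
have [Hq rq wq] := ptP XW.
have bq : b (pt X W).
  by apply: (cb _ _ b2 b3); apply/gseg_HH => //; split=> //; exists s; split=> //; exact: ltW.
apply: (cb _ _ b1 bq); apply/gseg_HH => //; split=> //; exists (l2 + l3).
have e1 : l1 = 1 - (l2 + l3) by lra.
have E (u v : R) : (l2 + l3) * ((1 - s) * u + s * v) = l2 * u + l3 * v.
  by rewrite /s; field; rewrite gt_eqF.
split; [exact: ltW|by lra| |].
  by rewrite rw rq /X -e1 E addrA.
by rewrite ww wq /W -e1 E addrA.
Qed.

(** Three points of [b] off a common line would span a triangle inside [b]. Its centre is a limit of
    points of [F], so some point of [F] lies in the triangle, hence in the boundary of the open set
    [F], which is absurd. *)
Lemma boundary_line F (b : set R[i]) : open F -> hconvex b -> b `<=` bdH F ->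
  exists x y : R, forall z, b z -> Re z = x \/ Wk z = (x + y) * Re z - x * y.
Proof.
move=> oF cb bF.
have bH : b `<=` @HH R by move=> z /bF[[]].
have [one|] := pselect (forall z w, b z -> b w -> z = w).
  have [[z bz]|ne] := pselect (b !=set0); last by exists 0, 0 => z bz; case: ne; exists z.
  (* For a vertical line the second number is a dummy. *)
  by exists (Re z), 0 => w bw; left; rewrite (one _ _ bz bw).
move=> /existsNP[z1 /existsNP[z2 /not_implyP[b1 /not_implyP[b2 n12]]]].
pose L z w p : R := (Wk w - Wk z) * (Re p - Re z) - (Re w - Re z) * (Wk p - Wk z).
have [col|] := pselect (forall p, b p -> L z1 z2 p = 0); last first.
  move=> /existsNP[z3 /not_implyP[b3 /eqP n3]]; exfalso.
  have LC p : L z1 z2 p + L z2 z3 p + L z3 z1 p = L z1 z2 z3 by rewrite /L; ring.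
  have [H1 H2 H3] : [/\ HH z1, HH z2 & HH z3] by split; exact: bH.
  pose X := (Re z1 + Re z2 + Re z3) / 3; pose W := (Wk z1 + Wk z2 + Wk z3) / 3.
  have XW : X ^+ 2 < W.
    have h1 := HH_Wk H1; have h2 := HH_Wk H2; have h3 := HH_Wk H3.
    have e : (Re z1 ^+ 2 + Re z2 ^+ 2 + Re z3 ^+ 2) / 3 - X ^+ 2 =
      ((Re z1 - Re z2) ^+ 2 + (Re z2 - Re z3) ^+ 2 + (Re z3 - Re z1) ^+ 2) / 9 by rewrite /X; field.
    have n : 0 <= ((Re z1 - Re z2) ^+ 2 + (Re z2 - Re z3) ^+ 2 + (Re z3 - Re z1) ^+ 2) / 9.
      by rewrite divr_ge0 ?ler0n// !addr_ge0 ?sqr_ge0.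
    rewrite /W; lra.
  have [Hc rc wc] := ptP XW; set c := pt X W in Hc rc wc.
  have third : 0 < (3^-1 : R) by rewrite invr_gt0.
  have bc : b c.
    apply: (convex_triangle cb bH b1 b2 b3 Hc third third third); first by field.
      by rewrite rc /X; field.
    by rewrite wc /W; field.
  have coef (z w : R[i]) p : L z w p / L z1 z2 z3 =
      lf ((- (Wk w - Wk z) * Re z + (Re w - Re z) * Wk z) / L z1 z2 z3) ((Wk w - Wk z) / L z1 z2 z3) (- (Re w - Re z) / L z1 z2 z3) p.
    by rewrite /lf {1}/L; field.
  have pos z w : L z w c / L z1 z2 z3 = 3^-1 -> nbhs c [set p | 0 < L z w p / L z1 z2 z3].
    move=> e; have /cvgr_gt := @lf_cont ((- (Wk w - Wk z) * Re z + (Re w - Re z) * Wk z) / L z1 z2 z3) ((Wk w - Wk z) / L z1 z2 z3) (- (Re w - Re z) / L z1 z2 z3) c.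
    move=> /(_ 0); rewrite -coef e => /(_ third); apply: filterS => p /=; by rewrite -coef.
  have [[cF _] ncF] := bF _ bc.
  have n1 : nbhs c [set p | 0 < L z1 z2 p / L z1 z2 z3].
    by apply: pos; rewrite /L rc wc /X /W -/(L z1 z2 z3); move: n3; rewrite /L => n3; field.
  have n2 : nbhs c [set p | 0 < L z2 z3 p / L z1 z2 z3].
    by apply: pos; rewrite /L rc wc /X /W -/(L z1 z2 z3); move: n3; rewrite /L => n3; field.
  have n3' : nbhs c [set p | 0 < L z3 z1 p / L z1 z2 z3].
    by apply: pos; rewrite /L rc wc /X /W -/(L z1 z2 z3); move: n3; rewrite /L => n3; field.
  have nH : nbhs c (@HH R) by apply: open_nbhs_nbhs; split=> //; exact: open_HH.
  have [f [Ff [[[f1 f2] f3] fH]]] := cF _ (filterI (filterI (filterI n1 n2) n3') nH).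
  have bf : b f.
    apply: (convex_triangle cb bH b1 b2 b3 fH f2 f3 f1).
    - by rewrite -!mulrDl -(LC f) addrC addrA divff// LC.
    - by rewrite /L; move: n3; rewrite /L => n3; field.
    - by rewrite /L; move: n3; rewrite /L => n3; field.
  by have [_] := bF _ bf; apply; rewrite (proj1 (interior_id F) oF).
have [H1 H2] : HH z1 /\ HH z2 by split; exact: bH.
have [r12|r12] := eqVneq (Re z1) (Re z2).
  exists (Re z1), 0 => z bz; left; have := col z bz; rewrite /L -r12 subrr mul0r subr0 => /eqP.
  rewrite mulf_eq0 !subr_eq0 => /orP[/eqP w12|/eqP//].
  by case: n12; apply: pt_eq.
have r21 : Re z2 - Re z1 != 0 by rewrite subr_eq0 eq_sym.
pose S := (Wk z2 - Wk z1) / (Re z2 - Re z1); pose P := S * Re z1 - Wk z1.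
have WS z : b z -> Wk z = S * Re z - P.
  move=> /col; rewrite /L /P /S => h; apply: (mulfI r21).
  apply/eqP; rewrite -subr_eq0; apply/eqP; rewrite -[RHS]oppr0 -h; field.
  exact: r21.
pose d := S ^+ 2 - 4 * P.
have d0 : 0 <= d.
  have := HH_Wk H1; rewrite (WS _ b1) => h; have := sqr_ge0 (2 * Re z1 - S); rewrite /d; lra.
exists ((S + Num.sqrt d) / 2), ((S - Num.sqrt d) / 2) => z bz; right.
have -> : (S + Num.sqrt d) / 2 + (S - Num.sqrt d) / 2 = S by field.
rewrite (_ : (S + Num.sqrt d) / 2 * ((S - Num.sqrt d) / 2) = (S ^+ 2 - Num.sqrt d ^+ 2) / 4); last by field.
by rewrite sqr_sqrtr// (WS _ bz) /d; field.
Qed.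

Lemma boundary_side F p : bdH F p -> exists2 b, sides F b & b p.
Proof.
move=> Fp; have [[_ Hp] _] := Fp.
pose P : set (set R[i]) := [set b | [/\ hconvex b, b `<=` bdH F & b = set0 \/ b p]].
have [|b [[cb bF bp] mx]] := @Zorn_bigcup _ P.
  move=> C CP tot; split.
  - move=> z w [B1 CB1 Bz] [B2 CB2 Bw] q zwq.
    have [h|h] := tot _ _ CB1 CB2.
      by exists B2 => //; have [c2 _ _] := CP _ CB2; apply: (c2 _ _ (h _ Bz) Bw).
    by exists B1 => //; have [c2 _ _] := CP _ CB1; apply: (c2 _ _ Bz (h _ Bw)).
  - by move=> z [B CB Bz]; have [_ h _] := CP _ CB; exact: h.
  - have [[B [CB Bp]]|n] := pselect (exists B, C B /\ B p); first by right; exists B.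
    left; apply/seteqP; split=> // z [B CB Bz]; have [_ _ [B0|Bp]] := CP _ CB.
      by rewrite B0 in Bz.
    by case: n; exists B.
have Pp : P [set p].
  split; [|by move=> _ ->|by right].
  move=> z w -> -> q /(gseg_HH q Hp Hp)[Hq [s [s0 s1 r W]]].
  by apply: pt_eq => //; rewrite ?r ?W; ring.
have bp' : b p.
  case: bp => // b0; case: (mx [set p]) => //; rewrite b0; split=> //.
  by move=> /(_ p erefl).
exists b => //; split=> //; first by exists p.
move=> b' cb' b'F bb'; apply: contrapT => ne; apply: (mx b'); last first.
  by split=> //; right; exact: bb'.
split=> // h; apply: ne; exact/seteqP.
Qed.

Lemma finite_choice (T : Type) (U : choiceType) (A : set T) (P : T -> U -> Prop) :
  finite_set A -> (forall a, A a -> exists u, P a u) -> exists s : seq U, forall a, A a ->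
  exists2 u, u \in s & P a u.
Proof.
move=> fA H; have [[a0 A0]|n] := pselect (A !=set0); last by exists [::] => a Aa; case: n; exists a.
have [u0 _] := H _ A0.
pose f a := xget u0 [set u | P a u].
have /finite_seqP[s sE] : finite_set (f @` A) by exact: finite_image.
exists s => a Aa; exists (f a); last by apply: (xgetPex u0 (H a Aa)).
have : (f @` A) (f a) by exists a.
by rewrite sE.
Qed.

Lemma boundary_seq F : open F -> finite_set (sides F) -> exists s : seq R,
  [/\ 0 \in s, 1 \in s & forall z, bdH F z -> exists x y, [/\ x \in s, y \in s &
    Re z = x \/ Wk z = (x + y) * Re z - x * y]].
Proof.
move=> oF fF; have [|l lP] := finite_choice (U := (R * R)%type)
  (P := fun b u => forall z, b z -> Re z = u.1 \/ Wk z = (u.1 + u.2) * Re z - u.1 * u.2) fF.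
  by move=> b [_ cb bF _]; have [x [y h]] := boundary_line oF cb bF; exists (x, y).
(* Adding 0 and 1 guarantees two distinct entries, between which a point over the largest entry
   still finds a triangle. *)
exists (0 :: 1 :: [seq u.1 | u <- l] ++ [seq u.2 | u <- l]); split; rewrite ?inE ?eqxx ?orbT//.
move=> z /boundary_side[b sb bz]; have [[x y] ul /(_ z bz) /= h] := lP _ sb.
exists x, y; split=> //; rewrite !inE mem_cat.
  by apply/orP; right; apply/orP; right; apply/orP; left; apply/mapP; exists (x, y).
by apply/orP; right; apply/orP; right; apply/orP; right; apply/mapP; exists (x, y).
Qed.

Lemma seq_max_le (s : seq R) (P : pred R) : has P s -> exists2 m, (m \in s) && P m & forall y, y \in s -> P y -> y <= m.
Proof.
move=> /hasP[x xs Px]; have xf : - x \in [seq - y | y <- s & P y].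
  by apply/mapP; exists x => //; rewrite mem_filter Px.
have [m /mapP[m' ] mf -> mm] := seq_min xf; exists m'; first by move: mf; rewrite mem_filter andbC.
move=> y ys Py; rewrite -lerN2; apply: mm; apply/mapP; exists y => //; by rewrite mem_filter Py.
Qed.

Lemma seq_min_ge (s : seq R) (P : pred R) : has P s -> exists2 m, (m \in s) && P m & forall y, y \in s -> P y -> m <= y.
Proof.
move=> /hasP[x xs Px]; have xf : x \in [seq y <- s | P y] by rewrite mem_filter Px.
have [m mf mm] := seq_min xf; exists m; first by move: mf; rewrite mem_filter andbC.
by move=> y ys Py; apply: mm; rewrite mem_filter Py.
Qed.

Lemma halfplane_sub F a b c : open F -> (forall z, HH z -> 0 < lf a b c z -> ~ bdH F z) ->
  forall z, clH F z -> 0 < lf a b c z -> forall w, HH w -> 0 < lf a b c w -> F w.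
Proof.
move=> oF nb z [cz Hz] lz w Hw lw.
have ins p : HH p -> 0 < lf a b c p -> closure F p -> F p.
  move=> Hp lp cp; apply: contrapT => nF; apply: (nb p) => //; split=> //.
  by rewrite (proj1 (interior_id F) oF).
apply: (conn_kseg Hz Hw oF (ins z Hz lz cz)) => p Hp [s [s0 s1 r W]]; apply: ins => //.
rewrite (lf_conv _ _ _ r W); have [s2|s2] := ltP s 1.
  by rewrite ltr_pwDl// ?mulr_gt0 ?subr_gt0// mulr_ge0// ltW.
have -> : s = 1 by apply/eqP; rewrite eq_le s1.
by rewrite subrr mul0r mul1r add0r.
Qed.

(** The list [s] contains all finite ideal endpoints of the lines carrying sides. Beyond the extreme
    entries, or below the geodesic joining two consecutive entries, there is a half plane free of
    boundary points; what remains lies above such a geodesic, in an ideal triangle with vertex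
    infinity. *)
Lemma flare_or_triangle F : open F -> finite_set (sides F) -> exists s : seq R, forall z, clH F z ->
  (exists a b c, 0 < lf a b c z /\ forall w, HH w -> 0 < lf a b c w -> F w) \/
  exists x y, [/\ x \in s, y \in s, x < y & x <= Re z <= y /\ (x + y) * Re z - x * y <= Wk z].
Proof.
move=> oF fF; have [s [s0 s1 sP]] := boundary_seq oF fF; exists s => z Fz; have [_ Hz] := Fz.
have range x y w : HH w -> Wk w = (x + y) * Re w - x * y -> (x < Re w /\ Re w < y) \/ (y < Re w /\ Re w < x).
  move=> /HH_Wk + e; rewrite e => h; have : 0 < (Re w - x) * (y - Re w) by lra.
  have [h1|h1|<-] := ltgtP x (Re w); last by rewrite subrr mul0r ltxx.
    by rewrite pmulr_rgt0 ?subr_gt0// => h2; left.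
  by rewrite nmulr_rgt0 ?subr_lt0// => h2; right.
have hp a b c : 0 < lf a b c z -> (forall w, HH w -> 0 < lf a b c w -> ~ bdH F w) ->
  (exists a b c, 0 < lf a b c z /\ forall w, HH w -> 0 < lf a b c w -> F w) \/
  exists x y, [/\ x \in s, y \in s, x < y & x <= Re z <= y /\ (x + y) * Re z - x * y <= Wk z].
  by move=> lz nb; left; exists a, b, c; split=> // w Hw lw; exact: (halfplane_sub oF nb Fz lz).
have triv x y : x \in s -> y \in s -> x < y -> Re z = x \/ Re z = y ->
  exists x y, [/\ x \in s, y \in s, x < y & x <= Re z <= y /\ (x + y) * Re z - x * y <= Wk z].
  move=> xs ys xy h; exists x, y; split=> //; have hz := HH_Wk Hz; split.
    by case: h => ->; rewrite lexx ltW.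
  by case: h => h; rewrite h in hz *; lra.
have [lo|lo] := boolP (has (fun x => x <= Re z) s); last first.
  have {}lo x : x \in s -> Re z < x by move=> xs; rewrite ltNge; apply: contra lo => h; apply/hasP; exists x.
  have [m ms mm] := seq_min s0.
  apply: (hp m (-1) 0); first by rewrite /lf; have := lo m ms; lra.
  move=> w Hw; rewrite /lf => lw /sP[x [y [xs ys h]]]; have mx := mm x xs; have my := mm y ys.
  by case: h => [h|/(range _ _ _ Hw)[[h1 h2]|[h1 h2]]]; lra.
have [q /andP[qs qz] qm] := seq_max_le lo.
have [hi|hi] := boolP (has (fun x => Re z < x) s); last first.
  have {}hi x : x \in s -> x <= Re z by move=> xs; rewrite leNgt; apply: contra hi => h; apply/hasP; exists x.
  have [qz'|qz'] := ltP q (Re z).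
    apply: (hp (- q) 1 0); first by rewrite /lf; lra.
    move=> w Hw; rewrite /lf => lw /sP[x [y [xs ys h]]]; have mx := qm x xs (hi x xs); have my := qm y ys (hi y ys).
    by case: h => [h|/(range _ _ _ Hw)[[h1 h2]|[h1 h2]]]; lra.
  right; have zq : Re z = q by apply/eqP; rewrite eq_le qz'.
  have [r rs rq] : exists2 r, r \in s & r < q.
    have [h|h] := ltP 0 q; first by exists 0.
    by have := qm 1 s1 (hi 1 s1); lra.
  by apply: (triv r q) => //; right.
have [r /andP[rs zr] rm] := seq_min_ge hi.
have [h|h] := leP ((q + r) * Re z - q * r) (Wk z).
  by right; exists q, r; split=> //; [lra|split=> //; rewrite qz ltW].
apply: (hp (- (q * r)) (q + r) (-1)); first by rewrite /lf; lra.
move=> w Hw; rewrite /lf => lw /sP[x [y [xs ys hw]]].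
have hq x' : x' \in s -> x' <= q \/ r <= x'.
  by move=> xs'; have [h'|h'] := leP x' (Re z); [left; exact: qm|right; exact: rm].
have qr : q < r by lra.
have wW := HH_Wk Hw; have : 0 < (Re w - q) * (r - Re w) by lra.
have [h1|h1|h1] := ltgtP q (Re w); last by rewrite h1 subrr mul0r ltxx.
  rewrite pmulr_rgt0 ?subr_gt0// => h2.
  have key x' y' : x' \in s -> y' \in s -> x' < Re w -> Re w < y' -> Wk w = (x' + y') * Re w - x' * y' -> False.
    move=> xs' ys' a1 a2 e.
    have x'q : x' <= q by case: (hq x' xs') => //; lra.
    have y'r : r <= y' by case: (hq y' ys') => //; lra.
    have : (Re w - q) * (r - Re w) <= (Re w - x') * (y' - Re w) by apply: ler_pM; lra.
    lra.
  case: hw => [hw|e]; first by case: (hq x xs); lra.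
  case: (range _ _ _ Hw e) => -[a1 a2]; first exact: (key x y).
  by apply: (key y x) => //; rewrite e; ring.
rewrite nmulr_rgt0 ?subr_lt0// => h2; lra.
Qed.

End Connect.

(** * Half planes contained in a fundamental region *)

Section Flares.
Variables (R : realType) (Gam : set (PSL2 R)).
Hypothesis fuchG : fuchsian Gam.
Hypothesis cuspG : inf_cuspidal Gam.
Variable F : set R[i].
Hypothesis FH : F `<=` @HH R.
Hypothesis dF : forall g h, Gam g -> Gam h -> g <> h -> (act g @` F) `&` (act h @` F) = set0.
Implicit Types (g h : PSL2 R) (z w : R[i]) (e a b c : R).

Lemma fund_uniq g z : Gam g -> F z -> F (act g z) -> g = 1%g.
Proof.
move=> Gg Fz Fgz; apply: contrapT => g1; have Hz := FH Fz.
have : ((act 1%g @` F) `&` (act g^-1%g @` F)) z.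
  split; first by exists z; rewrite ?act1.
  by exists (act g z); rewrite ?actK.
rewrite dF//; [exact: (Gam1 fuchG)|exact: (GamV fuchG)|].
by move=> e; apply: g1; rewrite -[g]invgK -e invg1.
Qed.

Lemma lf_act g z a b c : HH z -> lf a b c (act g z) * Nm g z =
  lf (a * cd g ^+ 2 + b * (cb g * cd g) + c * cb g ^+ 2)
     (2 * a * (cc g * cd g) + b * (ca g * cd g + cb g * cc g) + 2 * c * (ca g * cb g))
     (a * cc g ^+ 2 + b * (ca g * cc g) + c * ca g ^+ 2) z.
Proof.
move=> Hz; have n0 := lt0r_neq0 (Nm_gt0 g Hz).
rewrite /lf Wk_act// Re_actW//; set P := (X in b * (X / _)); set Q := (X in c * (X / _)).
have -> : (a + b * (P / Nm g z) + c * (Q / Nm g z)) * Nm g z = a * Nm g z + b * P + c * Q by field.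
by rewrite NmE /P /Q; ring.
Qed.

(** The expression is the coefficient of $|z|^2$ in the half plane pulled back by [g]. If it were
    positive, the pulled-back half plane would contain, high up, two points that differ by the
    translation [T]. *)
Lemma flare_end a b c g : (forall w, HH w -> 0 < lf a b c w -> F w) -> Gam g ->
  a * cc g ^+ 2 + b * (ca g * cc g) + c * ca g ^+ 2 <= 0.
Proof.
move=> PF Gg; rewrite leNgt; apply/negP => c0.
have [T GT [uT t0]] := transl_pos fuchG cuspG.
set c' := _ + _ in c0.
set a' := a * cd g ^+ 2 + b * (cb g * cd g) + c * cb g ^+ 2.
set b' := 2 * a * (cc g * cd g) + b * (ca g * cd g + cb g * cc g) + 2 * c * (ca g * cb g).
pose M := (`|a'| + `|b' * tau T|) / c' + 1.
have m0 : 0 <= (`|a'| + `|b' * tau T|) / c' by apply: divr_ge0; [exact: addr_ge0|exact: ltW].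
have M0 : 0 < M by exact: ltr_wpDl.
have sM : M <= M ^+ 2 by rewrite expr2 ler_peMl ?(ltW M0)// lerDr.
have cM : `|a'| + `|b' * tau T| < c' * M.
  by rewrite /M mulrDr mulr1 [c' * _]mulrC divfK ?gt_eqF// ltrDl.
have pos x : x = 0 \/ x = tau T -> 0 < lf a' b' c' (x +i* M).
  move=> xx; rewrite /lf /Wk /=.
  have h1 : - `|a'| <= a' by have := ler_norm (- a'); rewrite normrN; lra.
  have h2 : - `|b' * tau T| <= b' * x.
    case: xx => ->; first by rewrite mulr0 oppr_le0.
    by have := ler_norm (- (b' * tau T)); rewrite normrN; lra.
  have h3 : c' * M <= c' * (x ^+ 2 + M ^+ 2).
    by rewrite ler_pM2l//; have := sqr_ge0 x; lra.
  lra.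
have inF x : x = 0 \/ x = tau T -> F (act g (x +i* M)).
  move=> /pos p; have Hx : HH (x +i* M) by [].
  apply: PF; first exact: HH_act.
  by rewrite -(pmulr_lgt0 _ (Nm_gt0 g Hx)) lf_act.
have Hz : HH (0 +i* M : R[i]) by [].
have [r i] := unip_act uT Hz.
have Tz : act T (0 +i* M) = tau T +i* M by apply: complexP; rewrite ?r ?i //= add0r.
have e1 : (g * T * g^-1)%g = 1%g.
  apply: (fund_uniq (z := act g (0 +i* M))).
  - by apply: (GamM fuchG); [exact: (GamM fuchG)|exact: (GamV fuchG)].
  - by apply: inF; left.
  - rewrite actM; last exact: HH_act.
    by rewrite actK// actM// Tz; apply: inF; right.
have T1 : T = 1%g.
  have : (g^-1 * (g * T * g^-1) * g)%g = (g^-1 * 1 * g)%g by rewrite e1.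
  by rewrite mulg1 mulVg -!mulgA mulVg mulg1 mulKg.
by move: t0; rewrite T1 tau1 ltxx.
Qed.

(** The centre of the sphere of [h] is $h^{-1}.\infty$, again a cusp, so [flare_end] for $gh^{-1}$
    gives the sign of the pulled-back affine function there. *)
Lemma flare_cusp a b c g h : (forall w, HH w -> 0 < lf a b c w -> F w) -> Gam g -> Gam h -> cc h != 0 ->
  (a * cd g ^+ 2 + b * (cb g * cd g) + c * cb g ^+ 2) +
  (2 * a * (cc g * cd g) + b * (ca g * cd g + cb g * cc g) + 2 * c * (ca g * cb g)) * ctr h +
  (a * cc g ^+ 2 + b * (ca g * cc g) + c * ca g ^+ 2) * ctr h ^+ 2 <= 0.
Proof.
move=> PF Gg Gh c0; have := flare_end PF (GamM fuchG Gg (GamV fuchG Gh)).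
have [e [e1 ma _ mc _]] := pslM_coef g h^-1%g; have [f [f1 va _ vc _]] := pslV_coef h.
rewrite ma mc va vc; set V := (X in X <= 0 -> _); set W := (X in _ -> X <= 0).
have -> : V = e ^+ 2 * f ^+ 2 * cc h ^+ 2 * W by rewrite /V /W /ctr; field.
by rewrite e1 f1 !mul1r pmulr_rle0// exprn_even_gt0.
Qed.

(** The pulled-back affine function is nonpositive at three ideal points: the two centres and
    infinity. It is therefore nonpositive on the ideal triangle they span, and the zone lies in this
    triangle. *)
Lemma zone_flare a b c g h1 h2 z : (forall w, HH w -> 0 < lf a b c w -> F w) -> Gam g ->
  Gam h1 -> Gam h2 -> cc h1 != 0 -> cc h2 != 0 -> zone (ctr h1) (ctr h2) z -> lf a b c (act g z) <= 0.
Proof.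
move=> PF Gg G1 G2 c1 c2 [Hz z1 z2 z3].
rewrite -(pmulr_lle0 _ (Nm_gt0 g Hz)) lf_act//.
have F0 := flare_end PF Gg; have F1 := flare_cusp PF Gg G1 c1; have F2 := flare_cusp PF Gg G2 c2.
move: F0 F1 F2; set a' := a * cd g ^+ 2 + _ + _; set b' := 2 * a * _ + _ + _; set c' := a * cc g ^+ 2 + _ + _.
move: (ctr h1) (ctr h2) z1 z2 z3 => e1 e2 z1 z2 z3 F0 F1 F2.
have e12 : 0 < e2 - e1 by lra.
rewrite -(pmulr_rle0 _ e12).
have -> : (e2 - e1) * lf a' b' c' z = (e2 - Re z) * (a' + b' * e1 + c' * e1 ^+ 2) +
  (Re z - e1) * (a' + b' * e2 + c' * e2 ^+ 2) + (e2 - e1) * (c' * (Im z ^+ 2 - (Re z - e1) * (e2 - Re z))).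
  by rewrite /lf /Wk; ring.
have n1 : (e2 - Re z) * (a' + b' * e1 + c' * e1 ^+ 2) <= 0 by rewrite mulr_ge0_le0// subr_ge0 ltW.
have n2 : (Re z - e1) * (a' + b' * e2 + c' * e2 ^+ 2) <= 0 by rewrite mulr_ge0_le0// subr_ge0 ltW.
have n3 : (e2 - e1) * (c' * (Im z ^+ 2 - (Re z - e1) * (e2 - Re z))) <= 0.
  rewrite mulr_ge0_le0 ?(ltW e12)// mulr_le0_ge0// subr_ge0.
  have : (Re z - e1) * (e2 - Re z) <= (e2 - e1) * (e2 - e1) by apply: ler_pM; lra.
  have : (3 / 2 * (e2 - e1)) * (3 / 2 * (e2 - e1)) <= Im z * Im z by apply: ler_pM; lra.
  have : 0 <= (e2 - e1) ^+ 2 by exact: sqr_ge0.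
  rewrite !expr2; lra.
lra.
Qed.

End Flares.

(** * Covering ideal triangles by balls *)

Section Cover.
Variable R : realType.
Implicit Types (z w p q : R[i]) (x y s : R) (F : set R[i]) (g h k : PSL2 R).

(* 2 cosh d(z, w) - 2 *)
Definition uu z w : R := ((Re z - Re w) ^+ 2 + (Im z - Im w) ^+ 2) / (Im z * Im w).

Lemma uuE z w : HH z -> HH w -> uu z w = Qf z w / (Im z * Im w) - 2.
Proof.
move=> Hz Hw; rewrite /uu /Qf /Wk; field.
by rewrite (gt_eqF (Hz : 0 < Im z)) (gt_eqF (Hw : 0 < Im w)).
Qed.

Lemma uu_act g z w : HH z -> HH w -> uu (act g z) (act g w) = uu z w.
Proof.
move=> Hz Hw; have N1 := Nm_gt0 g Hz; have N2 := Nm_gt0 g Hw.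
rewrite !uuE//; try exact: HH_act.
rewrite Qf_act// !Im_act//; field.
by rewrite (gt_eqF (Hz : 0 < Im z)) (gt_eqF (Hw : 0 < Im w)) !gt_eqF.
Qed.

(** A mesh of 1/100. At height b/100 a point at most 1/100 away in both coordinates, and not lower,
    satisfies [uu] at most $2\cdot 100^{-2}/(b/100)^2 = 2/b^2$, which is [cradius b]. *)
Definition ball_ctr (b : nat) : R[i] := 0 +i* (b%:R / 100).
Definition cradius (b : nat) : R := 2 / b%:R ^+ 2.

Lemma HH_ball_ctr b : (0 < b)%N -> HH (ball_ctr b).
Proof. by move=> b0; rewrite /HH /= divr_gt0 ?ltr0n. Qed.

Lemma transl_ex x : exists k, forall z, HH z -> Re (act k z) = x + Re z /\ Im (act k z) = Im z.
Proof.
have [|k [e [e1 a b c d]]] := @mk_ex R 1 x 0 1; first by rewrite mulr1 mulr0 subr0.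
have ee : e * e = 1 by rewrite -expr2.
rewrite mulr1 in a d; rewrite mulr0 in c.
have N z : Nm k z = 1 by rewrite /Nm c d !mul0r add0r expr0n /= addr0 e1.
exists k => z Hz; rewrite Re_act// Im_act// N !divr1 a b c d; split=> //.
by transitivity (e * e * (x + Re z)); [ring|rewrite ee mul1r].
Qed.

Lemma scale_ex x s : 0 < s -> exists k, forall z, HH z ->
  Re (act k z) = x + s * Re z /\ Im (act k z) = s * Im z.
Proof.
move=> s0; pose r := Num.sqrt s; have r0 : 0 < r by rewrite sqrtr_gt0.
have r2 : r ^+ 2 = s by rewrite sqr_sqrtr// ltW.
have [|k [e [e1 a b c d]]] := @mk_ex R r (x / r) 0 (r^-1).
  by rewrite mulr0 subr0 divff ?gt_eqF.
have e0 := sign_neq0 e1; rewrite mulr0 in c.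
have N z : Nm k z = s^-1.
  by rewrite /Nm c d !mul0r add0r expr0n /= addr0 exprMn e1 mul1r exprVn r2.
exists k => z Hz; rewrite Re_act// Im_act// N invrK mulrC; split=> //; last by rewrite mulrC.
rewrite a b c d !mul0r mulr0 mul0r addr0 add0r.
rewrite (_ : (e * r * Re z + e * (x / r)) * (e / r) = e ^+ 2 * (Re z + x / r ^+ 2)); last by field; rewrite gt_eqF.
by rewrite e1 mul1r r2; field; rewrite gt_eqF.
Qed.

(** The rotations $1 - 1/z$ and $1/(1-z)$ of the ideal triangle with vertices 0, 1 and infinity;
    they send 0 and 1, respectively, to infinity. *)
Lemma rot_ex : exists k0 k1 : PSL2 R, forall z, HH z ->
  [/\ Re (act k0 z) = 1 - Re z / Wk z, Im (act k0 z) = Im z / Wk z,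
  Re (act k1 z) = (1 - Re z) / ((1 - Re z) ^+ 2 + Im z ^+ 2) &
  Im (act k1 z) = Im z / ((1 - Re z) ^+ 2 + Im z ^+ 2)].
Proof.
have [|k [e [e1 a b c d]]] := @mk_ex R 1 (-1) 1 0; first by ring.
have [|k' [e' [e1' a' b' c' d']]] := @mk_ex R 0 1 (-1) 1; first by ring.
exists k, k' => z Hz; have w0 : 0 < Wk z by apply: le_lt_trans (HH_Wk Hz); exact: sqr_ge0.
have Nk : Nm k z = Wk z.
  by rewrite /Nm c d !mulr1 mulr0 addr0 !exprMn e1 !mul1r.
have Nk' : Nm k' z = (1 - Re z) ^+ 2 + Im z ^+ 2.
  by rewrite /Nm c' d'; transitivity (e' ^+ 2 * ((1 - Re z) ^+ 2 + Im z ^+ 2)); [ring|rewrite e1' mul1r].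
rewrite !Re_act// !Im_act// Nk Nk' a b c d a' b' c' d'; split=> //.
  transitivity (e ^+ 2 * (Wk z - Re z) / Wk z); first by congr (_ / _); rewrite /Wk; ring.
  by rewrite e1 mul1r mulrBl divff ?gt_eqF.
by congr (_ / _); transitivity (e' ^+ 2 * (1 - Re z)); [ring|rewrite e1' mul1r].
Qed.

Lemma uu_le z w (b : nat) : (0 < b)%N -> HH z -> HH w -> Im z = b%:R / 100 -> Im z <= Im w ->
  `|Re z - Re w| <= 1 / 100 -> `|Im z - Im w| <= 1 / 100 -> uu z w <= cradius b.
Proof.
move=> b0 Hz Hw iz zw h1 h2; have bR : 0 < b%:R :> R by rewrite ltr0n.
have d0 : 0 < Im z * Im w by apply: mulr_gt0.
rewrite /uu (ler_pdivrMr _ _ d0); apply: (@le_trans _ _ (2 / 100 ^+ 2)).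
  have sq (u : R) : `|u| <= 1 / 100 -> u ^+ 2 <= (1 / 100) ^+ 2.
    by move=> hu; rewrite -[u ^+ 2]real_normK ?num_real// ler_sqr ?nnegrE.
  have := sq _ h1; have := sq _ h2; lra.
apply: (@le_trans _ _ (cradius b * (Im z * Im z))).
  suff -> : cradius b * (Im z * Im z) = 2 / 100 ^+ 2 by [].
  by rewrite iz /cradius; field; rewrite gt_eqF.
rewrite ler_pM2l; first by rewrite ler_pM2l.
by rewrite /cradius divr_gt0// exprn_gt0.
Qed.

Lemma strip_cover : exists L : seq (PSL2 R), forall z, HH z -> 0 <= Re z <= 1 -> 1 / 2 <= Im z ->
  exists k b, [/\ k \in L, (50 <= b)%N & uu (act k (ball_ctr b)) z <= cradius b].
Proof.
have [tr trP] := choice (fun a : nat => transl_ex (a%:R / 100)).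
(* The 101 translations are by 0, 1/100, ..., 1; height at least 1/2 means ball number at least
   50. *)
exists [seq tr a | a <- iota 0 101] => z Hz /andP[x0 x1] y0.
have a0 : 0 <= 100 * Re z by rewrite mulr_ge0.
have b0 : 0 <= 100 * Im z by rewrite mulr_ge0// ltW.
have /andP[a1 a2] := truncn_itv a0; have /andP[b1 b2] := truncn_itv b0.
set a := Num.truncn _ in a1 a2; set b := Num.truncn _ in b1 b2.
rewrite -natr1 in a2; rewrite -natr1 in b2.
have b50 : (50 <= b)%N.
  by rewrite -ltnS -(ltr_nat R) -natr1; lra.
exists (tr a), b; split=> //.
  apply/mapP; exists a => //; rewrite mem_iota /= add0n ltnS -(ler_nat R); lra.
have bp : (0 < b)%N by apply: leq_trans b50.
have Hb := HH_ball_ctr bp; have [r i] := trP a _ Hb.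
apply: uu_le => //; first exact: HH_act.
- by rewrite i /=; lra.
- by rewrite r /= addr0 ler_norml; apply/andP; split; lra.
- by rewrite i /= ler_norml; apply/andP; split; lra.
Qed.

(** The triangle with vertices 0, 1 and infinity is the union of its part of height at least 1/2 and
    the two preimages of this part under the rotations; [A] maps it to the given triangle. *)
Lemma triangle_cover x y : x < y -> exists L : seq (PSL2 R), forall z, HH z -> x <= Re z <= y ->
  (x + y) * Re z - x * y <= Wk z ->
  exists k b, [/\ k \in L, (50 <= b)%N & uu (act k (ball_ctr b)) z <= cradius b].
Proof.
move=> xy; have [L LP] := strip_cover; have [k0 [k1 rP]] := rot_ex.
have yx : 0 < y - x by rewrite subr_gt0.
have [A AP] := scale_ex x yx.
exists ([seq (A * k)%g | k <- L] ++ [seq (A * k0^-1 * k)%g | k <- L] ++ [seq (A * k1^-1 * k)%g | k <- L]).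
move=> z Hz /andP[zx zy] zW; pose z0 := act A^-1%g z; have H0 : HH z0 by exact: HH_act.
have [zr zi] := AP _ H0; rewrite actKV// in zr zi.
have fin_ (u : PSL2 R) : 0 <= Re (act u z0) <= 1 -> 1 / 2 <= Im (act u z0) ->
    exists k b, [/\ k \in L, (50 <= b)%N & uu (act (A * u^-1 * k)%g (ball_ctr b)) z <= cradius b].
  move=> h1 h2; have [k [b [kL b50 hu]]] := LP _ (HH_act u H0) h1 h2.
  exists k, b; split=> //; have Hb := HH_ball_ctr (leq_trans (isT : 0 < 50)%N b50).
  have Hk := HH_act k Hb; have Huk := HH_act u^-1%g Hk.
  rewrite !actM//; rewrite -[X in uu _ X <= _](actKV A Hz) uu_act// -/z0.
  by rewrite -[X in uu _ X <= _](actK u H0) uu_act//; exact: HH_act.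
have X0 : 0 <= Re z0 by rewrite -(pmulr_rge0 _ yx); lra.
have X1 : Re z0 <= 1 by rewrite -(ler_pM2l yx); lra.
have W0 : Re z0 <= Wk z0.
  have y2 : 0 < (y - x) ^+ 2 by rewrite exprn_gt0.
  have : 0 <= (y - x) ^+ 2 * (Wk z0 - Re z0).
    rewrite (_ : _ * _ = (x + (y - x) * Re z0) ^+ 2 + ((y - x) * Im z0) ^+ 2 - ((x + y) * (x + (y - x) * Re z0) - x * y)); last by rewrite /Wk; ring.
    by rewrite -zr -zi subr_ge0.
  by rewrite pmulr_rge0// subr_ge0.
have [y2|y2] := leP (1 / 2) (Im z0).
  have [||k [b [kL b50 hu]]] := fin_ 1%g; [by rewrite act1// X0|by rewrite act1|].
  exists (A * k)%g, b; split=> //; first by rewrite mem_cat; apply/orP; left; apply: map_f.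
  by move: hu; rewrite invg1 mulg1.
have [Wi [i1 i2 i3 i4]] : 0 < Wk z0 /\ [/\ Re (act k0 z0) = 1 - Re z0 / Wk z0, Im (act k0 z0) = Im z0 / Wk z0,
  Re (act k1 z0) = (1 - Re z0) / ((1 - Re z0) ^+ 2 + Im z0 ^+ 2) &
  Im (act k1 z0) = Im z0 / ((1 - Re z0) ^+ 2 + Im z0 ^+ 2)].
  by split; [apply: le_lt_trans (HH_Wk H0); exact: sqr_ge0|exact: rP].
have Yp : 0 < Im z0 by [].
have small (u : R) : 0 <= u -> u <= 1 / 2 -> u * (1 - u) <= Im z0 ^+ 2 -> u ^+ 2 + Im z0 ^+ 2 <= 2 * Im z0.
  move=> u0 u1 u2; have h1 : u * (1 / 2) <= u * (1 - u) by rewrite ler_wpM2l//; lra.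
  have h2 : Im z0 * Im z0 <= Im z0 * (1 / 2) by rewrite ler_pM2l// ltW.
  have h3 : u * u <= 1 / 2 * u by rewrite ler_wpM2r.
  rewrite !expr2 in u2 *; lra.
have W1 : Re z0 * (1 - Re z0) <= Im z0 ^+ 2 by move: W0; rewrite /Wk; lra.
have [xh|xh] := leP (Re z0) (1 / 2).
  have h := small _ X0 xh W1; rewrite -/(Wk z0) in h.
  have [||k [b [kL b50 hu]]] := fin_ k0.
  - rewrite i1 subr_ge0 ler_pdivrMr// mul1r W0/= lerBlDr lerDl divr_ge0// ltW//.
  - by rewrite i2 ler_pdivlMr//; lra.
  exists (A * k0^-1 * k)%g, b; split=> //; rewrite !mem_cat; apply/orP; right; apply/orP; left.
  by apply/mapP; exists k.
have x1' : 0 <= 1 - Re z0 by rewrite subr_ge0.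
have h := small (1 - Re z0) x1' ltac:(lra) ltac:(lra).
have D0 : 0 < (1 - Re z0) ^+ 2 + Im z0 ^+ 2 by rewrite ltr_wpDl ?sqr_ge0// exprn_gt0.
have [||k [b [kL b50 hu]]] := fin_ k1.
- rewrite i3 divr_ge0 ?(ltW D0)//= ler_pdivrMr// mul1r.
  by move: W1; rewrite !expr2; lra.
- by rewrite i4 ler_pdivlMr//; lra.
exists (A * k1^-1 * k)%g, b; split=> //; rewrite !mem_cat; apply/orP; right; apply/orP; right.
by apply/mapP; exists k.
Qed.

Lemma flare_or_ball F : open F -> finite_set (sides F) -> exists L : seq (PSL2 R), forall z, clH F z ->
  (exists a b c, 0 < lf a b c z /\ forall w, HH w -> 0 < lf a b c w -> F w) \/
  exists k b, [/\ k \in L, (50 <= b)%N & uu (act k (ball_ctr b)) z <= cradius b].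
Proof.
move=> oF fF; have [s sP] := flare_or_triangle oF fF.
have [||LL LLP] := @finite_choice (R * R)%type (seq (PSL2 R)) [set u | (u.1 \in s /\ u.2 \in s) /\ u.1 < u.2]
  (fun u L => forall z, HH z -> u.1 <= Re z <= u.2 -> (u.1 + u.2) * Re z - u.1 * u.2 <= Wk z ->
  exists k b, [/\ k \in L, (50 <= b)%N & uu (act k (ball_ctr b)) z <= cradius b]).
- apply: sub_finite_set (finite_setX (finite_seq s) (finite_seq s)) => -[x y] /= [[xs ys] _].
  by split.
- by move=> [x y] /= [_ xy]; exact: triangle_cover.
exists (flatten LL) => z Fz; have [|[x [y [xs ys xy [h1 h2]]]]] := sP z Fz; first by left.
right; have [//|L LL' LP] := LLP (x, y); have [_ Hz] := Fz.
have [k [b [kL b50 hu]]] := LP z Hz h1 h2; exists k, b; split=> //.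
by apply/flattenP; exists L.
Qed.

End Cover.

(** * Areas of squares in the plane *)

Section Squares.
Variable R : realType.
Local Notation mu := (@lebesgue_measure R).

Definition sq (X Y r : R) : set (R * R) := `[X - r, X + r]%classic `*` `[Y - r, Y + r]%classic.

Lemma sq_measure X Y r : 0 <= r -> (mu \x mu)%E (sq X Y r) = ((2 * r) ^+ 2)%:E.
Proof.
move=> r0; rewrite product_measure1E//.
have E (Z : R) : mu `[Z - r, Z + r]%classic = (2 * r)%:E.
  rewrite lebesgue_measure_itv /= lte_fin; case: ifPn => [_|].
    by rewrite -EFinB; congr EFin; ring.
  by rewrite -leNgt => h; congr EFin; lra.
transitivity ((2 * r)%:E * (2 * r)%:E)%E; last by rewrite -EFinM expr2.
by congr (_ * _)%E; exact: E.
Qed.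

(** Subadditivity of planar Lebesgue measure. *)
Lemma square_cover (T : eqType) (J : seq T) (X Y r : T -> R) (m Y0 w : R) : 0 <= w ->
  (forall x, 0 <= r x) ->
  (forall u v, `|u - m| <= w -> `|v - Y0| <= w -> exists2 x, x \in J & `|u - X x| <= r x /\ `|v - Y x| <= r x) ->
  (2 * w) ^+ 2 <= \sum_(x <- J) (2 * r x) ^+ 2.
Proof.
move=> w0 r0 cov; case: J cov => [|x0 J'] cov.
  by have [||x] := cov m Y0; rewrite ?subrr ?normr0.
set J := x0 :: J' in cov *.
pose F n := sq (X (nth x0 J n)) (Y (nth x0 J n)) (r (nth x0 J n)).
have ms x' y' r' : measurable (sq x' y' r' : set (R * R)) by apply: measurableX; exact: measurable_itv.
have := @content_subadditive _ _ _ (mu \x mu)%E (sq m Y0 w) F (size J) (fun k _ => ms _ _ _) (ms _ _ _).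
move=> H; rewrite -lee_fin -(sq_measure m Y0 w0); apply: le_trans (H _) _.
  move=> [u v] [/= hu hv]; rewrite -bigcup_mkord.
  have [||x xJ [h1 h2]] := cov u v.
  - by move: hu; rewrite in_itv /= => /andP[? ?]; rewrite ler_norml; apply/andP; split; lra.
  - by move: hv; rewrite in_itv /= => /andP[? ?]; rewrite ler_norml; apply/andP; split; lra.
  exists (index x J); first by change (index x J < size J)%N; rewrite index_mem.
  rewrite /F nth_index//; move: h1 h2; rewrite !ler_norml => /andP[? ?] /andP[? ?].
  by split; rewrite /= in_itv /=; apply/andP; split; lra.
rewrite (big_nth x0) big_mkord -sumEFin; apply: lee_sum => i _.
by rewrite -(sq_measure (X (nth x0 J i)) (Y (nth x0 J i)) (r0 _)); exact: lexx.
Qed.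

End Squares.

(** * Finitely many summits modulo translations *)

Section FiniteAxes.
Variables (R : realType) (Gam : set (PSL2 R)).
Hypothesis fuchG : fuchsian Gam.
Hypothesis cuspG : inf_cuspidal Gam.
Implicit Types (z w p q : R[i]) (F : set R[i]) (g h k : PSL2 R).

Lemma ball_bound (b : nat) p z (w : R) : (50 <= b)%N -> 0 < w -> HH p -> HH z -> uu p z <= cradius R b ->
  15 / 4 * w <= Im z -> Im z <= 17 / 4 * w ->
  `|Re z - Re p| <= 9 * w / b%:R /\ `|Im z - Im p| <= 9 * w / b%:R.
Proof.
move=> b50 w0 Hp Hz hu i1 i2; have b5 : 50 <= b%:R :> R by rewrite (ler_nat R 50).
have bR : 0 < b%:R :> R by lra.
have d0 : 0 < Im p * Im z by apply: mulr_gt0.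
have r0 : 0 <= cradius R b by rewrite /cradius divr_ge0// sqr_ge0.
have r1 : cradius R b < 1 / 2.
  rewrite /cradius ltr_pdivrMr ?exprn_gt0//; have : 50 * 50 <= (b%:R * b%:R : R) by apply: ler_pM.
  by rewrite expr2; lra.
move: hu; rewrite /uu (ler_pdivrMr _ _ d0) => hu.
have sX := sqr_ge0 (Re p - Re z); have sY := sqr_ge0 (Im p - Im z).
have p0 : 0 < Im p by []. have z0 : 0 < Im z by [].
have p2 : Im p <= 2 * Im z.
  rewrite leNgt; apply/negP => h.
  have h1 : Im p / 2 * Im z <= (Im p - Im z) * (Im p - Im z) by apply: ler_pM; lra.
  have h2 : cradius R b * (Im p * Im z) < 1 / 2 * (Im p * Im z) by rewrite ltr_pM2r.
  rewrite !expr2 in hu sX; lra.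
(* With [Im p <= 2 * Im z] and [Im z <= 17 / 4 * w] the bound is $(2/b^2)\cdot 2\cdot(17w/4)^2 =
   72.25\,w^2/b^2$, below $81\,w^2/b^2$. *)
have key : (Re p - Re z) ^+ 2 + (Im p - Im z) ^+ 2 <= (9 * w / b%:R) ^+ 2.
  apply: le_trans hu _; apply: (@le_trans _ _ (cradius R b * (2 * (17 / 4 * w) ^+ 2))).
    rewrite ler_wpM2l// expr2; apply: (@le_trans _ _ (2 * Im z * Im z)); first by rewrite ler_pM2r.
    have : Im z * Im z <= (17 / 4 * w) * (17 / 4 * w) by apply: ler_pM; lra.
    lra.
  rewrite /cradius (_ : (9 * w / b%:R) ^+ 2 = 81 * w ^+ 2 / b%:R ^+ 2); last by field; rewrite gt_eqF.
  rewrite mulrAC ler_pM2r ?invr_gt0 ?exprn_gt0//; have := sqr_ge0 w; rewrite !expr2; lra.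
have q0 : 0 <= 9 * w / b%:R by rewrite divr_ge0 ?(ltW bR)// mulr_ge0// ltW.
split; rewrite distrC -ler_sqr ?nnegrE// real_normK ?num_real//; lra.
Qed.

Lemma rect_compact (a b c d : R) : compact [set p : R[i] | a <= Re p <= b /\ c <= Im p <= d].
Proof.
have -> : [set p : R[i] | a <= Re p <= b /\ c <= Im p <= d] = (fun u : R * R => u.1 +i* u.2) @` (`[a, b] `*` `[c, d]).
  apply/seteqP; split => [w [w1 w2]|_ [[u v] /= [u1 u2] <-]]; last by move: u1 u2; rewrite !in_itv.
  by exists (Re w, Im w); [split; rewrite /= in_itv|case: w {w1 w2}].
apply: continuous_compact; last by apply: compact_setX; exact: segment_compact.
apply: continuous_subspaceT => -[u v] U /nbhs_boxP[e e0 bU].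
exists (ball u e, ball v e) => /=; first by split; apply: nbhsx_ballx.
by move=> [u' v'] [/= h1 h2]; apply: bU => /=; rewrite distrC.
Qed.

Lemma box_open (p : R[i]) (r : R) : open [set q | `|Re q - Re p| < r /\ `|Im q - Im p| < r].
Proof.
rewrite openE => q [h1 h2]; apply/nbhs_boxP.
pose m := Num.min (r - `|Re q - Re p|) (r - `|Im q - Im p|).
have [m1 m2] : m <= r - `|Re q - Re p| /\ m <= r - `|Im q - Im p| by rewrite !ge_min !lexx orbT.
exists m; first by rewrite lt_min !subr_gt0 h1.
move=> w w1 w2; split.
  by have := ler_normD (Re w - Re q) (Re q - Re p); rewrite addrA subrK; lra.
by have := ler_normD (Im w - Im q) (Im q - Im p); rewrite addrA subrK; lra.
Qed.

Definition tctr (x : PSL2 R * PSL2 R * nat) : R[i] := act x.1.1 (act x.1.2 (ball_ctr R x.2)).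

Definition zone_ball (L : seq (PSL2 R)) (e1 e2 : R) (x : PSL2 R * PSL2 R * nat) : Prop :=
  [/\ Gam x.1.1, x.1.2 \in L, (50 <= x.2)%N & zone e1 e2 (tctr x)].

(** The amount used by one zone of width 2w. The square around $m + 4wi$ of half side w/4 lies in
    the zone, away from all half planes by [zone_flare], hence is covered by translated balls. By
    [ball_bound] ball number b fits into a square of half side 10w/b, so $w^2/4 \le \sum
    400w^2/b^2$. The position of the square and $b \ge 50$ also keep the centres of the balls in the
    zone. *)
Lemma zone_cover F (L : seq (PSL2 R)) e1 e2 h1 h2 : fundamental_region Gam F ->
  (forall z, clH F z ->
  (exists a b c, 0 < lf a b c z /\ forall w, HH w -> 0 < lf a b c w -> F w) \/
  exists k b, [/\ k \in L, (50 <= b)%N & uu (act k (ball_ctr R b)) z <= cradius R b]) ->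
  axisS Gam h1 e1 -> axisS Gam h2 e2 -> e1 < e2 ->
  exists J : seq (PSL2 R * PSL2 R * nat), [/\ uniq J, forall x : PSL2 R * PSL2 R * nat, x \in J -> zone_ball L e1 e2 x &
    1 / 1600 <= \sum_(x <- J) (x.2%:R ^+ 2)^-1 :> R].
Proof.
move=> [oF FH dF cF] LP [Gh1 c1 ce1 _] [Gh2 c2 ce2 _] e12.
pose w := (e2 - e1) / 2; pose m := (e1 + e2) / 2; have w0 : 0 < w by rewrite divr_gt0// subr_gt0.
have wE : e2 - e1 = 2 * w by rewrite /w; field.
have e1E : e1 = m - w by rewrite /w /m; field. have e2E : e2 = m + w by rewrite /w /m; field.
have cov z : `|Re z - m| <= w / 4 -> `|Im z - 4 * w| <= w / 4 -> exists x, zone_ball L e1 e2 x /\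
    [/\ `|Re z - Re (tctr x)| <= 9 * w / x.2%:R & `|Im z - Im (tctr x)| <= 9 * w / x.2%:R].
  rewrite !ler_norml => /andP[x1 x2] /andP[y1 y2].
  have Hz : HH z by rewrite /HH /=; lra.
  have zz : zone e1 e2 z by split=> //; rewrite ?wE; lra.
  have /seteqP[_ /(_ z Hz) [g Gg [f Ff gf]]] := cF.
  have Hf : HH f by case: Ff.
  case: (LP f Ff) => [[a [b [c [l0 PF]]]]|[k [b [kL b50 hu]]]].
    have := @zone_flare _ _ fuchG cuspG F FH dF a b c g^-1%g h1 h2 z PF (GamV fuchG Gg) Gh1 Gh2 c1 c2.
    by rewrite ce1 ce2 -gf actK// => /(_ _); rewrite leNgt l0 gf => /(_ zz).
  have Hc := HH_ball_ctr R (leq_trans (isT : 0 < 50)%N b50).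
  have Hk := HH_act k Hc; have Hg := HH_act g Hk.
  have hu' : uu (tctr (g, k, b)) z <= cradius R b by rewrite /tctr/= -gf uu_act.
  have Hg' : HH (tctr (g, k, b)) := Hg.
  have [||n1 n2] := ball_bound b50 w0 Hg' Hz hu'; [lra|lra|].
  exists (g, k, b); split; last by split.
  split=> //; move: (tctr (g, k, b)) Hg' n1 n2 => p Hp.
  have b5 : 50 <= b%:R :> R by rewrite (ler_nat R 50).
  have nb : 9 * w / b%:R <= 9 / 50 * w.
    by rewrite ler_pdivrMr; [have : 50 * w <= b%:R * w by rewrite ler_pM2r|]; lra.
  rewrite !ler_norml => /andP[n1 n1'] /andP[n2 n2'].
  by clear -n1 n1' n2 n2' x1 x2 y1 y2 nb e1E e2E w0 wE Hp; split=> //; rewrite ?wE; lra.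
have cD := @rect_compact (m - w / 4) (m + w / 4) (4 * w - w / 4) (4 * w + w / 4).
rewrite compact_cover in cD.
(* Enlarging 9 to 10 turns the closed estimate into open squares, as compactness requires. *)
have [||J JG Jcov] := cD (PSL2 R * PSL2 R * nat)%type (zone_ball L e1 e2)
    (fun x => [set q | `|Re q - Re (tctr x)| < 10 * w / x.2%:R /\ `|Im q - Im (tctr x)| < 10 * w / x.2%:R]).
- by move=> x _; exact: box_open.
- move=> p [/andP[p1 p2] /andP[p3 p4]].
  have [||x [gx [n1 n2]]] := cov p.
  + by rewrite ler_norml; apply/andP; split; lra.
  + by rewrite ler_norml; apply/andP; split; lra.
  exists x => //; have [_ _ b50 _] := gx; have b0 : 0 < x.2%:R :> R by rewrite ltr0n (leq_trans _ b50).
  have lt : 9 * w / x.2%:R < 10 * w / x.2%:R by rewrite ltr_pM2r ?invr_gt0// ltr_pM2r//; lra.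
  by split; [exact: le_lt_trans n1 lt|exact: le_lt_trans n2 lt].
exists (finmap.enum_fset J); split; first exact: finmap.fset_uniq.
- by move=> x xJ; have := JG x xJ; rewrite inE.
have w4 : 0 <= w / 4 by rewrite divr_ge0// ltW.
have rp x : 0 <= 10 * w / (x : PSL2 R * PSL2 R * nat).2%:R by rewrite divr_ge0// mulr_ge0// ltW.
have := @square_cover R _ (finmap.enum_fset J) (fun x => Re (tctr x)) (fun x => Im (tctr x)) (fun x => 10 * w / x.2%:R) m (4 * w) (w / 4) w4 rp.
have c0 : 0 < 400 * w ^+ 2 by apply: mulr_gt0; [rewrite ltr0n|exact: exprn_gt0].
move=> H; have {}H := H _; rewrite -(ler_pM2l c0).
rewrite (_ : 400 * w ^+ 2 * (1 / 1600) = (2 * (w / 4)) ^+ 2); last by field.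
rewrite mulr_sumr; apply: le_trans (H _) _; last first.
  rewrite le_eqVlt; apply/orP; left; apply/eqP; apply: eq_big_seq => x xJ.
  have := JG x xJ; rewrite inE => -[_ _ b50 _]; have b0 : 0 < x.2%:R :> R by rewrite ltr0n (leq_trans _ b50).
  by field; rewrite gt_eqF.
move=> u v; rewrite !ler_norml => /andP[u1 u2] /andP[v1 v2].
have [|x xJ [n1 n2]] := Jcov (u +i* v).
  by split; apply/andP; split => /=; lra.
by exists x => //; split; exact: ltW.
Qed.

(** Telescoping, by $1/b^2 \le 1/(b-1) - 1/b$. *)
Lemma inv_sq_sum (n : nat) : \sum_(b < n) (if (2 <= b)%N then (b%:R ^+ 2)^-1 else 0) <= 1 :> R.
Proof.
suff H m : \sum_(b < m.+2) (if (2 <= b)%N then (b%:R ^+ 2)^-1 else 0) <= 1 - m.+1%:R^-1 :> R.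
  case: n => [|[|m]]; [by rewrite big_ord0|by rewrite big_ord1|].
  by apply: le_trans (H m) _; rewrite gerBl invr_ge0.
elim: m => [|m IH]; first by rewrite !big_ord_recr big_ord0 /= !addr0 invr1 subrr.
rewrite big_ord_recr /=; have p1 : 0 < m.+1%:R :> R by rewrite ltr0n.
have p2 : 0 < m.+2%:R :> R by rewrite ltr0n.
have E : m.+2%:R = m.+1%:R + 1 :> R by rewrite -natr1.
suff : (m.+2%:R ^+ 2)^-1 <= m.+1%:R^-1 - m.+2%:R^-1 :> R.
  by move=> h; have := lerD IH h; rewrite addrA subrK.
have -> : m.+1%:R^-1 - m.+2%:R^-1 = (m.+1%:R * m.+2%:R)^-1 :> R.
  have n1 : m.+1%:R != 0 :> R by rewrite gt_eqF.
  have n2 : m.+1%:R + 1 != 0 :> R by rewrite -E gt_eqF.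
  rewrite E; move: (m.+1%:R) n1 n2 => a n1 n2; field; by rewrite n1 n2.
by rewrite lef_pV2 ?posrE ?exprn_gt0 ?mulr_gt0// expr2 ler_pM2r// E lerDl.
Qed.

(** Double counting: the terms are grouped by the pair of their labels [la] and [be], and each pair
    occurs at most [M] times. *)
Lemma sum_count (T : eqType) (I : eqType) (S : seq T) (la : T -> I) (be : T -> nat) (L : seq I) (B M : nat) (f : nat -> R) :
  (forall b, 0 <= f b) -> uniq L ->
  (forall y, y \in S -> la y \in L /\ (be y < B)%N) ->
  (forall l b, (count (fun y => (la y == l) && (be y == b)) S <= M)%N) ->
  \sum_(y <- S) f (be y) <= (size L * M)%:R * \sum_(b < B) f b.
Proof.
move=> f0 uL SL cM.
have -> : \sum_(y <- S) f (be y) = \sum_(y <- S) \sum_(l <- L) \sum_(b < B) (if (la y == l) && (be y == b) then f b else 0).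
  apply: eq_big_seq => y yS; have [yL yB] := SL y yS.
  rewrite (bigD1_seq (la y)) //= [X in _ + X]big1 ?addr0; last first.
    by move=> l ly; apply: big1 => b _; rewrite eq_sym (negPf ly).
  rewrite (bigD1 (Ordinal yB)) //= !eqxx /= [X in _ + X]big1 ?addr0// => b nb.
  by case: eqP => // e; move: nb; rewrite -val_eqE /= -e eqxx.
rewrite exchange_big /=.
have -> : (size L * M)%:R * (\sum_(b < B) f b) = \sum_(l <- L) (M%:R * \sum_(b < B) f b).
  by rewrite big_const_seq count_predT iter_addr addr0 natrM -[RHS]mulr_natl mulrA.
apply: ler_sum => l _; rewrite exchange_big /= mulr_sumr; apply: ler_sum => b _.
rewrite -big_mkcond /= -big_filter big_const_seq count_predT iter_addr addr0 size_filter -[leLHS]mulr_natl.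
by rewrite ler_wpM2r// ler_nat.
Qed.

Lemma zone_re e1 e2 e1' e2' z : zone e1 e2 z -> zone e1' e2' z -> e1 < e2' /\ e1' < e2.
Proof. by move=> [_ a b _] [_ c d _]; split; [exact: lt_trans d|exact: lt_trans b]. Qed.

(** Among N+1 summits over the interval there are N consecutive zones, which use at least N/1600 of
    the sum of $b^{-2}$ over their balls. On the other hand each pair of a list element and a number
    b is used boundedly often, so this sum is at most a constant [C]. *)
Lemma finite_axes (rho : R) : geometrically_finite Gam ->
  finite_set [set e | 0 <= e <= rho /\ exists g, axisS Gam g e].
Proof.
move=> [F [fF cF sF]]; have [oF FH dF covF] := fF.
have [L LP] := flare_or_ball oF sF; apply: contrapT => inf.
have /finite_seqP[ts tsE] := finite_transl fuchG rho.
pose C := (size (undup L) * size ts)%N.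
(* The numeral is hidden behind [K], so that it is never unfolded as a unary number. *)
have [K KE] : exists K : nat, K%:R = 1600 :> R by exists 1600%N.
pose N := (K * C).+1.
have [B Bsub Bsize] := infinite_set_fset N.+1 inf.
pose es := sort <=%O (finmap.enum_fset B).
have ses : (N < size es)%N by rewrite size_sort.
have es_in i : (i < size es)%N -> 0 <= nth 0 es i <= rho /\ exists g, axisS Gam g (nth 0 es i).
  move=> hi; apply: Bsub => /=; have : nth 0 es i \in es by exact: mem_nth.
  by rewrite mem_sort.
have es_lt i j : (i < j)%N -> (j < size es)%N -> nth 0 es i < nth 0 es j.
  move=> ij js; have ss : sorted <%O es by rewrite sort_lt_sorted finmap.fset_uniq.
  by apply: (sorted_ltn_nth lt_trans) => //; rewrite inE; exact: ltn_trans js.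
have es_le i j : (i <= j)%N -> (j < size es)%N -> nth 0 es i <= nth 0 es j.
  by rewrite leq_eqVlt => /orP[/eqP->//|ij js]; apply/ltW/es_lt.
have /choice[J JP] : forall n, exists J : seq (PSL2 R * PSL2 R * nat), (n < N)%N ->
   [/\ uniq J, forall x : PSL2 R * PSL2 R * nat, x \in J -> zone_ball L (nth 0 es n) (nth 0 es n.+1) x &
    1 / 1600 <= \sum_(x <- J) (x.2%:R ^+ 2)^-1 :> R].
  move=> n; have [nN|] := boolP (n < N)%N; last by exists [::].
  have ns : (n.+1 < size es)%N by exact: leq_ltn_trans ses.
  have [_ [g ag]] := es_in n (ltn_trans (ltnSn n) ns); have [_ [h ah]] := es_in n.+1 ns.
  have [J] := zone_cover fF LP ag ah (es_lt n n.+1 (ltnSn n) ns).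
  by exists J.
pose S := [seq (n, x) | n <- iota 0 N, x <- J n].
have SP n x : (n, x) \in S -> (n < N)%N /\ x \in J n.
  by move=> /allpairsPdep[n' [x' [+ h [-> ->]]]]; rewrite mem_iota add0n => /andP[_ ->].
have uS : uniq S.
  apply: allpairs_uniq_dep; first exact: iota_uniq.
    by move=> n; rewrite mem_iota add0n => /andP[_ /JP[]].
  by move=> [n x] [m y] _ _ /= [-> ->].
pose BB := \max_(y <- S) y.2.2.
have low : N%:R / 1600 <= \sum_(y <- S) (if (2 <= y.2.2)%N then (y.2.2%:R ^+ 2)^-1 else 0) :> R.
  rewrite /S big_allpairs_dep /=.
  have -> : N%:R / 1600 = \sum_(n <- iota 0 N) (1 / 1600) :> R.
    by rewrite big_const_seq count_predT iter_addr addr0 size_iota div1r -[RHS]mulr_natl.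
  rewrite big_seq_cond [leRHS]big_seq_cond; apply: ler_sum => n.
  rewrite andbT mem_iota add0n => /andP[_ nN]; have [_ gJ] := JP n nN; move/le_trans; apply.
  rewrite le_eqVlt; apply/orP; left; apply/eqP; apply: eq_big_seq => x /gJ[_ _ b50 _].
  by rewrite (leq_trans _ b50).
(* Two translates of one ball with centres in zones differ, by [zone_disj], by a translation of
   length at most [rho], and these are listed in [ts]. The abscissa of the centre determines the
   zone. *)
have cnt l b : (count (fun y : nat * (PSL2 R * PSL2 R * nat) => (y.2.1.2 == l) && (y.2.2 == b)) S <= size ts)%N.
  pose S' := [seq y <- S | (y.2.1.2 == l) && (y.2.2 == b)].
  rewrite -size_filter -/S'.
  have S'P n x : (n, x) \in S' -> [/\ (n < N)%N, Gam x.1.1, x = (x.1.1, l, b), (50 <= b)%N & zone (nth 0 es n) (nth 0 es n.+1) (act x.1.1 (act l (ball_ctr R b)))].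
    rewrite mem_filter /= => /andP[/andP[/eqP xl /eqP xb] /SP[nN xJ]].
    have [_ /(_ x xJ)[Gk _ b50 zx] _] := JP n nN; rewrite xb in b50; split=> //.
      by rewrite -xl -xb; case: (x) => -[].
    by move: zx; rewrite /tctr xl xb.
  case E : S' => [//|[n0 x0] S'']; have h0 : (n0, x0) \in S' by rewrite E mem_head.
  rewrite -E; have [nN0 G0 x0E b50 z0] := S'P _ _ h0.
  have Hc := HH_act l (HH_ball_ctr R (leq_trans (isT : 0 < 50)%N b50)).
  have Hp0 := HH_act x0.1.1 Hc.
  have zs n : (n < N)%N -> (n < size es)%N /\ (n.+1 < size es)%N.
    by move=> nN; split; [exact: ltn_trans ses|exact: leq_ltn_trans ses].
  have rng n z : (n < N)%N -> zone (nth 0 es n) (nth 0 es n.+1) z -> 0 <= Re z <= rho.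
    move=> nN [_ a1 a2 _]; have [s1 s2] := zs n nN.
    have [/andP[q1 q2] _] := es_in n s1; have [/andP[q3 q4] _] := es_in n.+1 s2.
    by rewrite (ltW (le_lt_trans q1 a1)) (ltW (lt_le_trans a2 q4)).
  have EE n : (n < N)%N -> End Gam (nth 0 es n) /\ End Gam (nth 0 es n.+1).
    by move=> nN; have [s1 s2] := zs n nN; have [_ h1] := es_in n s1; have [_ h2] := es_in n.+1 s2; split; left.
  have tr n x : (n, x) \in S' -> (x.1.1 * x0.1.1^-1)%g \in ts.
    move=> h; have [nN Gk xE _ zx] := S'P _ _ h.
    have Gkk : Gam (x.1.1 * x0.1.1^-1)%g by apply: (GamM fuchG) => //; exact: (GamV fuchG).
    have zx' : zone (nth 0 es n) (nth 0 es n.+1) (act (x.1.1 * x0.1.1^-1)%g (act x0.1.1 (act l (ball_ctr R b)))).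
      by rewrite -actM// mulgVK.
    have [E1 E2] := EE n nN; have [E3 E4] := EE n0 nN0.
    have c0 := zone_disj fuchG cuspG E1 E2 E3 E4 Gkk z0 zx'.
    have uk := stab_unip fuchG cuspG Gkk c0.
    suff : [set` ts] (x.1.1 * x0.1.1^-1)%g by [].
    rewrite -tsE; split=> //; have [r _] := unip_act uk Hp0.
    have := rng n _ nN zx'; have := rng n0 _ nN0 z0; rewrite r => /andP[a1 a2] /andP[a3 a4].
    by clear -a1 a2 a3 a4; rewrite ler_norml; apply/andP; split; lra.
  rewrite -(size_map (fun y : nat * (PSL2 R * PSL2 R * nat) => (y.2.1.1 * x0.1.1^-1)%g)); apply: uniq_leq_size.
    rewrite map_inj_in_uniq; first by rewrite filter_uniq.
    move=> [n x] [n' x'] h h' /= /(congr1 (fun g => g * x0.1.1)%g); rewrite !mulgVK => kk.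
    have [nN _ xE _ zx] := S'P _ _ h; have [nN' _ xE' _ zx'] := S'P _ _ h'.
    have xx : x = x' by rewrite xE xE' kk.
    congr (_, _) => //; rewrite xx in zx; have [l1 l2] := zone_re zx zx'.
    have [s1 s2] := zs n nN; have [s1' s2'] := zs n' nN'.
    have [nn|nn|//] := ltngtP n n'.
      by have := es_le n.+1 n' nn s1'; rewrite leNgt l2.
    by have := es_le n'.+1 n nn s1; rewrite leNgt l1.
  by move=> g /mapP[[n x] h ->]; exact: (tr n x h).
have := @sum_count _ _ S (fun y => y.2.1.2) (fun y => y.2.2) (undup L) BB.+1 (size ts)
  (fun b => if (2 <= b)%N then (b%:R ^+ 2)^-1 else 0) _ (undup_uniq L) _ cnt.
move=> H; have {H} up := H _ _.
have {up} up : \sum_(y <- S) (if (2 <= y.2.2)%N then (y.2.2%:R ^+ 2)^-1 else 0) <= C%:R :> R.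
  apply: le_trans (up _ _) _.
  - by move=> b; case: ifP => // _; rewrite invr_ge0 sqr_ge0.
  - move=> [n x] h; have [nN xJ] := SP _ _ h; split.
      by rewrite mem_undup; have [_ /(_ x xJ)[]] := JP n nN.
    by rewrite ltnS; apply: (@leq_bigmax_seq _ S (fun=> true) (fun y => y.2.2) (n, x)).
  - by rewrite -[leRHS]mulr1 ler_wpM2l// inv_sq_sum.
have {low up} h := le_trans low up.
have K0 : 0 < 1600 :> R by rewrite ltr0n.
rewrite (ler_pdivrMr _ _ K0) -KE -natrM ler_nat in h.
by move: h; rewrite /N [(C * K)%N]mulnC ltnn.
Qed.

End FiniteAxes.

(** * Extension to the boundary *)

Section Limits.
Variable R : realType.
Implicit Types (g h k : PSL2 R) (z w p : R[i]) (x s : R).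

Lemma actS1 (v : one_point_compactification R[i]) : actS 1%g v = v.
Proof.
have [e [e2 a1 b1 c1 d1]] := psl1_coef R; have e0 := sign_neq0 e2.
have eC : e%:C != 0 :> R[i] by rewrite -[0]/(0%:C) (inj_eq (@complexI R)).
case: v => [z|] /=; last by rewrite /actS -/(cc _) c1 eqxx.
rewrite /actS /denom /act -/(cc _) -/(cd _) -/(ca _) -/(cb _) a1 b1 c1 d1 mul0r add0r (negPf eC).
by rewrite /denom -/(cc _) -/(cd _) c1 d1 mul0r !add0r addr0 mulrAC divff// mul1r.
Qed.

Lemma actS_HH g z : HH z -> actS g (fin z) = fin (act g z).
Proof. by move=> Hz; rewrite /actS /fin (negPf (denom_neq0 g Hz)). Qed.

Lemma velocity_SH k (t : R) : SH (velocity (geo k) t).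
Proof.
split; first exact: HH_geo.
rewrite velocity_geo; cbn [fst snd]; set D := denom k (geod_i t); have D0 : D != 0 by exact: denom_neq0 (HH_i t).
set v := _ / D ^+ 2; have E : v * (D * D) = 0 +i* expR t.
  by rewrite /v -expr2 divfK// expf_neq0.
pose N (z : R[i]) := Re z ^+ 2 + Im z ^+ 2.
have NM (v1 v2 : R[i]) : N (v1 * v2) = N v1 * N v2 by rewrite /N ReM ImM; ring.
have ND : N D = Nm k (geod_i t) by rewrite /N Re_denom Im_denom.
have N0 := Nm_gt0 k (HH_i t).
have E2 : N v * (Nm k (geod_i t) * Nm k (geod_i t)) = expR t ^+ 2.
  by rewrite -ND -!NM E /N /= expr0n add0r.
rewrite cabsE -/(N v) (_ : N v = (expR t / Nm k (geod_i t)) ^+ 2); last first.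
  by rewrite expr_div_n -E2 -expr2 mulfK// expf_neq0// gt_eqF.
rewrite sqrtr_sqr ger0_norm; first by rewrite /geo Im_act//; exact: HH_i.
by rewrite divr_ge0// ?expR_ge0// ltW.
Qed.

Lemma geo_cont k (t : R) : {for t, continuous (geo k)}.
Proof.
have c : {for t, continuous (@geod_i R)}.
  apply: (@continuous_reim R (fun=> 0) (@expR R)); [exact: cst_continuous|exact: continuous_expR].
by rewrite /geo; apply: (@continuous_comp _ _ _ (@geod_i R) (act k) t c); exact: continuous_act (HH_i t).
Qed.

Lemma velocity_shift (gam : R -> R[i]) (t : R) : velocity (fun r => gam (r + t)) 0 = velocity gam t.
Proof.
by rewrite /velocity /derive1 /= add0r; congr (_, _ +i* _); congr (lim _); under eq_fun do rewrite addr0.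
Qed.

Lemma half_shift (a r : R) : 0 < r -> `|a + r / 2 - a| < r.
Proof. by move=> r0; rewrite addrC addKr gtr0_norm; lra. Qed.

Lemma half_shift_neq (a r : R) : 0 < r -> a + r / 2 <> a.
Proof. by move=> r0; lra. Qed.

Lemma conv_lt (t a b c : R) : 0 <= t -> t <= 1 -> c < a -> c < b -> c < (1 - t) * a + t * b.
Proof.
move=> t0 t1 ca cb; have : 0 < (1 - t) * (a - c) + t * (b - c); last lra.
case: (ltP t 1) => h; first by rewrite ltr_pwDl// ?mulr_gt0 ?mulr_ge0 ?subr_gt0 ?(ltW cb)//; lra.
have -> : t = 1 by lra.
by rewrite subrr mul0r add0r mul1r subr_gt0.
Qed.

(** The factor [Nm g] makes the signed position relative to the preimage of a vertical line affine
    in the Klein coordinates, so crossing points on segments are given by a formula. *)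
Lemma lin_conv g (x : R) z w p (t : R) : HH z -> HH w -> HH p -> Re p = (1 - t) * Re z + t * Re w ->
  Wk p = (1 - t) * Wk z + t * Wk w ->
  Nm g p * (Re (act g p) - x) = (1 - t) * (Nm g z * (Re (act g z) - x)) + t * (Nm g w * (Re (act g w) - x)).
Proof.
move=> Hz Hw Hp rE wE.
have E v : HH v -> Nm g v * (Re (act g v) - x) =
    ca g * cc g * Wk v + (ca g * cd g + cb g * cc g) * Re v + cb g * cd g - x * (cc g ^+ 2 * Wk v + 2 * cc g * cd g * Re v + cd g ^+ 2).
  move=> Hv; rewrite mulrBr Re_actW// mulrC divfK ?gt_eqF ?Nm_gt0// NmE; ring.
by rewrite !E// rE wE; ring.
Qed.

Lemma kseg_pt z w (t : R) : HH z -> HH w -> 0 <= t -> t <= 1 -> exists p, [/\ HH p,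
  Re p = (1 - t) * Re z + t * Re w & Wk p = (1 - t) * Wk z + t * Wk w].
Proof.
move=> Hz Hw t0 t1; pose X := (1 - t) * Re z + t * Re w; pose W := (1 - t) * Wk z + t * Wk w.
have XW : X ^+ 2 < W.
  have h1 := HH_Wk Hz; have h2 := HH_Wk Hw.
  have g1 : X ^+ 2 <= (1 - t) * Re z ^+ 2 + t * Re w ^+ 2.
    rewrite -subr_ge0 (_ : _ - _ = (1 - t) * t * (Re z - Re w) ^+ 2); last by rewrite /X; ring.
    by rewrite mulr_ge0 ?sqr_ge0// mulr_ge0//; lra.
  have : 0 < (1 - t) * (Wk z - Re z ^+ 2) + t * (Wk w - Re w ^+ 2).
    by apply: conv_lt => //; rewrite subr_gt0.
  by move: g1; rewrite /W; lra.
by have [Hp rp wp] := ptP XW; exists (pt X W).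
Qed.

Lemma kseg_zero g x z w : HH z -> HH w -> Nm g z * (Re (act g z) - x) < 0 ->
  0 <= Nm g w * (Re (act g w) - x) -> exists p, [/\ HH p, kseg z w p & Re (act g p) = x].
Proof.
move=> Hz Hw Lz Lw; set l0 := Nm g z * _ in Lz; set l1 := Nm g w * _ in Lw.
pose t := - l0 / (l1 - l0); have D : 0 < l1 - l0 by lra.
have t0 : 0 <= t by rewrite divr_ge0//; lra.
have t1 : t <= 1 by rewrite /t ler_pdivrMr//; lra.
have [p [Hp rp wp]] := kseg_pt Hz Hw t0 t1; exists p; split=> //; first by exists t.
have := lin_conv g x Hz Hw Hp rp wp; rewrite -/l0 -/l1.
have -> : (1 - t) * l0 + t * l1 = 0 by rewrite /t; field; rewrite gt_eqF.
by move/eqP; rewrite mulf_eq0 (gt_eqF (Nm_gt0 g Hp)) /= subr_eq0 => /eqP.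
Qed.

Lemma kseg_zero2 g x z w s : sg s -> HH z -> HH w -> s * (Nm g z * (Re (act g z) - x)) < 0 ->
  0 <= s * (Nm g w * (Re (act g w) - x)) -> exists p, [/\ HH p, kseg z w p & Re (act g p) = x].
Proof.
move=> S Hz Hw h1 h2; have ksym v1 v2 v : kseg v1 v2 v -> kseg v2 v1 v.
  by move=> [t [t0 t1 r W]]; exists (1 - t); split; [lra|lra|rewrite r; ring|rewrite W; ring].
case: S h1 h2 => -> h1 h2; first by apply: kseg_zero => //; lra.
case: (ltP (Nm g w * (Re (act g w) - x)) 0) => h3.
  by have [|p [Hp kp rp]] := kseg_zero Hw Hz h3 _; [lra|exists p; split=> //; exact: ksym].
exists w; split=> //; first by exists 1; split; rewrite ?subrr ?mul0r ?add0r ?mul1r.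
have : Nm g w * (Re (act g w) - x) = 0 by lra.
by move/eqP; rewrite mulf_eq0 (gt_eqF (Nm_gt0 g Hw)) /= subr_eq0 => /eqP.
Qed.

End Limits.

(** * The action on the Riemann sphere; compactness estimates *)

Section Sphere.
Variable R : realType.
Local Notation C := R[i].
Local Notation P1 := (one_point_compactification R[i]).
Implicit Types (g h k : PSL2 R) (z w p : R[i]) (x y : P1).

(** The point with homogeneous coordinates [u : v]. In these coordinates the action is linear, which
    makes [actSM] a computation instead of a case analysis at poles. *)
Definition toP (u v : C) : P1 := if v == 0 then pinf R else fin (u / v).

Lemma toP_scale (e u v : C) : e != 0 -> toP (e * u) (e * v) = toP u v.
Proof.
move=> e0; rewrite /toP mulf_eq0 (negPf e0) /=; case: eqP => // /eqP v0.
by rewrite invfM mulrACA divff// mul1r.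
Qed.

Definition hom1 x : C := if x is Some z then z else 1.
Definition hom2 x : C := if x is Some _ then 1 else 0.

Lemma actS_hom g x : actS g x = toP ((ca g)%:C * hom1 x + (cb g)%:C * hom2 x) ((cc g)%:C * hom1 x + (cd g)%:C * hom2 x).
Proof.
case: x => [z|]; rewrite /toP /= ?mulr1 ?mulr0 ?addr0; first by [].
rewrite /actS -[X in _ = if X then _ else _]/((cc g)%:C == 0%:C) (inj_eq (@complexI R)).
by case: ifP => // c0; congr Some; rewrite fmorph_div.
Qed.

Lemma actS_toP g (u v : C) : (u != 0) || (v != 0) ->
  actS g (toP u v) = toP ((ca g)%:C * u + (cb g)%:C * v) ((cc g)%:C * u + (cd g)%:C * v).
Proof.
rewrite {1}/toP; case: (eqVneq v 0) => [->|v0 _]; rewrite actS_hom /=.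
  rewrite orbF => u0; rewrite !mulr1 !mulr0 !addr0.
  by rewrite -(toP_scale _ _ u0) ![u * _]mulrC.
by rewrite -(toP_scale _ _ v0); congr toP; field.
Qed.

Lemma actSM g h x : actS (g * h)%g x = actS g (actS h x).
Proof.
have [e [e2 a b c d]] := pslM_coef g h; have e0 := sign_neq0 e2.
have eC : e%:C != 0 by rewrite -[0]/(0%:C) (inj_eq (@complexI R)).
have dt : (ca h)%:C * (cd h)%:C - (cb h)%:C * (cc h)%:C = 1.
  by rewrite -!rmorphM -rmorphB psl_det.
rewrite [actS h x]actS_hom actS_toP; last first.
  rewrite -negb_and; apply/negP => /andP[/eqP u0 /eqP v0].
  have h1 : hom1 x = 0.
    have : (cd h)%:C * ((ca h)%:C * hom1 x + (cb h)%:C * hom2 x) - (cb h)%:C * ((cc h)%:C * hom1 x + (cd h)%:C * hom2 x) = 0 by rewrite u0 v0; ring.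
    have -> : (cd h)%:C * ((ca h)%:C * hom1 x + (cb h)%:C * hom2 x) - (cb h)%:C * ((cc h)%:C * hom1 x + (cd h)%:C * hom2 x) = ((ca h)%:C * (cd h)%:C - (cb h)%:C * (cc h)%:C) * hom1 x by ring.
    by rewrite dt mul1r.
  have h2 : hom2 x = 0.
    have : (ca h)%:C * ((cc h)%:C * hom1 x + (cd h)%:C * hom2 x) - (cc h)%:C * ((ca h)%:C * hom1 x + (cb h)%:C * hom2 x) = 0 by rewrite u0 v0; ring.
    have -> : (ca h)%:C * ((cc h)%:C * hom1 x + (cd h)%:C * hom2 x) - (cc h)%:C * ((ca h)%:C * hom1 x + (cb h)%:C * hom2 x) = ((ca h)%:C * (cd h)%:C - (cb h)%:C * (cc h)%:C) * hom2 x by ring.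
    by rewrite dt mul1r.
  by case: x h1 h2 {u0 v0} => [z _ /eqP|/eqP]; rewrite /= oner_eq0.
rewrite actS_hom -[RHS](toP_scale _ _ eC) a b c d !(rmorphM, rmorphD) /=.
by congr toP; ring.
Qed.

Lemma actSK g x : actS g^-1%g (actS g x) = x.
Proof. by rewrite -actSM mulVg actS1. Qed.

Lemma actS_real g (r : R) : cc g * r + cd g != 0 ->
  actS g (fin r%:C) = fin ((ca g * r + cb g) / (cc g * r + cd g))%:C.
Proof.
move=> d0; rewrite actS_hom /= !mulr1 /toP -!rmorphM -!rmorphD.
rewrite -[X in if X then _ else _]/((cc g * r + cd g)%:C == 0%:C) (inj_eq (@complexI R)) (negPf d0).
by rewrite -fmorph_div.
Qed.

Lemma actS_real_pole g (r : R) : cc g * r + cd g = 0 -> actS g (fin r%:C) = pinf R.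
Proof. by move=> d0; rewrite actS_hom /= !mulr1 /toP -!rmorphM -!rmorphD d0 eqxx. Qed.

Lemma bdS_pinf g : bdS (actS g (pinf R)).
Proof. by rewrite actS_pinf; case: ifP; [left|right; eexists]. Qed.

Lemma reaches_closure (gam : R -> C) x (V : set C) : reaches gam +oo%E x ->
  (exists T : R, forall t, T < t -> V (gam t)) -> closure ([set fin w | w in V] : set P1) x.
Proof.
move=> rx [T TV] U nU; have H' : \forall t \near +oo, U (fin (gam t)) := rx _ nU.
have [T' T'U] := (pinftyP _).1 H'; pose t := Num.max T T' + 1.
have [h1 h2] : T < t /\ T' < t by rewrite /t; split; rewrite ltr_pwDr// le_max lexx ?orbT.
by exists (fin (gam t)); split; [exists (gam t) => //; exact: TV|exact: T'U].
Qed.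

Lemma closure_fin (V : set C) (z : C) : closure ([set fin w | w in V] : set P1) (fin z) -> closure V z.
Proof.
move=> H U nU; have nU' : nbhs (fin z : P1) (Some @` U) by exact: one_point_compactification_some_nbhs.
have [_ [[w Vw <-] [w' Uw' [ww]]]] := H _ nU'.
by exists w; split=> //; rewrite -ww.
Qed.

Lemma box_bnd (a m b : R) : 0 < m -> exists2 B, 1 <= B & forall p, `|Re p| <= a -> m <= Im p -> Im p <= b -> box B p.
Proof.
move=> m0; have i0 : 0 < m^-1 by rewrite invr_gt0.
have a0 := normr_ge0 a; have b0 := normr_ge0 b; have a1 := ler_norm a; have b1 := ler_norm b.
exists (1 + `|a| + `|b| + m^-1) => [|p h1 h2 h3]; first lra.
split; [lra| |lra]; apply: le_trans h2; rewrite -[leRHS]invrK lef_pV2 ?posrE//; lra.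
Qed.

Lemma sqr_norm_le (x y : R) : 0 <= y -> x ^+ 2 <= y ^+ 2 -> `|x| <= y.
Proof. by move=> y0; rewrite -[x ^+ 2]real_normK ?num_real// ler_sqr ?nnegrE. Qed.

(** Hyperbolic balls are relatively compact: the bound on [uu] confines the ratio of heights to the
    interval from $1/(c+2)$ to $c+2$. *)
Lemma uu_box z (c : R) : HH z -> 0 <= c -> exists2 B, 1 <= B & forall w, HH w -> uu z w <= c -> box B w.
Proof.
move=> Hz c0; have y0 : 0 < Im z by []. have c2 : 0 < c + 2 by lra.
have m0 : 0 < Im z / (c + 2) by rewrite divr_gt0.
have [B B1 BP] := @box_bnd (`|Re z| + (c + 2) * Im z) _ ((c + 2) * Im z) m0; exists B => // w Hw.
have v0 : 0 < Im w by [].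
rewrite /uu ler_pdivrMr ?mulr_gt0// => h.
have hi : (Im z - Im w) ^+ 2 <= c * (Im z * Im w) by have := sqr_ge0 (Re z - Re w); lra.
have hr : (Re z - Re w) ^+ 2 <= c * (Im z * Im w) by have := sqr_ge0 (Im z - Im w); lra.
have key (a b : R) : 0 < a -> 0 < b -> (a - b) ^+ 2 <= c * (a * b) -> b <= (c + 2) * a.
  move=> a0 b0 H; rewrite leNgt; apply/negP => lt.
  have : (c + 2) * a * b < b * b by rewrite ltr_pM2r.
  have := sqr_ge0 a; have := H; rewrite sqrrB; lra.
have vhi := key _ _ y0 v0 hi.
have vlo : Im z <= (c + 2) * Im w.
  by apply: key => //; rewrite [Im w * _]mulrC -sqrrN opprB.
apply: BP => //; last by rewrite ler_pdivrMr// mulrC.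
have : `|Re z - Re w| <= (c + 2) * Im z.
  apply: sqr_norm_le; first by rewrite mulr_ge0 ?ltW.
  apply: le_trans hr _; rewrite exprMn.
  apply: le_trans (_ : c * (Im z * ((c + 2) * Im z)) <= _).
    by rewrite ler_wpM2l// ler_wpM2l// ltW.
  rewrite (_ : c * _ = c * (c + 2) * Im z ^+ 2); last ring.
  by rewrite ler_wpM2r ?sqr_ge0// expr2 ler_wpM2r//; lra.
by have := ler_normB (Re z) (Re z - Re w); rewrite opprB addrC subrK; lra.
Qed.

Lemma uu_geo k (s t : R) : `|s - t| <= 1 -> uu (geo k s) (geo k t) <= 2 * expR 1.
Proof.
move=> st; rewrite uuE//; try exact: HH_geo.
have [_ iso] := geodesic_geo k; have := hdistE (HH_geo k s) (HH_geo k t); rewrite iso => ->.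
have I1 : 0 < Im (geo k s) := HH_geo k s; have I2 : 0 < Im (geo k t) := HH_geo k t.
rewrite [_ * _ / _]mulrAC divff ?gt_eqF ?mulr_gt0// mul1r.
have e1 : expR `|s - t| <= expR 1 by rewrite ler_expR.
have e2 : expR (- `|s - t|) <= expR 1 by rewrite ler_expR; have := normr_ge0 (s - t); lra.
lra.
Qed.

Lemma kseg_box z w : HH z -> HH w -> exists2 B, 1 <= B & forall p, HH p -> kseg z w p -> box B p.
Proof.
move=> Hz Hw; have y0 : 0 < Im z by []. have v0 : 0 < Im w by [].
pose m := Num.min (Im z) (Im w); have m0 : 0 < m by rewrite lt_min y0.
have [m1 m2] : m <= Im z /\ m <= Im w by rewrite !ge_min !lexx orbT.
have W1 : 0 <= Wk z by rewrite addr_ge0 ?sqr_ge0.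
have W2 : 0 <= Wk w by rewrite addr_ge0 ?sqr_ge0.
have [B B1 BP] := @box_bnd (`|Re z| + `|Re w|) _ (1 + Wk z + Wk w) m0; exists B => // p Hp [t [t0 t1 rE wE]].
have p0 : 0 < Im p by [].
have s0 : 0 <= 1 - t by lra.
have n1 := normr_ge0 (Re z); have n2 := normr_ge0 (Re w).
have tn (a : R) : 0 <= a -> 0 <= t * a by move=> a0; rewrite mulr_ge0.
have sn (a : R) : 0 <= a -> 0 <= (1 - t) * a by move=> a0; rewrite mulr_ge0.
have W3 : Wk p <= Wk z + Wk w.
  have := tn _ W1; have := sn _ W2; rewrite wE; lra.
apply: BP.
- rewrite rE; have := ler_normD ((1 - t) * Re z) (t * Re w); rewrite !normrM (ger0_norm s0) (ger0_norm t0).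
  have := tn _ n1; have := sn _ n2; lra.
- rewrite -ler_sqr ?nnegrE ?(ltW m0) ?(ltW p0)//.
  have q1 : m ^+ 2 <= Im z ^+ 2 by rewrite ler_sqr ?nnegrE ?(ltW m0) ?(ltW y0).
  have q2 : m ^+ 2 <= Im w ^+ 2 by rewrite ler_sqr ?nnegrE ?(ltW m0) ?(ltW v0).
  have e1 : Im p ^+ 2 = Wk p - Re p ^+ 2 by rewrite /Wk; ring.
  have e2 : Im p ^+ 2 = (1 - t) * Im z ^+ 2 + t * Im w ^+ 2 + (1 - t) * t * (Re z - Re w) ^+ 2.
    by rewrite e1 wE rE /Wk; ring.
  have g1 : 0 <= (1 - t) * (Im z ^+ 2 - m ^+ 2) by apply: sn; rewrite subr_ge0.
  have g2 : 0 <= t * (Im w ^+ 2 - m ^+ 2) by apply: tn; rewrite subr_ge0.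
  have g3 : 0 <= (1 - t) * t * (Re z - Re w) ^+ 2 by rewrite mulr_ge0 ?sqr_ge0 ?mulr_ge0.
  rewrite e2; lra.
- rewrite leNgt; apply/negP => lt.
  have : Im p * 1 < Im p ^+ 2 by rewrite expr2 ltr_pM2l//; lra.
  have : Im p ^+ 2 <= Wk p by rewrite lerDr sqr_ge0.
  lra.
Qed.

Lemma time_uniq k (s t : R) : cc k != 0 -> cd k != 0 -> Re (geo k s) = Re (geo k t) -> s = t.
Proof.
move=> c0 d0; have [H1 H2] := wt_mono c0 d0.
have [r1 _] := geo_wt s c0 d0; have [r2 _] := geo_wt t c0 d0; rewrite r1 r2 => E.
have D : ca k / cc k - cb k / cd k != 0.
  apply/eqP => D; have := psl_det k; have : (ca k / cc k - cb k / cd k) * (cc k * cd k) = ca k * cd k - cb k * cc k by field; rewrite c0 d0.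
  by rewrite D mul0r => <- /eqP; rewrite eq_sym oner_eq0.
have {}E : wt k s = wt k t.
  by apply: (mulIf D); move: E; lra.
by apply/eqP; rewrite eq_le -(H2 s) -(H2 t) E lexx.
Qed.

Lemma finite_rel (S T : Type) (A : set S) (B : set T) (r : S -> T -> Prop) : finite_set B ->
  (forall a, A a -> exists2 b, B b & r a b) -> (forall a a' b, r a b -> r a' b -> a = a') -> finite_set A.
Proof.
move=> fB H U; case: (pselect (A !=set0)) => [[x0 /H[y0 _ _]]|N]; last first.
  by rewrite (_ : A = set0)// -subset0 => a Aa; apply: N; exists a.
have ex (x : S) : exists y : T, A x -> B y /\ r x y.
  by case: (pselect (A x)) => [/H[y By ry]|nA]; [exists y|exists y0].
have [f fP] := choice ex; apply: (@finite_inj _ _ A B f fB) => [x /fP[]//|x x' Ax Ax' E].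
by apply: (U _ _ (f x)); [case: (fP x Ax)|rewrite E; case: (fP x' Ax')].
Qed.

Lemma finite_bnd (E : set R) : finite_set E -> exists M, forall t, E t -> `|t| <= M.
Proof.
move=> /finite_seqP[L ->]; elim: L => [|a L [M MP]]; first by exists 0.
exists (`|a| + `|M|) => t /=; rewrite inE => /orP[/eqP->|/MP h]; first by rewrite lerDl.
by apply: le_trans h _; apply: le_trans (ler_norm _) _; rewrite lerDr.
Qed.

Lemma finite_isolated (E : set R) t : finite_set E -> exists2 e : R, 0 < e & forall r, E r -> `|t - r| < e -> r = t.
Proof.
move=> /finite_seqP[L ->]; elim: L => [|a L [e e0 eP]]; first by exists 1.
case: (eqVneq a t) => [->|ta].
  by exists e => // r /=; rewrite inE => /orP[/eqP//|]; exact: eP.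
have n0 : 0 < `|t - a| by rewrite normr_gt0 subr_eq0 eq_sym.
exists (Num.min e `|t - a|) => [|r /=]; first by rewrite lt_min e0.
by rewrite inE lt_min => /orP[/eqP->|rL] /andP[h1 h2]; [rewrite ltxx in h2|exact: eP].
Qed.

End Sphere.

(** * Geodesics with two real endpoints *)

Section Ends.
Variable R : realType.
Implicit Types (g h k : PSL2 R) (y s : R).

Definition ends k y y' := [/\ cc k != 0, cd k != 0, ca k / cc k = y & cb k / cd k = y'].

Lemma endsP k y y' : ends k y y' <-> actS k (pinf R) = fin y%:C /\ actS k (fin 0) = fin y'%:C.
Proof.
rewrite actS_pinf actS_0; split=> [[c0 d0 <- <-]|]; first by rewrite (negPf c0) (negPf d0).
by case: eqP => [_ [//]|/eqP c0]; case: eqP => [_ [_ //]|/eqP d0] [[E] [E']].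
Qed.

Lemma ends_shift k k' (t : R) : (forall r, geo k' r = geo k (t + r)) ->
  actS k' (pinf R) = actS k (pinf R) /\ actS k' (fin 0) = actS k (fin 0).
Proof.
move=> H; have [k2 [kE c d a b]] := geo_shift k t.
have E : geo k' = geo k2 by apply/funext => r; rewrite H kE addrC.
have r1 : reaches (geo k') +oo%E (actS k2 (pinf R)) by rewrite E; apply/reaches_geo_p.
have r2 : reaches (geo k') -oo%E (actS k2 (fin 0)) by rewrite E; apply/reaches_geo_m.
have /reaches_geo_p <- := r1; have /reaches_geo_m <- := r2.
by rewrite !actS_pinf !actS_0 c d a b.
Qed.

Lemma ends_neq k y y' : ends k y y' -> y != y'.
Proof.
move=> [c0 d0 <- <-]; apply/eqP => D; have := psl_det k.
have : (ca k / cc k - cb k / cd k) * (cc k * cd k) = ca k * cd k - cb k * cc k by field; rewrite c0 d0.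
by rewrite D subrr mul0r => <- /eqP; rewrite eq_sym oner_eq0.
Qed.

(** Along such a geodesic the abscissa moves strictly monotonically from [y'] to [y]; the sign [s]
    treats both directions at once. *)
Lemma ends_side k y y' s t : ends k y y' ->
  [/\ 0 < s * (y - y') -> s * (y' - Re (geo k t)) < 0 /\ 0 < s * (y - Re (geo k t)),
      0 < s * (y - Re (geo k t)) -> 0 < s * (y - y') &
      0 < s * (y - y') -> forall r, t < r -> 0 < s * (Re (geo k r) - Re (geo k t))].
Proof.
move=> [c0 d0 yE yE']; have [H1 H2] := wt_mono c0 d0; have /andP[w0 w1] := H1 t.
have rE r : Re (geo k r) = y' + wt k r * (y - y') by have [] := geo_wt r c0 d0; rewrite yE yE'.
have e1 : s * (y - Re (geo k t)) = (1 - wt k t) * (s * (y - y')) by rewrite rE; ring.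
split.
- move=> p; rewrite e1 mulr_gt0 ?subr_gt0// rE; split=> //.
  rewrite (_ : s * _ = - (wt k t * (s * (y - y')))); last ring.
  by rewrite oppr_lt0 mulr_gt0.
- by rewrite e1 pmulr_rgt0// subr_gt0.
- move=> p r tr; rewrite !rE.
  rewrite (_ : s * _ = (wt k r - wt k t) * (s * (y - y'))); last ring.
  by rewrite mulr_gt0// subr_gt0 ltNge H2 -ltNge.
Qed.

Lemma ends_Wk k y y' t : ends k y y' -> Wk (geo k t) = (y + y') * Re (geo k t) - y * y'.
Proof. by move=> [c0 d0 yE yE']; have [_] := geo_wt t c0 d0; rewrite yE yE'. Qed.

Lemma geo_near k t (V : set R[i]) : nbhs (geo k t) V -> exists2 e : R, 0 < e & forall r, `|t - r| < e -> V (geo k r).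
Proof. by move=> nV; have /nbhs_ballP[e e0 h] := geo_cont nV; exists e => // r hr; exact: (h r). Qed.

Lemma finite_max (E : set R) y : finite_set E -> E y -> exists2 m, E m & forall r, E r -> r <= m.
Proof.
move=> /finite_seqP[L ->]; elim: L y => [//|a L IH] y /= _.
case: L IH => [|b L] IH; first by exists a; rewrite ?mem_head// => r; rewrite inE => /eqP->.
have [m mL mM] := IH b (mem_head b L).
case: (leP m a) => h.
  by exists a; rewrite ?mem_head// => r; rewrite inE => /orP[/eqP->//|/mM rm]; exact: le_trans h.
exists m; first by rewrite inE mL orbT.
by move=> r; rewrite inE => /orP[/eqP->|/mM//]; exact: ltW.
Qed.

End Ends.

Section Cells.
Variables (R : realType) (Gam : set (PSL2 R)).
Hypothesis fuchG : fuchsian Gam.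
Hypothesis cuspG : inf_cuspidal Gam.
Hypothesis condA : condition_A Gam.
Hypothesis geoF : geometrically_finite Gam.
Variables (AA : set (set R[i])).
Hypothesis basal : basal_family Gam AA.
Local Notation clK := (clK Gam).
Local Notation onK := (onK Gam).
Local Notation axisS := (axisS Gam).
Local Notation ivert := (ivert Gam).
Local Notation tset := (tset Gam).
Local Notation cut := (cut Gam).
Local Notation nct := (nct Gam).
Local Notation stt := (stt Gam).
Local Notation tile := (tile Gam).
Local Notation End := (End Gam).
Let GM := GamM fuchG.
Let GV := GamV fuchG.
Let G1 := Gam1 fuchG.
Local Notation onK_clK := (onK_clK fuchG cuspG).
Local Notation onK_KK := (onK_KK fuchG cuspG).
Local Notation onK_ivert := (onK_ivert fuchG cuspG).
Local Notation ivert_KK := (ivert_KK fuchG cuspG).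
Local Notation clK_lin := (clK_lin fuchG cuspG).
Local Notation clK_end := (clK_end fuchG cuspG).
Local Notation noncross := (noncross fuchG cuspG).
Local Notation tile_open := (tile_open fuchG cuspG).
Local Notation tile_int := (tile_int fuchG cuspG).
Local Notation nc_data := (nc_data fuchG cuspG condA).
Local Notation cu_data := (cu_data fuchG cuspG condA).
Local Notation st_data := (st_data fuchG cuspG condA).
Local Notation onK_flip := (onK_flip fuchG).
Local Notation axisS_flip := (axisS_flip fuchG).
Local Notation axisS_tr := (axisS_tr fuchG).
Local Notation axisS_tl := (axisS_tl fuchG).
Local Notation End_tr := (End_tr fuchG).
Local Notation tile_tr := (tile_tr fuchG).
Local Notation AA_tile := (AA_tile fuchG cuspG condA basal).
Local Notation AA_cover_high := (AA_cover_high fuchG cuspG condA basal).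
Local Notation AA_uniq := (AA_uniq fuchG cuspG condA basal).
Local Notation AA_cover := (AA_cover basal).
Local Notation high_KK := (high_KK fuchG cuspG).
Local Notation KK_clK := (KK_clK fuchG cuspG).
Local Notation shift_ex := (shift_ex fuchG cuspG).
Local Notation KK_unip := (KK_unip fuchG).
Local Notation stab_unip := (stab_unip fuchG cuspG).
Local Notation finite_box := (finite_box fuchG).
Local Notation clK_above := (clK_above fuchG cuspG).
Local Notation KK_above := (KK_above fuchG cuspG).
Local Notation KK_stab := (KK_stab fuchG cuspG).
Local Notation cc_min := (cc_min fuchG cuspG).

(** * Gluing of precells along non-vertical sides *)

Section Neighbours.
Implicit Types (g h k t : PSL2 R) (z w p q : R[i]) (X Y e d u s : R) (A B : set R[i]).

Lemma Nm_same g h z : cc g != 0 -> ctr g = ctr h -> cc g ^+ 2 = cc h ^+ 2 -> Nm g z = Nm h z.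
Proof. by move=> c0 ce cE; rewrite !NmC2 ?(cc_neq0 (esym cE))// ce cE. Qed.

Lemma onK_same g h X : Gam h -> ctr g = ctr h -> cc g ^+ 2 = cc h ^+ 2 -> onK g X -> onK h X.
Proof.
move=> Gh ce cE [Gg c0 [z [Kz zX N]]]; split=> //; first by rewrite -(cc_neq0 cE).
by exists z; split=> //; rewrite -(Nm_same _ c0 ce cE).
Qed.

Lemma axisS_onK g e : axisS g e -> onK g e.
Proof. by move=> [_ _ _ [s s0 gX]]; apply: gX; rewrite subrr normr0 ltW. Qed.

Lemma axisS_same g h e : axisS g e -> axisS h e -> ctr g = ctr h /\ cc g ^+ 2 = cc h ^+ 2.
Proof.
move=> ag ah; have [_ _ cg _] := ag; have [_ _ ch _] := ah.
have E : ctr g = ctr h by rewrite cg ch.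
by split=> //; apply: ctr_eq => //; exists e; apply: onK_hg (axisS_onK ag) (axisS_onK ah).
Qed.

(** In Klein coordinates the sphere is a line and [clK] is convex. *)
Lemma onK_convex g X Y Z : onK g X -> onK g Y -> X <= Z <= Y -> onK g Z.
Proof.
move=> gX gY /andP[XZ ZY]; have [Gg c0] := onK_Gam gX.
have [|XY] := eqVneq X Y; first by move=> E; rewrite (_ : Z = X)//; apply/eqP; rewrite eq_le XZ E ZY.
have [l1 K1 N1] := onK_pt gX; have [l2 K2 N2] := onK_pt gY.
have [H1 r1 w1] := ptP l1; have [H2 r2 w2] := ptP l2.
have lt : X < Y by rewrite lt_neqAle XY (le_trans XZ).
pose s := (Z - X) / (Y - X); have n0 : Y - X != 0 by rewrite subr_eq0 eq_sym.
have s0 : 0 <= s by rewrite divr_ge0// subr_ge0// ltW.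
have s1 : s <= 1 by rewrite ler_pdivrMr ?subr_gt0// mul1r lerB.
have ZE : Z = (1 - s) * X + s * Y by rewrite /s; field.
have hE : hg g Z = (1 - s) * hg g X + s * hg g Y by rewrite ZE /hg; ring.
have lt3 : Z ^+ 2 < hg g Z.
  have a1 : (1 - s) * X ^+ 2 <= (1 - s) * hg g X by rewrite ler_wpM2l ?subr_ge0// ltW.
  have a2 : s * Y ^+ 2 <= s * hg g Y by rewrite ler_wpM2l// ltW.
  have a3 : Z ^+ 2 = (1 - s) * X ^+ 2 + s * Y ^+ 2 - s * (1 - s) * (X - Y) ^+ 2 by rewrite ZE; ring.
  have [s2|s2] := ltP 0 s; last first.
    have s3 : s = 0 by apply/eqP; rewrite eq_le s2.
    have -> : Z = X by rewrite ZE s3; ring.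
    by [].
  have a4 : s * Y ^+ 2 < s * hg g Y by rewrite ltr_pM2l.
  have a5 : 0 <= s * (1 - s) * (X - Y) ^+ 2 by apply: mulr_ge0; [apply: mulr_ge0; [|rewrite subr_ge0]|exact: sqr_ge0].
  lra.
have [H3 r3 w3] := ptP lt3.
have W3 : Wk (pt Z (hg g Z)) = hg g (Re (pt Z (hg g Z))) by rewrite w3 r3.
split=> //; exists (pt Z (hg g Z)); split=> //; last exact/Nm_eq1.
apply: (kseg_clK K1 K2 H3); exists s; split=> //.
by rewrite w3 w1 w2.
Qed.

Lemma high_ex X : exists2 z, KK Gam z & Re z = X.
Proof.
have [H H0 HK] := high_KK; exists (X +i* (H + 1)) => //.
by apply: HK; rewrite /HH /= ?ltrDl// addr_gt0.
Qed.

Lemma tile_range A e s d z : tile A e s d -> KK Gam z -> (A z <-> 0 <= s * (Re z - e) <= d).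
Proof.
move=> /tile_set[S d0 ->] Kz; split=> [[]//|h]; split=> //; exact: (KK_clK).
Qed.

(** Near infinity a tile is a full vertical strip, so the set determines its interval, up to the
    choice of the starting end. *)
Lemma tile_inj A e s d e' s' d' : tile A e s d -> tile A e' s' d' ->
  d' = d /\ ((e' = e /\ s' = s) \/ (e' = e + s * d /\ s' = - s)).
Proof.
move=> T T'; have [S d0 _] := tile_set T; have [S' d0' _] := tile_set T'.
have E X : 0 <= s * (X - e) <= d <-> 0 <= s' * (X - e') <= d'.
  have [z Kz <-] := high_ex X; split=> h.
    by apply/(tile_range T' Kz)/(tile_range T Kz).
  by apply/(tile_range T Kz)/(tile_range T' Kz).
have mk x y : x <= y -> (forall X, x <= X <= y <-> 0 <= s * (X - e) <= d) ->
  (s = 1 /\ x = e /\ y = e + d) \/ (s = -1 /\ x = e - d /\ y = e).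
  move=> xy H; case: S H => -> H; [left|right].
    have /andP[h1 h2] : x <= e <= y by apply/H; apply/andP; split; lra.
    have /andP[h3 h4] : x <= e + d <= y by apply/H; apply/andP; split; lra.
    have /H/andP[h5 h6] : x <= x <= y by rewrite lexx.
    have /H/andP[h7 h8] : x <= y <= y by rewrite lexx xy.
    by split=> //; split; lra.
  have /andP[h1 h2] : x <= e <= y by apply/H; apply/andP; split; lra.
  have /andP[h3 h4] : x <= e - d <= y by apply/H; apply/andP; split; lra.
  have /H/andP[h5 h6] : x <= x <= y by rewrite lexx.
  have /H/andP[h7 h8] : x <= y <= y by rewrite lexx xy.
  by split=> //; split; lra.
case: S' => S'; rewrite S' in E *.
  have [||[-> [h1 h2]]|[-> [h1 h2]]] := mk e' (e' + d'); [lra| | |].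
  - by move=> X; rewrite E; split=> /andP[a b]; apply/andP; split; lra.
  - by split; [lra|left; split=> //; lra].
  - by split; [lra|right; split; lra].
have [||[-> [h1 h2]]|[-> [h1 h2]]] := mk (e' - d') e'; [lra| | |].
- by move=> X; rewrite E; split=> /andP[a b]; apply/andP; split; lra.
- by split; [lra|right; split; lra].
- by split; [lra|left; split=> //; lra].
Qed.

Lemma tile_axis A e s d g : tile A e s d -> axisS g e ->
  (exists u h p, nct A e s d u g h p) \/ cut A e s d g.
Proof.
move=> T ag; have oe := axisS_onK ag; have [Gg c0 ce _] := ag.
case: T => [[u [g0 [h [p [a [[ag0 b c dd] [e1 e2 e3 e4]]]]]]]|[g0 [a [ag0 b c dd]]]|[g0 [a [_ b _ _]]]|[[S d0 _] [iv _ _]]].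
- have [cE cE2] := axisS_same ag0 ag; have [_ c00 _ _] := ag0.
  left; exists u, h, p; split=> //; split; split=> //.
    by move=> X /c; exact: onK_same.
  by rewrite -(Nm_same _ c00 cE cE2).
- have [cE cE2] := axisS_same ag0 ag; have [_ c00 _ _] := ag0.
  right; split=> //; split=> //.
    by rewrite c; congr (_^-1); apply/eqP; rewrite -(@eqrXn2 _ 2)// !real_normK ?num_real// cE2.
  by move=> X /dd; exact: onK_same.
- by exfalso; apply: (onK_ivert oe); rewrite mulNr addrK in b.
- exfalso; apply: (onK_ivert oe); apply: iv.
  by rewrite subrr mulr0 lexx ltW.
Qed.

(* The arc of the sphere of [g] in the boundary of [KK Gam] starts at its summit,
   over [e], and extends in direction [s] exactly up to the abscissa [e + s * u]. *)
Definition amax g e s u := 0 < u /\ (forall X, 0 <= s * (X - e) < u -> onK g X) /\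
  forall X, u < s * (X - e) -> ~ onK g X.

Lemma amax_uniq g e s u u' : sg s -> amax g e s u -> amax g e s u' -> u = u'.
Proof.
have key v v' : sg s -> amax g e s v -> amax g e s v' -> v' <= v.
  move=> S [v0 [a b]] [v0' [a' b']]; rewrite leNgt; apply/negP => lt.
  have E (x : R) : s * (e + s * x - e) = x by rewrite addrC addKr mulrA sg2// mul1r.
  by apply: (b (e + s * ((v + v') / 2))); [|apply: a']; rewrite E; [|apply/andP; split]; lra.
by move=> S a b; apply/eqP; rewrite eq_le; apply/andP; split; apply: key.
Qed.

Lemma amax_flip g e s u : ctr g = e -> Gam g -> cc g != 0 -> amax g e s u -> amax g^-1%g (pol g) (- s) u.
Proof.
move=> ce Gg c0 [u0 [a b]].
have E2 X : - s * (X - pol g) = s * (e - (X - pol g) - e) by ring.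
split=> //; split=> X.
  rewrite E2 => /a /(onK_flip); rewrite ce (_ : pol g - _ = X)//; ring.
rewrite E2 => /b nX /(onK_flip); rewrite invgK (ctrV _).1 (ctrV _).2 ce; exact.
Qed.

Lemma nct_amax A e s d u g h p : nct A e s d u g h p -> amax g e s u /\ onK g (e + s * u).
Proof.
move=> [[S u0 ud _] [[ag ah gX hX] _]]; have [_ _ cg _] := ag; have [_ _ ch _] := ah.
have E (x : R) : s * (e + s * x - e) = x by rewrite addrC addKr mulrA sg2// mul1r.
split; last by apply: gX; rewrite E lexx ltW.
split=> //; split=> [X /andP[x1 x2]|X xu oX]; first by apply: gX; rewrite x1 ltW.
pose m := Num.min (s * (X - e)) d.
have m1 : u < m by rewrite lt_min xu ud.
have [m2 m3] : m <= s * (X - e) /\ m <= d by rewrite !ge_min !lexx orbT.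
have oe := axisS_onK ag.
have gm x : 0 <= x <= m -> onK g (e + s * x).
  move=> /andP[x0 xm]; case: S m2 xm => sE; rewrite sE => m2 xm.
    by apply: (onK_convex oe oX); apply/andP; split; lra.
  by apply: (onK_convex oX oe); apply/andP; split; lra.
have [||||| cE _] := @onK2_ctr R Gam g h (e + s * u) (e + s * m).
- by apply: gm; apply/andP; split; lra.
- by apply: hX; rewrite E; apply/andP; split; lra.
- by apply: gm; apply/andP; split; lra.
- by apply: hX; rewrite E; apply/andP; split; lra.
- by apply/eqP => ee; have := E u; rewrite ee E; lra.
have := E d; rewrite -ch -cE cg subrr mulr0; lra.
Qed.

Lemma cut_amax A e s d g : cut A e s d g -> amax g e s d.
Proof.
move=> [[S d0 _] [ag iv _ gX]]; split=> //; split=> // X xd oX; have oe := axisS_onK ag.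
apply: (onK_ivert _ iv).
case: S iv xd => sE; rewrite sE => iv xd.
  by apply: (onK_convex oe oX); apply/andP; split; lra.
by apply: (onK_convex oX oe); apply/andP; split; lra.
Qed.

(** Each precell is labelled by a summit, translated into [0, rho], and a tag: 0 or 1 for the summit
    over its left or right end, and 2 for a strip, where the summit of the arc ending at its left
    end is taken. Precells with equal labels overlap after translation, so they are equal by
    [AA_uniq]. *)
Lemma finite_AA : finite_set AA.
Proof.
have [rho r0 sh] := shift_ex; have fx := finite_axes fuchG cuspG rho geoF.
pose spec A (u : R * nat) := exists e d t, [/\ Gam t, unip t, tile A e 1 d & 0 <= u.1 <= rho] /\
  ((exists h, axisS h e) /\ u.1 = e + tau t /\ u.2 = 0%N \/
   (exists h, axisS h (e + d)) /\ u.1 = e + d + tau t /\ u.2 = 1%N \/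
   (exists e' d' h, [/\ cut (tset e' 1 d') e' 1 d' h, e' + d' = e, u.1 = e' + tau t & u.2 = 2%N])).
have ex A : AA A -> exists u : R * nat, spec A u.
  move=> /(AA_tile)[e [d T]].
  have [_ d0 _] := tile_set T.
  have C : (exists h, axisS h e) \/ (exists h, axisS h (e + d)) \/
     (exists e' d' h, cut (tset e' 1 d') e' 1 d' h /\ e' + d' = e).
    case: T => [[u [g0 [h [p [a [[ag0 b c dd] _]]]]]]|[g0 [a [ag0 b c dd]]]|[g0 [a [ag _ _ _]]]|[_ [_ [e' [d' [g [c E]]]] _]]].
    - by left; exists g0.
    - by left; exists g0.
    - by right; left; exists g0; rewrite mul1r in ag.
    - by right; right; exists e', d', g; rewrite mul1r in E.
  case: C => [c|[c|[e' [d' [h [c E]]]]]].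
  - have [t Gt [ut tr]] := sh e; exists (e + tau t, 0%N), e, d, t; split=> //; by left.
  - have [t Gt [ut tr]] := sh (e + d); exists (e + d + tau t, 1%N), e, d, t; split=> //; by right; left.
  - have [t Gt [ut tr]] := sh e'; exists (e' + tau t, 2%N), e, d, t; split=> //; right; right.
    by exists e', d', h.
have /choice[f fP] : forall A, exists u : R * nat, AA A -> spec A u.
  move=> A; have [AAA|n] := pselect (AA A); last by exists (0, 0%N).
  by have [u] := ex A AAA; exists u.
have fB : finite_set ([set e | 0 <= e <= rho /\ exists g, axisS g e] `*` `I_3) by apply: finite_setX.
apply: (finite_inj (f := f) fB) => [A AAA|A A' AAA AAA' fE].
  have [e [d [t [[Gt ut T r] C]]]] := fP A AAA; split.
    split=> //; case: C => [[[h ah] [-> _]]|[[[h ah] [-> _]]|[e' [d' [h [[_ [ah _ _ _]] _ -> _]]]]]].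
    - by exists (h * t^-1)%g; exact: axisS_tr.
    - by exists (h * t^-1)%g; exact: axisS_tr.
    - by exists (h * t^-1)%g; exact: axisS_tr.
  by case: C => [[_ [_ ->]]|[[_ [_ ->]]|[e' [d' [h [_ _ _ ->]]]]]].
have [e [d [t [[Gt ut T r] C]]]] := fP A AAA; have [e' [d' [t' [[Gt' ut' T' r'] C']]]] := fP A' AAA'.
rewrite -fE in C'.
have [_ d0 _] := tile_set T; have [_ d0' _] := tile_set T'.
have [uV tV] := unipV ut'; have [uM tM] := unipM uV ut.
have GT : Gam (t'^-1 * t)%g by apply: GM => //; exact: GV.
pose m := Num.min d d' / 2.
have mm : 0 < Num.min d d' by rewrite lt_min d0.
have [md md'] : Num.min d d' <= d /\ Num.min d d' <= d' by rewrite !ge_min !lexx orbT.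
suff [X [x1 x2]] : exists X, e < X < e + d /\ e' < X + tau (t'^-1 * t)%g < e' + d'.
  by have [_ ->] := AA_uniq AAA AAA' T T' GT uM x1 x2.
rewrite tM tV.
case: C C' => [[_ [a b]]|[[_ [a b]]|[x [y [h [c1 E1 a b]]]]]] [[_ [a' b']]|[[_ [a' b']]|[x' [y' [h' [c1' E1' a' b']]]]]];
  try (by rewrite b in b').
- by exists (e + m); split; apply/andP; split; rewrite /m; lra.
- by exists (e + d - m); split; apply/andP; split; rewrite /m; lra.
(* For strips the summits agree after translation; the spheres then have equal radii, hence the left
   ends agree too. *)
- exists (e + m); suff : y = y' by rewrite /m => E; split; apply/andP; split; lra.
  have [_ [ax _ dE _]] := c1; have [_ [ax' _ dE' _]] := c1'.
  have ax2 := axisS_tr Gt ut ax; have ax2' := axisS_tr Gt' ut' ax'.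
  rewrite -a a' in ax2; have [_ cE] := axisS_same ax2 ax2'.
  have [_ _ q1] := unipMr h ut; have [_ _ q2] := unipMr h' ut'; rewrite q1 q2 in cE.
  by rewrite dE dE'; congr (_^-1); apply/eqP; rewrite -(@eqrXn2 _ 2)// !real_normK ?num_real// cE.
Qed.

Lemma AA_nonempty : exists A, AA A.
Proof. by have [_ [A [_ [_ A0 _ _]]]] := AA_cover (HH_i (0 : R)); exists A. Qed.

Lemma act_img1 g A : (forall z, A z -> HH z) -> act g^-1%g @` (act g @` A) = A.
Proof.
move=> AH; apply/seteqP; split=> [_ [_ [z Az <-] <-]|z Az]; first by rewrite actK//; exact: AH.
by exists (act g z); [exists z|rewrite actK//; exact: AH].
Qed.

Lemma tile_HH A e s d : tile A e s d -> forall z, A z -> HH z.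
Proof. by move=> T z /(tile_clK T)[]. Qed.

(** Finiteness of the family gives a positive lower bound [d0] for the widths, so that intervals
    cannot accumulate at an end. *)
Lemma cover_line : exists2 d0 : R, 0 < d0 & forall X, exists t A l d,
  [/\ Gam t, unip t, AA A & tile (act t @` A) l 1 d] /\ (d0 <= d /\ l <= X <= l + d).
Proof.
have [|ds dsP] := finite_choice (U := R) (P := fun A d => exists e, tile A e 1 d) finite_AA.
  by move=> A /(AA_tile)[e [d T]]; exists d, e.
pose ds' := [seq d <- ds | 0 < d].
have [A0 AA0] := AA_nonempty; have [x0 x0s [e0 T0]] := dsP _ AA0.
have x0s' : x0 \in ds' by have [_ d0 _] := tile_set T0; rewrite mem_filter d0.
have [d0 d0s dm] := seq_min x0s'.
exists d0; first by move: d0s; rewrite mem_filter => /andP[].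
have [H H0 HP] := AA_cover_high.
move=> X; have [|Kz [t [A [e1 [d1 [Gt ut AAA T' r]]]]]] := HP (X +i* (H + 1)); first by rewrite /= ltrDl.
have [d dd [e T]] := dsP _ AAA; have [uV tV] := unipV ut; have GtV := GV Gt.
have [_ dp _] := tile_set T.
have Hz : HH (X +i* (H + 1)) by case: Kz.
have Ktz := KK_unip Gt ut Hz Kz.
have tz : 0 <= 1 * (Re (act t (X +i* (H + 1))) - e) <= d.
  apply/(tile_range T Ktz)/(tile_range T' Ktz).
  by move/andP: r => [? ?]; apply/andP; split; lra.
exists t^-1%g, A, (e - tau t), d; split.
  by split=> //; rewrite -tV; apply: tile_tr.
split; first by apply: dm; rewrite mem_filter dp dd.
have [rr _] := unip_act ut Hz; rewrite rr /= in tz.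
by move/andP: tz => [? ?]; apply/andP; split; lra.
Qed.

Lemma adjacent e s : End e -> sg s -> exists t A d, [/\ Gam t, unip t, AA A & tile (act t @` A) e s d].
Proof.
move=> Ee S; have [d0 d00 cov] := cover_line.
have outside B l d e' : tile B l 1 d -> End e' -> e' <= l \/ l + d <= e'.
  move=> T E'; have [h|h] := leP e' l; [by left|right]; rewrite leNgt; apply/negP => h'.
  by apply: (tile_open T _ E'); apply/andP; split; lra.
case: S => ->.
  have [t [A [l [d [[Gt ut AAA T] [dd /andP[x1 x2]]]]]]] := cov (e + d0 / 2).
  have [_ dp _] := tile_set T.
  have el : e <= l by case: (outside _ _ _ _ T Ee) => //; lra.
  move: el; rewrite le_eqVlt => /orP[/eqP->|el]; first by exists t, A, d.
  (* If the interval containing [e + d0 / 2] started strictly after [e], the interval over the gap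
     would be enclosed between two ends less than [d0] apart. *)
  exfalso; have [t2 [A2 [l2 [d2 [[_ _ _ T2] [dd2 /andP[y1 y2]]]]]]] := cov ((e + l) / 2).
  have [_ dp2 _] := tile_set T2.
  have el2 : e <= l2 by case: (outside _ _ _ _ T2 Ee) => //; lra.
  by case: (outside _ _ _ _ T2 (tile_end T)); lra.
have [t [A [l [d [[Gt ut AAA T] [dd /andP[x1 x2]]]]]]] := cov (e - d0 / 2).
have [_ dp _] := tile_set T.
have el : l + d <= e by case: (outside _ _ _ _ T Ee) => //; lra.
move: el; rewrite le_eqVlt => /orP[/eqP<-|el].
  by exists t, A, d; split=> //; have := tile_sym T; rewrite mul1r.
exfalso; have [t2 [A2 [l2 [d2 [[_ _ _ T2] [dd2 /andP[y1 y2]]]]]]] := cov ((e + (l + d)) / 2).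
have [_ dp2 _] := tile_set T2.
have el2 : l2 + d2 <= e by case: (outside _ _ _ _ T2 Ee) => //; lra.
have E2 := tile_end2 T; rewrite mul1r in E2.
by case: (outside _ _ _ _ T2 E2); lra.
Qed.

Lemma tile_side_uniq A A' t e s d d' : AA A -> AA A' -> Gam t -> unip t ->
  tile A e s d -> tile A' (e + tau t) s d' -> t = 1%g /\ A = A'.
Proof.
move=> AAA AAA' Gt ut T T'; have [S d0 _] := tile_set T; have [_ d0' _] := tile_set T'.
pose m := Num.min d d' / 2.
have mm : 0 < Num.min d d' by rewrite lt_min d0.
have [md md'] : Num.min d d' <= d /\ Num.min d d' <= d' by rewrite !ge_min !lexx orbT.
case: S T T' => sE; rewrite sE => T T'.
  by apply: (AA_uniq AAA AAA' T T' Gt ut (X := e + m)); apply/andP; split; rewrite /m; lra.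
have T2 := tile_sym T; have T2' := tile_sym T'; rewrite opprK in T2 T2'.
by apply: (AA_uniq AAA AAA' T2 T2' Gt ut (X := e - m)); apply/andP; split; rewrite /m; lra.
Qed.

(* [A'] is glued by [h] to the precell that starts at [e] in direction [s], along
   the non-vertical side with summit over [e]. *)
Definition nbr e s h A' d' := [/\ axisS h e, AA A' & tile A' (pol h) (- s) d'].

(** [g] reverses the direction at the summit, so the tile starting at [pol g] in direction [- s] is
    the neighbour; a translation brings it into the family and is absorbed into [h]. *)
Lemma nbr_ex e s g : axisS g e -> sg s -> exists h A' d', nbr e s h A' d'.
Proof.
move=> ag S; have [Gg c0 ce _] := ag; have ax := axisS_flip ag.
have [|t [A [d [Gt ut AAA T]]]] := adjacent (e := pol g) _ (sgN S); first by left; exists g^-1%g.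
have [uV tV] := unipV ut; have GtV := GV Gt; have [_ pE _] := unipMl g uV.
exists (t^-1 * g)%g, A, d; split=> //; first exact: axisS_tl.
rewrite pE// tV.
have := tile_tr GtV uV T; rewrite tV (_ : act t^-1%g @` (act t @` A) = A)//.
apply: act_img1 => z Az.
by have [e' [d' T']] := AA_tile AAA; apply: (tile_HH T').
Qed.

(** Both elements send [e] to infinity, hence differ by a translation, and the family contains only
    one translate of the neighbour. *)
Lemma nbr_uniq e s h A d h' A' d' : nbr e s h A d -> nbr e s h' A' d' -> h = h' /\ A = A'.
Proof.
move=> [ah AAA T] [ah' AAA' T']; have [Gh c0 ce _] := ah; have [Gh' c0' ce' _] := ah'.
have Gk : Gam (h' * h^-1)%g by apply: GM => //; exact: GV.
have ck : cc (h' * h^-1)%g = 0.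
  have [x [x1 _ _ -> _]] := pslM_coef h' h^-1%g; have [y [y1 -> _ -> _]] := pslV_coef h.
  have E : cd h = - cc h * ctr h by rewrite /ctr; field.
  have E' : cd h' = - cc h' * ctr h' by rewrite /ctr; field.
  by rewrite E E' ce ce'; ring.
have uk := stab_unip Gk ck.
have hE : h' = (h' * h^-1 * h)%g by rewrite mulgVK.
have [_ pE _] := unipMl h uk; rewrite -hE in pE; rewrite pE// in T'.
have [k1 AE] := tile_side_uniq AAA AAA' Gk uk T T'.
by split=> //; rewrite hE k1 mul1g.
Qed.

Lemma nbr_sym A e s d h A' d' : AA A -> tile A e s d -> nbr e s h A' d' -> nbr (pol h) (- s) h^-1%g A d.
Proof.
move=> AAA T [ah AAA' T']; have [_ _ ce _] := ah.
split; [exact: (axisS_flip ah)|by []|].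
by rewrite (ctrV _).2 ce opprK.
Qed.

End Neighbours.

(** * Non-vertical sides and assigned elements *)

Section Sides.
Implicit Types (g h k t : PSL2 R) (z w p q : R[i]) (X Y e d u s : R) (A B : set R[i]).

Definition sideset e s u g : set R[i] := [set z | [/\ HH z, Nm g z = 1 & 0 <= s * (Re z - e) <= u]].

Lemma sg_at e s (x : R) : sg s -> s * (e + s * x - e) = x.
Proof. by move=> S; rewrite addrC addKr mulrA sg2// mul1r. Qed.

Lemma sg_at' e s X : sg s -> X = e + s * (s * (X - e)).
Proof. by move=> S; rewrite mulrA sg2// mul1r addrC subrK. Qed.

Lemma arc_side g e s u z : cc g != 0 -> ctr g = e -> sg s -> 0 < u -> 0 <= Im z ->
  Re z = e + s * u -> Wk z = hg g (Re z) -> gseg (fin (summit g)) (fin z) = sideset e s u g.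
Proof.
move=> c0 ce S u0 z0 rz wz; have [S1 S2 S3 S4] := summitP c0.
have hS X : hg g X = 2 * e * X - (e ^+ 2 - (cc g ^+ 2)^-1) by rewrite /hg ce; ring.
have W1 : Wk (summit g) = 2 * e * Re (summit g) - (e ^+ 2 - (cc g ^+ 2)^-1) by rewrite S4 hS S2 ce.
rewrite hS in wz; have R1 : Re (summit g) = e by rewrite S2 ce.
have nW p : (Wk p = 2 * e * Re p - (e ^+ 2 - (cc g ^+ 2)^-1)) <-> Nm g p = 1.
  by rewrite -hS; split=> /Nm_eq1; exact.
apply/seteqP; split=> p; case: S rz => -> rz.
- move=> /(gseg_circ p (ltW S1) z0 _ W1 wz); rewrite R1 rz => -[|Hp wp /andP[h1 h2]]; first by lra.
  by split=> //; [apply/nW|apply/andP; split; lra].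
- move=> /gseg_sym /(gseg_circ p z0 (ltW S1) _ wz W1); rewrite R1 rz => -[|Hp wp /andP[h1 h2]]; first by lra.
  by split=> //; [apply/nW|apply/andP; split; lra].
- move=> [Hp /nW wp /andP[h1 h2]]; apply/(gseg_circ p (ltW S1) z0 _ W1 wz); first by rewrite R1 rz; lra.
  by split=> //; rewrite R1 rz; apply/andP; split; lra.
- move=> [Hp /nW wp /andP[h1 h2]]; apply: gseg_sym; apply/(gseg_circ p z0 (ltW S1) _ wz W1); first by rewrite R1 rz; lra.
  by split=> //; rewrite R1 rz; apply/andP; split; lra.
Qed.

Lemma nct_side A e s d u g h p : nct A e s d u g h p -> gseg (fin (summit g)) (fin p) = sideset e s u g.
Proof.
move=> [[S u0 ud _] [[[Gg c0 cg _] _ _ _] [[Hp _] rp n1 _]]].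
by apply: arc_side => //; [exact: ltW|apply/Nm_eq1].
Qed.

Lemma cut_radius e s d g : sg s -> cc g != 0 -> ctr g = e -> d = `|cc g|^-1 -> hg g (e + s * d) = (e + s * d) ^+ 2.
Proof.
move=> S c0 ce dE; rewrite hgE ce (_ : e + s * d - e = s * d); last ring.
by rewrite exprMn [s ^+ 2]expr2 sg2// mul1r dE exprVn real_normK ?num_real// subrr addr0.
Qed.

Lemma cut_side A e s d g : cut A e s d g -> gseg (fin (summit g)) (fin (e + s * d)%:C) = sideset e s d g.
Proof.
move=> [[S d0 _] [[Gg c0 cg _] _ dE _]]; apply: arc_side => //.
by rewrite cut_radius// /Wk /= expr0n addr0.
Qed.

Lemma nct_tile A e s d u g h p : nct A e s d u g h p -> tile A e s d.
Proof. by move=> n; constructor 1; exists u, g, h, p. Qed.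

Lemma cut_tile A e s d g : cut A e s d g -> tile A e s d.
Proof. by move=> n; constructor 2; exists g. Qed.

Lemma nct_no_ivert A e s d u g h p x s' d' : nct A e s d u g h p -> tile A x s' d' -> ~ ivert x.
Proof.
move=> n T iv; have [_ [[ag ah _ _] _]] := n.
have [_ [[xe _]|[xe _]]] := tile_inj (nct_tile n) T; rewrite xe in iv.
  exact: (onK_ivert (axisS_onK ag) iv).
exact: (onK_ivert (axisS_onK ah) iv).
Qed.

Lemma cut_tile2 A e s d g : cut A e s d g -> tile A (e + s * d) (- s) d /\ ivert (e + s * d).
Proof. by move=> c; split; [exact: (tile_sym (cut_tile c))|case: c => _ []]. Qed.

Lemma nct_cut A e s d u g h p e' s' d' g' : nct A e s d u g h p -> cut A e' s' d' g' -> False.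
Proof. by move=> n /cut_tile2[T iv]; exact: (nct_no_ivert n T iv). Qed.

Lemma stt_tile A e s d : stt A e s d -> tile A e s d /\ (forall x s' d', tile A x s' d' -> ivert x).
Proof.
move=> st; have T : tile A e s d by constructor 4.
split=> // x s' d' T'; have [[S d0 _] [iv _ _]] := st.
have [_ [[-> _]|[-> _]]] := tile_inj T T'; apply: iv.
  by rewrite subrr mulr0 lexx ltW.
by rewrite sg_at// lexx ltW.
Qed.

Lemma nct_stt A e s d u g h p e' s' d' : nct A e s d u g h p -> stt A e' s' d' -> False.
Proof. by move=> n /stt_tile[T iv]; exact: (nct_no_ivert n T (iv _ _ _ T)). Qed.

Lemma cut_stt A e s d g e' s' d' : cut A e s d g -> stt A e' s' d' -> False.
Proof.
move=> c /stt_tile[T iv]; have [_ [ag _ _ _]] := c.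
exact: (onK_ivert (axisS_onK ag) (iv _ _ _ (cut_tile c))).
Qed.

Lemma summit_same g h : ctr g = ctr h -> cc g ^+ 2 = cc h ^+ 2 -> summit g = summit h.
Proof.
move=> ce cE; rewrite /summit ce (_ : `|cc g| = `|cc h|)//; apply/eqP.
by rewrite -(@eqrXn2 _ 2)// !real_normK ?num_real// cE.
Qed.

Lemma axis_amax_same g g' e s u u' : axisS g e -> axisS g' e -> sg s -> amax g e s u -> amax g' e s u' -> u = u'.
Proof.
move=> ag ag' S a [u0' [b c]]; have [cE cE2] := axisS_same ag ag'; have [Gg _ _ _] := ag.
apply: (amax_uniq S a); split=> //; split=> X h; first by apply: (onK_same _ (esym cE) (esym cE2)) => //; exact: b.
by move=> /(onK_same _ cE cE2) h'; apply: (c X h); apply: h'; case: ag'.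
Qed.

Lemma nct_uniq A e s d u g h p d' u' g' h' p' : nct A e s d u g h p -> nct A e s d' u' g' h' p' ->
  [/\ u = u', d = d', p = p', summit g = summit g' & summit h = summit h'].
Proof.
move=> n n'; have [[S u0 ud _] [[ag ah _ _] [[Hp _] rp n1 _]]] := n.
have [[_ _ _ _] [[ag' ah' _ _] [[Hp' _] rp' n1' _]]] := n'.
have [a _] := nct_amax n; have [a' _] := nct_amax n'.
have uE := axis_amax_same ag ag' S a a'.
have [dE _] := tile_inj (nct_tile n) (nct_tile n').
have [cE cE2] := axisS_same ag ag'; rewrite dE in ah'; have [hE hE2] := axisS_same ah ah'.
have [_ c0 _ _] := ag; have [_ c0' _ _] := ag'.
split=> //; [|exact: summit_same|exact: summit_same].
apply: pt_eq => //; first by rewrite rp rp' uE.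
rewrite ((Nm_eq1 _ c0).1 n1) ((Nm_eq1 _ c0').1 n1') rp rp' uE /hg cE cE2 //.
Qed.

Lemma nct_precell A e s d u g h p : AA A -> nct A e s d u g h p ->
  noncuspidal_precell Gam (fin p) (summit g) (summit h) A \/
  noncuspidal_precell Gam (fin p) (summit h) (summit g) A.
Proof.
move=> AAA n; case: basal => + _ => /(_ A AAA)[[v [s1 [s2 N]]]|[v [s' N]]|[v1 [v2 N]]]; last 2 first.
- have [e0 [s0 [d0 [g0 [c _ _]]]]] := cu_data N; by case: (nct_cut n c).
- by have st := st_data N; case: (nct_stt n st).
have [e0 [s0 [d0 [u0 [g0 [h0 [p0 [n0 vE s1E s2E]]]]]]]] := nc_data N.
have [dE [[eE sE]|[eE sE]]] := tile_inj (nct_tile n) (nct_tile n0).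
  rewrite eE sE in n0; have [_ _ pE gE hE] := nct_uniq n n0.
  by left; rewrite pE gE hE -s1E -s2E -vE.
have n1 := nct_sym n; rewrite eE sE in n0; have [_ _ pE gE hE] := nct_uniq n1 n0.
by right; rewrite pE gE hE -s1E -s2E -vE.
Qed.

Lemma cut_precell A e s d g : AA A -> cut A e s d g ->
  cuspidal_precell Gam (fin (e + s * d)%:C) (summit g) A.
Proof.
move=> AAA c; case: basal => + _ => /(_ A AAA)[[v [s1 [s2 N]]]|[v [s' N]]|[v1 [v2 N]]].
- have [e0 [s0 [d0 [u0 [g0 [h0 [p0 [n0 _ _ _]]]]]]]] := nc_data N.
  by case: (nct_cut n0 c).
- have [e0 [s0 [d0 [g0 [c0 vE sE]]]]] := cu_data N.
  have [_ [ag iv _ _]] := c; have [_ [ag0 iv0 _ _]] := c0.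
  have [dE [[eE sE']|[eE sE']]] := tile_inj (cut_tile c) (cut_tile c0).
    rewrite eE in ag0; have [cE cE2] := axisS_same ag ag0.
    by rewrite (summit_same cE cE2) -sE -dE -eE -sE' -vE.
  by case: (onK_ivert (axisS_onK ag0)); rewrite eE.
- by have st := st_data N; case: (cut_stt c st).
Qed.

Lemma nvs_data A b : nonvertical_side Gam A b -> exists e s d u g,
  [/\ tile A e s d, axisS g e, amax g e s u & b = sideset e s u g].
Proof.
case=> [[v [s1 [s2 [N H]]]]|[v [s' [N H]]]]; last first.
  have [e [s [d [g [c vE sE]]]]] := cu_data N.
  exists e, s, d, d, g; split; [exact: (cut_tile c)|by case: c => _ []|exact: (cut_amax c)|].
  by rewrite H vE sE (cut_side c).
have [e [s [d [u [g [h [p [n vE s1E s2E]]]]]]]] := nc_data N.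
case: H => ->.
  exists e, s, d, u, g; split; [exact: (nct_tile n)|by case: n => _ [[]]|by case: (nct_amax n)|].
  by rewrite vE s1E (nct_side n).
have n' := nct_sym n; exists (e + s * d), (- s), d, (d - u), h; split; [exact: (nct_tile n')|by case: n' => _ [[]]|by case: (nct_amax n')|].
by rewrite vE s2E (nct_side n').
Qed.

Lemma nvs_intro A e s d u g : AA A -> tile A e s d -> axisS g e -> amax g e s u ->
  nonvertical_side Gam A (sideset e s u g).
Proof.
move=> AAA T ag a; have [S _ _] := tile_set T.
case: (tile_axis T ag) => [[u' [h [p n]]]|c]; last first.
  have uE := amax_uniq S a (cut_amax c); rewrite uE.
  right; exists (fin (e + s * d)%:C), (summit g); split; first exact: cut_precell.
  by rewrite (cut_side c).
have uE := amax_uniq S a (nct_amax n).1; rewrite uE -(nct_side n); left.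
case: (nct_precell AAA n) => N; first by exists (fin p), (summit g), (summit h); split=> //; left.
by exists (fin p), (summit h), (summit g); split=> //; right.
Qed.

Lemma side_img e s u g : cc g != 0 -> ctr g = e ->
  act g @` sideset e s u g = sideset (pol g) (- s) u g^-1%g.
Proof.
move=> c0 ce; apply/seteqP; split=> z.
  move=> [w [Hw N /andP[h1 h2]] <-]; split; first exact: HH_act.
    by rewrite NmV// N invr1.
  by rewrite Re_actC// N divr1 ce; apply/andP; split; lra.
move=> [Hz N /andP[h1 h2]]; exists (act g^-1%g z); last by rewrite actKV.
split; first exact: HH_act.
  by rewrite -[g in Nm g]invgK NmV// N invr1.
rewrite Re_actC ?(ccV _).1// N divr1 (ctrV _).1 (ctrV _).2 ce; apply/andP; split; lra.
Qed.

Lemma axisS_transfer g h e : axisS g e -> Gam h -> ctr g = ctr h -> cc g ^+ 2 = cc h ^+ 2 -> axisS h e.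
Proof.
move=> [Gg c0 ce [s s0 gX]] Gh cE cE2; split=> //; rewrite -?cE//; first by rewrite -(cc_neq0 cE2).
by exists s => // X /gX; exact: onK_same.
Qed.

Lemma side_circle e s u g k : sg s -> cc g != 0 -> cc k != 0 -> amax g e s u ->
  (sideset e s u g `<=` [set z | Nm k z = 1]) -> ctr g = ctr k /\ cc g ^+ 2 = cc k ^+ 2.
Proof.
move=> S c0 k0 [u0 [a _]] sub.
have pk (x : R) : 0 <= x < u -> hg g (e + s * x) = hg k (e + s * x).
  move=> /andP[x0 x1]; have oX : onK g (e + s * x) by apply: a; rewrite sg_at// x0.
  have [l K N] := onK_pt oX; have [H r w] := ptP l.
  have /(Nm_eq1 _ k0) : Nm k (pt (e + s * x) (hg g (e + s * x))) = 1.
    by apply: sub; split=> //; rewrite r sg_at// x0 ltW.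
  by rewrite w r.
have e1 := pk 0 ltac:(by rewrite lexx).
have e2 := pk (u / 2) ltac:(by apply/andP; split; lra).
have cE : ctr g = ctr k.
  have : (ctr g - ctr k) * (s * u) = 0 by move: e1 e2; rewrite /hg !mulr0 !addr0; lra.
  have su : s * u != 0 by rewrite mulf_neq0 ?(gt_eqF u0)//; case: S => ->; rewrite ?oppr_eq0 oner_eq0.
  by move/eqP; rewrite mulf_eq0 (negPf su) orbF subr_eq0 => /eqP.
by split=> //; apply: ctr_eq => //; exists (e + s * 0).
Qed.

Lemma side_dir e s u g s' u' g' : sg s -> sg s' -> amax g e s u ->
  (sideset e s u g `<=` sideset e s' u' g') -> s' = s.
Proof.
move=> S S' [u0 [a _]] sub.
have oX : onK g (e + s * (u / 2)) by apply: a; rewrite sg_at//; apply/andP; split; lra.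
have [l K N] := onK_pt oX; have [H r w] := ptP l.
have [_ _ /andP[h _]] : sideset e s' u' g' (pt (e + s * (u / 2)) (hg g (e + s * (u / 2)))).
  by apply: sub; split=> //; rewrite r sg_at//; apply/andP; split; lra.
rewrite r addrC addKr in h; case: S h => ->; case: S' => -> //; lra.
Qed.

(** With its converse [nbr_assigned] this replaces assigned elements by [nbr]. The side lies on the
    circle of [g] and on that of the precell, so both have the same centre and radius; inclusion of
    the image in the other side fixes the direction. *)
Lemma assigned_nbr A b g A' : assigned_at Gam AA A b g A' -> exists e s d d' u,
  [/\ tile A e s d, nbr e s g A' d', amax g e s u & b = sideset e s u g].
Proof.
move=> [nb /hypP[Gg c0] bI AAA' nb'].
have [e [s [d [u [g0 [T ag0 a bE]]]]]] := nvs_data nb; have [S d0 _] := tile_set T.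
have [Gg0 c00 cg0 _] := ag0.
have sub : sideset e s u g0 `<=` [set z | Nm g z = 1] by rewrite -bE => z /bI/isosphereE[].
have [cE cE2] := side_circle S c00 c0 a sub.
have ag : axisS g e by exact: axisS_transfer cE cE2.
have [_ _ cg _] := ag.
have bE' : b = sideset e s u g.
  rewrite bE; apply/seteqP; split=> z [Hz N h]; split=> //; by move: N; rewrite (Nm_same z c00 cE cE2).
have a' : amax g e s u.
  have [u0 [b1 b2]] := a; split=> //; split=> X h; first by apply: (onK_same Gg cE cE2); exact: b1.
  by move=> /(onK_same Gg0 (esym cE) (esym cE2)); exact: b2.
rewrite bE' side_img// in nb'.
have [e' [s' [d' [u' [g' [T' ag' a2 bE2]]]]]] := nvs_data nb'; have [S' d0' _] := tile_set T'.
have af := amax_flip cg Gg c0 a'; have [Gg' c0' cg' _] := ag'.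
have sub2 : sideset (pol g) (- s) u g^-1%g `<=` [set z | Nm g' z = 1] by rewrite bE2 => z [].
have [cE' cE2'] := side_circle (sgN S) (eq_ind_r (fun b => ~~ b) c0 (ccV g).1) c0' af sub2.
have ee : e' = pol g by rewrite -cg' -cE' (ctrV _).1.
have ss : s' = - s.
  have sub3 : sideset (pol g) (- s) u g^-1%g `<=` sideset (pol g) s' u' g' by rewrite bE2 ee.
  exact: (side_dir (sgN S) S' af sub3).
by exists e, s, d, d', u; split=> //; split=> //; rewrite -ee -ss.
Qed.

Lemma nbr_assigned A e s d g A' d' u : AA A -> tile A e s d -> nbr e s g A' d' -> amax g e s u ->
  assigned_at Gam AA A (sideset e s u g) g A'.
Proof.
move=> AAA T [ag AAA' T'] a; have [Gg c0 cg _] := ag.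
split=> //; first exact: nvs_intro T ag a.
- by apply/hypP.
- by move=> z [Hz N _]; apply/isosphereE.
- rewrite side_img//; apply: (nvs_intro AAA' T'); first exact: (axisS_flip ag).
  exact: (amax_flip cg Gg c0 a).
Qed.

Lemma tile_amax A e s d g : tile A e s d -> axisS g e -> exists u, amax g e s u.
Proof.
move=> T ag; case: (tile_axis T ag) => [[u [h [p n]]]|c].
  by exists u; case: (nct_amax n).
by exists d; exact: (cut_amax c).
Qed.

Lemma assignedP A g : AA A -> (assigned Gam AA A g <-> exists e s d A' d', tile A e s d /\ nbr e s g A' d').
Proof.
move=> AAA; split=> [[b [A' /assigned_nbr[e [s [d [d' [u [T n _ _]]]]]]]]|[e [s [d [A' [d' [T n]]]]]]].
  by exists e, s, d, A', d'.
have [ag _ _] := n; have [u a] := tile_amax T ag.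
by exists (sideset e s u g), A'; exact: (nbr_assigned AAA T n a).
Qed.

(** The glued arc has the same extent on both sides and ends at a point of [HH], so the neighbour
    cannot be cuspidal, and its vertex is the image of [p]. *)
Lemma nct_next A e s d u g h p k A' d' : nct A e s d u g h p -> nbr e s k A' d' ->
  exists h', nct A' (pol k) (- s) d' u k^-1%g h' (act k p).
Proof.
move=> n [ak AAA' T']; have [[S u0 ud _] [[ag ah gX hX] [Kp rp n1 _]]] := n; have [Hp _] := Kp.
have [Gk c0 ck _] := ak; have [cE cE2] := axisS_same ag ak; have [_ g0 _ _] := ag.
have nk : Nm k p = 1 by rewrite -(Nm_same p g0 cE cE2).
have [[_ [a1 a2]] oe] := nct_amax n; have [Gg _ _ _] := ag.
have a : amax k e s u.
  split=> //; split=> X hX'; first by apply: (onK_same Gk cE cE2); exact: a1.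
  by move=> /(onK_same Gg (esym cE) (esym cE2)); exact: a2.
have af := amax_flip ck Gk c0 a.
have ov := onK_flip (onK_same Gk cE cE2 oe).
have oE : pol k - (e + s * u - ctr k) = pol k + - s * u by rewrite ck; ring.
rewrite oE in ov.
case: (tile_axis T' (axisS_flip ak)) => [[u' [h' [p' n']]]|c]; last first.
  have uE := amax_uniq (sgN S) af (cut_amax c).
  by have [_ [_ iv _ _]] := c; rewrite -uE in iv; case: (onK_ivert ov iv).
have uE := amax_uniq (sgN S) af (nct_amax n').1; rewrite -uE in n'.
exists h'; have [_ [_ [[Hp' _] rp' n1' _]]] := n'.
rewrite (_ : act k p = p')//; apply: pt_eq => //; first exact: HH_act.
  by rewrite Re_actC// nk divr1 rp rp' ck; ring.
have cV : cc k^-1%g != 0 by rewrite (ccV k).1.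
have nV : Nm k^-1%g (act k p) = 1 by rewrite NmV// nk invr1.
rewrite ((Nm_eq1 _ cV).1 n1') ((Nm_eq1 _ cV).1 nV); congr hg.
by rewrite Re_actC// nk divr1 rp rp' ck; ring.
Qed.

Lemma cut_next A e s d g k A' d' : cut A e s d g -> nbr e s k A' d' ->
  cut A' (pol k) (- s) d k^-1%g /\ d' = d.
Proof.
move=> c [ak AAA' T']; have [[S d0 _] [ag iv dE gX]] := c.
have [Gk c0 ck _] := ak; have [cE cE2] := axisS_same ag ak; have [Gg _ _ _] := ag.
have [_ [a1 a2]] := cut_amax c.
have a : amax k e s d.
  split=> //; split=> X hX'; first by apply: (onK_same Gk cE cE2); exact: a1.
  by move=> /(onK_same Gg (esym cE) (esym cE2)); exact: a2.
have af := amax_flip ck Gk c0 a.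
case: (tile_axis T' (axisS_flip ak)) => [[u' [h' [p' n']]]|c'].
  have [af' ov] := nct_amax n'; have uE := amax_uniq (sgN S) af af'; rewrite -uE in ov.
  have := onK_flip ov; rewrite invgK (ctrV _).1 (ctrV _).2 ck (_ : e - _ = e + s * d); last ring.
  by move=> o; case: (onK_ivert o iv).
have uE := amax_uniq (sgN S) af (cut_amax c').
by rewrite -uE in c'; split=> //; rewrite -uE.
Qed.

End Sides.

(** * Cycles *)

Section Orbits.
Implicit Types (g h t : PSL2 R) (z w p q : R[i]) (X Y e d u s : R) (A B : set R[i]).
Local Notation state := (set R[i] * R * PSL2 R)%type.
Implicit Types (x y : state) (f : nat -> state).

Lemma tile_dir1 A e s d X : tile A e s d -> 0 < s * (X - e) < d ->
  exists e', tile A e' 1 d /\ e' < X < e' + d.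
Proof.
move=> T h; have [S d0 _] := tile_set T; case: S T h => -> T h.
  by exists e; split=> //; lra.
exists (e + -1 * d); split; first by have := tile_sym T; rewrite opprK.
lra.
Qed.

Lemma AA_uniqX A A' e s d e' s' d' X : AA A -> AA A' -> tile A e s d -> tile A' e' s' d' ->
  0 < s * (X - e) < d -> 0 < s' * (X - e') < d' -> A = A'.
Proof.
move=> AA1 AA2 T T' /(tile_dir1 T)[e1 [T1 h1]] /(tile_dir1 T')[e2 [T2 h2]].
have h3 : e2 < X + tau (1%g : PSL2 R) < e2 + d' by rewrite tau1 addr0.
exact: (AA_uniq AA1 AA2 T1 T2 G1 (unip1 R) h1 h3).2.
Qed.

Lemma nct_vertex A A' e s d u g h p e' s' d' u' g' h' : AA A -> AA A' ->
  nct A e s d u g h p -> nct A' e' s' d' u' g' h' p -> A = A'.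
Proof.
move=> AA1 AA2 n n'.
have [[S u0 ud _] [_ [_ rp _ _]]] := n; have [[S' u0' ud' _] [_ [_ rp' _ _]]] := n'.
apply: (AA_uniqX (X := Re p) AA1 AA2 (nct_tile n) (nct_tile n')); first by rewrite rp sg_at// u0 ud.
by rewrite rp' sg_at// u0' ud'.
Qed.

Lemma nct_vertex_uniq A e s d u g h p e' s' d' u' g' h' p' :
  nct A e s d u g h p -> nct A e' s' d' u' g' h' p' -> p = p'.
Proof.
move=> n n'; have [dE [[eE sE]|[eE sE]]] := tile_inj (nct_tile n) (nct_tile n').
  by rewrite eE sE in n'; have [] := nct_uniq n n'.
by have n1 := nct_sym n; rewrite eE sE in n'; have [] := nct_uniq n1 n'.
Qed.

(* A state (A, e, g) of the cycle around [p]: [A] has vertex [g p] and starts at [e]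
   in the fixed direction [s]; a step passes to the neighbour at [e]. *)
Definition good s p x := [/\ AA x.1.1, Gam x.2 & exists d u g h, nct x.1.1 x.1.2 s d u g h (act x.2 p)].

Definition hstep x y : PSL2 R := (y.2 * x.2^-1)%g.

(** The neighbour is entered at [pol] and runs in direction [- s]; read from its other end, at
    distance [d'], it runs in direction [s] again. The next step leaves through that end. *)
Definition step s x y := exists d', nbr x.1.2 s (hstep x y) y.1.1 d' /\ y.1.2 = pol (hstep x y) - s * d'.

Lemma step_ex s p x : HH p -> good s p x -> exists y, good s p y /\ step s x y.
Proof.
move=> Hp [AAx Gx [d [u [g [h n]]]]]; have [[S _ _ _] [[ag _ _ _] _]] := n.
have [k [A' [d' nb]]] := nbr_ex ag S.
have [h' /nct_sym] := nct_next n nb; rewrite opprK mulNr => n'.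
have [[Gk _ _ _] AA' _] := nb.
have hE : hstep x (A', pol k - s * d', (k * x.2)%g) = k by rewrite /hstep /= mulgK.
exists (A', pol k - s * d', (k * x.2)%g); split; last by exists d'; rewrite hE.
split=> //=; first exact: GM.
by rewrite actM//; exists d', (d' - u), h', k^-1%g.
Qed.

Lemma sg_neq s : sg s -> s = - s -> False.
Proof. by case=> ->; lra. Qed.

Lemma step_det s p x y y' : good s p x -> step s x y -> step s x y' -> y = y'.
Proof.
move=> _ [d [n eE]] [d' [n' eE']]; have [hE AE] := nbr_uniq n n'.
have [_ _ T] := n; have [_ _ T'] := n'; rewrite -hE -AE in T'.
have [dE _] := tile_inj T T'.
have e2 : y.1.2 = y'.1.2 by rewrite eE eE' hE dE.
move/mulIg: hE => g2; case: y y' AE g2 e2 {n n' T T' eE eE'} => [[A e] g] [[A' e'] g'] /= -> -> ->.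
by [].
Qed.

Lemma step_det2 s x x' y y' : step s x y -> step s x' y' -> x.1.2 = x'.1.2 ->
  y.1 = y'.1 /\ hstep x y = hstep x' y'.
Proof.
move=> [d [n eE]] [d' [n' eE']] xE; rewrite xE in n.
have [hE AE] := nbr_uniq n n'.
have [_ _ T] := n; have [_ _ T'] := n'; rewrite -hE -AE in T'.
have [dE _] := tile_inj T T'; split=> //.
by rewrite [y.1]surjective_pairing [y'.1]surjective_pairing eE eE' hE dE AE.
Qed.

Lemma good_end s p x y : good s p x -> good s p y -> x.1.1 = y.1.1 -> x.1.2 = y.1.2.
Proof.
move=> [_ _ [d [u [g [h n]]]]] [_ _ [d' [u' [g' [h' n']]]]] E; rewrite E in n.
have [_ [[-> _]//|[_ sE]]] := tile_inj (nct_tile n) (nct_tile n').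
by have [[S _ _ _] _] := n; case: (sg_neq S sE).
Qed.

Lemma step_inj s p x x' y : good s p x -> good s p x' -> step s x y -> step s x' y -> x = x'.
Proof.
move=> G G' [d [n eE]] [d' [n' eE']].
have [AAx _ [dx [ux [gx [hx nx]]]]] := G; have [AAx' _ [dx' [ux' [gx' [hx' nx']]]]] := G'.
have [_ _ T] := n; have [_ _ T'] := n'; have [S _ _] := tile_set T.
have [_ [[pE _]|[_ sE]]] := tile_inj T T'; last by case: (sg_neq S sE).
have m := nbr_sym AAx (nct_tile nx) n.
have m' := nbr_sym AAx' (nct_tile nx') n'; rewrite pE in m'.
have [hE AE] := nbr_uniq m m'.
have eEx := good_end G G' AE; move/invg_inj: hE; rewrite /hstep => /mulgI/invg_inj.
case: x x' AE eEx {G G' n n' eE eE' AAx AAx' nx nx' T T' pE m m'} => [[A e] g] [[A' e'] g'] /= -> -> -> //.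
Qed.

(** The family is finite, and by proper discontinuity only finitely many elements map [p] to the
    vertex of a given precell. *)
Lemma good_finite s p : HH p -> finite_set [set x | good s p x].
Proof.
move=> Hp; pose S A := [set g | exists e, good s p (A, e, g)].
have fS A : finite_set (S A).
  case: (pselect (S A !=set0)) => [[g0 [e0 [_ _ [d [u [g [h n]]]]]]]|N]; last first.
    by rewrite (_ : S A = set0)// -subset0 => g Sg; apply: N; exists g.
  have Hq : HH (act g0 p) by exact: HH_act.
  have [B1 B1ge [_ b1]] := box_ex Hp 0; have [B B2ge [BM b2]] := box_ex Hq B1.
  have bp : box B p.
    have B1p : 0 < B1 by exact: lt_le_trans B1ge.
    have [x1 x2 x3] := b1; split; [exact: le_trans x1 BM| |exact: le_trans x3 BM].
    by apply: le_trans x2; rewrite lef_pV2// posrE//; exact: lt_le_trans BM.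
  apply: (sub_finite_set _ (finite_box B2ge)) => g1 [e1 [_ Gg1 [d' [u' [g' [h' n']]]]]].
  by split=> //; exists p; split=> //; rewrite (nct_vertex_uniq n' n).
apply: (@finite_inj _ _ _ (\bigcup_(A in AA) [set (A, g) | g in S A]) (fun x => (x.1.1, x.2))).
- by apply: bigcup_finite => [|A _]; [exact: finite_AA|exact: finite_image].
- move=> [[A e] g] /= G; have [AAx _ _] := G; exists A => //; exists g => //; by exists e.
- move=> x y G G' [AE gE]; have eE := good_end G G' AE.
  by case: x y AE gE eE {G G'} => [[A e] g] [[A' e'] g'] /= -> -> ->.
Qed.

Definition orbit s p f (k : nat) := [/\ HH p, forall j, good s p (f j) /\ step s (f j) (f j.+1),
  (f 0%N).2 = 1%g & [/\ (0 < k)%N, f k = f 0%N & forall j, (0 < j < k)%N -> (f j).2 <> 1%g]].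

Lemma good_same s p x y : HH p -> good s p x -> good s p y -> x.2 = y.2 -> x = y.
Proof.
move=> Hp G G' gE; have [AAx _ [d [u [g [h n]]]]] := G; have [AAy _ [d' [u' [g' [h' n']]]]] := G'.
rewrite gE in n; have AE := nct_vertex AAx AAy n n'; have eE := good_end G G' AE.
by case: x y AE gE eE {G G' n n' AAx AAy} => [[A e] ?] [[A' e'] ?] /= -> -> ->.
Qed.

(** Steps are deterministic and injective on a finite set, so the sequence returns to its first
    state. A state is determined by its element, hence the first return is the first time the
    element is 1. *)
Lemma orbit_ex A e s d u g h p : AA A -> nct A e s d u g h p ->
  exists f (k : nat), orbit s p f k /\ f 0%N = (A, e, 1%g).
Proof.
move=> AAA n; have [_ [_ [[Hp _] _ _ _]]] := n.
have G0 : good s p (A, e, 1%g) by split=> //; exists d, u, g, h; rewrite /= act1.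
have [f f0 fS] : exists2 f, f 0%N = (A, e, 1%g) & forall j, good s p (f j) -> good s p (f j.+1) /\ step s (f j) (f j.+1).
  have ch x : {y | good s p x -> good s p y /\ step s x y}.
    apply: cid; case: (pselect (good s p x)) => [/(step_ex Hp)[y Y]|N]; first by exists y.
    by exists x => /N.
  by have [f [f0 fS]] := dependent_choice ch (A, e, 1%g); exists f.
have fG j : good s p (f j) by elim: j => [|j /fS[]//]; rewrite f0.
have fS' j : step s (f j) (f j.+1) by case: (fS j (fG j)).
have [m [l [ml fE]]] := finite_nat_inj (good_finite s Hp) fG.
have per : forall m l, (m < l)%N -> f m = f l -> f (l - m)%N = f 0%N.
  elim=> [|m' IH] l' ml' E; first by rewrite subn0.
  case: l' ml' E => // l' ml' E; rewrite subSS; apply: IH => //.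
  by apply: (step_inj (fG _) (fG _) (fS' m')); rewrite E; exact: fS'.
have ex : exists k, (0 < k)%N && ((f k).2 == 1%g).
  by exists (l - m)%N; rewrite subn_gt0 ml per// f0 eqxx.
have [k /andP[k0 /eqP k1] kmin] := ex_minnP ex; exists f, k; split=> //; split=> //; last split=> //.
- by rewrite f0.
- by apply: (good_same Hp (fG _) (fG _)); rewrite k1 f0.
- move=> j /andP[j0 jk] j1; have := kmin j; rewrite j0 j1 eqxx => /(_ isT).
  by rewrite leqNgt jk.
Qed.

Definition ocyc f (k : nat) : precycle R := mkseq (fun j => ((f j).1.1, hstep (f j) (f j.+1))) k.

Lemma ocyc_pair f k j : (j < k)%N -> cyc_pair (ocyc f k) j = ((f j).1.1, hstep (f j) (f j.+1)).
Proof. by move=> jk; rewrite /cyc_pair /ocyc nth_mkseq. Qed.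

Lemma cyc_eltS (c : precycle R) j : (j < size c)%N -> cyc_elt c j.+1 = ((cyc_pair c j).2 * cyc_elt c j)%g.
Proof. by move=> jk; rewrite /cyc_elt (take_nth (set0, 1%g)) // foldl_rcons. Qed.

Lemma ocyc_elt f k j : (f 0%N).2 = 1%g -> (j <= k)%N -> cyc_elt (ocyc f k) j = (f j).2.
Proof.
move=> f0; elim: j => [|j IH] jk; first by rewrite /cyc_elt take0 f0.
by rewrite cyc_eltS ?size_mkseq// ocyc_pair// IH ?(ltnW jk)// /hstep /= mulgVK.
Qed.

Lemma step_tile s p x y : good s p x -> step s x y -> exists d d',
  [/\ tile x.1.1 x.1.2 s d, tile y.1.1 y.1.2 s d', nbr x.1.2 s (hstep x y) y.1.1 d',
   y.1.2 + s * d' = pol (hstep x y) & nbr (y.1.2 + s * d') (- s) (hstep x y)^-1%g x.1.1 d].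
Proof.
move=> [AAx _ [d [u [g [h n]]]]] [d' [nb eE]]; exists d, d'.
have e2 : y.1.2 + s * d' = pol (hstep x y) by rewrite eE subrK.
have [_ _ T] := nb; have T2 := tile_sym T; rewrite opprK mulNr -eE in T2.
split=> //; first exact: nct_tile n.
by rewrite e2; exact: (nbr_sym AAx (nct_tile n) nb).
Qed.

Lemma orbit_assigned s p x y (z : state) : good s p x -> good s p y -> step s x y -> step s y z ->
  assigned Gam AA y.1.1 = [set hstep y z; (hstep x y)^-1%g].
Proof.
move=> G G' st st'; have [AAx _ _] := G; have [AAy _ _] := G'.
have [d [d' [_ T _ _ nb2]]] := step_tile G st.
have [d1 [d2 [T' _ nb _ _]]] := step_tile G' st'.
apply/seteqP; split=> g.
  move=> /(assignedP g AAy)[e [s' [d0 [A' [d0' [T0 n0]]]]]].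
  have [_ [[eE sE]|[eE sE]]] := tile_inj T T0; rewrite eE sE in n0.
    by left; case: (nbr_uniq n0 nb).
  by right; case: (nbr_uniq n0 nb2).
move=> gE; apply/(assignedP g AAy); case: gE => ->.
  by exists y.1.2, s, d1, z.1.1, d2.
by exists (y.1.2 + s * d'), (- s), d', x.1.1, d; split=> //; exact: tile_sym.
Qed.

Lemma good_precell s p x : HH p -> good s p x ->
  exists s1 s2 : R[i], noncuspidal_precell Gam (actS x.2 (fin p)) s1 s2 x.1.1.
Proof.
move=> Hp [AAx _ [d [u [g [h n]]]]]; rewrite actS_HH//.
by case: (nct_precell AAx n) => N; [exists (summit g), (summit h)|exists (summit h), (summit g)].
Qed.

Lemma hstep0 s p f k : orbit s p f k -> hstep (f 0%N) (f 1%N) = (f 1%N).2.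
Proof. by move=> [_ _ f0 _]; rewrite /hstep f0 invg1 mulg1. Qed.

Lemma orbit_cycle s p f k : orbit s p f k ->
  noncuspidal_cycle Gam AA (f 0%N).1.1 (f 1%N).2 (ocyc f k).
Proof.
move=> O; have [Hp fS f0 [k0 fk fm]] := O; exists (fin p).
have sz : size (ocyc f k) = k by rewrite size_mkseq.
split; last first.
  rewrite sz ocyc_elt// fk f0; split=> // j /andP[j0 jk].
  by rewrite ocyc_elt ?(ltnW jk)//; apply: fm; rewrite j0.
split.
- by rewrite sz.
- by rewrite ocyc_pair// (hstep0 O).
- have [G st] := fS 0%N; have [AAx _ _] := G.
  apply/(assignedP _ AAx); have [d [d' [T _ nb _ _]]] := step_tile G st.
  by rewrite -(hstep0 O); exists (f 0%N).1.2, s, d, (f 1%N).1.1, d'.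
- move=> j; rewrite sz => jk; rewrite ocyc_pair//=; have [G _] := fS j; split; first by case: G.
  by rewrite ocyc_elt ?(ltnW jk)//; exact: good_precell G.
- move=> [//|j]; rewrite sz => /andP[_ jk]; rewrite ocyc_pair// ocyc_pair ?(ltnW jk)//=.
  have [G st] := fS j; have [G' st'] := fS j.+1; exact: (orbit_assigned G G' st st').
Qed.

(** The spheres of the two elements have their centres at the two different ends of the precell
    [y]. *)
Lemma hstep_neq s p x y (z : state) : good s p x -> good s p y -> step s x y -> step s y z ->
  hstep y z <> (hstep x y)^-1%g.
Proof.
move=> G G' st st' E; have [d [d' [_ T _ pE _]]] := step_tile G st.
have [d1 [d2 [_ _ [[_ _ cE _] _ _] _ _]]] := step_tile G' st'; have [S d0 _] := tile_set T.
rewrite E (ctrV _).1 -pE in cE; case: S cE => ->; lra.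
Qed.

(** The first element fixes the end at which the orbit starts and its direction. Afterwards the next
    element of the cycle is forced, being the assigned one that does not lead back. *)
Lemma cycle_orbit A h c : noncuspidal_cycle Gam AA A h c -> exists s p f (k : nat),
  [/\ orbit s p f k, (f 0%N).1.1 = A, (f 1%N).2 = h & c = ocyc f k].
Proof.
move=> [v [[c0 cE ah cA cas] [cg cmin]]].
have [AAA [s1 [s2]]] := cA 0%N c0; rewrite cE /= in AAA *; rewrite {1}/cyc_elt take0 /= actS1.
move=> /(nc_data)[e0 [s0 [d0 [u0 [g0 [h0 [p [n vE _ _]]]]]]]]; rewrite vE in cA.
have [e [s [d [A' [d' [T nb]]]]]] := (assignedP h AAA).1 ah.
have {n} [u [g [h' n]]] : exists u g h', nct A e s d0 u g h' p.
  have [_ [[-> ->]|[-> ->]]] := tile_inj (nct_tile n) T; first by exists u0, g0, h0.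
  by exists (d0 - u0), h0, g0; exact: nct_sym.
have [f [k [orb f0]]] := orbit_ex AAA n; exists s, p, f, k.
have [Hp fS f01 [k0 fk fm]] := orb.
have hE : (f 1%N).2 = h.
  rewrite -(hstep0 orb); have [G st] := fS 0%N; have [d1 [d2 [_ _ nb' _ _]]] := step_tile G st.
  by rewrite f0 in nb'; rewrite f0; case: (nbr_uniq nb' nb).
have vtx B j : AA B -> (exists s1 s2 : R[i], noncuspidal_precell Gam (actS (f j).2 (fin p)) s1 s2 B) -> B = (f j).1.1.
  move=> AAB [t1 [t2]]; rewrite actS_HH// => /(nc_data)[e1 [s1' [d1 [u1 [g1 [h1 [q [n1 [qE] _ _]]]]]]]].
  rewrite -qE in n1; have [[AAf _ [d2 [u2 [g2 [h2 n2]]]]] _] := fS j.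
  exact: nct_vertex AAB AAf n1 n2.
have main j : (j <= size c)%N -> cyc_elt c j = (f j).2 /\ forall i, (i < j)%N -> cyc_pair c i = ((f i).1.1, hstep (f i) (f i.+1)).
  elim: j => [|j IH] jc; first by rewrite /cyc_elt take0 f01.
  have [ej ep] := IH (ltnW jc); have pj : cyc_pair c j = ((f j).1.1, hstep (f j) (f j.+1)).
    have [AAj pre] := cA j jc; rewrite ej in pre; have Aj := vtx _ _ AAj pre.
    case: j {IH pre} jc ej ep Aj AAj => [|j] jc ej ep Aj AAj; first by rewrite cE (hstep0 orb) hE f0.
    rewrite [LHS]surjective_pairing Aj; congr pair.
    have [G st] := fS j; have [G' st'] := fS j.+1.
    have := cas j.+1 jc; rewrite Aj (orbit_assigned G G' st st') /= ep//= => E.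
    have : [set (cyc_pair c j.+1).2; (hstep (f j) (f j.+1))^-1%g] (hstep (f j.+1) (f j.+2)) by rewrite -E; left.
    by case=> // E2; case: (hstep_neq G G' st st' E2).
  split; last by move=> i; rewrite ltnS leq_eqVlt => /orP[/eqP->|/ep].
  by rewrite cyc_eltS// pj ej /hstep /= mulgVK.
have [_ cp] := main _ (leqnn (size c)).
have sz : size c = k.
  have ce j : (j <= size c)%N -> cyc_elt c j = (f j).2 by move=> /main[].
  case: (ltngtP (size c) k) => // lt.
    by case: (fm (size c)); rewrite ?c0// -ce.
  by case: (cmin k); rewrite ?k0//= ce ?(ltnW lt)// fk.
split=> //; first by rewrite f0.
apply: (@eq_from_nth _ (set0, 1%g)); first by rewrite size_mkseq.
by move=> i ic; rewrite -/(cyc_pair c i) cp// -/(cyc_pair _ i) ocyc_pair// -sz.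
Qed.

End Orbits.

(** * Cells *)

Section CellShape.
Implicit Types (g h k t : PSL2 R) (z w p q : R[i]) (X Y e d u s : R) (A B : set R[i]).
Local Notation state := (set R[i] * R * PSL2 R)%type.
Implicit Types (x y : state) (f : nat -> state).

(* The cell of [A] is the union of the sets g^-1 B over these pairs (g, B). *)
Inductive pcs A : PSL2 R -> set R[i] -> Prop :=
| pcs1 : pcs A 1%g A
| pcsS g B e s d h B' d' : pcs A g B -> tile B e s d -> nbr e s h B' d' -> pcs A (h * g)%g B'.

Lemma pcs_AA A g B : AA A -> pcs A g B -> AA B /\ Gam g.
Proof.
move=> AAA; elim=> [//|{}g {}B e s d h B' d' _ [_ Gg] _ [[Gh _ _ _] AA' _]]; split=> //.
exact: GM.
Qed.

Lemma AA_kind A : AA A -> [\/ exists e s d u g h p, nct A e s d u g h p,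
  exists e s d g, cut A e s d g | is_strip Gam A /\ exists e d, stt A e 1 d].
Proof.
move=> AAA; case: basal => + _ => /(_ A AAA)[[v [s1 [s2 N]]]|[v [s' N]]|[v1 [v2 N]]].
- constructor 1; have [e [s [d [u [g [h [p [n _ _ _]]]]]]]] := nc_data N.
  by exists e, s, d, u, g, h, p.
- by constructor 2; have [e [s [d [g [c _ _]]]]] := cu_data N; exists e, s, d, g.
- constructor 3; split; first by exists v1, v2.
  by exists v1, (v2 - v1); exact: st_data.
Qed.

Lemma orbit_per s p f (n : nat) : orbit s p f n -> forall j, f (j + n)%N = f j.
Proof.
move=> [Hp fS f0 [n0 fn fm]]; elim=> [//|j IH]; have [G st] := fS j.
have [_ st'] := fS (j + n)%N; rewrite IH in st'; rewrite addSn.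
exact: (step_det G st' st).
Qed.

Lemma orbit_mod s p f (n : nat) : orbit s p f n -> forall j, f j = f (j %% n)%N.
Proof.
move=> O j; rewrite {1}(divn_eq j n); elim: (j %/ n)%N => [|q IH]; first by rewrite mul0n.
by rewrite mulSn -addnA addnC (orbit_per O).
Qed.

Lemma orbit_nbr s p f (n : nat) j e s' d h B' d' : orbit s p f n ->
  tile (f j).1.1 e s' d -> nbr e s' h B' d' -> exists i, (f i).1.1 = B' /\ (f i).2 = (h * (f j).2)%g.
Proof.
move=> O T nb; have [Hp fS f0 [n0 fn fm]] := O.
have [G st] := fS j; have [d1 [d2 [T1 _ nb1 _ _]]] := step_tile G st.
have [_ [[eE sE]|[eE sE]]] := tile_inj T1 T; rewrite eE sE in nb.
  have [hE AE] := nbr_uniq nb nb1; exists j.+1; split=> //.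
  by rewrite hE /hstep mulgVK.
(* The predecessor of [f j]; one period is added to cover [j = 0]. *)
have [G' st'] := fS (j + n).-1; rewrite prednK ?addn_gt0 ?n0 ?orbT// in st'.
rewrite (orbit_per O) in st'; have [d3 [d4 [_ T2 nb2 eE2 nb3]]] := step_tile G' st'.
have [dE _] := tile_inj T1 T2; rewrite dE in eE2 nb3.
have [hE AE] := nbr_uniq nb nb3; exists (j + n).-1; split=> //.
by rewrite hE /hstep invgM invgK mulgVK.
Qed.

Lemma pcs_orbit s p f (n : nat) A e g B : orbit s p f n -> f 0%N = (A, e, 1%g) ->
  (pcs A g B <-> exists2 j, (j < n)%N & (f j).1.1 = B /\ (f j).2 = g).
Proof.
move=> O fE; have [Hp fS f0 [n0 fn fm]] := O; split.
  elim=> [|{}g {}B e0 s0 d h B' d' _ [j jn [<- <-]] T nb]; first by exists 0%N => //; rewrite fE.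
  have [i [iB ig]] := orbit_nbr O T nb; exists (i %% n)%N; first by rewrite ltn_mod.
  by rewrite -(orbit_mod O).
move=> [j jn [<- <-]]; elim: j jn => [|j IH] jn; first by rewrite fE; exact: pcs1.
have [G st] := fS j; have [d1 [d2 [T1 _ nb1 _ _]]] := step_tile G st.
rewrite (_ : (f j.+1).2 = (hstep (f j) (f j.+1) * (f j).2)%g); last by rewrite /hstep mulgVK.
exact: pcsS (IH (ltnW jn)) T1 nb1.
Qed.

Lemma cut_axis A e s d g e' s' d' h : cut A e s d g -> tile A e' s' d' -> axisS h e' -> e' = e /\ s' = s.
Proof.
move=> c T ah; have [_ [[->->]//|[eE _]]] := tile_inj (cut_tile c) T.
by have [_ [_ iv _ _]] := c; rewrite eE in ah; case: (onK_ivert (axisS_onK ah) iv).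
Qed.

Lemma pcs_cut A e s d g0 h A' d' g B : AA A -> cut A e s d g0 -> nbr e s h A' d' ->
  (pcs A g B <-> (g = 1%g /\ B = A) \/ (g = h /\ B = A')).
Proof.
move=> AAA c nb; have [c' dE] := cut_next c nb; split; last first.
  by case=> -[-> ->]; [exact: pcs1|rewrite -[h]mulg1; exact: pcsS (pcs1 A) (cut_tile c) nb].
elim=> [|{}g {}B e0 s0 d0 h0 B' d0' _ IH T n0]; first by left.
have [ah0 _ _] := n0; case: IH => -[gE BE]; rewrite BE in T.
  have [eE sE] := cut_axis c T ah0; rewrite eE sE in n0.
  by have [-> ->] := nbr_uniq n0 nb; right; rewrite gE mulg1.
have [eE sE] := cut_axis c' T ah0; rewrite eE sE in n0.
have [-> ->] := nbr_uniq n0 (nbr_sym AAA (cut_tile c) nb); left.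
by rewrite gE mulVg.
Qed.

Lemma pcs_stt A e s d g B : stt A e s d -> pcs A g B -> g = 1%g /\ B = A.
Proof.
move=> st; elim=> [//|{}g {}B e0 s0 d0 h0 B' d0' _ [_ BE] T [ah _ _]]; rewrite BE in T.
by have [_ iv] := stt_tile st; case: (onK_ivert (axisS_onK ah) (iv _ _ _ T)).
Qed.

Lemma orbit_nct s p f (n : nat) j : orbit s p f n ->
  exists d u g h, nct (f j).1.1 (f j).1.2 s d u g h (act (f j).2 p).
Proof. by move=> [_ fS _ _]; have [[]] := fS j. Qed.

Lemma strip_nct A e s d u g h p : is_strip Gam A -> nct A e s d u g h p -> False.
Proof. by move=> [v1 [v2 N]] n; exact: (nct_stt n (st_data N)). Qed.

Lemma strip_cut A e s d g : is_strip Gam A -> cut A e s d g -> False.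
Proof. by move=> [v1 [v2 N]] c; exact: (cut_stt c (st_data N)). Qed.

Lemma cuspidal_nct A e s d u g h p : is_cuspidal Gam A -> nct A e s d u g h p -> False.
Proof. by move=> [v [s' N]] n; have [? [? [? [? [c _ _]]]]] := cu_data N; exact: (nct_cut n c). Qed.

Lemma cuspidal_stt A e s d : is_cuspidal Gam A -> stt A e s d -> False.
Proof. by move=> [v [s' N]] n; have [? [? [? [? [c _ _]]]]] := cu_data N; exact: (cut_stt c n). Qed.

Lemma orbit0 s p f (n : nat) : orbit s p f n -> f 0%N = ((f 0%N).1.1, (f 0%N).1.2, 1%g).
Proof. by move=> [_ _ f0 _]; rewrite -f0; case: (f 0%N) => -[]. Qed.

Lemma is_cycle_inv A h c : is_cycle Gam AA A h c ->
  [\/ [/\ AA A, is_strip Gam A, h = 1%g & c = [:: (A, 1%g)]],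
   exists b A', [/\ AA A, is_cuspidal Gam A, assigned_at Gam AA A b h A' & c = [:: (A, h); (A', h^-1%g)]] |
   noncuspidal_cycle Gam AA A h c].
Proof.
case=> [B AB st|B b g B' AB cu ass|B h' c' N]; [by constructor 1| |by constructor 3].
by constructor 2; exists b, B'.
Qed.

(** Since [pcs] follows neighbours in both directions, this also shows that the cell does not depend
    on the element with which the cycle starts. *)
Lemma cellP A z : AA A -> (cell Gam AA A z <-> HH z /\ exists g B, pcs A g B /\ B (act g z)).
Proof.
move=> AAA; have toim g B : AA B -> (act g^-1%g @` B) z -> HH z /\ B (act g z).
  move=> /AA_tile[e [d T]] [w Bw <-]; have Hw := tile_HH T Bw.
  by split; [exact: HH_act|rewrite actKV].
have frim g B : HH z -> B (act g z) -> (act g^-1%g @` B) z.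
  by move=> Hz Bz; exists (act g z) => //; rewrite actK.
have im g B : pcs A g B -> (act g^-1%g @` B) z -> HH z /\ exists g B, pcs A g B /\ B (act g z).
  by move=> P /toim[]; [case: (pcs_AA AAA P)|move=> Hz Bz; split=> //; exists g, B].
split.
- move=> [h [c [cy [j jc]]]]; case: (is_cycle_inv cy) => [[_ _ _ cE]|[b [A' [_ _ /assigned_nbr[e [s [d [d' [u [T nb _ _]]]]]] cE]]]|/cycle_orbit[s [p [f [n [orb fA _ cE]]]]]].
  + rewrite cE in jc *; case: j jc => // _; apply: im; exact: pcs1.
  + have P : pcs A h A' by rewrite -[h]mulg1; exact: pcsS (pcs1 A) T nb.
    rewrite cE in jc *; case: j jc => [|[|]]// _; first by apply: im; exact: pcs1.
    by rewrite /cyc_elt /= mulg1; exact: im.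
  + rewrite cE size_mkseq in jc *; have [_ _ f0 _] := orb.
    rewrite ocyc_elt ?(ltnW jc)// ocyc_pair//=; apply: im.
    have fE := orbit0 orb; rewrite fA in fE.
    by apply/(pcs_orbit _ _ orb fE); exists j.
- move=> [Hz [g [B [P Bz]]]]; case: (AA_kind AAA) => [[e [s [d [u [g0 [h0 [p ns]]]]]]]|[e [s [d [g0 c]]]]|[st [e [d std]]]].
  + have [f [n [orb fE]]] := orbit_ex AAA ns; have [j jn [jB jg]] := (pcs_orbit g B orb fE).1 P.
    have [_ _ f0 _] := orb; exists (f 1%N).2, (ocyc f n); split.
      by apply: NoncuspidalCycle; have := orbit_cycle orb; rewrite fE.
    exists j; rewrite ?size_mkseq// ocyc_elt ?(ltnW jn)// ocyc_pair//= jB jg; exact: frim.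
  + have [_ [ag _ _ _]] := c; have [[S _ _] _] := c; have [h [A' [d' nb]]] := nbr_ex ag S.
    have [ah _ _] := nb; have [u a] := tile_amax (cut_tile c) ah.
    have cu : is_cuspidal Gam A by exists (fin (e + s * d)%:C), (summit g0); exact: (cut_precell AAA c).
    exists h, [:: (A, h); (A', h^-1%g)]; split.
      exact: (CuspidalCycle AAA cu (nbr_assigned AAA (cut_tile c) nb a)).
    case: ((pcs_cut g B AAA c nb).1 P) => -[gE BE]; rewrite gE BE in Bz.
      by exists 0%N => //=; rewrite /cyc_elt /=; exact: frim.
    by exists 1%N => //=; rewrite /cyc_elt /= mulg1; exact: frim.
  + exists 1%g, [:: (A, 1%g)]; split; first exact: StripCycle.
    have [gE BE] := pcs_stt std P; rewrite gE BE in Bz.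
    by exists 0%N => //=; rewrite /cyc_elt /=; exact: frim.
Qed.

Lemma pcs_finite A : AA A -> finite_set [set x : PSL2 R * set R[i] | pcs A x.1 x.2].
Proof.
move=> AAA; case: (AA_kind AAA) => [[e [s [d [u [g0 [h0 [p ns]]]]]]]|[e [s [d [g0 c]]]]|[st [e [d std]]]].
- have [f [n [orb fE]]] := orbit_ex AAA ns.
  apply: (@sub_finite_set _ _ [set ((f j).2, (f j).1.1) | j in `I_n]); last first.
    exact/finite_image/finite_II.
  by move=> [g B] /= /(pcs_orbit _ _ orb fE)[j jn [<- <-]]; exists j.
- have [_ [ag _ _ _]] := c; have [[S _ _] _] := c; have [h [A' [d' nb]]] := nbr_ex ag S.
  apply: (@sub_finite_set _ _ [set (1%g, A); (h, A')]) => // -[g B] /= /(pcs_cut _ _ AAA c nb).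
  by case=> -[-> ->]; [left|right].
- apply: (@sub_finite_set _ _ [set (1%g, A)]) => // -[g B] /= /(pcs_stt std)[-> ->] //.
Qed.

Lemma near_fin (T : choiceType) (S : set T) (P : T -> set R[i]) z : finite_set S ->
  (forall i, S i -> nbhs z (P i)) -> nbhs z [set w | forall i, S i -> P i w].
Proof.
move=> /finite_seqP[L ->]; elim: L => [|a L IH] H; first by apply: filterE => w i.
have h1 : nbhs z (P a) by apply: H; rewrite /= mem_head.
have h2 := IH (fun i iL => H i (mem_behead (s := a :: L) iL)).
by apply: filterS2 h1 h2 => w w1 w2 i; rewrite /= inE => /orP[/eqP->|/w2].
Qed.

Lemma near_act g z (P : set R[i]) : HH z -> nbhs (act g z) P -> \forall w \near z, P (act g w).
Proof. by move=> Hz; exact: continuous_act. Qed.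

Lemma near_HH z : HH z -> \forall w \near z, HH w.
Proof. by move=> Hz; exact: open_nbhs_nbhs (conj (@open_HH R) Hz). Qed.

Lemma amax_le B e s d k u : tile B e s d -> axisS k e -> amax k e s u -> u <= d.
Proof.
move=> T ak a; have [S d0 _] := tile_set T.
case: (tile_axis T ak) => [[u' [h [p n]]]|c].
  by have [[_ _ ud _] _] := n; rewrite (amax_uniq S a (nct_amax n).1) ltW.
by rewrite (amax_uniq S a (cut_amax c)).
Qed.

(** A point outside the sphere of [k] belongs to [B]; one inside is mapped by [k] outside the sphere
    of the inverse, into the neighbour. The second inequality says that the image still lies over
    the arc. *)
Lemma half_axis B e s d k B' d' u w : tile B e s d -> nbr e s k B' d' -> amax k e s u -> HH w ->
  0 <= s * (Re w - e) < u -> s * (Re w - e) < u * Nm k w -> B w \/ B' (act k w).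
Proof.
move=> T [ak AA' T'] a Hw /andP[x0 xu] xn; have [S d0 BE] := tile_set T; have [_ _ BE'] := tile_set T'.
have [Gk c0 ck _] := ak; have [_ [a1 _]] := a; have N0 := Nm_gt0 k Hw.
have ud := amax_le T ak a; have af := amax_flip ck Gk c0 a; have ud' := amax_le T' (axisS_flip ak) af.
case: (leP 1 (Nm k w)) => N1.
  left; rewrite BE; split; last by rewrite x0 (le_trans (ltW xu)).
  apply/(onK_clK (a1 (Re w) _) Hw erefl); first by rewrite x0.
  by rewrite -Nm_ge1.
right; rewrite BE'; have Hk := HH_act k Hw.
have rE : - s * (Re (act k w) - pol k) = s * (Re w - e) / Nm k w by rewrite Re_actC// ck; ring.
have r0 : 0 <= - s * (Re (act k w) - pol k) by rewrite rE divr_ge0// ltW.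
have ru : - s * (Re (act k w) - pol k) < u by rewrite rE ltr_pdivrMr.
have [_ [b1 _]] := af; split; last by rewrite r0 (le_trans (ltW ru)).
apply/(onK_clK (b1 _ _) Hk erefl); first by rewrite r0.
rewrite -Nm_ge1; last by rewrite (ccV k).1.
by rewrite NmV// invf_ge1// ltW.
Qed.

Lemma half_ivert B e s d z : tile B e s d -> ivert e -> HH z -> Re z = e ->
  \forall w \near z, 0 <= s * (Re w - e) -> B w.
Proof.
move=> T iv Hz rz; have [S d0 BE] := tile_set T; have Hn := near_HH Hz.
have dn : \forall w \near z, s * (Re w - e) < d.
  have c : {for z, continuous (fun w => s * (Re w - e))}.
    by apply: cvgM; [exact: cvg_cst|apply: cvgB; [exact: continuous_Re|exact: cvg_cst]].
  by apply: (cvgr_lt _ c); rewrite rz subrr mulr0.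
case: T => [[u [g [h [p n]]]]|[g c]|[g c]|st].
- by case: (nct_no_ivert n (nct_tile n) iv).
- by have [_ [ag _ _ _]] := c; case: (onK_ivert (axisS_onK ag) iv).
- have [[S' _ _] [ag _ dE gX]] := c; have [Gg c0 cg _] := ag.
  have eE : e + s * d + - s * d = e by ring.
  have hE : hg g e = e ^+ 2 by rewrite -{1 2}eE; exact: cut_radius.
  have N1 : 1 < Nm g z by rewrite Nm_gt1// rz hE -rz; exact: HH_Wk.
  have Nn : \forall w \near z, 1 < Nm g w by apply: (cvgr_gt _ (@continuous_Nm R g z)).
  near=> w => w0; rewrite BE; have wd : s * (Re w - e) < d by near: w.
  have Hw : HH w by near: w.
  split; last by rewrite w0 ltW.
  move: w0; rewrite le_eqVlt => /orP[/eqP w0|w0].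
    apply: iv => //; have : s * (s * (Re w - e)) = 0 by rewrite -w0 mulr0.
    by rewrite mulrA sg2// mul1r => /eqP; rewrite subr_eq0 => /eqP.
  apply/(onK_clK (gX (Re w) _) Hw erefl).
    rewrite (_ : - s * (Re w - (e + s * d)) = s * s * d - s * (Re w - e)); last ring.
    by rewrite sg2// mul1r subr_ge0 (ltW wd)/= ltrBlDr ltrDl.
  by rewrite -Nm_ge1// ltW//; near: w.
- have [_ [iv' _ _]] := st; near=> w => w0; rewrite BE; have wd : s * (Re w - e) < d by near: w.
  by split; [apply: (iv' (Re w)) => //; [rewrite w0 ltW|near: w]|rewrite w0 ltW].
Unshelve. all: by end_near. Qed.

Lemma near_sRe s e z (r : R) : s * (Re z - e) < r -> \forall w \near z, s * (Re w - e) < r.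
Proof.
have c : {for z, continuous (fun w => s * (Re w - e))}.
  by apply: cvgM; [exact: cvg_cst|apply: cvgB; [exact: continuous_Re|exact: cvg_cst]].
by move=> h; apply: (cvgr_lt _ c).
Qed.

Lemma near_sRe0 s e z (r : R) : r < s * (Re z - e) -> \forall w \near z, r < s * (Re w - e).
Proof.
move=> h; have := @near_sRe (- s) e z (- r); rewrite mulNr ltrN2 => /(_ h).
by apply: filterS => w; rewrite mulNr ltrN2.
Qed.

Lemma near_sReN s e k u z : s * (Re z - e) < u * Nm k z -> \forall w \near z, s * (Re w - e) < u * Nm k w.
Proof.
have c : {for z, continuous (fun w => u * Nm k w - s * (Re w - e))}.
  apply: cvgB; first by apply: cvgM; [exact: cvg_cst|exact: continuous_Nm].
  by apply: cvgM; [exact: cvg_cst|apply: cvgB; [exact: continuous_Re|exact: cvg_cst]].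
rewrite -subr_gt0 => h; have := cvgr_gt _ c _ h => /(_ (nbhs_filter z)).
by apply: filterS => w; rewrite subr_gt0.
Qed.

Lemma pcs_cell A g B z : AA A -> pcs A g B -> HH z -> B (act g z) -> cell Gam AA A z.
Proof. by move=> AAA P Hz Bz; apply/(cellP z AAA); split=> //; exists g, B. Qed.

Lemma pcs_next A g B e s d k B' d' z : AA A -> pcs A g B -> tile B e s d -> nbr e s k B' d' ->
  HH z -> B' (act k (act g z)) -> cell Gam AA A z.
Proof.
by move=> AAA P T nb Hz; rewrite -actM//; exact: pcs_cell AAA (pcsS P T nb) Hz.
Qed.

(** Below a summit the precell stops at the sphere, and the missing part of the half neighbourhood
    is supplied by the neighbouring piece of the cell. *)
Lemma cell_half A g B e s d z : AA A -> pcs A g B -> tile B e s d -> HH z -> Re (act g z) = e ->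
  \forall w \near z, 0 <= s * (Re (act g w) - e) -> cell Gam AA A w.
Proof.
move=> AAA P T Hz rz; have Hg := HH_act g Hz; have [S d0 _] := tile_set T; have Hn := near_HH Hz.
case: (pselect (exists k, axisS k e)) => [[k0 ak0]|N].
  have [k [B' [d' nb]]] := nbr_ex ak0 S; have [ak _ _] := nb; have [u a] := tile_amax T ak.
  have [u0 _] := a; have N0 := Nm_gt0 k Hg.
  have h1 : s * (Re (act g z) - e) < u by rewrite rz subrr mulr0.
  have h2 : s * (Re (act g z) - e) < u * Nm k (act g z) by rewrite rz subrr mulr0 mulr_gt0.
  have n1 := near_act Hz (near_sRe h1); have n2 := near_act Hz (near_sReN h2).
  near=> w => w0; have Hw : HH w by near: w.
  have m1 : s * (Re (act g w) - e) < u by near: w.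
  have m2 : s * (Re (act g w) - e) < u * Nm k (act g w) by near: w.
  case: (half_axis T nb a (HH_act g Hw) _ m2); first by rewrite w0.
    exact: pcs_cell AAA P Hw.
  exact: pcs_next AAA P T nb Hw.
have iv : ivert e.
  case: (End_case (tile_end T)) => // -[k ak]; case: N; by exists k.
have := near_act Hz (half_ivert T iv Hg rz); apply: filterS2 Hn => w Hw h /h; exact: pcs_cell AAA P Hw.
Unshelve. all: by end_near. Qed.

Lemma tile_closed B e s d w : tile B e s d -> HH w -> ~ B w -> nbhs w (~` B).
Proof.
move=> T Hw nB; have [S d0 BE] := tile_set T.
case: (pselect (clK w)) => [cw|ncw]; last first.
  have : ~ closure clK w by move=> /(clK_closed Hw).
  move=> nc; apply: contrapT => H; apply: nc => V nV.
  apply: contrapT => E; apply: H; apply: filterS nV => v Vv Bv; apply: E; exists v; split=> //.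
  exact: (tile_clK T).
case: (leP 0 (s * (Re w - e))) => h1; last first.
  by have := near_sRe h1; apply: filterS => v hv; rewrite BE => -[_ /andP[]]; rewrite leNgt hv.
case: (leP (s * (Re w - e)) d) => h2; last first.
  by have := near_sRe0 h2; apply: filterS => v hv; rewrite BE => -[_ /andP[_]]; rewrite leNgt hv.
by case: nB; rewrite BE; split=> //; rewrite h1.
Qed.

Lemma cell_closed A z : AA A -> HH z -> closure (cell Gam AA A) z -> cell Gam AA A z.
Proof.
move=> AAA Hz cz; apply: contrapT => nz.
have : nbhs z [set w | forall i, [set x : PSL2 R * set R[i] | pcs A x.1 x.2] i -> ~ i.2 (act i.1 w)].
  apply: (near_fin (P := fun i => [set w | ~ i.2 (act i.1 w)])); first exact: pcs_finite.
  move=> [g B] /= P; have [/AA_tile[e [d T]] _] := pcs_AA AAA P.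
  have nB : ~ B (act g z) by move=> Bz; apply: nz; exact: pcs_cell AAA P Hz Bz.
  exact: (near_act Hz (tile_closed T (HH_act g Hz) nB)).
move=> /cz[w [/(cellP w AAA)[Hw [g [B [P Bw]]]] /(_ (g, B) P)]]; exact.
Qed.

Lemma arc_int A g B e s d k B' d' u z : AA A -> pcs A g B -> tile B e s d -> nbr e s k B' d' ->
  amax k e s u -> HH z -> Nm k (act g z) = 1 -> 0 < s * (Re (act g z) - e) < u ->
  interior (cell Gam AA A) z.
Proof.
move=> AAA P T nb a Hz N1 /andP[h1 h2]; have Hg := HH_act g Hz; have Hn := near_HH Hz.
have n0 := near_act Hz (near_sRe0 h1); have n1 := near_act Hz (near_sRe h2).
have h3 : s * (Re (act g z) - e) < u * Nm k (act g z) by rewrite N1 mulr1.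
have n2 := near_act Hz (near_sReN h3); near=> w; have Hw : HH w by near: w.
have m0 : 0 < s * (Re (act g w) - e) by near: w.
have m1 : s * (Re (act g w) - e) < u by near: w.
have m2 : s * (Re (act g w) - e) < u * Nm k (act g w) by near: w.
case: (half_axis T nb a (HH_act g Hw) _ m2); first by rewrite ltW.
  exact: pcs_cell AAA P Hw.
exact: pcs_next AAA P T nb Hw.
Unshelve. all: by end_near. Qed.

Lemma arc_int2 A g B e s d h u z : AA A -> pcs A g B -> tile B e s d -> axisS h e -> amax h e s u ->
  HH z -> B (act g z) -> ~ KK Gam (act g z) -> 0 < s * (Re (act g z) - e) < u ->
  interior (cell Gam AA A) z.
Proof.
move=> AAA P T ah a Hz Bz nK hu; have [S _ _] := tile_set T; have Hg := HH_act g Hz.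
have [k [B' [d' nb]]] := nbr_ex ah S; have [ak _ _] := nb; have [u' a'] := tile_amax T ak.
have uE := axis_amax_same ak ah S a' a; rewrite uE in a'.
apply: (arc_int AAA P T nb a' Hz _ hu); have [_ [b _]] := a'.
have oX : onK k (Re (act g z)) by apply: b; case/andP: hu => /ltW-> ->.
have [Gk c0 _ _] := ak; apply/(Nm_eq1 _ c0); apply/eqP; rewrite eq_le.
have /(onK_clK oX Hg erefl)-> := tile_clK T Bz; rewrite andbT leNgt; apply/negP => lt.
by apply: nK; apply/(onK_KK oX Hg erefl).
Qed.

Lemma cell_int_nv A g B e s d z : AA A -> pcs A g B -> tile B e s d -> HH z -> B (act g z) ->
  0 < s * (Re (act g z) - e) < d ->
  (forall e s d u g1 h1, nct B e s d u g1 h1 (act g z) -> False) -> interior (cell Gam AA A) z.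
Proof.
move=> AAA P T Hz Bz hz nv; have Hg := HH_act g Hz.
case: (pselect (KK Gam (act g z))) => [Kz|nK].
  have := near_act Hz (tile_int T Kz hz); apply: filterS2 (near_HH Hz) => w Hw.
  exact: pcs_cell AAA P Hw.
have [S d0 _] := tile_set T.
case: (T) => [[u [g1 [h1 [p n]]]]|[g1 c]|[g1 c]|st].
- have [_ [[ag ah gX hX] [Kp rp n1 n2]]] := n; have [a oe] := nct_amax n.
  have n' := nct_sym n; have [a' _] := nct_amax n'.
  case: (ltgtP (s * (Re (act g z) - e)) u) => hu.
  + by apply: (arc_int2 AAA P T ag a Hz Bz nK); rewrite hu andbT; case/andP: hz.
  + apply: (arc_int2 AAA P (nct_tile n') ah a' Hz Bz nK).
    rewrite (_ : - s * (Re (act g z) - (e + s * d)) = s * s * d - s * (Re (act g z) - e)); last ring.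
    by rewrite sg2// mul1r; case/andP: hz => _ ?; apply/andP; split; lra.
  + case: (nv e s d u g1 h1); rewrite (_ : act g z = p)//.
    have [Gg c0 cg _] := ag; have [Hp _] := Kp.
    have rE : Re (act g z) = Re p by rewrite rp -hu mulrA sg2// mul1r addrC subrK.
    apply: pt_eq => //; rewrite ((Nm_eq1 p c0).1 n1) -rE.
    apply/eqP; rewrite eq_le; have oz : onK g1 (Re (act g z)) by rewrite rE rp.
    have /(onK_clK oz Hg erefl)-> := tile_clK T Bz; rewrite andbT leNgt; apply/negP => lt.
    by apply: nK; apply/(onK_KK oz Hg erefl).
- have [_ [ag _ _ _]] := c; exact: (arc_int2 AAA P T ag (cut_amax c) Hz Bz nK hz).
- have [_ [ag _ _ _]] := c; apply: (arc_int2 AAA P (cut_tile c) ag (cut_amax c) Hz Bz nK).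
  rewrite (_ : - s * (Re (act g z) - (e + s * d)) = s * s * d - s * (Re (act g z) - e)); last ring.
  by rewrite sg2// mul1r; case/andP: hz => ? ?; apply/andP; split; lra.
- have [_ [iv _ _]] := st; case: nK; apply: (@ivert_KK (Re (act g z))) => //.
  by apply: iv; case/andP: hz => /ltW-> /ltW->.
Qed.

Lemma pcs_nct A e s d u g0 h0 p g B : nct A e s d u g0 h0 p -> pcs A g B ->
  exists e' s' d' u' g' h', nct B e' s' d' u' g' h' (act g p).
Proof.
move=> n; have [_ [_ [[Hp _] _ _ _]]] := n.
elim=> [|{}g {}B e1 s1 d1 h B' d1' _ [e' [s' [d' [u' [g' [h' n']]]]]] T nb].
  by exists e, s, d, u, g0, h0; rewrite act1.
have {n'} [u2 [g2 [h2 n2]]] : exists u2 g2 h2, nct B e1 s1 d1 u2 g2 h2 (act g p).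
  have [-> [[-> ->]|[-> ->]]] := tile_inj (nct_tile n') T; first by exists u', g', h'.
  by exists (d' - u'), h', g'; exact: nct_sym.
have [h3 n3] := nct_next n2 nb; rewrite actM//.
by exists (pol h), (- s1), d1', u2, h^-1%g, h3.
Qed.

(** Away from the translated vertical lines, points inside a precell or on a glued side are
    interior. The delicate point is the common vertex of all pieces: a neighbourhood of it is
    reached along segments that avoid it, on which the cell is both open and closed. *)
Lemma cell_bd A z : AA A -> cell Gam AA A z -> ~ interior (cell Gam AA A) z ->
  exists g B e s d, [/\ pcs A g B, tile B e s d & Re (act g z) = e].
Proof.
move=> AAA /(cellP z AAA)[Hz [g [B [P Bz]]]] ni; apply: contrapT => N.
(* Being strictly between the lines of every piece; this condition is open, since there are finitely
   many pieces, and convex. *)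
pose strict w := forall k B', pcs A k B' ->
  forall e d, tile B' e 1 d -> 0 < 1 * (Re (act k w) - e) < d.
have nonend g' B' e s d : pcs A g' B' -> tile B' e s d -> Re (act g' z) <> e.
  by move=> P' T' E; apply: N; exists g', B', e, s, d.
have inner g' B' e s d w : pcs A g' B' -> tile B' e s d -> B' (act g' w) ->
   Re (act g' w) <> e -> Re (act g' w) <> e + s * d -> 0 < s * (Re (act g' w) - e) < d.
  move=> P' T' Bw n1 n2; have [S d0 BE] := tile_set T'; rewrite BE in Bw; have [_ /andP[h1 h2]] := Bw.
  rewrite !lt_neqAle h1 h2 !andbT; apply/andP; split; apply/eqP => E.
    by apply: n1; rewrite (sg_at' e (Re _) S) -E mulr0 addr0.
  by apply: n2; rewrite {1}(sg_at' e (Re _) S) E.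
have [e0 [d0 T0]] := AA_tile (pcs_AA AAA P).1.
have hz := inner _ _ _ _ _ z P T0 Bz (nonend _ _ _ _ _ P T0) (nonend _ _ _ _ _ P (tile_sym T0)).
case: (pselect (exists e s d u g1 h1, nct B e s d u g1 h1 (act g z))) => [[e1 [s1 [d1 [u1 [g1 [h1 n]]]]]]|nv]; last first.
  apply: ni; apply: (cell_int_nv AAA P T0 Hz Bz hz) => e s d u g1 h1 n; apply: nv.
  by exists e, s, d, u, g1, h1.
have [eA [sA [dA [uA [gA [hA nA]]]]]] : exists e s d u g1 h1, nct A e s d u g1 h1 z.
  have nctA : exists e s d u g1 h1 p, nct A e s d u g1 h1 p.
    case: (AA_kind AAA) => // [[e [s [d [g0 c]]]]|[st [e [d std]]]]; last first.
      by have [_ BE] := pcs_stt std P; rewrite BE in n; case: (nct_stt n std).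
    have [_ [ag _ _ _]] := c; have [[S _ _] _] := c; have [h [A' [d' nb]]] := nbr_ex ag S.
    have [c' _] := cut_next c nb.
    by case: ((pcs_cut g B AAA c nb).1 P) => -[_ BE]; rewrite BE in n; [case: (nct_cut n c)|case: (nct_cut n c')].
  have [e [s [d [u [g2 [h2 [p n2]]]]]]] := nctA.
  have [e' [s' [d' [u' [g' [h' n3]]]]]] := pcs_nct n2 P; have pE := nct_vertex_uniq n n3.
  have [_ [_ [[Hp _] _ _ _]]] := n2.
  by have := act_inj Hz Hp pE => zE; exists e, s, d, u, g2, h2; rewrite zE.
have [KA0 rA _ _] := nA.2.2.
have sz : strict z.
  move=> g' B' P' e d T'; apply: (inner _ _ _ _ _ _ P' T').
  - have [e' [s' [d' [u' [g2 [h2 n2]]]]]] := pcs_nct nA P'.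
    have [[S' u0' ud' BE'] [_ [K' r' _ _]]] := n2; rewrite BE'; split=> //.
    by rewrite r' sg_at// !ltW.
  - exact: nonend P' T'.
  - exact: nonend P' (tile_sym T').
have Ns : nbhs z strict.
  have := @near_fin _ [set x : PSL2 R * set R[i] | pcs A x.1 x.2]
    (fun i => [set w | forall e d, tile i.2 e 1 d -> 0 < 1 * (Re (act i.1 w) - e) < d]) z (pcs_finite AAA).
  move=> H; apply: filterS (H _) => [w Hw k B' P' e d|]; first exact: (Hw (k, B')).
  move=> [g' B'] /= P'; have [e [d T']] := AA_tile (pcs_AA AAA P').1.
  have /andP[k1 k2] := sz _ _ P' e d T'.
  have n1 := near_act Hz (near_sRe0 k1); have n2 := near_act Hz (near_sRe k2).
  apply: filterS2 n1 n2 => w w1 w2 e' d' T2.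
  have [-> [[-> _]|[_ sE]]] := tile_inj T' T2; first by rewrite w1 w2.
  by case: (sg_neq (or_introl erefl) sE).
have intN w : HH w -> strict w -> cell Gam AA A w -> w <> z -> interior (cell Gam AA A) w.
  move=> Hw sw /(cellP w AAA)[_ [g' [B' [P' Bw]]]] wz.
  have [e [d T']] := AA_tile (pcs_AA AAA P').1.
  apply: (cell_int_nv AAA P' T' Hw Bw (sw _ _ P' e d T')) => e2 s2 d2 u2 g2 h2 n2.
  have [e' [s' [d' [u' [g3 [h3 n3]]]]]] := pcs_nct nA P'.
  by apply: wz; apply: (act_inj Hw Hz (nct_vertex_uniq n2 n3)).
have sconv w1 w2 w : HH w1 -> HH w2 -> HH w -> strict w1 -> strict w2 -> kseg w1 w2 w -> strict w.
  move=> H1 H2 Hw S1 S2 ks k B' Pi e d Ti.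
  have [t [t0 t1 rE _]] := kseg_act k H1 H2 Hw ks.
  have /andP[a1 a2] := S1 _ _ Pi _ _ Ti; have /andP[b1 b2] := S2 _ _ Pi _ _ Ti.
  rewrite !mul1r in a1 a2 b1 b2 *; rewrite rE; apply/andP; split.
    by have := conv_lt (a := Re (act k w1)) (b := Re (act k w2)) (c := e) t0 t1; lra.
  by have := conv_lt (a := - Re (act k w1)) (b := - Re (act k w2)) (c := - (e + d)) t0 t1; lra.
(* The interior is also closed along a segment that misses the vertex [z], since points of the cell
   other than [z] are interior there. *)
have walk w1 w2 : HH w1 -> HH w2 -> strict w1 -> strict w2 -> interior (cell Gam AA A) w1 ->
    (forall w, kseg w1 w2 w -> w <> z) -> interior (cell Gam AA A) w2.
  move=> H1 H2 S1 S2 I1 avoid.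
  apply: (conn_kseg H1 H2 _ I1) => [|w Hw ks cw]; first exact: open_interior.
  have cw2 : cell Gam AA A w by apply: (cell_closed AAA Hw); exact: (closure_subset (@interior_subset _ _) cw).
  exact: (intN w Hw (sconv _ _ _ H1 H2 Hw S1 S2 ks) cw2 (avoid w ks)).
have [r r0 rN] := (nbhs_boxP z _).1 Ns.
pose z0 : R[i] := Re z +i* (Im z + r / 2).
have Imz : 0 < Im z by [].
have H0 : HH z0 by rewrite /HH /=; lra.
have W0 : Wk z < Wk z0 by rewrite (Im_ltWk Hz H0 erefl) /= ltrDl divr_gt0.
have S0 : strict z0.
  apply: rN => /=; first by rewrite subrr normr0.
  exact: half_shift.
have I0 : interior (cell Gam AA A) z0.
  apply: intN => //.
    apply: (pcs_cell AAA (pcs1 A) H0); rewrite act1//.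
    have [[SA uA0 udA AE] _] := nA; rewrite AE; split; last by rewrite /= rA sg_at// !ltW.
    by apply: (clK_above KA0) => //=; lra.
  by move=> /(congr1 (@complex.Im R)); exact: half_shift_neq.
(* From [z0], straight above [z], every nearby point not vertically below [z] is visible. *)
have off w : HH w -> strict w -> Re w <> Re z \/ Im z < Im w -> interior (cell Gam AA A) w.
  move=> Hw Sw D; apply: (walk z0 w H0 Hw S0 Sw I0) => v [t [t0 t1 rE wE]] vz; rewrite vz /= in rE wE.
  case: D => [rw|iw].
    have : t * (Re w - Re z) = 0 by lra.
    move/eqP; rewrite mulf_eq0 subr_eq0 => /orP[/eqP tE|/eqP//].
    by rewrite tE subr0 mul1r mul0r addr0 in wE; lra.
  case: (pselect (Re w = Re z)) => [rw|rw].
    have W1 : Wk z < Wk w by rewrite (Im_ltWk Hz Hw (esym rw)).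
    by have := conv_lt t0 t1 W0 W1; rewrite -wE ltxx.
  have : t * (Re w - Re z) = 0 by lra.
  move/eqP; rewrite mulf_eq0 subr_eq0 => /orP[/eqP tE|/eqP//].
  by rewrite tE subr0 mul1r mul0r addr0 in wE; lra.
(* Points below [z] are hidden from [z0] and are reached from [z2], beside [z]. *)
pose z2 : R[i] := (Re z + r / 2) +i* Im z.
have H2 : HH z2 by [].
have S2 : strict z2.
  apply: rN => /=; last by rewrite subrr normr0.
  exact: half_shift.
have I2 : interior (cell Gam AA A) z2 by apply: (off z2 H2 S2); left; exact: half_shift_neq.
apply: ni; near=> w.
have [Hw Sw] : HH w /\ strict w by split; near: w; [exact: near_HH|].
case: (pselect (w = z)) => [->|wz]; first by apply: (pcs_cell AAA P Hz).
apply: interior_subset.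
case: (pselect (Re w <> Re z \/ Im z < Im w)) => [|nD]; first exact: off.
have rw : Re w = Re z by apply: contrapT => E; apply: nD; left.
have iw : Im w <= Im z by rewrite leNgt; apply/negP => E; apply: nD; right.
have iw' : Im w < Im z by rewrite lt_neqAle iw andbT; apply/eqP => E; apply: wz; exact: complexP.
have W1 : Wk w < Wk z by rewrite (Im_ltWk Hw Hz rw).
apply: (walk z2 w H2 Hw S2 Sw I2) => v [t [t0 t1 rE wE]] vz; rewrite vz rw /= in rE wE.
have : (1 - t) * (r / 2) = 0 by lra.
move/eqP; rewrite mulf_eq0 subr_eq0 => /orP[/eqP tE|/eqP]; last by lra.
by rewrite -tE subrr mul0r add0r mul1r in wE; lra.
Unshelve. all: by end_near. Qed.

(** If the piece had points on both sides of the line over [e], a segment inside [KK Gam] would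
    cross the translated line at some [p]. Moving [p] along that line into [clK] amounts to a
    translation, so [p] itself lies over an end, yet strictly inside the interval of [B]. *)
Lemma piece_side A g B e0 s0 d0 e s q : AA A -> pcs A g B -> End e -> sg s -> tile B e0 s0 d0 ->
  clK q -> 0 < s0 * (Re q - e0) < d0 -> 0 < s * (Re (act g^-1%g q) - e) ->
  forall w, B w -> 0 <= s * (Re (act g^-1%g w) - e).
Proof.
move=> AAA P Ee S T cq hq sq w Bw; rewrite leNgt; apply/negP => sw.
have [_ Gg] := pcs_AA AAA P; have [S0 d00 BE] := tile_set T; have [Hq _] := cq.
have [cw hw] : clK w /\ 0 <= s0 * (Re w - e0) <= d0 by rewrite BE in Bw.
have [Hw _] := cw; pose G := g^-1%g.
have [r r0 rN] := (nbhs_boxP q _).1 (near_act Hq (near_sRe0 sq)).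
have Iq : 0 < Im q by [].
(* Raising [q] slightly puts it into the open region, hence also all points of the segment except
   possibly [w]. *)
pose q' : R[i] := Re q +i* (Im q + r / 2); have Hq' : HH q' by rewrite /HH /=; lra.
have Kq' : KK Gam q' by apply: (KK_above cq) => //=; lra.
have sq' : 0 < s * (Re (act G q') - e).
  apply: rN => /=; first by rewrite subrr normr0.
  exact: half_shift.
have lw : s * (Nm G w * (Re (act G w) - e)) < 0 by rewrite mulrCA pmulr_rlt0// Nm_gt0.
have lq : 0 <= s * (Nm G q' * (Re (act G q') - e)) by rewrite mulrCA ltW// mulr_gt0// Nm_gt0.
have [p [Hp [t [t0 t1 rp wp]] Lp]] := kseg_zero2 S Hw Hq' lw lq.
have tp : 0 < t.
  rewrite lt_neqAle t0 andbT; apply/eqP => tE.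
  have pw : p = w by apply: pt_eq => //; rewrite ?rp ?wp -tE subr0 mul1r mul0r addr0.
  by move: sw; rewrite -pw Lp subrr mulr0 ltxx.
have Kp : KK Gam p by exact: (kseg_KK cw Kq' Hp tp t1 rp wp).
have HG : HH (act G p) by exact: HH_act.
have [k [x [Gk _ Ex lk ck]]] := clK_end (End_case Ee) HG Lp.
rewrite -actM// in ck; have cc0 := KK_stab (GM Gk (GV Gg)) Kp ck.
have un := stab_unip (GM Gk (GV Gg)) cc0.
have rx : Re (act (k * G)%g p) = x by rewrite actM//; apply/(lk _ HG).
have [rt _] := unip_act un Hp; rewrite rt in rx.
have Ep : End (Re p).
  by apply: (@End_tr' _ _ fuchG (k * G)%g) => //; [exact: GM Gk (GV Gg)|rewrite rx; exact: Ex Ee].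
apply: (tile_open T _ Ep); rewrite rp.
case/andP: hq => q1 q2; case/andP: hw => w1 w2.
rewrite (_ : s0 * _ = (1 - t) * (s0 * (Re w - e0)) + t * (s0 * (Re q - e0))); last ring.
have a1 : 0 <= (1 - t) * (s0 * (Re w - e0)) by rewrite mulr_ge0//; lra.
have a2 : 0 < t * (s0 * (Re q - e0)) by rewrite mulr_gt0.
have a3 : (1 - t) * (s0 * (Re w - e0)) <= (1 - t) * d0 by rewrite ler_wpM2l//; lra.
have a4 : t * (s0 * (Re q - e0)) < t * d0 by rewrite ltr_pM2l.
by apply/andP; split; lra.
Qed.

(** [piece_side] needs one point of each piece on the correct side: the common vertex, or an inner
    point of the side along which two cuspidal precells are glued. *)
Lemma cell_side A e s d z : AA A -> tile A e s d -> cell Gam AA A z -> 0 <= s * (Re z - e).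
Proof.
move=> AAA T /(cellP z AAA)[Hz [g [B [P Bz]]]]; have [S d0 AE] := tile_set T.
rewrite -(actK g Hz); have Ee := tile_end T.
have triv : g = 1%g /\ B = A -> 0 <= s * (Re (act g^-1%g (act g z)) - e).
  by move=> [gE BE]; rewrite actK//; move: Bz; rewrite gE BE act1// AE => -[_ /andP[]].
case: (AA_kind AAA) => [[e1 [s1 [d1 [u1 [g1 [h1 [p n]]]]]]]|[e1 [s1 [d1 [g1 c]]]]|[st [e1 [d1 std]]]]; last first.
- exact: triv (pcs_stt std P).
- have [[S1 d10 _] [ag iv _ _]] := c; have [h [A' [d' nb]]] := nbr_ex ag S1.
  case: ((pcs_cut g B AAA c nb).1 P) => // -[gE BE].
  have [c' _] := cut_next c nb; have [ah _ _] := nb; have [u a] := tile_amax (cut_tile c) ah.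
  have [Gh c0 ch _] := ah; have uE := axis_amax_same ah ag S1 a (cut_amax c); rewrite uE in a.
  have oX : onK h (e1 + s1 * (d1 / 2)).
    by have [_ [b _]] := a; apply: b; rewrite sg_at//; apply/andP; split; lra.
  have [l Kq Nq] := onK_pt oX; have [Hq rq wq] := ptP l; set q := pt _ _ in Kq Nq Hq rq wq.
  have Kh : clK (act h q) by exact: clK_act.
  rewrite BE gE in P Bz *.
  apply: (piece_side AAA P Ee S (cut_tile c') Kh) => //.
    rewrite Re_actC// Nq divr1 rq ch.
    rewrite (_ : - s1 * _ = s1 * s1 * (d1 / 2)); last ring.
    by rewrite sg2// mul1r; apply/andP; split; lra.
  rewrite actK// rq; have [dE [[-> ->]|[-> ->]]] := tile_inj (cut_tile c) T.
    by rewrite sg_at//; lra.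
  rewrite (_ : - s1 * _ = s1 * s1 * (d1 / 2)); last by field.
  by rewrite sg2// mul1r; lra.
- have [[S1 u0 ud _] [_ [Kp rp _ _]]] := n; have [Hp _] := Kp.
  have [e2 [s2 [d2 [u2 [g2 [h2 n2]]]]]] := pcs_nct n P.
  have [[S2 u20 ud2 _] [_ [Kp2 rp2 _ _]]] := n2.
  apply: (piece_side AAA P Ee S (nct_tile n2) Kp2) => //; first by rewrite rp2 sg_at// u20.
  rewrite actK// rp; have [dE [[-> ->]|[-> ->]]] := tile_inj (nct_tile n) T; first by rewrite sg_at.
  rewrite (_ : - s1 * _ = s1 * s1 * (d1 - u1)); last ring.
  by rewrite sg2// mul1r subr_gt0.
Qed.

End CellShape.

Variables (SS : set (set R[i] * PSL2 R)) (choiceS : set_of_choices Gam AA SS).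
Variable TT : label R -> PSL2 R.
Hypothesis shiftT : shift_map Gam AA SS TT.
Local Notation labels := (labels Gam AA SS).
Local Notation Iint := (Iint Gam AA TT).
Local Notation Jint := (Jint Gam AA TT).
Local Notation CS' := (CS' Gam AA TT).
Local Notation Ired := (Ired Gam AA SS TT).
Local Notation bd := (bd Gam AA).

(** * Representatives *)

Section Labels.
Local Notation rep := (rep Gam AA).
Local Notation is_cycle := (is_cycle Gam AA).
Local Notation noncuspidal_cycle := (noncuspidal_cycle Gam AA).
Implicit Types (g h k t : PSL2 R) (z w p q : R[i]) (X Y e d u s : R) (A B b : set R[i]).
Local Notation state := (set R[i] * R * PSL2 R)%type.
Implicit Types (f : nat -> state) (al be : label R) (c : precycle R).

Lemma rep_inv al B b : rep al B b -> let A := al.1.1 in let h := al.1.2 in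
  [\/ exists c, [/\ noncuspidal_cycle A h c, (1 <= al.2 <= cyl Gam c)%N,
        B = cell Gam AA (cyc_pair c al.2.-1).1 & b = gseg (actS ((cyc_pair c al.2.-1).2)^-1%g (pinf R)) (pinf R)],
      exists v q A', [/\ cuspidal_precell Gam v q A, assigned_at Gam AA A (gseg (fin q) v) h A' &
        [\/ [/\ al.2 = 1%N, B = cell Gam AA A & b = gseg v (pinf R)],
            [/\ al.2 = 2%N, B = cell Gam AA A' & b = gseg (actS h v) (pinf R)] |
            [/\ al.2 = 3%N, B = cell Gam AA A & b = gseg (actS h^-1%g (pinf R)) (pinf R)]]] |
      exists v1 v2, [/\ strip_precell Gam v1 v2 A, h = 1%g, B = A &
        (al.2 = 1%N /\ b = gseg (fin v1%:C) (pinf R)) \/ (al.2 = 2%N /\ b = gseg (fin v2%:C) (pinf R))]].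
Proof.
case=> /=.
- by move=> A h m c N mc; constructor 1; exists c.
- by move=> A v s g A' N a; constructor 2; exists v, s, A'; split=> //; constructor 1.
- by move=> A v s g A' N a; constructor 2; exists v, s, A'; split=> //; constructor 2.
- by move=> A v s g A' N a; constructor 2; exists v, s, A'; split=> //; constructor 3.
- by move=> A v1 v2 N; constructor 3; exists v1, v2; split=> //; left.
- by move=> A v1 v2 N; constructor 3; exists v1, v2; split=> //; right.
Qed.

(** The centre of the first element is the end at which the orbit starts, which also fixes the
    direction; from there on steps are deterministic. *)
Lemma orbit_uniq s p f (n : nat) s' p' f' (n' : nat) : orbit s p f n -> orbit s' p' f' n' ->
  (f 0%N).1.1 = (f' 0%N).1.1 -> (f 1%N).2 = (f' 1%N).2 -> [/\ s = s', f =1 f' & n = n'].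
Proof.
move=> orb orb' AE hE.
have [d [u [g [h n0]]]] := orbit_nct 0%N orb; have [d' [u' [g' [h' n0']]]] := orbit_nct 0%N orb'.
have [Hp fS f0 [k0 fk fm]] := orb; have [Hp' fS' f0' [k0' fk' fm']] := orb'.
have [G st] := fS 0%N; have [G' st'] := fS' 0%N.
have [d1 [d2 [T _ [[_ _ c1 _] _ _] _ _]]] := step_tile G st.
have [d1' [d2' [T' _ [[_ _ c1' _] _ _] _ _]]] := step_tile G' st'.
rewrite (hstep0 orb) in c1; rewrite (hstep0 orb') -hE in c1'.
have eE : (f 0%N).1.2 = (f' 0%N).1.2 by rewrite -c1 c1'.
rewrite -AE in T'; have [_ [[_ sE]|[eE2 _]]] := tile_inj T T'; last first.
  have [S d0 _] := tile_set T; rewrite -eE in eE2.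
  have : s * d1 = 0 by lra.
  by move/eqP; rewrite mulf_eq0 (gt_eqF d0) orbF; case: S => ->; rewrite ?oppr_eq0 oner_eq0.
rewrite sE in orb' fS' n0' *; have ff0 : f 0%N = f' 0%N.
  by rewrite (orbit0 orb) (orbit0 orb') AE eE.
have pE : p = p'.
  by rewrite ff0 in n0; have := nct_vertex_uniq n0 n0'; rewrite f0' !act1.
have ff : f =1 f'.
  elim=> [//|j IH]; have [Gj stj] := fS j; have [_ stj'] := fS' j; rewrite -IH in stj'.
  exact: (step_det Gj stj stj').
split=> //; case: (ltngtP n n') => // lt.
  by case: (fm' n); rewrite ?k0// -ff fk f0.
by case: (fm n'); rewrite ?k0'// ff fk' f0'.
Qed.

Lemma cycle_uniq A h c c' : noncuspidal_cycle A h c -> noncuspidal_cycle A h c' -> c = c'.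
Proof.
move=> /cycle_orbit[s [p [f [n [orb fA fh ->]]]]] /cycle_orbit[s' [p' [f' [n' [orb' fA' fh' ->]]]]].
have [_ ff ->] := orbit_uniq orb orb' (etrans fA (esym fA')) (etrans fh (esym fh')).
by apply: eq_mkseq => j; rewrite !ff.
Qed.

Lemma nonc_nct A h c : noncuspidal_cycle A h c -> exists e s d u g h' p, nct A e s d u g h' p.
Proof.
move=> /cycle_orbit[s [p [f [n [orb <- _ _]]]]]; have [d [u [g [h' nn]]]] := orbit_nct 0%N orb.
by exists (f 0%N).1.2, s, d, u, g, h', (act (f 0%N).2 p).
Qed.

Lemma cusp_cut A (v : one_point_compactification R[i]) (s0 : R[i]) b h A' : cuspidal_precell Gam v s0 A -> assigned_at Gam AA A b h A' ->
  exists e s d g, [/\ cut A e s d g, v = fin (e + s * d)%:C & nbr e s h A' d].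
Proof.
move=> /cu_data[e [s [d [g [c vE _]]]]] /assigned_nbr[e' [s' [d0 [d' [u [T nb _ _]]]]]].
have [ah _ _] := nb; have [eE sE] := cut_axis c T ah; rewrite eE sE in nb.
have [_ dE] := cut_next c nb; rewrite dE in nb; by exists e, s, d, g.
Qed.

Lemma gsegA h e : axisS h e -> gseg (actS h^-1%g (pinf R)) (pinf R) = gseg (fin e%:C) (pinf R).
Proof.
move=> [Gh c0 ch _]; rewrite actS_pinf (ccV h).1 (negPf c0) -/(pol h^-1%g) (ctrV h).2 ch //.
Qed.

Lemma actS_cut h e s d : axisS h e -> sg s -> d = `|cc h|^-1 ->
  actS h (fin (e + s * d)%:C) = fin (pol h - s * d)%:C.
Proof.
move=> [Gh c0 ch _] S dE.
have ad : ca h * cd h - cb h * cc h = 1 := psl_det h.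
have d2 : d ^+ 2 * cc h ^+ 2 = 1.
  by rewrite dE exprVn real_normK ?num_real// mulVf// sqrf_eq0.
have d0 : d != 0 by rewrite dE invr_eq0 normr_eq0.
have x0 : cc h * (e + s * d) + cd h = cc h * (s * d) by rewrite -ch /ctr; field.
have sd0 : cc h * (s * d) != 0.
  by rewrite !mulf_neq0//; case: S => ->; rewrite ?oppr_eq0 oner_eq0.
have dE' : denom h (e + s * d)%:C = (cc h * (s * d))%:C.
  by apply: complexP; rewrite ?Re_denom ?Im_denom /= ?mulr0.
rewrite /actS /fin dE' -[0]/(0%:C) (inj_eq (@complexI R)) (negPf sd0); congr Some.
rewrite /act dE' -/(ca h) -/(cb h).
have -> : (ca h)%:C * (e + s * d)%:C + (cb h)%:C = (ca h * (e + s * d) + cb h)%:C.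
  by apply: complexP => /=; ring.
rewrite -fmorph_div; congr (_ %:C); rewrite -ch /ctr /pol.
apply: (mulIf sd0); rewrite divfK//.
have s2 := sg2 S.
have -> : (ca h / cc h - s * d) * (cc h * (s * d)) = ca h * (s * d) - (s * s) * (d ^+ 2 * cc h ^+ 2) / cc h by field.
by rewrite s2 d2 mul1r; apply: (mulIf c0); rewrite -[in RHS]ad; field.
Qed.

Lemma rep_uniq al B b B' b' : rep al B b -> rep al B' b' -> B = B' /\ b = b'.
Proof.
move=> /rep_inv /= [[c [N mc -> ->]]|[v [s0 [A' [N a H]]]]|[v1 [v2 [N h1 -> H]]]]
  /rep_inv /= [[c' [N' mc' -> ->]]|[v' [s0' [A'' [N' a' H']]]]|[v1' [v2' [N' h1' -> H']]]].
- by rewrite (cycle_uniq N N').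
- by have [? [? [? [? [? [? [? n]]]]]]] := nonc_nct N; case: (cuspidal_nct _ n); exists v', s0'.
- by have [? [? [? [? [? [? [? n]]]]]]] := nonc_nct N; case: (strip_nct _ n); exists v1', v2'.
- by have [? [? [? [? [? [? [? n]]]]]]] := nonc_nct N'; case: (cuspidal_nct _ n); exists v, s0.
- have [e [s [d [g [cu vE nb]]]]] := cusp_cut N a; have [e' [s' [d' [g' [cu' vE' nb']]]]] := cusp_cut N' a'.
  have [_ [ag _ _ _]] := cu'; have [eE sE] := cut_axis cu (cut_tile cu') ag.
  have [dE _] := tile_inj (cut_tile cu) (cut_tile cu'); rewrite eE sE in nb' vE'.
  have [_ AE] := nbr_uniq nb nb'.
  have vv : v' = v by rewrite vE vE' dE.
  by case: H => -[m -> ->]; case: H' => -[m' -> ->]; move: m'; rewrite m ?AE ?vv.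
- have st := st_data N'; case: (cuspidal_stt _ st); by exists v, s0.
- by have [? [? [? [? [? [? [? n]]]]]]] := nonc_nct N'; case: (strip_nct _ n); exists v1, v2.
- have st := st_data N; case: (cuspidal_stt _ st); by exists v', s0'.
- have st := st_data N; have st' := st_data N'.
  have [dE [[eE sE]|[eE sE]]] := tile_inj (stt_tile st).1 (stt_tile st').1; last first.
    by case: (sg_neq (or_introl erefl) sE).
  have v2E : v2' = v2 by lra.
  rewrite eE v2E in H'; split=> //.
  case: H => -[m ->]; case: H' => -[m' ->]; [exact: erefl| | |exact: erefl].
    by exfalso; move: m'; rewrite m.
  by exfalso; move: m'; rewrite m.
Qed.

Lemma cyl_nonc A h c : noncuspidal_cycle A h c -> exists s p f (n : nat), [/\ orbit s p f n,
  c = ocyc f n, cyl Gam c = (index A (behead (map fst c))).+1, (f 0%N).1.1 = A & (f 1%N).2 = h] .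
Proof.
move=> N; have [e [s0 [d [u [g [h' [p0 n0]]]]]]] := nonc_nct N.
have [s [p [f [n [orb fA fh cE]]]]] := cycle_orbit N; exists s, p, f, n; split=> //.
rewrite /cyl; have -> : (cyc_pair c 0).1 = A.
  by have [_ _ _ [k0 _ _]] := orb; rewrite cE ocyc_pair.
case: asboolP => [/strip_nct/(_ n0)//|_]; by case: asboolP => [/cuspidal_nct/(_ n0)//|_].
Qed.

Lemma cyl_le A h c : noncuspidal_cycle A h c -> (cyl Gam c <= size c)%N.
Proof.
move=> N; have [s [p [f [n [orb cE -> _ _]]]]] := cyl_nonc N.
have [_ _ _ [k0 _ _]] := orb; have c0 : (0 < size c)%N by rewrite cE size_mkseq.
by apply: leq_trans (_ : (size (behead (map fst c))).+1 <= _)%N; rewrite ?ltnS ?index_size// size_behead size_map prednK.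
Qed.

(** If the vertex is an elliptic fixed point, a cycle runs through its precells several times.
    Precells and starting ends, but not the group elements, already repeat with period [cyl]. *)
Lemma cyl_per A h c s p f (n : nat) : noncuspidal_cycle A h c -> orbit s p f n -> c = ocyc f n ->
  (f 0%N).1.1 = A -> forall i, (f i).1 = (f (i %% cyl Gam c)%N).1.
Proof.
move=> N orb cE fA; have [_ [_ [_ [_ [_ _ lE _ _]]]]] := cyl_nonc N.
have [_ fS _ [k0 fk _]] := orb.
have cylA : (f (cyl Gam c)).1.1 = A.
  rewrite lE; set l := index _ _; have lz : (l <= n.-1)%N.
    by rewrite (leq_trans (index_size _ _))// size_behead size_map cE size_mkseq.
  have sz : size (behead (map fst c)) = n.-1 by rewrite size_behead size_map cE size_mkseq.
  case: (ltnP l n.-1) => ln; last first.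
    have -> : l = n.-1 by apply/eqP; rewrite eqn_leq lz.
    by rewrite prednK// fk.
  have := @nth_index _ set0 A (behead (map fst c)); rewrite -index_mem sz => /(_ ln).
  rewrite -/l nth_behead (nth_map (set0, 1%g)); last by rewrite cE size_mkseq -ltn_predRL.
  by rewrite cE -/(cyc_pair _ _) ocyc_pair// -ltn_predRL.
have per i : (f (i + cyl Gam c)%N).1 = (f i).1.
  elim: i => [|i IH].
    rewrite add0n [LHS]surjective_pairing [RHS]surjective_pairing cylA fA; congr pair.
    exact: (good_end (fS _).1 (fS 0%N).1 (etrans cylA (esym fA))).
  rewrite addSn; have [_ st] := fS (i + cyl Gam c)%N; have [_ st'] := fS i.
  by have [] := step_det2 st st' (congr1 snd IH).
move=> i; rewrite {1}(divn_eq i (cyl Gam c)); elim: (i %/ _)%N => [|q IH]; first by rewrite mul0n.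
by rewrite mulSn -addnA addnC per.
Qed.

Lemma cell_stt A e s d : AA A -> stt A e s d -> cell Gam AA A = A.
Proof.
move=> AAA st; apply/seteqP; split=> z.
  by move=> /(cellP z AAA)[Hz [g [B [/(pcs_stt st)[-> ->]]]]]; rewrite act1.
move=> Az; have Hz := tile_HH (stt_tile st).1 Az.
by apply/(cellP z AAA); split=> //; exists 1%g, A; split; [exact: pcs1|rewrite act1].
Qed.

Lemma cycle_AA A h c : is_cycle A h c -> AA A.
Proof.
move=> /is_cycle_inv[[//]|[b [A' [//]]]|N].
have [v [[c0 cE _ H _] _]] := N; by have [] := H 0%N c0; rewrite cE.
Qed.

Lemma cc_abs g h : cc g ^+ 2 = cc h ^+ 2 -> `|cc g| = `|cc h|.
Proof. by move=> E; apply/eqP; rewrite -(@eqrXn2 _ 2)// !real_normK ?num_real// E. Qed.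

Lemma cut_absE A e s d g h A' d' : cut A e s d g -> nbr e s h A' d' -> d = `|cc h|^-1.
Proof.
move=> [_ [ag _ -> _]] [ah _ _]; have [_ cE] := axisS_same ag ah; by rewrite (cc_abs cE).
Qed.

(** The representative of [al] before shifting: the cell of [A], with its vertical side over [e],
    from which it extends in direction [s]. *)
Definition ldat0 al A e s := [/\ labels al, AA A, exists d, tile A e s d &
  rep al (cell Gam AA A) (gseg (fin e%:C) (pinf R))].

Lemma rep_ldat0 al B b : labels al -> rep al B b -> exists A e s, ldat0 al A e s.
Proof.
move=> L r; have [SSal [c0 cy _]] := L; have AAA := cycle_AA cy.
case: (rep_inv r) => /= [[c [N mc BE bE]]|[v [q [A' [N a H]]]]|[v1 [v2 [N h1 BE H]]]].
- have [s [p [f [n [orb cE lE fA fh]]]]] := cyl_nonc N; have [_ fS _ _] := orb.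
  have jn : (al.2.-1 < n)%N.
    have : (al.2 <= n)%N by case/andP: mc => _ /leq_trans; apply; rewrite -[n](size_mkseq (fun j => ((f j).1.1, hstep (f j) (f j.+1)))) -/(ocyc f n) -cE; exact: cyl_le N.
    by case/andP: mc; case: al.2.
  have [G st] := fS al.2.-1; have [d [d' [T _ [ah _ _] _ _]]] := step_tile G st; have [AAj _ _] := G.
  exists (f al.2.-1).1.1, (f al.2.-1).1.2, s; split=> //; first by exists d.
  by rewrite -(gsegA ah); move: r; rewrite BE bE cE ocyc_pair.
- have [e [s [d [g [cu vE nb]]]]] := cusp_cut N a; have [ah AA' _] := nb.
  have [c' _] := cut_next cu nb; have [[S _ _] _] := cu.
  case: H => -[m BE bE]; rewrite BE bE in r.
  + exists al.1.1, (e + s * d), (- s); split=> //; last by rewrite -vE.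
    by exists d; exact: (tile_sym (cut_tile cu)).
  + exists A', (pol al.1.2 - s * d), s; split=> //; last first.
      by rewrite -(actS_cut ah S (cut_absE cu nb)) -vE.
    by exists d; have := tile_sym (cut_tile c'); rewrite opprK mulNr.
  + exists al.1.1, e, s; split=> //; last by rewrite -(gsegA ah).
    by exists d; exact: cut_tile cu.
- have st := st_data N; rewrite BE -(cell_stt AAA st) in r; have T := (stt_tile st).1.
  case: H => -[m bE]; rewrite bE in r.
    by exists al.1.1, v1, 1; split=> //; exists (v2 - v1).
  exists al.1.1, v2, (- 1); split=> //; exists (v2 - v1).
  by have := tile_sym T; rewrite mul1r addrC subrK.
Qed.

Definition sided k e s x s' := lmap k e x /\
  forall w, HH w -> 0 < s * (Re w - e) -> 0 < s' * (Re (act k w) - x).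

(* The side [s] of the vertical line over [e] is equivalent under Gamma to the
   side of a chosen vertical line on which its cell lies. *)
Definition covered e s := exists k al A' e' s', [/\ Gam k, ldat0 al A' e' s' & sided k e s e' s'].

Lemma cov_same al A e s : ldat0 al A e s -> covered e s.
Proof.
by move=> L; exists 1%g, al, A, e, s; split=> //; split; [exact: lmap1|move=> w Hw; rewrite act1].
Qed.

(** The element of the sphere maps the line over its centre to the line over [pol h] and exchanges
    the sides. *)
Lemma cov_flip al A e s h : ldat0 al A e s -> axisS h e -> covered (pol h) (- s).
Proof.
move=> L [Gh c0 ch _]; exists h^-1%g, al, A, e, s; split=> //; first exact: GV.
have cV : cc h^-1%g != 0 by rewrite (ccV h).1.
split; first by apply: lmapV; rewrite -ch; exact: lmap_ctr.
move=> w Hw sw; rewrite Re_actC// (ctrV h).1 (ctrV h).2 ch.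
rewrite (_ : s * _ = - s * (Re w - pol h) / Nm h^-1%g w); last ring.
by rewrite divr_gt0// Nm_gt0.
Qed.

Lemma nct_label h c A s p f (n : nat) : SS (A, h) -> noncuspidal_cycle A h c -> orbit s p f n ->
  c = ocyc f n -> (f 0%N).1.1 = A ->
  forall i, ldat0 ((A, h), (i %% cyl Gam c).+1) (f i).1.1 (f i).1.2 s.
Proof.
move=> SSp N orb cE fA i; have [_ [_ [_ [_ [_ _ lE _ _]]]]] := cyl_nonc N.
have l0 : (0 < cyl Gam c)%N by rewrite lE.
have jl : (i %% cyl Gam c < cyl Gam c)%N by rewrite ltn_mod.
have jn : (i %% cyl Gam c < n)%N.
  by apply: leq_trans jl _; rewrite (leq_trans (cyl_le N))// cE size_mkseq.
rewrite (cyl_per N orb cE fA); set j := (_ %% _)%N in jl jn *.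
have [_ fS _ _] := orb; have [G st] := fS j.
have [d [d' [T _ [ah _ _] _ _]]] := step_tile G st; have [AAj _ _] := G.
split=> //; [|by exists d|].
  by split=> //=; exists c; [exact: NoncuspidalCycle|].
rewrite -(gsegA ah); have := @RepNoncuspidal R Gam AA A h j.+1 c N jl.
by rewrite /= cE ocyc_pair.
Qed.

Lemma orbit_conn s p f (n : nat) s' p' f' (n' : nat) i j : orbit s p f n -> orbit s' p' f' n' ->
  (f j).1.1 = (f' i).1.1 -> exists i', (f 0%N).1.1 = (f' i').1.1.
Proof.
move=> orb orb' E; have step1 m : exists i', (f (j + m)%N).1.1 = (f' i').1.1.
  elim: m => [|m [i' IH]]; first by rewrite addn0; exists i.
  have [_ fS _ _] := orb; have [G st] := fS (j + m)%N.
  have [d1 [d2 [T _ nb _ _]]] := step_tile G st; rewrite IH in T.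
  have [i2 [A2 _]] := orbit_nbr orb' T nb; by exists i2; rewrite addnS A2.
have [_ _ _ [n0 _ _]] := orb.
(* The index $j + j(n-1) = jn$ is a multiple of the period, so the walk ends at the first
   precell. *)
have := step1 (j * n.-1)%N; rewrite -mulnS prednK// (orbit_mod orb) modnMl //.
Qed.

Lemma ocyc_mem f (n : nat) B : B \in map fst (ocyc f n) -> exists2 j, (j < n)%N & B = (f j).1.1.
Proof.
by rewrite /ocyc /mkseq -map_comp => /mapP[j]; rewrite mem_iota => jn ->; exists j.
Qed.

Lemma choice_ex A h c : is_cycle A h c -> exists A0 h0 c' B, [/\ SS (A0, h0), is_cycle A0 h0 c',
  B \in map fst c & B \in map fst c'].
Proof.
move=> cy; case: choiceS => _ /(_ _ _ _ cy)[[A0 h0] [[SSp [c' cy' [B [B1 B2]]]] _]].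
by exists A0, h0, c', B.
Qed.

(** The chosen cycle contains [A]. If it passes [A] in direction [s], the label at this place
    serves; otherwise [e] is the end through which [A] is entered, and the label of the preceding
    precell serves after a flip. *)
Lemma covered_nct A e s d u g h p : AA A -> nct A e s d u g h p -> covered e s.
Proof.
move=> AAA n0; have [f [n [orb fE]]] := orbit_ex AAA n0.
have N := orbit_cycle orb; rewrite fE /= in N.
have [A0 [h0 [c' [B [SSp cy' /ocyc_mem[j jn BB] Bc']]]]] := choice_ex (NoncuspidalCycle N).
have [dB [uB [gB [hB nB]]]] := orbit_nct j orb; rewrite -BB in nB.
case: (is_cycle_inv cy') => [[_ st _ cE]|[b [A' [AA0 cu ass cE]]]|N'].
- by rewrite cE /= inE in Bc'; rewrite (eqP Bc') in nB; case: (strip_nct st nB).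
- exfalso; rewrite cE /= !inE in Bc'; case/orP: Bc' => /eqP E; rewrite E in nB; first by case: (cuspidal_nct cu nB).
  have [v [q Nq]] := cu; have [e' [s' [d' [g' [cu' _ nb]]]]] := cusp_cut Nq ass.
  by have [c2 _] := cut_next cu' nb; case: (nct_cut nB c2).
have [s' [p' [f' [n' [orb' cE lE fA fh]]]]] := cyl_nonc N'.
move: Bc'; rewrite cE => /ocyc_mem[i _ BB2].
have [i' AE] := orbit_conn orb orb' (etrans (esym BB) BB2); rewrite fE /= in AE.
have lab := nct_label SSp N' orb' cE fA.
have [_ fS _ [n'0 _ _]] := orb'; have [G st] := fS (i' + n').-1.
rewrite prednK ?addn_gt0 ?n'0 ?orbT// (orbit_per orb') in st.
have [d1 [d2 [T1 T2 [ah _ _] pE _]]] := step_tile G st; rewrite -AE in T2.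
have [dE [[eE sE]|[eE sE]]] := tile_inj T2 (nct_tile n0).
  by have := lab i'; rewrite -AE -eE -sE; exact: cov_same.
by rewrite eE sE pE; exact: cov_flip (lab _) ah.
Qed.

Lemma cusp_labels A b h A' : SS (A, h) -> AA A -> is_cuspidal Gam A -> assigned_at Gam AA A b h A' ->
  exists e s d g, [/\ cut A e s d g, nbr e s h A' d,
    ldat0 ((A, h), 1%N) A (e + s * d) (- s), ldat0 ((A, h), 2%N) A' (pol h - s * d) s &
    ldat0 ((A, h), 3%N) A e s].
Proof.
move=> SSp AAA cu ass; have cy := CuspidalCycle AAA cu ass.
have lab m : (1 <= m <= 3)%N -> labels ((A, h), m).
  move=> m3; split=> //; exists [:: (A, h); (A', h^-1%g)] => //=; rewrite /cyl /cyc_pair /=.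
  by have [v [q /cu_data[e [s [d [g [c _ _]]]]]]] := cu; case: asboolP => [/strip_cut/(_ c)//|_]; case: asboolP.
have [v [q [N bE]]] : exists v q, cuspidal_precell Gam v q A /\ b = gseg (fin q) v.
  case: ass => -[[v [s1 [s2 [/nc_data[e [s [d [u [g [h' [p [n0 _ _ _]]]]]]]] _]]]]|[v [q [N bE]]]] _ _ _ _.
    by case: (cuspidal_nct cu n0).
  by exists v, q.
rewrite bE in ass; have [e [s [d [g [c vE nb]]]]] := cusp_cut N ass.
exists e, s, d, g; have [ah AA' _] := nb; have [c' _] := cut_next c nb; have [[S _ _] _] := c.
split=> //; split=> //; try exact: lab.
- by exists d; exact: (tile_sym (cut_tile c)).
- by rewrite -vE; exact: RepCuspidal1 N ass.
- by exists d; have := tile_sym (cut_tile c'); rewrite opprK mulNr.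
- by rewrite -(actS_cut ah S (cut_absE c nb)) -vE; exact: RepCuspidal2 N ass.
- by exists d; exact: cut_tile c.
- by rewrite -(gsegA ah); exact: RepCuspidal3 N ass.
Qed.

(** The three labels of the chosen pair are the ideal sides of both precells and the summit line of
    the first; the summit line of the second is the flip of the latter. *)
Lemma covered_cut A e s d g : AA A -> cut A e s d g -> covered e s /\ covered (e + s * d) (- s).
Proof.
move=> AAA c; have [[S _ _] [ag _ _ _]] := c; have [h [A' [d' nb]]] := nbr_ex ag S.
have [c2 dE] := cut_next c nb; rewrite dE in nb; have [ah AA' T'] := nb; have [u a] := tile_amax (cut_tile c) ah.
have cu : is_cuspidal Gam A by exists (fin (e + s * d)%:C), (summit g); exact: (cut_precell AAA c).
have cy := CuspidalCycle AAA cu (nbr_assigned AAA (cut_tile c) nb a).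
have [A0 [h0 [c' [B [SSp cy' B1 B2]]]]] := choice_ex cy.
have cutB : exists e s d g, cut B e s d g.
  by move: B1; rewrite /= !inE => /orP[]/eqP->; [exists e, s, d, g|exists (pol h), (- s), d, h^-1%g].
have [eB [sB [dB [gB cB]]]] := cutB; have AA0 := cycle_AA cy'.
case: (is_cycle_inv cy') => [[_ st _ cE]|[b [A0' [_ cu0 ass cE]]]|N']; last first.
- exfalso; have [s' [p' [f' [n' [orb' cE lE fA fh]]]]] := cyl_nonc N'.
  move: B2; rewrite cE => /ocyc_mem[i _ BB].
  have [d3 [u3 [g3 [h3 n3]]]] := orbit_nct i orb'; rewrite -BB in n3; exact: (nct_cut n3 cB).
- have [e0 [s0 [d0 [g0 [c0 nb0 L1 L2 L3]]]]] := cusp_labels SSp AA0 cu0 ass.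
  have [c02 _] := cut_next c0 nb0; have [ah0 AA0' _] := nb0; have nb0' := nbr_sym AA0 (cut_tile c0) nb0.
  have : A = A0 \/ A = A0'.
    rewrite cE /= !inE in B1 B2.
    case/orP: B1 => /eqP E1; case/orP: B2 => /eqP E2; rewrite E1 in E2; [by left|by right| |].
    + right; rewrite E2 in c2; have [_ [ax _ _ _]] := c2.
      have [eE sE] := cut_axis c0 (cut_tile c2) ax.
      have := nbr_sym AAA (cut_tile c) nb; rewrite eE sE => nb3.
      by have [_ ->] := nbr_uniq nb3 nb0.
    + left; rewrite E2 in c2; have [_ [ax _ _ _]] := c2.
      have [eE sE] := cut_axis c02 (cut_tile c2) ax.
      have := nbr_sym AAA (cut_tile c) nb; rewrite eE sE => nb3.
      by have [_ ->] := nbr_uniq nb3 nb0'.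
  move=> [E|E]; rewrite E in c.
    have [_ [ax _ _ _]] := c; have [eE sE] := cut_axis c0 (cut_tile c) ax.
    have [dE2 _] := tile_inj (cut_tile c0) (cut_tile c).
    by rewrite eE sE dE2; split; [exact: cov_same L3|exact: cov_same L1].
  have [_ [ax _ _ _]] := c; have [eE sE] := cut_axis c02 (cut_tile c) ax.
  have [dE2 _] := tile_inj (cut_tile c02) (cut_tile c).
  rewrite eE sE dE2; split; first exact: cov_flip L3 ah0.
  by rewrite opprK mulNr; exact: cov_same L2.
- exfalso; move: B2; rewrite cE /= inE => /eqP E; rewrite E in cB; exact: (strip_cut st cB).
Qed.

Lemma covered_stt A : AA A -> is_strip Gam A -> exists e d, [/\ stt A e 1 d, covered e 1 & covered (e + 1 * d) (- 1)].
Proof.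
move=> AAA st; have [v1 [v2 N]] := st; have std := st_data N.
have cy := StripCycle AAA st.
have [A0 [h0 [c' [B [SSp cy' B1 B2]]]]] := choice_ex cy.
move: B1; rewrite /= inE => /eqP BE; rewrite BE in B2.
have pE : A0 = A /\ h0 = 1%g.
  case: (is_cycle_inv cy') => [[_ _ -> cE]|[b [A0' [AA0 cu0 ass cE]]]|N'].
  - by rewrite cE /= inE in B2; rewrite (eqP B2).
  - exfalso; rewrite cE /= !inE in B2; case/orP: B2 => /eqP E; first by rewrite E in std; exact: (cuspidal_stt cu0 std).
    have [v [q Nq]] := cu0; have [e0 [s0 [d0 [g0 [c0 _ nb0]]]]] := cusp_cut Nq ass.
    by have [c02 _] := cut_next c0 nb0; rewrite E in std; exact: (cut_stt c02 std).
  - exfalso; have [s' [p' [f' [n' [orb' cE lE fA fh]]]]] := cyl_nonc N'.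
    move: B2; rewrite cE => /ocyc_mem[i _ BB].
    have [d3 [u3 [g3 [h3 n3]]]] := orbit_nct i orb'; rewrite -BB in n3; exact: (nct_stt n3 std).
have [AE hE] := pE; rewrite AE hE in SSp.
have lab m : (1 <= m <= 2)%N -> labels ((A, 1%g), m).
  move=> m2; split=> //; exists [:: (A, 1%g)] => //=; rewrite /cyl /cyc_pair /=.
  by case: asboolP.
have T := (stt_tile std).1; exists v1, (v2 - v1); split=> //.
  apply: (@cov_same ((A, 1%g), 1%N) A); split=> //; [exact: lab|by exists (v2 - v1)|].
  by rewrite (cell_stt AAA std); exact: RepStrip1 N.
apply: (@cov_same ((A, 1%g), 2%N) A); split=> //; [exact: lab| |].
  by exists (v2 - v1); exact: tile_sym T.
by rewrite (cell_stt AAA std) mul1r addrC subrK; exact: RepStrip2 N.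
Qed.

Lemma covered_tile A e s d : AA A -> tile A e s d -> covered e s.
Proof.
move=> AAA T; case: (T) => [[u [g [h [p n]]]]|[g c]|[g c]|st].
- exact: covered_nct AAA n.
- by have [] := covered_cut AAA c.
- by have [S _ _] := tile_set T; have [_] := covered_cut AAA c; rewrite opprK sg_end.
have ist : is_strip Gam A.
  case: (AA_kind AAA) => [[? [? [? [? [? [? [? n]]]]]]]|[? [? [? [? c]]]]|[//]].
    by case: (nct_stt n st).
  by case: (cut_stt c st).
have [e0 [d0 [st0 C1 C2]]] := covered_stt AAA ist.
by have [_ [[-> ->]|[-> ->]]] := tile_inj (stt_tile st0).1 T.
Qed.

Local Notation shifted_rep := (shifted_rep Gam AA TT).
Local Notation on_right := (on_right Gam AA TT).
Local Notation on_left := (on_left Gam AA TT).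

(* The interval I_al is the half line from [x] in direction [s]. *)
Definition ldat al x s := exists A e, ldat0 al A e s /\ x = e + tau (TT al).

Lemma shiftP al : labels al -> Gam (TT al) /\ unip (TT al).
Proof.
move=> /shiftT/stab_infE[Gt c0]; split=> //; exact: (stab_unip Gt c0).
Qed.

Lemma ldat_sg al x s : ldat al x s -> sg s.
Proof. by move=> [A [e [[_ _ [d /tile_set[]]]]]]. Qed.

Lemma ldat_labels al x s : ldat al x s -> labels al.
Proof. by move=> [A [e [[]]]]. Qed.

(** The third item lets [s] be read off from the side on which the cell lies; by the fourth, the
    cell fills a one-sided neighbourhood of its vertical side, so a geodesic crossing in direction
    [s] enters its interior. *)
Lemma shifted_data al x s B b : ldat al x s -> shifted_rep al B b ->
  [/\ b = gseg (fin x%:C) (pinf R), forall z, B z -> 0 <= s * (Re z - x),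
      exists2 z, B z & 0 < s * (Re z - x) &
      forall z, HH z -> Re z = x -> \forall w \near z, 0 <= s * (Re w - x) -> B w].
Proof.
move=> [A [e [[L AAA [d T] r] xE]]] [B0 [b0 [r0 -> ->]]].
have [BE bE] := rep_uniq r0 r; rewrite BE bE {B0 b0 r0 BE bE}.
have [Gt ut] := shiftP L; set t := TT al in Gt ut xE *; have [S d0 _] := tile_set T.
have ReV w : HH w -> Re (act t^-1%g w) = Re w - tau t.
  by move=> Hw; have [u' tE] := unipV ut; have [-> _] := unip_act u' Hw; rewrite tE.
have cHH z : cell Gam AA A z -> HH z by move=> /(cellP z AAA)[].
split.
- apply/seteqP; split=> w.
    move=> [v /gseg_line[Hv rv] <-]; apply/gseg_line; split; first exact: HH_act.
    by have [-> _] := unip_act ut Hv; rewrite rv xE.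
  move=> /gseg_line[Hw rw]; exists (act t^-1%g w); last by rewrite actKV.
  by apply/gseg_line; split; [exact: HH_act|rewrite ReV// rw xE addrK].
- move=> z [w cw <-]; have [-> _] := unip_act ut (cHH w cw).
  by rewrite xE (_ : _ - _ = Re w - e); [exact: (cell_side AAA T cw)|ring].
- have [z Kz rz] := high_ex (e + s * (d / 2)); have [Hz _] := (KKE Gam z).1 Kz.
  have Az : A z by apply/(tile_range T Kz); rewrite rz sg_at//; apply/andP; split; lra.
  exists (act t z).
    by exists z => //; apply: (pcs_cell AAA (pcs1 A) Hz); rewrite act1.
  have [-> _] := unip_act ut Hz; rewrite xE rz (_ : _ - _ = e + s * (d / 2) - e); last ring.
  by rewrite sg_at//; lra.
- move=> z Hz rz; pose z' := act t^-1%g z; have Hz' : HH z' by exact: HH_act.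
  have rz' : Re (act 1%g z') = e by rewrite act1// ReV// rz xE addrK.
  have := near_act Hz (cell_half AAA (pcs1 A) T Hz' rz').
  apply: filterS2 (near_HH Hz) => w Hw h sw; exists (act t^-1%g w); last by rewrite actKV.
  apply: h; rewrite act1 ?ReV//; last exact: HH_act.
  by rewrite (_ : _ - _ - _ = Re w - x)// xE; ring.
Qed.

Lemma shifted_ex al x s : ldat al x s -> exists B b, shifted_rep al B b.
Proof.
move=> [A [e [[L AAA [d T] r] xE]]].
by exists (act (TT al) @` cell Gam AA A), (act (TT al) @` gseg (fin e%:C) (pinf R)), (cell Gam AA A), (gseg (fin e%:C) (pinf R)).
Qed.

Lemma gseg_line_inj (x y : R) : gseg (fin x%:C) (pinf R) = gseg (fin y%:C) (pinf R) -> x = y.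
Proof.
move=> E; have Hx : HH (x +i* 1 : R[i]) by rewrite /HH /=; exact: ltr01.
by have := (gseg_line x _).2 (conj Hx erefl); rewrite E => /gseg_line[].
Qed.

Lemma ldat_right al x s y : ldat al x s -> (on_right al y <-> s = 1 /\ y = x).
Proof.
move=> L; have S := ldat_sg L; split.
  move=> [B [b [sr bE sub]]]; have [bE' h1 [z Bz h2] _] := shifted_data L sr.
  have yx : y = x by apply: gseg_line_inj; rewrite -bE -bE'.
  split=> //; case: S h2 => // ->; have := sub z Bz; rewrite /= yx => ?; lra.
move=> [sE ->]; have [B [b sr]] := shifted_ex L; have [bE' h1 _ _] := shifted_data L sr.
exists B, b; split=> // z Bz /=; have := h1 z Bz; rewrite sE mul1r subr_ge0; exact.
Qed.

Lemma ldat_left al x s y : ldat al x s -> (on_left al y <-> s = -1 /\ y = x).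
Proof.
move=> L; have S := ldat_sg L; split.
  move=> [B [b [sr bE sub]]]; have [bE' h1 [z Bz h2] _] := shifted_data L sr.
  have yx : y = x by apply: gseg_line_inj; rewrite -bE -bE'.
  split=> //; case: S h2 => // ->; have := sub z Bz; rewrite /= yx => ?; lra.
move=> [sE ->]; have [B [b sr]] := shifted_ex L; have [bE' h1 _ _] := shifted_data L sr.
exists B, b; split=> // z Bz /=; have := h1 z Bz; rewrite sE mulN1r oppr_ge0 subr_le0; exact.
Qed.

Lemma IintP al x s y : ldat al x s -> (Iint al y <-> 0 < s * (y - x)).
Proof.
move=> L; split.
  move=> [[x' /(ldat_right _ L)[-> ->] h]|[x' /(ldat_left _ L)[-> ->] h]]; lra.
case: (ldat_sg L) => sE h; [left|right]; exists x.
- by apply/(ldat_right _ L).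
- by move: h; rewrite sE; lra.
- by apply/(ldat_left _ L).
- by move: h; rewrite sE; lra.
Qed.

Lemma JintP al x s y : ldat al x s -> (Jint al y <-> s * (y - x) < 0).
Proof.
move=> L; split.
  move=> [[x' /(ldat_right _ L)[-> ->] h]|[x' /(ldat_left _ L)[-> ->] h]]; lra.
case: (ldat_sg L) => sE h; [left|right]; exists x.
- by apply/(ldat_right _ L).
- by move: h; rewrite sE; lra.
- by apply/(ldat_left _ L).
- by move: h; rewrite sE; lra.
Qed.

Lemma shifted_ldat al B b : labels al -> shifted_rep al B b -> exists x s, ldat al x s.
Proof.
move=> L [B0 [b0 [r _ _]]]; have [A [e [s h]]] := rep_ldat0 L r.
by exists (e + tau (TT al)), s, A, e.
Qed.

Lemma Iint_ldat al y : labels al -> Iint al y -> exists x s, ldat al x s.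
Proof. by move=> L [[x [B [b [sr _ _]]] _]|[x [B [b [sr _ _]]] _]]; exact: shifted_ldat L sr. Qed.

Lemma CS'_ldat al v : labels al -> CS' al v -> exists x s, ldat al x s /\ Re v.1 = x.
Proof.
move=> L [_ [B [b [sr bv _]]]]; have [x [s D]] := shifted_ldat L sr; exists x, s; split=> //.
by have [bE _ _ _] := shifted_data D sr; move: bv; rewrite bE => /gseg_line[].
Qed.

Lemma hit al x s k (t e0 : R) : ldat al x s -> Re (geo k t) = x -> 0 < e0 ->
  (forall r, t < r < t + e0 -> 0 < s * (Re (geo k r) - x)) -> CS' al (velocity (geo k) t).
Proof.
move=> L rt e00 H; split; first exact: velocity_SH.
have [B [b sr]] := shifted_ex L; have [bE _ _ nB] := shifted_data L sr; exists B, b; split=> //.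
  by rewrite bE; apply/gseg_line; split; [exact: HH_geo|].
have [k' [k'E _ _ _ _]] := geo_shift k t; exists (geo k'); split; first exact: geodesic_geo.
  by rewrite -[RHS]velocity_shift; congr velocity; apply/funext.
have [r r0 rB] := (nbhs_boxP _ _).1 (nB _ (HH_geo k t) rt).
have bx w : `|Re w - Re (geo k t)| < r /\ `|Im w - Im (geo k t)| < r ->
    nbhs w [set q | `|Re q - Re (geo k t)| < r /\ `|Im q - Im (geo k t)| < r].
  by move=> bw; apply: open_nbhs_nbhs; split=> //; exact: box_open.
have [e1 e10 e1B] : exists2 e1 : R, 0 < e1 & forall r', `|t - r'| < e1 ->
    `|Re (geo k r') - Re (geo k t)| < r /\ `|Im (geo k r') - Im (geo k t)| < r.
  have b0 : `|Re (geo k t) - Re (geo k t)| < r /\ `|Im (geo k t) - Im (geo k t)| < r by rewrite !subrr normr0.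
  have /nbhs_ballP[e1 e10 h] := geo_cont (bx _ b0); exists e1 => // r' hr; exact: (h r').
exists (Num.min e0 e1); first by rewrite lt_min e00.
move=> q /andP[q0]; rewrite lt_min => /andP[qe0 qe1]; rewrite k'E.
have sq : 0 < s * (Re (geo k (q + t)) - x) by apply: H; apply/andP; split; lra.
have bq : `|Re (geo k (q + t)) - Re (geo k t)| < r /\ `|Im (geo k (q + t)) - Im (geo k t)| < r.
  by apply: e1B; rewrite (_ : t - (q + t) = - q) ?normrN ?gtr0_norm//; ring.
have := near_sRe0 sq; apply: filterS2 (bx _ bq) => w [w1 w2] w3.
by apply: rB => //; exact: ltW.
Qed.

(** Chosen pairs with the same precell belong to equivalent cycles, so the set of choices injects
    into the finite basal family. *)
Lemma SS_finite : finite_set SS.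
Proof.
apply: (@finite_inj _ _ SS AA fst finite_AA).
  by move=> p Sp; have [H _] := choiceS; have [c] := H p Sp; exact: cycle_AA.
move=> p p' Sp Sp' E; have [H U] := choiceS; have [c cy] := H p Sp; have [c' cy'] := H p' Sp'.
have hd A h c0 : is_cycle A h c0 -> A \in map fst c0.
  case/is_cycle_inv => [[_ _ _ ->]|[b [A' [_ _ _ ->]]]|N]; rewrite ?inE ?eqxx//=.
  have [s [q [f [n [orb cE lE fA fh]]]]] := cyl_nonc N; have [_ _ _ [n0 _ _]] := orb.
  by rewrite cE -fA; apply/mapP; exists ((f 0%N).1.1, hstep (f 0%N) (f 1%N)) => //; apply/mapP; exists 0%N; rewrite ?mem_iota.
have [q [_ Uq]] := U _ _ _ cy.
have e1 : cycle_equiv c c by exists p.1; split; exact: hd cy.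
have e2 : cycle_equiv c c' by exists p.1; split; [exact: hd cy|rewrite E; exact: hd cy'].
have p1 : SS p /\ exists2 c', is_cycle p.1 p.2 c' & cycle_equiv c c' by split=> //; exists c.
have p2 : SS p' /\ exists2 c', is_cycle p'.1 p'.2 c' & cycle_equiv c c' by split=> //; exists c'.
by rewrite -(Uq _ p1) -(Uq _ p2).
Qed.

Lemma labels_finite : finite_set labels.
Proof.
have bnd (p : set R[i] * PSL2 R) : exists N : nat, forall c, is_cycle p.1 p.2 c -> (cyl Gam c <= N)%N.
  have gen c : (cyl Gam c <= maxn 3 (size c).+1)%N.
    rewrite /cyl; case: asboolP => _; first by rewrite leq_max.
    case: asboolP => _; first by rewrite leq_max.
    apply: leq_trans (leq_maxr _ _); rewrite ltnS; apply: leq_trans (index_size _ _) _.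
    by rewrite size_behead size_map; exact: leq_pred.
  case: (pselect (exists c, noncuspidal_cycle p.1 p.2 c)) => [[c0 N0]|no].
    exists (maxn 3 (size c0).+1) => c cy; apply: leq_trans (gen c) _.
    case: (is_cycle_inv cy) => [[_ _ _ ->]|[b [A' [_ _ _ ->]]]|N]; rewrite ?leq_max//.
    by rewrite (cycle_uniq N N0) -leq_max.
  exists 3%N => c cy; apply: leq_trans (gen c) _.
  case: (is_cycle_inv cy) => [[_ _ _ ->]|[b [A' [_ _ _ ->]]]|N]; rewrite ?geq_max//.
  by case: no; exists c.
have [N NP] := choice bnd.
apply: (@sub_finite_set _ _ (\bigcup_(p in SS) [set (p, m) | m in `I_(N p).+1])).
  move=> [p m] [Sp [c cy /andP[_ mc]]]; exists p => //; exists m => //=.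
  by rewrite ltnS (leq_trans mc)//; exact: NP.
by apply: bigcup_finite => [|p _]; [exact: SS_finite|exact/finite_image/finite_II].
Qed.

Lemma covered_ldat e s : covered e s -> exists k al x s', [/\ Gam k, ldat al x s' & sided k e s x s'].
Proof.
move=> [k [al [A [e' [s' [Gk L [lk sk]]]]]]]; have [La _ _ _] := L.
have [Gt ut] := shiftP La; exists (TT al * k)%g, al, (e' + tau (TT al)), s'.
split; [exact: GM|by exists A, e'|]; split; first exact: lmapM lk (lmap_unip _ ut).
move=> w Hw sw; rewrite actM//; have [-> _] := unip_act ut (HH_act k Hw).
rewrite (_ : _ - _ = Re (act k w) - e'); last ring.
exact: sk.
Qed.

End Labels.

(** * Recurrence *)

Section Recurrence.
Implicit Types (g h k : PSL2 R) (z w p q : R[i]) (X Y e d u s x y : R) (A B : set R[i]) (al be : label R).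

(** By [clK_lin] the point on the line can be moved, by one of finitely many elements, to a point of
    [clK] of known abscissa. Its height is the largest in the orbit of a point of the box, hence
    bounded above by [cc_min] and below by the height of [z]; this reduces to [finite_box]. *)
Lemma line_hitters_finite x (M : R) : Lin Gam x -> 1 <= M -> finite_set [set g | Gam g /\ exists z, box M z /\ Re (act g z) = x].
Proof.
move=> Lx M1; have M0 : 0 < M by lra. have [K [KP Kz]] := clK_lin Lx; have [c0 c00 cm] := cc_min.
pose S := \bigcup_(v in [set` K]) [set (v.1^-1 * h)%g | h in [set h | Gam h /\ exists z, box M z /\ clK (act h z) /\ Re (act h z) = v.2]].
apply: (@sub_finite_set _ _ S).
  move=> g [Gg [z [bz rz]]]; have Hz := box_HH M0 bz; have Hg := HH_act g Hz.
  have [v vK cv] := Kz _ Hg rz; have [Gv Lv _ lv] := KP v vK.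
  exists v => //; exists (v.1 * g)%g; last by rewrite mulKg.
  by split; [exact: GM|exists z; rewrite actM//; split=> //; split=> //; apply/(lv _ Hg)].
apply: bigcup_finite => [|v vK]; first exact: finite_seq.
apply: finite_image; pose M2 := M + `|v.2| + M ^+ 3 / c0 ^+ 2.
have i0 : 0 < M ^+ 3 / c0 ^+ 2 by rewrite divr_gt0// exprn_gt0.
have n0 := normr_ge0 v.2; have M21 : 1 <= M2 by rewrite /M2; lra.
apply: (sub_finite_set _ (finite_box M21)) => h [Gh [z [bz [cz rz]]]]; split=> //; exists z.
have Hz := box_HH M0 bz; have [b1 b2 b3] := bz; have Iz : 0 < Im z by [].
have vM : M2^-1 <= M^-1 by rewrite lef_pV2 ?posrE//; rewrite /M2; lra.
split; first by split; [rewrite /M2; lra|exact: le_trans vM b2|rewrite /M2; lra].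
have N0 := Nm_gt0 h Hz.
have N1 : Nm h z <= 1.
  have [_ /(_ _ (GV Gh))] := cz; rewrite NmV// => h1.
  by rewrite -[Nm h z]invrK invf_le1// invr_gt0.
split; first by rewrite rz /M2; lra.
- apply: le_trans vM _; apply: le_trans b2 _; rewrite Im_act// ler_pdivlMr//.
  by rewrite ler_piMr// ltW.
- rewrite Im_act// ler_pdivrMr//; case: (eqVneq (cc h) 0) => [h0|h0].
    rewrite (Nm_unip z (stab_unip Gh h0)) mulr1; apply: le_trans b3 _; rewrite /M2; lra.
  have NL : c0 ^+ 2 * M^-1 ^+ 2 <= Nm h z.
    rewrite /Nm; apply: le_trans (_ : (cc h * Im z) ^+ 2 <= _); last by rewrite lerDr sqr_ge0.
    rewrite exprMn; apply: ler_pM; rewrite ?sqr_ge0//.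
      by rewrite -[cc h ^+ 2]real_normK ?num_real// ler_sqr ?nnegrE ?(ltW c00)// cm.
    by rewrite ler_sqr ?nnegrE ?invr_ge0 ?(ltW M0) ?(ltW Iz).
  apply: le_trans b3 _; apply: le_trans (_ : (M ^+ 3 / c0 ^+ 2) * (c0 ^+ 2 * M^-1 ^+ 2) <= _).
    rewrite (_ : _ * _ = M)//; field; rewrite ?(gt_eqF c00) ?(gt_eqF M0)//.
  apply: ler_pM => //; [by rewrite ltW|by rewrite mulr_ge0 ?sqr_ge0|rewrite /M2; lra].
Qed.

Definition xs : set R := [set x | exists al s, ldat al x s].

Lemma ldat_uniq al x s x' s' : ldat al x s -> ldat al x' s' -> x = x'.
Proof.
move=> L L'; have [B [b sr]] := shifted_ex L.
have [bE _ _ _] := shifted_data L sr; have [bE' _ _ _] := shifted_data L' sr.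
by apply: gseg_line_inj; rewrite -bE.
Qed.

Lemma xs_finite : finite_set xs.
Proof.
apply: (finite_rel (r := fun x al => exists s, ldat al x s) labels_finite).
  by move=> x [al [s L]]; exists al; [exact: ldat_labels L|exists s].
by move=> x x' al [s L] [s' L']; exact: ldat_uniq L L'.
Qed.

Lemma xs_Lin x : xs x -> Lin Gam x.
Proof.
move=> [al [s [A [e [[L _ [d T] _] ->]]]]]; have [Gt ut] := shiftP L.
exact: End_case (End_tr Gt ut (tile_end T)).
Qed.

Definition hitters (M : R) : set (PSL2 R) := [set g | Gam g /\ exists2 x, xs x & exists z, box M z /\ Re (act g z) = x].

Lemma hitters_finite (M : R) : 1 <= M -> finite_set (hitters M).
Proof.
move=> M1; apply: (@sub_finite_set _ _ (\bigcup_(x in xs) [set g | Gam g /\ exists z, box M z /\ Re (act g z) = x])).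
  by move=> g [Gg [x xx H]]; exists x.
by apply: bigcup_finite => [|x xx]; [exact: xs_finite|apply: line_hitters_finite => //; exact: xs_Lin].
Qed.

(* Unlike [crs], this does not change if the geodesic is reversed. *)
Definition meets k (P : set (PSL2 R)) (t : R) := exists g x,
  [/\ P g, xs x, cc (g * k)%g != 0, cd (g * k)%g != 0 & Re (geo (g * k)%g t) = x].

Lemma times_finite k (M : R) : 1 <= M -> finite_set (meets k (hitters M)).
Proof.
move=> M1; apply: (finite_rel (B := hitters M `*` xs)
  (r := fun t (v : PSL2 R * R) => [/\ cc (v.1 * k)%g != 0, cd (v.1 * k)%g != 0 & Re (geo (v.1 * k)%g t) = v.2])).
- by apply: finite_setX; [exact: hitters_finite|exact: xs_finite].
- by move=> t [g [x [Pg xx c0 d0 rx]]]; exists (g, x).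
- by move=> t t' v [c0 d0 r1] [_ _ r2]; apply: (time_uniq c0 d0); rewrite r1 r2.
Qed.

Lemma meets_isolated k (t : R) : exists2 e : R, 0 < e & forall r, `|t - r| < e -> meets k Gam r -> r = t.
Proof.
have c0 : 0 <= 2 * expR 1 :> R by have := @expR_gt0 R 1; lra.
have [M M1 MP] := uu_box (HH_geo k t) c0.
have [e e0 eP] := finite_isolated t (times_finite k M1).
exists (Num.min e 1); first by rewrite lt_min e0 ltr01.
move=> r; rewrite lt_min => /andP[h1 h2] [g [x [Gg xx cg dg rx]]]; apply: eP => //.
exists g, x; split=> //; split=> //; exists x => //; exists (geo k r); split; last by rewrite -geoM.
by apply: MP; [exact: HH_geo|apply: uu_geo; exact: ltW].
Qed.

(** The times at which the projected geodesic has its vector in the reduced cross section, expressed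
    by endpoints; the equivalence is [CSredP]. *)
Definition crs k (t : R) := exists g al x s y y',
  [/\ Gam g, ldat al x s, ends (g * k)%g y y', Re (geo (g * k)%g t) = x & Ired al y].

Lemma crs_meets k t : crs k t -> meets k Gam t.
Proof.
move=> [g [al [x [s [y [y' [Gg L [c0 d0 _ _] rx _]]]]]]]; exists g, x; split=> //; by exists al, s.
Qed.

Lemma piSH_act g k t : Gam g -> piSH Gam (velocity (geo (g * k)%g) t) = piSH Gam (velocity (geo k) t).
Proof.
move=> Gg; apply/seteqP; split=> v [h Gh <-].
  by exists (h * g)%g; [exact: GM|rewrite -!velocity_act mulgA].
by exists (h * g^-1)%g; [exact: GM Gh (GV Gg)|rewrite -!velocity_act mulgA mulgVK].
Qed.

Lemma piSH_refl k t : piSH Gam (velocity (geo k) t) (velocity (geo k) t).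
Proof. by exists 1%g => //; rewrite -velocity_act mul1g. Qed.

Lemma CSredP k t : CSred Gam AA SS TT (piSH Gam (velocity (geo k) t)) <-> crs k t.
Proof.
split.
  move=> [v0 [al La [cs [gam [y [y' [geod vE ry ry' [Iy Jy]]]]]]] E].
  have [k0 gE] := geodesicE geod; rewrite gE in vE ry ry'.
  have := piSH_refl k0 0; rewrite vE E => -[g Gg]; rewrite -velocity_act => vE'.
  have [x [s [L rx]]] := CS'_ldat La cs.
  have H r : geo k0 r = geo (g * k)%g (t + r).
    by have := velocity_inj (etrans vE (esym vE')) r; rewrite add0r.
  have [e1 e2] := ends_shift H; exists g, al, x, s, y, y'; split=> //.
    by apply/endsP; rewrite -e1 -e2; split; [exact/esym/reaches_geo_p|exact/esym/reaches_geo_m].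
  by rewrite -rx -vE'.
move=> [g [al [x [s [y [y' [Gg L en rx Iy]]]]]]]; rewrite -(piSH_act k t Gg).
exists (velocity (geo (g * k)%g) t) => //; exists al; first exact: ldat_labels L.
have [Iy0 _] := Iy; have /(IintP y L) sy := Iy0.
have [h1 h2 h3] := ends_side s t en; rewrite rx in h1 h2 h3; have sy' := h2 sy.
split; first by apply: (hit L rx ltr01) => r /andP[tr _]; exact: h3.
have [k' [k'E _ _ _ _]] := geo_shift (g * k)%g t; exists (geo k'), y, y'.
have [e1 e2] : actS k' (pinf R) = actS (g * k)%g (pinf R) /\ actS k' (fin 0) = actS (g * k)%g (fin 0).
  by apply: (ends_shift (t := t)) => r; rewrite k'E addrC.
have [e3 e4] := (endsP _ _ _).1 en; split.
- exact: geodesic_geo.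
- by rewrite -[RHS]velocity_shift; congr velocity; apply/funext.
- by apply/reaches_geo_p; rewrite e1 e3.
- by apply/reaches_geo_m; rewrite e2 e4.
- by split=> //; apply/(JintP y' L); have [] := h1 sy'.
Qed.

Lemma bd_inv g (v : one_point_compactification R[i]) : Gam g -> bd v -> bd (actS g v).
Proof.
move=> Gg [h Gh [A AAA [v1 bv <-]]]; exists (g * h)%g; first exact: GM.
by exists A => //; exists v1 => //; rewrite actSM.
Qed.

Lemma bd_pinf : bd (pinf R).
Proof.
have [A AAA] := AA_nonempty; have [e [d T]] := AA_tile AAA; have [_ d0 _] := tile_set T.
exists 1%g => //; exists A => //; exists (pinf R); last by rewrite actS1.
split; last by left.
have [k [c0 d1 _ kE]] := vert_ex (e + d / 2); have [H _ HP] := high_KK.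
have r : reaches (geo k) +oo%E (pinf R) by apply/reaches_geo_p; rewrite actS_pinf c0 eqxx.
apply: (reaches_closure r); exists H => t tH.
have Kt : KK Gam (geo k t).
  apply: HP; first exact: HH_geo.
  rewrite kE /=; apply: lt_le_trans tH _.
  by have := expR_ge1Dx t; lra.
apply: (pcs_cell AAA (pcs1 A)); first exact: HH_geo.
rewrite act1; last exact: HH_geo.
by apply/(tile_range T Kt); rewrite kE /=; apply/andP; split; lra.
Qed.

Definition nobd k := ~ bd (actS k (pinf R)) /\ ~ bd (actS k (fin 0)).

Lemma nobd_mul g k : Gam g -> nobd k -> nobd (g * k)%g.
Proof.
move=> Gg [n1 n2]; split; rewrite actSM => b; [apply: n1|apply: n2].
  by have := bd_inv (GV Gg) b; rewrite actSK.
by have := bd_inv (GV Gg) b; rewrite actSK.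
Qed.

Lemma nobd_ends k : nobd k -> exists y y', ends k y y'.
Proof.
move=> [n1 n2]; exists (ca k / cc k), (cb k / cd k); split=> //; apply/eqP => E.
  by apply: n1; rewrite actS_pinf E eqxx; exact: bd_pinf.
by apply: n2; rewrite actS_0 E eqxx; exact: bd_pinf.
Qed.

Lemma actS_flip0 k : actS (k * flip R)%g (fin 0) = actS k (pinf R).
Proof. by rewrite actSM actS_0; have [_ -> _ _] := flipP R; rewrite eqxx. Qed.

Lemma nobd_flip k : nobd k -> nobd (k * flip R)%g.
Proof. by move=> [n1 n2]; split; rewrite ?actS_flip ?actS_flip0. Qed.

Lemma crossing k (T : R) : nobd k -> exists t g e,
  [/\ T <= t, Gam g, End e & Re (geo (g * k)%g t) = e].
Proof.
move=> nk; have [k0 [A [w [Gk0 AAA Aw wz]]]] := AA_cover (HH_geo k T).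
have GV0 := GV Gk0; pose k1 := (k0^-1 * k)%g; have [e0 [d0 T0]] := AA_tile AAA.
have nk1 : nobd k1 by exact: nobd_mul.
have Hw := tile_HH T0 Aw.
pose U := cell Gam AA A; pose ga t := geo k1 t.
have U0 : U (ga T).
  rewrite /ga geoM -wz actK//; apply: (pcs_cell AAA (pcs1 A)) => //.
  by rewrite act1.
pose E := [set t | T <= t /\ forall r, T <= r <= t -> U (ga r)].
have ET : E T by split=> // r /andP[h1 h2]; rewrite (_ : r = T)//; apply/eqP; rewrite eq_le h1 h2.
(* Staying in the cell forever would put the endpoint into the boundary of the cell. Thus the time
   [t1] up to which the geodesic stays is finite, and there it is on the boundary of the cell. *)
have [ts tT nts] : exists2 ts, T < ts & ~ U (ga ts).
  apply: contrapT => N; case: nk1 => n1 _; apply: n1.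
  exists 1%g => //; exists A => //; exists (actS k1 (pinf R)); last by rewrite actS1.
  split; last exact: bdS_pinf.
  have r : reaches (geo k1) +oo%E (actS k1 (pinf R)) by apply/reaches_geo_p.
  apply: (reaches_closure r); exists T => t tT; apply: contrapT => nU; apply: N; by exists t.
have ubE t : E t -> t <= ts.
  move=> [h1 h2]; rewrite leNgt; apply/negP => lt; apply: nts; apply: h2; rewrite (ltW tT)/= ltW//.
have hsE : has_sup E by split; [exists T|exists ts => t /ubE].
pose t1 := sup E; have T1 : T <= t1 by exact: (sup_upper_bound hsE).
have Ub r : T <= r -> r < t1 -> U (ga r).
  move=> r0 r1; have p : 0 < t1 - r by rewrite subr_gt0.
  have [t [_ Et]] := sup_adherent p hsE.
  by rewrite -/t1 subKr => rt; apply: Et; rewrite r0 ltW.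
have U1 : U (ga t1).
  case: (eqVneq T t1) => [<-//|Tn]; have Tt : T < t1 by rewrite lt_neqAle Tn.
  apply: (cell_closed AAA (HH_geo _ _)) => V /geo_near[e ee eV].
  pose r := Num.max T (t1 - e / 2); have rt : r < t1 by rewrite gt_max Tt; lra.
  have Tr : T <= r by rewrite le_max lexx.
  have re : t1 - e / 2 <= r by rewrite le_max lexx orbT.
  exists (ga r); split; [exact: Ub|apply: eV]; rewrite gtr0_norm ?subr_gt0//; lra.
have nI : ~ interior U (ga t1).
  move=> /geo_near[e ee eV]; have : t1 + e / 2 <= t1; last lra.
  apply: (sup_upper_bound hsE); split; first lra.
  move=> r /andP[r0 r1]; case: (ltP r t1) => [/(Ub r r0)//|r2].
  apply: eV; rewrite distrC ger0_norm ?subr_ge0//; lra.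
have [g [B [e [s [d [P TB rB]]]]]] := cell_bd AAA U1 nI.
have [_ Gg] := pcs_AA AAA P.
exists t1, (g * k0^-1)%g, e; split=> //; [exact: GM|exact: tile_end TB|].
by rewrite -mulgA geoM.
Qed.

(** The geodesic crosses the line towards its future endpoint; on that side a translated precell
    starts, and this side of the line is [covered] by a chosen one. *)
Lemma label_cross k t e y y' : End e -> ends k y y' -> Re (geo k t) = e ->
  exists h al x s, [/\ Gam h, ldat al x s, Re (geo (h * k)%g t) = x &
   forall r, t < r -> 0 < s * (Re (geo (h * k)%g r) - x)].
Proof.
move=> Ee en rt; have [s0 S s0y] : exists2 s0, sg s0 & 0 < s0 * (y - y').
  case: (ltgtP y y') => h; [exists (- 1); [by right|lra]|exists 1; [by left|lra]|].
  by have := ends_neq en; rewrite h eqxx.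
have [_ _ /(_ s0y) af] := ends_side s0 t en; rewrite rt in af.
have [t0 [A [d [Gt0 ut0 AAA T]]]] := adjacent Ee S.
have [e1 [d1 TA]] := AA_tile AAA; have [ut1 tE] := unipV ut0.
have T1 : tile A (e + tau t0^-1%g) s0 d.
  by have := tile_tr (GV Gt0) ut1 T; rewrite act_img1//; exact: tile_HH TA.
have [k3 [al [x [s' [Gk3 L [lk sk]]]]]] := covered_ldat (covered_tile AAA T1).
exists (k3 * t0^-1)%g, al, x, s'; have lk' := lmapM (lmap_unip e ut1) lk.
split=> //; first exact: GM Gk3 (GV Gt0).
  by rewrite geoM; apply/(lk' _ (HH_geo _ _)).
move=> r tr; rewrite geoM actM; last exact: HH_geo.
apply: sk; first exact/HH_act/HH_geo.
have [-> _] := unip_act ut1 (HH_geo k r).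
rewrite (_ : _ - _ = Re (geo k r) - e); first exact: af.
ring.
Qed.

Lemma red_cross g k t al x s y y' : Gam g -> ldat al x s -> ends (g * k)%g y y' ->
  Re (geo (g * k)%g t) = x -> 0 < s * (y - x) ->
  exists be xb t2, [/\ t <= t2, ldat be xb s, Ired be y, Re (geo (g * k)%g t2) = xb & 0 <= s * (xb - x)].
Proof.
move=> Gg L en rx sy; have S := ldat_sg L.
(* The chosen lines of direction [s] from [x] on that still separate the geodesic from [y]; the last
   one is taken. *)
pose Q := [set xb | (exists be, ldat be xb s) /\ 0 < s * (y - xb) /\ 0 <= s * (xb - x)].
have fQ : finite_set [set s * xb | xb in Q].
  by apply/finite_image/(sub_finite_set _ xs_finite) => xb [[be Lb] _]; exists be, s.
have [_ [xb [[be Lb] [yb xxb]] <-] mx] : exists2 m, [set s * xb | xb in Q] m & forall r, [set s * xb | xb in Q] r -> r <= m.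
  apply: (@finite_max _ _ (s * x)) => //; exists x => //; split; first by exists al.
  by rewrite subrr mulr0.
have [h1 h2 h3] := ends_side s t en; rewrite rx in h1 h2 h3.
have syy := h2 sy; have [sy' _] := h1 syy.
have [c0 d0 yE yE'] := en.
(* The geodesic passes over [xb], because [xb] lies strictly between its endpoints. *)
have XW : xb ^+ 2 < (y + y') * xb - y * y'.
  rewrite -subr_gt0 (_ : _ - _ = (s * s) * ((y - xb) * (xb - y'))); last by rewrite sg2//; ring.
  rewrite (_ : _ * _ = (s * (y - xb)) * (s * (xb - y'))); last ring.
  by rewrite mulr_gt0//; lra.
have [Hp rp wp] := ptP XW; have := geo_hit c0 d0 yE yE' Hp; rewrite wp rp => /(_ erefl)[t2 pE].
have r2 : Re (geo (g * k)%g t2) = xb by rewrite -pE.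
exists be, xb, t2; split=> //.
  rewrite leNgt; apply/negP => lt; have [_ _ /(_ syy _ lt)] := ends_side s t2 en.
  by rewrite rx r2; lra.
split; first by apply/(IintP y Lb).
move=> de [Lb' Ld sub _] Iy; have [xd [sd D]] := Iint_ldat Ld Iy.
have [sub1 sub2] : Iint de `<=` Iint be /\ ~ Iint be `<=` Iint de by case: sub.
have S' := ldat_sg D.
have incl v : 0 < sd * (v - xd) -> 0 < s * (v - xb).
  by move=> /(IintP v D)/sub1/(IintP v Lb).
(* Half lines of opposite directions are not nested: a point beyond both [xd] and [xb] tells them
   apart. *)
have sE : sd = s.
  case: S' incl => ->; case: S => -> // incl.
    by have := incl (`|xd| + `|xb| + 1); have := ler_norm xd; have := ler_norm xb; have := normr_ge0 xd; have := normr_ge0 xb; lra.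
  by have := incl (- (`|xd| + `|xb| + 1)); have := ler_norm (- xd); have := ler_norm (- xb); rewrite !normrN; have := normr_ge0 xd; have := normr_ge0 xb; lra.
rewrite sE in D incl; have /(IintP y D) yd := Iy.
have bd : 0 <= s * (xd - xb).
  rewrite leNgt; apply/negP => lt; have := incl ((xd + xb) / 2); lra.
have le : s * xd <= s * xb.
  by apply: mx; exists xd => //; split; [exists de|split=> //; lra].
apply: sub2 => v /(IintP v Lb) h; apply/(IintP v D).
have E : s * xd = s * xb by lra.
lra.
Qed.

Lemma cross_red k t g e : nobd k -> Gam g -> End e -> Re (geo (g * k)%g t) = e ->
  exists g' al x s y y' be xb t2,
  [/\ Gam g', ldat al x s, ends (g' * k)%g y y', Re (geo (g' * k)%g t) = x & 0 < s * (y - x)] /\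
  [/\ t <= t2, ldat be xb s, Ired be y, Re (geo (g' * k)%g t2) = xb & 0 <= s * (xb - x)].
Proof.
move=> nk Gg Ee rt; have [y0 [y0' en0]] := nobd_ends (nobd_mul Gg nk).
have [h [al [x [s [Gh L rx af]]]]] := label_cross Ee en0 rt.
rewrite mulgA in rx af; have Ghg := GM Gh Gg.
have [y [y' en]] := nobd_ends (nobd_mul Ghg nk).
(* The abscissa is monotone and moves in direction [s] right after [t], so the future endpoint lies
   on that side of the line. *)
have sy : 0 < s * (y - x).
  have t1 : t < t + 1 by lra.
  have [_ h2 _] := ends_side s t en; have [g1 _ g3] := ends_side (- s) t en.
  rewrite rx in g1 g3 h2; rewrite ltNge; apply/negP => le.
  have := ends_neq en; rewrite -subr_eq0 => yy.
  case: (ltgtP (s * (y - y')) 0) => hh.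
  - by have := af _ t1; have := g3 _ _ t1; rewrite !mulNr; lra.
  - by have [+ _ _] := ends_side s t en; move=> /(_ hh)[_]; rewrite rx; lra.
  - by move/eqP: hh; rewrite mulf_eq0 (negPf yy) orbF; case: (ldat_sg L) => ->; rewrite ?oppr_eq0 oner_eq0.
have [be [xb [t2 [t12 Lb Iy r2 xbx]]]] := red_cross Ghg L en rx sy.
by exists (h * g)%g, al, x, s, y, y', be, xb, t2.
Qed.

Lemma future k (T : R) : nobd k -> exists2 t, T <= t & crs k t.
Proof.
move=> nk; have [t [g [e [Tt Gg Ee rt]]]] := crossing T nk.
have [g' [al [x [s [y [y' [be [xb [t2 [[Gg' _ en _ _] [tt2 Lb Iy r2 _]]]]]]]]]]] := cross_red nk Gg Ee rt.
by exists t2; [exact: le_trans tt2|exists g', be, xb, s, y, y'].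
Qed.

End Recurrence.

(** * The past, endpoints in [bd], and the conclusion *)

Section Main.
Implicit Types (g h k : PSL2 R) (z w p q : R[i]) (X Y e d u s x y : R) (A B : set R[i]) (al be : label R).
Local Notation P1 := (one_point_compactification R[i]).

Lemma crossing_back k (T : R) : nobd k -> exists t g e,
  [/\ t <= T, Gam g, End e & Re (geo (g * k)%g t) = e].
Proof.
move=> /nobd_flip nk; have [t [g [e [Tt Gg Ee rt]]]] := crossing (- T) nk.
exists (- t), g, e; split=> //; first lra.
by rewrite -geo_flip -mulgA.
Qed.

(** Reversing the geodesic is no way to deduce this from [future], because [crs] depends on the
    direction: a crossing found in the past may be followed by its reduced one only after [T]. The
    bound [N] is fixed beforehand, and a crossing before [-N] is shown not to have this defect. *)
Lemma past k (T : R) : nobd k -> exists2 t, t <= T & crs k t.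
Proof.
move=> nk; have [M M1 MP] := uu_box (HH_geo k T) (@ler01 R).
have [N NP] := finite_bnd (times_finite k M1).
have [t [g [e [tT Gg Ee rt]]]] := crossing_back (Num.min T (- N - 1)) nk.
have [g' [al [x [s [y [y' [be [xb [t2 [[Gg' L en rx sy] [tt2 Lb Iy r2 xbx]]]]]]]]]]] := cross_red nk Gg Ee rt.
move: tT; rewrite le_min => /andP[tT tN].
case: (leP t2 T) => t2T; first by exists t2 => //; exists g', be, xb, s, y, y'.
exfalso; have xx : xs x by exists al, s. have xxb : xs xb by exists be, s.
have S := ldat_sg L; have [_ h0 _] := ends_side s t en; rewrite rx in h0; have syy := h0 sy.
have Hz := HH_geo (g' * k)%g T; set z := geo (g' * k)%g T in Hz.
have [/(_ syy)[zy' zy] _ af] := ends_side s T en; rewrite -/z in zy' zy af.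
have zx : 0 <= s * (Re z - x).
  have [_ _ /(_ syy T)] := ends_side s t en; rewrite rx -/z => h.
  move: tT; rewrite le_eqVlt => /orP[/eqP tE|/h/ltW//].
  by rewrite (_ : Re z = x) ?subrr ?mulr0// /z -tE.
have zb : 0 < s * (xb - Re z) by have := af syy _ t2T; rewrite r2.
have [/(_ syy)[xy' _] _ _] := ends_side s t en; rewrite rx in xy'.
have [/(_ syy)[_ by_] _ _] := ends_side s t2 en; rewrite r2 in by_.
have Wz := ends_Wk T en; rewrite -/z in Wz.
have IzE : Im z ^+ 2 = (s * (y - Re z)) * (s * (Re z - y')).
  rewrite (_ : _ * _ = (s * s) * ((y - Re z) * (Re z - y'))); last ring.
  by rewrite sg2// mul1r -[LHS](addKr (Re z ^+ 2)) -/(Wk z) Wz; ring.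
have Iz : 0 < Im z by [].
(* The point [z] at time [T] lies on a semicircle over an interval containing [x] and [xb], so it
   cannot be lower than the geodesic joining them. Hence its abscissa is within [Im z] of one of the
   two. *)
have Ige : (s * (xb - Re z)) * (s * (Re z - x)) <= Im z ^+ 2.
  rewrite IzE; apply: ler_pM; [exact: ltW|exact: zx|lra|lra].
(* The point of the line over [v] at the height of [z] has [uu] at most 1 from [z]. Pulled back by
   [g'] it lies in the box around [geo k T]. *)
have key v : xs v -> (Re z - v) ^+ 2 <= Im z ^+ 2 -> hitters M g'.
  move=> xv hv; split=> //; exists v => //; pose w : R[i] := v +i* Im z; have Hw : HH w by [].
  exists (act g'^-1%g w); split; last by rewrite actKV.
  apply: MP; first exact: HH_act.
  rewrite -(uu_act g' (HH_geo k T))//; last exact: HH_act.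
  rewrite actKV// -geoM -/z /uu /= subrr expr0n addr0 ler_pdivrMr ?mul1r -?expr2 ?exprn_gt0//.
have Lg : hitters M g'.
  case: (leP (s * (Re z - x)) (s * (xb - Re z))) => cmp.
    apply: (key x xx); apply: le_trans Ige; rewrite (_ : _ ^+ 2 = (s * (Re z - x)) * (s * (Re z - x))).
      by rewrite ler_wpM2r.
    by rewrite -[LHS]mul1r -(sg2 S); ring.
  apply: (key xb xxb); apply: le_trans Ige; rewrite (_ : _ ^+ 2 = (s * (xb - Re z)) * (s * (xb - Re z))).
    by rewrite ler_wpM2l ?ltW.
  by rewrite -[LHS]mul1r -(sg2 S); ring.
have [c0 d0 _ _] := en.
have : meets k (hitters M) t by exists g', x.
by move=> /NP; have := ler_norm (- t); rewrite normrN; lra.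
Qed.

Lemma closureN (V : set R[i]) z : ~ closure V z -> nbhs z (~` V).
Proof.
move=> nc; apply: contrapT => H; apply: nc => U nU; apply: contrapT => E; apply: H.
by apply: filterS nU => v Uv Vv; apply: E; exists v.
Qed.

(** Points of [B] have maximal height in their orbits, an inequality between [Nm h] and [Nm (j * h)]
    that passes to the limit [r]. At the real point $h.r$ it says $|c_jr'+d_j| \ge 1$, which
    persists on the whole line over it. *)
Lemma ivert_limit h (r : R) B e s d : Gam h -> tile B e s d -> cc h * r + cd h != 0 ->
  closure [set w | HH w /\ B (act h w)] r%:C -> ivert ((ca h * r + cb h) / (cc h * r + cd h)).
Proof.
move=> Gh T D cl z Hz rz; split=> // j Gj.
have lim : Nm h r%:C <= Nm (j * h)%g r%:C.
  rewrite leNgt; apply/negP => lt.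
  have c : {for (r%:C : R[i]), continuous (fun w => Nm h w - Nm (j * h)%g w)}.
    by apply: cvgB; exact: continuous_Nm.
  have p0 : 0 < Nm h r%:C - Nm (j * h)%g r%:C by rewrite subr_gt0.
  have /(_ (nbhs_filter _)) n := cvgr_gt _ c _ p0.
  have [w [[Hw Bw]]] := cl _ n; rewrite /= subr_gt0 NmM// => l2.
  have [_ /(_ j Gj) N1] := tile_clK T Bw.
  by move: l2; rewrite ltNge => /negP; apply; rewrite ler_peMl// ltW// Nm_gt0.
have NR g : Nm g r%:C = (cc g * r + cd g) ^+ 2 by rewrite /Nm /= mulr0 expr0n addr0.
rewrite !NR in lim; have [e1 [e2 _ _ c d1]] := pslM_coef j h.
set r' := _ / _ in rz.
have E : (cc (j * h)%g * r + cd (j * h)%g) ^+ 2 = (cc j * r' + cd j) ^+ 2 * (cc h * r + cd h) ^+ 2.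
  rewrite c d1 (_ : _ + _ = e1 * ((cc j * r' + cd j) * (cc h * r + cd h))).
    by rewrite exprMn e2 mul1r exprMn.
  by rewrite /r'; field.
have D2 : 0 < (cc h * r + cd h) ^+ 2 by rewrite lt_neqAle sqr_ge0 eq_sym sqrf_eq0 D.
rewrite E in lim; have : 1 <= (cc j * r' + cd j) ^+ 2 by rewrite -(ler_pM2r D2) mul1r.
by rewrite /Nm rz => h1; apply: le_trans h1 _; rewrite lerDl sqr_ge0.
Qed.

(** A cell is a finite union of translated pieces, so a limit point of it is one of a single piece;
    [ivert_limit] applies unless the piece sends this point to infinity. *)
Lemma bd_cases (v : P1) : bd v -> exists g, Gam g /\
  (v = actS g (pinf R) \/ exists p : R, ivert p /\ v = actS g (fin p%:C)).
Proof.
move=> [g Gg [A AAA [q [cq [qE|[r qE]]] <-]]]; first by exists g; split=> //; left; rewrite qE.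
rewrite qE in cq *; have cr := closure_fin cq.
have [h [B [P cl]]] : exists h B, pcs A h B /\ closure [set w | HH w /\ B (act h w)] r%:C.
  apply: contrapT => N.
  have fs := pcs_finite AAA.
  have n := near_fin (P := fun i : PSL2 R * set R[i] => ~` [set w | HH w /\ i.2 (act i.1 w)]) (z := r%:C) fs.
  have {}n := n _; have {}n : nbhs (r%:C : R[i]) [set w | forall i : PSL2 R * set R[i], pcs A i.1 i.2 ->
      ~ (HH w /\ i.2 (act i.1 w))].
    by apply: n => -[h B] /= P; apply: closureN => cl; apply: N; exists h, B.
  have [w [/(cellP w AAA)[Hw [h [B [P Bw]]]] /(_ (h, B) P)]] := cr _ n; by apply.
have [AAB Gh] := pcs_AA AAA P; have [e [d T]] := AA_tile AAB.
case: (eqVneq (cc h * r + cd h) 0) => [D|D].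
  exists (g * h^-1)%g; split; first exact: GM Gg (GV Gh).
  by left; rewrite actSM -(actS_real_pole D) actSK.
exists (g * h^-1)%g; split; first exact: GM Gg (GV Gh).
right; exists ((ca h * r + cb h) / (cc h * r + cd h)); split; first exact: ivert_limit Gh T D cl.
by rewrite actSM -(actS_real D) actSK.
Qed.

Lemma meets_inv h k t : Gam h -> meets (h * k)%g Gam t -> meets k Gam t.
Proof.
move=> Gh [g [x [Gg xx c0 d0 rx]]]; exists (g * h)%g, x; rewrite -mulgA; split=> //; exact: GM.
Qed.

Lemma const_not_meets k x : cc k != 0 -> cd k != 0 -> (forall r, Re (geo k r) = x) -> False.
Proof.
by move=> c0 d0 H; have := @time_uniq R k 0 (0 + 1) c0 d0; rewrite !H => /(_ erefl); lra.
Qed.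

(** High up the geodesic runs inside [KK Gam]. A translated line met there is moved into [clK] by an
    element which can only be a translation, so it is vertical and contains the whole geodesic; the
    definition of [meets] excludes this. *)
Lemma cusp_inf k : cc k = 0 -> exists T : R, forall t, T < t -> ~ meets k Gam t.
Proof.
move=> k0; have d0 : cd k != 0.
  by apply/eqP => E; have := psl_det k; rewrite k0 E !mulr0 subrr => /eqP; rewrite eq_sym oner_eq0.
have [H _ HP] := high_KK; exists (H * cd k ^+ 2) => t tT [g [x [Gg xx cg dg rx]]].
have D : 0 < cd k ^+ 2 by rewrite lt_neqAle sqr_ge0 eq_sym sqrf_eq0 d0.
have Hz := HH_geo k t; have Kz : KK Gam (geo k t).
  apply: HP => //; rewrite geo_Im k0 expr0n mul0r add0r ltr_pdivlMr//.
  by apply: lt_le_trans tT _; have := expR_ge1Dx t; lra.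
have Hg := HH_geo (g * k)%g t.
have [k1 [x' [Gk1 _ _ l1 ck]]] := clK_end (xs_Lin xx) Hg rx.
rewrite geoM -actM// in ck; have cc0 := KK_stab (GM Gk1 Gg) Kz ck.
pose K := ((k1 * g) * k)%g; have KE r : geo K r = act k1 (geo (g * k)%g r) by rewrite /K -mulgA [LHS]geoM.
have cK : cc K = 0.
  by have [e [_ _ _ -> _]] := pslM_coef (k1 * g)%g k; rewrite cc0 k0 mul0r mulr0 addr0 mulr0.
have Rt r : Re (geo K r) = x'.
  have h1 : Re (geo K t) = x' by rewrite KE; apply/(l1 _ Hg).
  by rewrite -h1 !geo_Re cK !(mulr0, mul0r, expr0n) /= ?mul0r ?add0r.
apply: (@const_not_meets _ x cg dg) => r; apply/(l1 _ (HH_geo _ _)).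
by rewrite -KE Rt.
Qed.

Lemma linE g x : exists a b c : R, forall w, HH w -> Nm g w * (Re (act g w) - x) = a + b * Re w + c * Wk w.
Proof.
exists (cb g * cd g - x * cd g ^+ 2), (ca g * cd g + cb g * cc g - x * (2 * cc g * cd g)),
  (ca g * cc g - x * cc g ^+ 2) => w Hw.
rewrite mulrBr Re_actW// mulrC divfK ?gt_eqF ?Nm_gt0// NmE; ring.
Qed.

(** A translated line met after time 0 separates the start from [p] and does not cross the line over
    [p]. It must therefore hit the segment from [geo k 0] to the point $p+i$, which lies in a box,
    so finitely many elements occur. *)
Lemma cusp_ivert k (p : R) : ivert p -> actS k (pinf R) = fin p%:C ->
  exists T : R, forall t, T < t -> ~ meets k Gam t.
Proof.
move=> iv; rewrite actS_pinf; case: eqP => [_ //|/eqP c0 [pE]].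
have Lp : Lin Gam p by right.
(* Here the geodesic is itself the line over [p]; by [noncross] a line meeting it would contain
   it. *)
case: (eqVneq (cd k) 0) => [d0|d0].
  have Rp r : Re (geo k r) = p.
    have E0 : expR r != 0 by rewrite gt_eqF// expR_gt0.
    by rewrite geo_Re d0 expr0n mulr0 !addr0 -pE; field; rewrite c0 E0.
  exists 0 => t _ [g [x [Gg xx cg dg rx]]].
  have l := noncross (xs_Lin xx) Lp Gg (HH_geo k t) (Rp t) (etrans (congr1 (@complex.Re R) (esym (geoM g k t))) rx).
  by apply: (@const_not_meets _ x cg dg) => r; rewrite geoM; apply/(l _ (HH_geo k r)).
pose zp : R[i] := p +i* 1; have Hzp : HH zp by exact: ltr01.
have [M M1 MP] := kseg_box (HH_geo k 0) Hzp; have [N NP] := finite_bnd (times_finite k M1).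
exists (Num.max 0 N) => t; rewrite gt_max => /andP[t0 tN] [g [x [Gg xx cg dg rx]]].
suff Lg : hitters M g.
  have : meets k (hitters M) t by exists g, x.
  by move=> /NP; have := ler_norm t; lra.
split=> //; exists x => //.
suff [v [Hv kv rv]] : exists v, [/\ HH v, kseg (geo k 0) zp v & Re (act g v) = x].
  by exists v; split=> //; exact: MP.
(* [L] vanishes exactly on the preimage under [g] of the line over [x]. It is zero at time [t] and
   has the sign of [- s] at time 0; the goal is the opposite sign, or zero, at [zp]. *)
have [a [b [c lE]]] := linE g x; pose L w := a + b * Re w + c * Wk w.
have LE w : HH w -> Nm g w * (Re (act g w) - x) = L w by exact: lE.
have Lt : L (geo k t) = 0 by rewrite -LE; [rewrite -geoM rx subrr mulr0|exact: HH_geo].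
have L0 : L (geo k 0) != 0.
  rewrite -LE; last exact: HH_geo.
  rewrite -geoM; apply: mulf_neq0; first by rewrite gt_eqF// Nm_gt0//; exact: HH_geo.
  by rewrite subr_eq0; apply/eqP => E; have := time_uniq cg dg (etrans rx (esym E)); lra.
have [s S sL0] : exists2 s, sg s & s * L (geo k 0) < 0.
  by case: (ltgtP (L (geo k 0)) 0) L0 => // h _; [exists 1; [left|lra]|exists (- 1); [right|lra]].
apply: (kseg_zero2 S (HH_geo k 0) Hzp); first by rewrite LE//; exact: HH_geo.
rewrite LE// leNgt; apply/negP => sLz.
have [H1 H2] := wt_mono c0 d0; pose y' := cb k / cd k; pose Ly := a + b * y' + c * y' ^+ 2; pose Lp0 := a + b * p + c * p ^+ 2.
have Lg r : L (geo k r) = (1 - wt k r) * Ly + wt k r * Lp0.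
  have [r1 r2] := geo_wt r c0 d0; rewrite pE -/y' in r1 r2.
  by rewrite /L r2 r1 /Ly /Lp0; ring.
have /andP[w0 w1] := H1 t; have wlt : wt k 0 < wt k t by rewrite ltNge H2 -ltNge.
have e1 : L (geo k 0) * (1 - wt k t) = (wt k 0 - wt k t) * Lp0.
  have e2 : (1 - wt k t) * Ly = - (wt k t * Lp0) by rewrite Lg in Lt; lra.
  transitivity ((1 - wt k 0) * ((1 - wt k t) * Ly) + wt k 0 * Lp0 * (1 - wt k t)); first by rewrite Lg; ring.
  by rewrite e2; ring.
(* [L] is affine along the chord and changes sign at time [t], so it has the sign of [s] at the
   endpoint [p]. *)
have sLp : 0 < s * Lp0.
  have : (s * L (geo k 0)) * (1 - wt k t) < 0 by rewrite pmulr_llt0// subr_gt0.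
  rewrite -mulrA e1 (_ : s * _ = - ((wt k t - wt k 0) * (s * Lp0))); last ring.
  by rewrite oppr_lt0 pmulr_rgt0// subr_gt0.
have Lzp : L zp = Lp0 + c by rewrite /L /Lp0 /Wk /=; ring.
rewrite Lzp in sLz; have sc : s * c < 0 by lra.
have cn : c != 0 by apply/eqP => E; move: sc; rewrite E mulr0 ltxx.
(* If the sign at [zp] were that of [- s], [L] would vanish over [p] at squared height [ta]. By
   [noncross] it would then vanish on the whole line, in particular at [zp]. *)
pose ta := - Lp0 / c; have ta0 : 0 < ta.
  rewrite /ta (_ : _ / c = (s * Lp0) / - (s * c)).
    by rewrite divr_gt0// oppr_gt0.
  by field; rewrite cn; case: S => ->; rewrite ?oppr_eq0 oner_eq0.
have XW : p ^+ 2 < p ^+ 2 + ta by rewrite ltrDl.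
have [Hw rw ww] := ptP XW; set w := pt _ _ in Hw rw ww.
have Lw : Re (act g w) = x.
  have : Nm g w * (Re (act g w) - x) = 0.
    rewrite (LE w Hw) /L rw ww (_ : _ + _ = Lp0 + c * ta); last by rewrite /Lp0; ring.
    by rewrite /ta; field.
  by move/eqP; rewrite mulf_eq0 (gt_eqF (Nm_gt0 g Hw)) /= subr_eq0 => /eqP.
have l := noncross (xs_Lin xx) Lp Gg Hw rw Lw.
have : L zp = 0 by rewrite -LE// (l _ Hzp).1// subrr mulr0.
by rewrite Lzp => E; move: sLz; rewrite E mulr0 ltxx.
Qed.

Lemma bd_plus k : bd (actS k (pinf R)) -> exists T : R, forall t, T < t -> ~ meets k Gam t.
Proof.
move=> /bd_cases[g [Gg H]]; have GgV := GV Gg.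
suff [T TP] : exists T : R, forall t, T < t -> ~ meets (g^-1 * k)%g Gam t.
  exists T => t /TP nm m; apply: nm; apply: (@meets_inv g) => //.
  by rewrite mulgA mulgV mul1g.
case: H => [E|[p [iv E]]].
  apply: cusp_inf; have : actS (g^-1 * k)%g (pinf R) = pinf R by rewrite actSM E actSK.
  by rewrite actS_pinf; case: eqP.
by apply: (cusp_ivert iv); rewrite actSM E actSK.
Qed.

Lemma meets_flip k t : meets k Gam t -> meets (k * flip R)%g Gam (- t).
Proof.
move=> [g [x [Gg xx c0 d0 rx]]]; exists g, x; rewrite mulgA.
have [e e2 [_ _ cE dE]] := flip_coef (g * k)%g; have e0 := sign_neq0 e2; split=> //.
- by rewrite cE mulf_neq0.
- by rewrite dE mulf_neq0// oppr_eq0.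
- by rewrite geo_flip opprK.
Qed.

Lemma bd_minus k : bd (actS k (fin 0)) -> exists T : R, forall t, t < T -> ~ meets k Gam t.
Proof.
rewrite -actS_flip => /bd_plus[T TP]; exists (- T) => t tT /meets_flip; apply: TP; lra.
Qed.

Lemma lift_ex (eta : geodY Gam) : exists k, lift_geod eta = geo k.
Proof. by rewrite /lift_geod; case: cid2 => gam geod _ /=; exact: geodesicE. Qed.

Lemma NICP (eta : geodY Gam) k : lift_geod eta = geo k ->
  (NIC AA eta <-> bd (actS k (pinf R)) \/ bd (actS k (fin 0))).
Proof.
move=> kE; have refl (v : P1) : piS Gam v v by exists 1%g => //; rewrite actS1.
split.
  move=> [_ [v [rv ->]] [q bq qE]].
  have bv : bd v by have := refl v; rewrite -qE => -[g Gg <-]; exact: bd_inv.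
  rewrite kE in rv; case: rv => [/reaches_geo_p|/reaches_geo_m] vE; rewrite vE in bv; [by left|by right].
case=> b.
  exists (piS Gam (actS k (pinf R))); last by exists (actS k (pinf R)).
  by exists (actS k (pinf R)); split=> //; left; rewrite kE; apply/reaches_geo_p.
exists (piS Gam (actS k (fin 0))); last by exists (actS k (fin 0)).
by exists (actS k (fin 0)); split=> //; right; rewrite kE; apply/reaches_geo_m.
Qed.

Local Notation CR := (CSred Gam AA SS TT).
Local Notation CST := (CSstred Gam AA SS TT).

Lemma recurrent_intro (CC : set (set (R[i] * R[i]))) (eta : geodY Gam) :
  (forall T, exists2 t, T <= t & CC (velocityY eta t)) ->
  (forall T, exists2 t, t <= T & CC (velocityY eta t)) -> recurrent_in CC eta.
Proof.
move=> H1 H2; split.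
  have h n : exists t : R, n%:R <= t /\ CC (velocityY eta t) by have [t ? ?] := H1 n%:R; exists t.
  have [t tP] := choice h; exists t => [|n]; last by case: (tP n).
  apply/cvgryPge => M; near=> n; apply: le_trans (tP n).1; near: n; exact: nbhs_infty_ger.
have h n : exists t : R, t <= - n%:R /\ CC (velocityY eta t) by have [t ? ?] := H2 (- n%:R); exists t.
have [t tP] := choice h; exists t => [|n]; last by case: (tP n).
apply/cvgrNyPle => M; near=> n; apply: le_trans (tP n).1 _; rewrite lerNl; near: n; exact: nbhs_infty_ger.
Unshelve. all: by end_near. Qed.

Lemma recurrent_elim (CC : set (set (R[i] * R[i]))) (eta : geodY Gam) : recurrent_in CC eta ->
  (forall T : R, exists2 t, T < t & CC (velocityY eta t)) /\
  (forall T : R, exists2 t, t < T & CC (velocityY eta t)).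
Proof.
move=> [[t tc tP] [t' tc' tP']]; split=> T.
  by have /cvgryPgt/(_ T)[N _ h] := tc; exists (t N) => //; exact: (h N (leqnn N)).
by have /cvgrNyPlt/(_ T)[N _ h] := tc'; exists (t' N) => //; exact: (h N (leqnn N)).
Qed.

Lemma notNIC_nobd (eta : geodY Gam) k : lift_geod eta = geo k -> ~ NIC AA eta -> nobd k.
Proof. by move=> kE nN; split=> b; apply: nN; apply/(NICP kE); [left|right]. Qed.

Lemma CSredY (eta : geodY Gam) k t : lift_geod eta = geo k -> (CR (velocityY eta t) <-> crs k t).
Proof. by move=> kE; rewrite /velocityY kE; exact: CSredP. Qed.

Lemma NIC_not_rec (eta : geodY Gam) : NIC AA eta -> ~ recurrent_in CR eta.
Proof.
have [k kE] := lift_ex eta; move=> /(NICP kE) b /recurrent_elim[r1 r2].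
case: b => [/bd_plus|/bd_minus] [T TP].
  by have [t tT /(CSredY t kE)/crs_meets] := r1 T; exact: TP.
by have [t tT /(CSredY t kE)/crs_meets] := r2 T; exact: TP.
Qed.

(** [CSstred] removes vectors, whereas [NIC] consists of geodesics. Equal vectors have lifts that
    agree up to Gamma and a time shift, so their endpoints agree modulo Gamma. *)
Lemma velocity_NIC (eta eta' : geodY Gam) t t' : velocityY eta t = velocityY eta' t' ->
  NIC AA eta' -> NIC AA eta.
Proof.
have [k kE] := lift_ex eta; have [k' kE'] := lift_ex eta'.
rewrite /velocityY kE kE' => E /(NICP kE') b; apply/(NICP kE).
have := piSH_refl k t; rewrite E => -[g Gg]; rewrite -velocity_act => vE.
have H r : geo (k * 1)%g (t + r) = geo (g * k')%g (t' + r) by rewrite mulg1 (velocity_inj vE).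
have [k2 [k2E _ _ _ _]] := geo_shift k t; have h1 r : geo k2 r = geo k (t + r) by rewrite k2E addrC.
have h2 r : geo k2 r = geo (g * k')%g (t' + r) by rewrite h1 (velocity_inj vE).
have [e1 e2] := ends_shift h1; have [e3 e4] := ends_shift h2.
by case: b => b; [left; rewrite -e1 e3 actSM|right; rewrite -e2 e4 actSM]; exact: bd_inv.
Qed.

Lemma CSred_discrete (eta : geodY Gam) t : exists2 e : R, 0 < e &
  forall r, r \in `]t - e, t + e[ -> CR (velocityY eta r) -> r = t.
Proof.
have [k kE] := lift_ex eta; have [e e0 eP] := meets_isolated k t; exists e => // r.
rewrite in_itv /= => /andP[h1 h2] /(CSredY r kE)/crs_meets; apply: eP.
by rewrite ltr_distlC; apply/andP; split; lra.
Qed.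

Lemma notNIC_rec (eta : geodY Gam) : ~ NIC AA eta -> recurrent_in CST eta.
Proof.
move=> nN; have [k kE] := lift_ex eta; have nk := notNIC_nobd kE nN.
have st t : CR (velocityY eta t) -> CST (velocityY eta t).
  by move=> c; split=> // -[eta' [t' [N' E]]]; apply: nN; exact: velocity_NIC (esym E) N'.
apply: recurrent_intro => T.
  by have [t tT c] := future T nk; exists t => //; apply/st/(CSredY t kE).
by have [t tT c] := past T nk; exists t => //; apply/st/(CSredY t kE).
Qed.

Lemma CSred_SY : CR `<=` SY Gam.
Proof. by move=> _ [v [al _ [[Sv _] _]] <-]; exists v. Qed.

Lemma CSstred_NIC (eta : geodY Gam) t : NIC AA eta -> ~ CST (velocityY eta t).
Proof. by move=> N [_]; apply; exists eta, t. Qed.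

Lemma recurrent_sub (CC D : set (set (R[i] * R[i]))) (eta : geodY Gam) : CC `<=` D -> recurrent_in CC eta -> recurrent_in D eta.
Proof. by move=> sub [[t tc tP] [t' tc' tP']]; split; [exists t|exists t'] => // n; apply: sub. Qed.

Section Measure.
Variables (G : set (set (geodY Gam))) (mu : {measure set (g_sigma_algebraType G) -> \bar R}).

Lemma cross_section_sub (CC : set (set (R[i] * R[i]))) : CC `<=` CR -> (forall eta : geodY Gam, ~ NIC AA eta -> recurrent_in CC eta) ->
  mu.-negligible (NIC AA) -> cross_section mu CC.
Proof.
move=> sub rc neg; split.
- by apply: subset_trans sub _; exact: CSred_SY.
- apply: negligibleS neg => eta /= nr; apply: contrapT => nN; apply: nr; exact: rc.
- move=> eta t c; have [e e0 eP] := CSred_discrete eta t; exists e => //.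
  apply/seteqP; split=> p.
    by move=> [[r rI <-] cr] /=; rewrite (eP r rI (sub _ cr)).
  move=> -> /=; split=> //; exists t => //=.
  by rewrite in_itv /=; apply/andP; split; lra.
Qed.

(** No vector of a geodesic in [NIC] lies in [CST], so all of [NIC] belongs to the exceptional set
    of (C1). *)
Lemma cross_section_NIC : cross_section mu CST -> mu.-negligible (NIC AA).
Proof.
move=> [_ ae _]; apply: negligibleS ae => eta N /= /recurrent_elim[r _].
by have [t _ /(CSstred_NIC N)] := r 0.
Qed.

Lemma CST_sub : CST `<=` CR. Proof. by move=> v []. Qed.

Lemma CST_strong : mu.-negligible (NIC AA) -> strong_cross_section mu CST.
Proof.
move=> neg; split; first by apply: cross_section_sub neg => //; [exact: CST_sub|exact: notNIC_rec].
by move=> eta [t c]; apply: notNIC_rec => /CSstred_NIC/(_ c).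
Qed.

Lemma main_result :
  (cross_section mu CR /\ cross_section mu CST <-> mu.-negligible (NIC AA)) /\
  (mu.-negligible (NIC AA) -> maximal_strong_cross_section_in mu CR CST).
Proof.
split; first split.
- by move=> [_ /cross_section_NIC].
- move=> neg; split; last by case: (CST_strong neg).
  apply: cross_section_sub neg => // eta nN; apply: recurrent_sub (notNIC_rec nN); exact: CST_sub.
- move=> neg; split; [exact: CST_strong|exact: CST_sub|].
  move=> D' [_ rD] sD v Dv; split; first exact: sD.
  (* A strong cross section containing a vector of a geodesic in [NIC] would meet this geodesic
     infinitely often in both directions, within [CR]. *)
  move=> [eta [t [N E]]]; apply: (NIC_not_rec N); apply: recurrent_sub sD _; apply: rD.
  by exists t; rewrite E.
Qed.

End Measure.
End Main.

End Cells.

Theorem corollary9p7 (R : realType) (Gam : set (PSL2 R))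
    (fuchsian_Gam : fuchsian Gam)
    (finite_Gam : geometrically_finite Gam)
    (cuspidal_Gam : inf_cuspidal Gam)
    (Gam_neq_stab : Gam <> stab_inf Gam)
    (A_Gam : condition_A Gam)
    (AA : set (set R[i])) (basal_AA : basal_family Gam AA)
    (SS : set (set R[i] * PSL2 R)) (choices_SS : set_of_choices Gam AA SS)
    (TT : label R -> PSL2 R) (shift_TT : shift_map Gam AA SS TT)
    (G : set (set (geodY Gam)))
    (mu : {measure set (g_sigma_algebraType G) -> \bar R}) :
  (cross_section mu (CSred Gam AA SS TT) /\
   cross_section mu (CSstred Gam AA SS TT)
     <-> mu.-negligible (NIC AA)) /\
  (mu.-negligible (NIC AA) ->
   maximal_strong_cross_section_in mu (CSred Gam AA SS TT) (CSstred Gam AA SS TT)).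
Proof.
exact: (main_result fuchsian_Gam cuspidal_Gam A_Gam finite_Gam basal_AA choices_SS shift_TT mu).
Qed.
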